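(* For $x_0\in\mathbb R$ let $R_{x_0}:\mathbb R\to\mathbb C$ be the function $$R_{x_0}(t)=\sum_{n\in\mathbb Z\setminus\{0\}}\frac{e^{2\pi i(n^2t+nx_0)}}{n^2},\qquad t\in\mathbb R .$$ Then: (1) For every $x_0\in\mathbb R$, the function $R_{x_0}$ is multifractal, i.e. the set $\{\alpha_{R_{x_0}}(t) : t\in\mathbb R\}$ of its local Hölder exponents is infinite. (2) If $x_0\in\mathbb Q$, then the spectrum of singularities of $R_{x_0}$ is $$d_{R_{x_0}}(\alpha)=\begin{cases}4\alpha-2, & \tfrac12\le\alpha\le\tfrac34,\\ 0, & \alpha=\tfrac32,\\ -\infty, & \text{otherwise.}\end{cases}$$
   Context: Local Hölder regularity: for $f:\mathbb R\to\mathbb C$, $t\in\mathbb R$ and $\alpha>0$, one writes $f\in\mathcal C^\alpha(t)$ if there exist a polynomial $P$ (with complex coefficients) of degree at most $\alpha$ and a constant $C>0$ such that $|f(t+h)-P(h)|\le C|h|^\alpha$ for all sufficiently small $h\in\mathbb R$. For $0<\alpha<1$ and continuous $f$ this says $|f(t+h)-f(t)|\le C|h|^\alpha$ for all sufficiently small $h$. Local Hölder exponent: $\alpha_f(t)=\sup\{\alpha : f\in\mathcal C^\alpha(t)\}$. A function is called multifractal if it possesses infinitely many distinct local Hölder exponents. Spectrum of singularities: $d_f(\alpha)=\dim_{\mathcal H}\{t\in\mathbb R : \alpha_f(t)=\alpha\}$, where $\dim_{\mathcal H}$ denotes Hausdorff dimension, with the convention $d_f(\alpha)=-\infty$ if the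 set $\{t : \alpha_f(t)=\alpha\}$ is empty. *)

(* Defs.v *)
From HB Require Import structures.
From mathcomp Require Import all_boot all_order all_algebra.
From mathcomp Require Import complex.
From mathcomp Require Import all_classical all_reals all_analysis.
Set Implicit Arguments.
Unset Strict Implicit.
Unset Printing Implicit Defensive.
Import Order.TTheory GRing.Theory Num.Theory.
Import numFieldNormedType.Exports.
Local Open Scope classical_set_scope.
Local Open Scope ring_scope.
Local Open Scope complex_scope.

Definition expi {R : realType} (x : R) : R[i] := cos x +i* sin x.

(* Sum over the nonzero integers, as the limit of the sums over
   [0 < `|n| <= N].  It is only used for an absolutely convergent family, whose
   sum does not depend on the order of summation.  The regular algebra
   [R[i]^o] is the type that carries the norm topology of [R[i]]. *)
Definition sum_nonzero_int {R : realType} (u : int -> R[i]) : R[i] :=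
  limn ((fun N : nat => \sum_(k < N) (u k.+1%:Z + u (- k.+1%:Z)))
          : nat -> R[i]^o).

Definition riemann_term {R : realType} (x0 t : R) (n : int) : R[i] :=
  expi (2 * pi * (n%:~R ^+ 2 * t + n%:~R * x0)) / n%:~R ^+ 2.

Definition riemann_fun {R : realType} (x0 t : R) : R[i] :=
  sum_nonzero_int (riemann_term x0 t).

(* The degree of [P] is [(size P).-1], the zero polynomial being admitted
   whenever [0 <= a].  The inequality is between complex numbers: its left-hand
   side is the modulus, seen as an element of [R[i]]. *)
Definition holder_at {R : realType} (f : R -> R[i]) (t a : R) : Prop :=
  exists P : {poly R[i]}, exists C : R,
    [/\ ((size P).-1)%:R <= a, 0 < C &
        \forall h \near (0 : R),
          `|f (t + h) - P.[h%:C]| <= (C * `|h| `^ a)%:C].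

(* The supremum is taken in the extended reals: it is [+oo] if [f] is regular of
   every order at [t], and [-oo] if [f] is regular of no positive order there. *)
Definition holder_exponent {R : realType} (f : R -> R[i]) (t : R) : \bar R :=
  ereal_sup [set a%:E | a in [set a : R | 0 < a /\ holder_at f t a]].

Definition multifractal {R : realType} (f : R -> R[i]) : Prop :=
  infinite_set (range (holder_exponent f)).

Definition diameter {R : realType} (U : set R) : \bar R :=
  ereal_sup [set `|z.1 - z.2|%:E | z in U `*` U].

(* [diam(U)^s], with [diam(set0)^s = 0] and [diam(U)^0 = 1] for [U] nonempty. *)
Definition diameter_pow {R : realType} (s : R) (U : set R) : \bar R :=
  (if U == set0 then 0 else poweR (diameter U) s)%E.

Definition hausdorff_premeasure {R : realType} (s delta : R) (A : set R)
    : \bar R :=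
  ereal_inf [set (\sum_(0 <= k <oo) diameter_pow s (U k))%E |
    U in [set U : nat -> set R |
      A `<=` \bigcup_k U k /\ forall k, (diameter (U k) <= delta%:E)%E]].

(* The supremum over [delta > 0] is the limit as [delta] tends to [0]. *)
Definition hausdorff_measure {R : realType} (s : R) (A : set R) : \bar R :=
  ereal_sup [set hausdorff_premeasure s delta A |
    delta in [set delta : R | 0 < delta]].

Definition hausdorff_dim {R : realType} (A : set R) : \bar R :=
  ereal_inf [set s%:E |
    s in [set s : R | 0 <= s /\ hausdorff_measure s A = 0%E]].

Definition spectrum {R : realType} (f : R -> R[i]) (a : \bar R) : \bar R :=
  let E := [set t | holder_exponent f t = a] in
  if E == set0 then -oo%E else hausdorff_dim E.

(* Main.v *)
(* Lower bounds for the exponent. Weyl differencing shows that the exponent is at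
   least [1/2 + 1/(2 mu)] at any [t] with [|t - p/q| >= c q^-mu] for all [p/q].

   Upper bounds. Averaging [R_{x0}(t' + h)] against [sum_i |i| e(-|i| h)], where
   [i] ranges over [[0, L)^4] and [|i|] is the sum of the entries, extracts the
   exponential sums over windows of squares of length [L], the weight [|i|]
   compensating for [n^-2]. A regularity [a] at [t] forces these sums to be small
   for every [t'] close to [t], whereas Gauss sums make them large at a reduced
   fraction [t' = p/q] with [4 | q] and [x0] close to [m/q], [m] even. Hence the
   exponent is at most [1/2 + 1/(2 mu)] at a point which is approximated to within
   [q^-mu] by such fractions.

   When [x0] is rational, irrational points are approximated to within [C q^-2] by
   such fractions, so their exponents lie in [1/2, 3/4]. At a rational [t] the
   function is a combination of the functions [h |-> R_{k/q}(h)]; the exponent is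
   [1/2] if the mean of the associated Gauss sum is nonzero, and otherwise [3/2],
   since then only those [R_w] with [w] not an integer occur, and they are regular
   of every order [a < 3/2] at [0].

   Dimension. The points [t] approximated to within [q^-mu] infinitely often have
   dimension at most [2/mu] by the obvious covers. For the lower bound one builds a
   map [F] from [0, 1) into the points well approximated by such fractions, with
   [y - x <= C |F y - F x|^s] for all [s] below the critical value: a set of zero
   [s]-dimensional measure then pulls back to a Lebesgue null set, so that [F] can
   avoid the points which are approximated too well. For an arbitrary [x0] the
   denominators [q] with [x0] close to [m/q] are provided by the pigeonhole
   principle, and the same map yields exponents below [3/4] and arbitrarily close
   to it. *)

Require Import Defs.
From HB Require Import structures.
From mathcomp Require Import all_boot all_order all_algebra.
From mathcomp Require Import complex.
From mathcomp Require Import all_classical all_reals all_analysis.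
From mathcomp Require Import ring lra zify.
Set Implicit Arguments.
Unset Strict Implicit.
Unset Printing Implicit Defensive.
Import Order.TTheory GRing.Theory Num.Theory Num.Def.
Import numFieldNormedType.Exports.
Import Normc.
Local Open Scope classical_set_scope.
Local Open Scope ring_scope.
Local Open Scope complex_scope.

(** The kernel uses fourfold sums because a single window is a Dirichlet kernel, whose decay is too
    slow to integrate against |h|^a. It is D^3 D' up to a constant: two factors D serve Parseval,
    and the pair D D' gives a decay (1 + L^2 h^2)^-1, which absorbs |h|^a for every a <= 2. Means
    are taken over finite grids on which orthogonality is exact.

    With L about q^la, a regularity a at a point within q^-mu of a fraction as above gives, up to
    small powers, q^(la/2) <= q + q^(1/2 + la - mu a) + q^(1/2 + la - la a). This fails when la > 2,
    la (2a - 1) > 1 and la < 2 mu a - 1; the choice la = mu yields 1/2 + 1/(2 mu). The windows reach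
    n of size q^(la/2), so x0 must be that close to m/q. For rational x0 equality holds and la is
    free; for arbitrary x0 only la slightly above 2 is used, whence exponents just below 3/4.

    In the construction of F the fractions are known to be evenly spread down to the scale Q^(-1/2)
    only, and merely separated by Q^-2 below it; this imposes two scales in each step. *)

Ltac pos_step := match goal with
  | |- is_true (@Order.le _ _ _ (@GRing.mul _ _ _)) => apply: mulr_ge0
  | |- is_true (@Order.le _ _ _ (@GRing.exp _ _ 2)) => exact: sqr_ge0
  | |- is_true (@Order.le _ _ _ (@GRing.exp _ _ _)) => apply: exprn_ge0
  | |- is_true (@Order.le _ _ _ (@GRing.inv _ _)) => rewrite invr_ge0
  | |- is_true (@Order.le _ _ _ (@powR _ _ _)) => exact: powR_ge0
  | |- _ => first [exact: ler0n | done | exact: normr_ge0 | exact: sqrtr_ge0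
      | (apply: ltW; assumption) | apply: addr_ge0]
  end.
Ltac pos := by repeat pos_step.

(** * Exponentials, partial sums and pointwise regularity *)

Section Basics.
Variable R : realType.
Implicit Types (x y h t a b : R) (z w : R[i]).

Lemma normC_normc z : `|z| = (normc z)%:C.
Proof. by case: z. Qed.

Lemma normcB z w : normc (z - w) <= normc z + normc w.
Proof. by rewrite (le_trans (le_normcD _ _))// normcN. Qed.

Lemma normc_ge0 z : 0 <= normc z.
Proof. by case: z => a b; rewrite sqrtr_ge0. Qed.

Lemma normc_real x : normc x%:C = `|x|.
Proof. by rewrite /normc /= expr0n /= addr0 sqrtr_sqr. Qed.

Lemma normcZ x z : normc (x%:C * z) = `|x| * normc z.
Proof. by rewrite normcM normc_real. Qed.

Lemma normc_distC z w : normc (z - w) = normc (w - z).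
Proof. by rewrite -normcN opprB. Qed.

Lemma normc_sum (I : Type) (r : seq I) (P : pred I) (F : I -> R[i]) :
  normc (\sum_(i <- r | P i) F i) <= \sum_(i <- r | P i) normc (F i).
Proof.
elim/big_ind2 : _ => //; first by rewrite normc0.
by move=> x1 x2 y1 y2 h1 h2; rewrite (le_trans (le_normcD _ _))// lerD.
Qed.

Lemma normc_le_add z : normc z <= `|complex.Re z| + `|complex.Im z|.
Proof.
case: z => a b /=.
rewrite -(@ler_pXn2r _ 2)// ?nnegrE ?sqrtr_ge0 ?addr_ge0//.
rewrite sqr_sqrtr ?addr_ge0 ?sqr_ge0// sqrrD !real_normK ?num_real//.
by rewrite lerD2r lerDl mulrn_wge0 ?mulr_ge0.
Qed.

Lemma normc_sqr z : normc z ^+ 2 = complex.Re z ^+ 2 + complex.Im z ^+ 2.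
Proof. by case: z => a b; rewrite sqr_sqrtr ?addr_ge0 ?sqr_ge0. Qed.

Lemma normc_Re z : `|complex.Re z| <= normc z.
Proof.
rewrite -(@ler_pXn2r _ 2)// ?nnegrE ?normc_ge0// normc_sqr real_normK ?num_real//.
by rewrite lerDl sqr_ge0.
Qed.

Lemma normc_Im z : `|complex.Im z| <= normc z.
Proof.
rewrite -(@ler_pXn2r _ 2)// ?nnegrE ?normc_ge0// normc_sqr real_normK ?num_real//.
by rewrite lerDr sqr_ge0.
Qed.

Definition cj z : R[i] := conjc z.

Lemma cjD z w : cj (z + w) = cj z + cj w.
Proof. exact: (rmorphD (@conjc R)). Qed.

Lemma cj_sum (I : Type) (r : seq I) (P : pred I) (F : I -> R[i]) :
  cj (\sum_(i <- r | P i) F i) = \sum_(i <- r | P i) cj (F i).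
Proof. exact: (big_morph _ cjD (rmorph0 (@conjc R))). Qed.

Lemma normc_sqrE z : (normc z ^+ 2)%:C = z * cj z.
Proof.
case: z => a b; rewrite [normc _ ^+ 2]normc_sqr /=.
by apply/eqP; rewrite eq_complex /=; apply/andP; split; apply/eqP; ring.
Qed.

Lemma normc_triangle z w u : normc (z - w) <= normc (z - u) + normc (u - w).
Proof. by rewrite (_ : z - w = (z - u) + (u - w)) ?le_normcD//; ring. Qed.

Lemma normc_subr_ge z w : normc z - normc w <= normc (z - w).
Proof. by rewrite lerBlDr -{1}(subrK w z) le_normcD. Qed.

Lemma normc_nat n : normc (n%:R : R[i]) = n%:R.
Proof.
by rewrite (_ : n%:R = (n%:R : R)%:C) ?normc_real ?ger0_norm// rmorph_nat.
Qed.

Definition e x : R[i] := expi (2 * pi * x).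

Lemma e0 : e 0 = 1.
Proof. by rewrite /e /expi mulr0 cos0 sin0. Qed.

Lemma eD x y : e (x + y) = e x * e y.
Proof.
rewrite /e /expi mulrDr cosD sinD; apply/eqP; rewrite eq_complex /=.
by apply/andP; split; apply/eqP; ring.
Qed.

Lemma eN x : e (- x) = cj (e x).
Proof. by rewrite /e /expi mulrN cosN sinN. Qed.

Lemma normc_e x : normc (e x) = 1.
Proof. by rewrite /e /expi /normc cos2Dsin2 sqrtr1. Qed.

Lemma eK x : e x * e (- x) = 1.
Proof. by rewrite -eD subrr e0. Qed.

Lemma e1 : e 1 = 1.
Proof.
rewrite /e /expi mulr1 (_ : 2 * pi = pi *+ 2); last by rewrite mulr_natl.
by rewrite cos2pi sin2pi.
Qed.

Lemma e_nat n : e n%:R = 1.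
Proof. by elim: n => [|n IH]; rewrite ?e0// -addn1 natrD eD IH mul1r e1. Qed.

Lemma e_int (n : int) : e n%:~R = 1.
Proof.
case: n => n; first by rewrite -pmulrn e_nat.
by rewrite NegzE mulrNz eN -pmulrn e_nat; apply/eqP; rewrite eq_complex /= oppr0 !eqxx.
Qed.

Lemma eDint x (n : int) : e (x + n%:~R) = e x.
Proof. by rewrite eD e_int mulr1. Qed.

Lemma eMn x n : e (n%:R * x) = e x ^+ n.
Proof.
elim: n => [|n IH]; first by rewrite mul0r e0 expr0.
by rewrite -addn1 natrD mulrDl mul1r eD IH addn1 exprSr.
Qed.

Lemma normc_e1_sqr x : normc (e x - 1) ^+ 2 = 4 * sin (pi * x) ^+ 2.
Proof.
rewrite normc_sqr /e /expi /= (_ : 2 * pi * x = (pi * x) *+ 2); last first.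
  by rewrite -mulrA mulr_natl.
rewrite cos_mulr2n sin_mulr2n oppr0 addr0.
have := cos2Dsin2 (pi * x); set c := cos _; set s := sin _ => h.
have -> : c ^+ 2 = 1 - s ^+ 2 by rewrite -h addrK.
have h2 : (c * s) ^+ 2 = (1 - s ^+ 2) * s ^+ 2 by rewrite exprMn -h addrK.
transitivity (4 * (s ^+ 2) ^+ 2 + 4 * (c * s) ^+ 2); first by ring.
by rewrite h2; ring.
Qed.

Lemma normc_e1E x : normc (e x - 1) = 2 * `|sin (pi * x)|.
Proof.
apply/eqP; rewrite -(@eqrXn2 _ 2)// ?normc_ge0 ?mulr_ge0// normc_e1_sqr exprMn.
by rewrite real_normK ?num_real//; apply/eqP; ring.
Qed.

Lemma sin_le x : 0 <= x -> sin x <= x.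
Proof.
move=> x0.
have [c _] := @MVT_segment R (@sin R) (@cos R) 0 x x0
  (fun y _ => is_derive_sin y)
  (continuous_subspaceT (@continuous_sin R)).
rewrite sin0 !subr0 => ->.
by rewrite ler_piMl// cos_le1.
Qed.

Lemma abs_sin_le x : `|sin x| <= `|x|.
Proof.
have main : forall y, 0 <= y -> `|sin y| <= y.
  move=> y y0; have := sin_le y0.
  have [y2|y2] := leP y 2; last by rewrite (le_trans (sin_max _))//; lra.
  rewrite ger0_norm//.
  have [->|yn0] := eqVneq y 0; first by rewrite sin0.
  have [->|yn2] := eqVneq y 2; first by rewrite sin_ge0_pi// pi_ge2 andbT.
  by rewrite ltW// sin2_gt0// !lt_neqAle eq_sym yn0 y0 yn2.
have [x0|x0] := leP 0 x; first by rewrite [leRHS]ger0_norm// main.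
by rewrite -normrN -sinN -[leRHS]normrN [leRHS]gtr0_norm ?oppr_gt0// main// oppr_ge0 ltW.
Qed.

(** Half of Jordan's bound is enough: cos is at least 1/2 on [0, pi/4], which settles the first half
    of the interval by the mean value theorem, and the second half follows from sin x = cos (pi/2 -
    x). *)
Lemma sin_lower x : 0 <= x <= pi / 2 -> x / pi <= sin x.
Proof.
move=> /andP[x0 x2]; have pp := @pi_gt0 R.
have cosq : forall y : R, 0 <= y <= pi / 4 -> 1 / 2 <= cos y.
  move=> y /andP[y0 y4].
  have sc : sin y <= cos y.
    rewrite -(sinDpihalf y).
    have -> : sin (y + pi / 2) = sin (pi / 2 - y).
      by rewrite sinDpihalf sinB cos_pihalf sin_pihalf; ring.
    have [<-//|yn] := eqVneq y (pi / 2 - y).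
    rewrite ltW// ltr_sin ?in_itv /=; last 2 first.
    - by apply/andP; split; lra.
    - by apply/andP; split; lra.
    by rewrite lt_neqAle yn/=; lra.
  have s0 : 0 <= sin y by rewrite sin_ge0_pi//; lra.
  have := cos2Dsin2 y; nra.
have [x4|x4] := leP x (pi / 4).
  have [c] := @MVT_segment R (@sin R) (@cos R) 0 x x0
    (fun y _ => is_derive_sin y)
    (continuous_subspaceT (@continuous_sin R)).
  rewrite in_itv /= => /andP[c0 cx]; rewrite sin0 !subr0 => ->.
  rewrite mulrC ler_wpM2r// (le_trans _ (cosq c _))//; last by rewrite c0 (le_trans cx).
  by rewrite div1r lef_pV2 ?posrE// pi_ge2.
apply: (@le_trans _ _ (1 / 2)); first by rewrite ler_pdivrMr//; lra.
have : cos (pi / 2 - x) = sin x by rewrite cosB cos_pihalf sin_pihalf; ring.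
by move=> <-; apply: cosq; apply/andP; split; lra.
Qed.

Lemma normc_e1_le x : normc (e x - 1) <= 2 * pi * `|x|.
Proof.
rewrite normc_e1E -mulrA ler_pM2l// (le_trans (abs_sin_le _))//.
by rewrite normrM ger0_norm// pi_ge0.
Qed.

Lemma pi_lt4 : @pi R < 4. Proof. by have := @pihalf_lt2 R; lra. Qed.

Lemma normc_e1_le8 x : normc (e x - 1) <= 8 * `|x|.
Proof.
rewrite (le_trans (normc_e1_le _))// ler_wpM2r//; have := pi_lt4; lra.
Qed.

Lemma normc_e1_le2 x : normc (e x - 1) <= 2.
Proof. by rewrite (le_trans (normcB _ _))// normc_e normc1; lra. Qed.

Lemma normc_eB x y : normc (e x - e y) = normc (e (x - y) - 1).
Proof.
rewrite -[LHS]mul1r -(normc_e (- y)) -normcM mulrBr -!eD addNr e0.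
by rewrite [- y + x]addrC.
Qed.

Lemma normc_e1_ge x : `|x| <= 1 / 2 -> 2 * `|x| <= normc (e x - 1).
Proof.
move=> x2; rewrite normc_e1E ler_pM2l//; have pp := @pi_gt0 R.
have E : `|sin (pi * x)| = `|sin (pi * `|x|)|.
  have [x0|x0] := leP 0 x; first by rewrite (ger0_norm x0).
  by rewrite (ltr0_norm x0) mulrN sinN normrN.
rewrite E (le_trans _ (ler_norm _))//.
rewrite -[leLHS](mulKf (lt0r_neq0 pp)) [_^-1 * _]mulrC sin_lower//.
rewrite mulr_ge0 ?pi_ge0//=; have := pi_gt0 R; nra.
Qed.

Definition ee x t n : R[i] := e (n%:R ^+ 2 * t + n%:R * x).

Lemma normc_ee x t n : normc (ee x t n) = 1. Proof. exact: normc_e. Qed.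

Definition rterm x0 t n : R[i] :=
  (n%:R ^- 2)%:C * (ee x0 t n + ee (- x0) t n).

Definition rpart x0 t N : R[i] := \sum_(k < N) rterm x0 t k.+1.

Lemma normc_rterm x0 t n : normc (rterm x0 t n) <= 2 * n%:R ^- 2.
Proof.
rewrite normcZ mulrC ger0_norm ?invr_ge0 ?exprn_ge0// ler_wpM2r ?invr_ge0 ?exprn_ge0//.
by rewrite (le_trans (le_normcD _ _))// !normc_ee.
Qed.

Lemma rpartE x0 t N :
  \sum_(k < N) (riemann_term x0 t k.+1%:Z + riemann_term x0 t (- k.+1%:Z)) =
  rpart x0 t N.
Proof.
apply: eq_bigr => k _; rewrite /riemann_term /rterm /ee /e mulrDr.
rewrite !mulrNz !sqrrN -!pmulrn mulNr -mulrDr.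
by rewrite -mulrDl [RHS]mulrC fmorphV rmorphXn rmorph_nat !mulrDr !mulrN.
Qed.

Lemma sum_inv_sqr (n m : nat) : (0 < n)%N -> (n <= m)%N ->
  \sum_(n <= k < m) (k.+1%:R : R) ^- 2 <= n%:R^-1 - m%:R^-1.
Proof.
move=> n0; elim: m => [|m IH]; first by rewrite leqn0 => /eqP ->; rewrite big_geq// subrr.
rewrite leq_eqVlt => /orP[/eqP->|nm]; first by rewrite big_geq// subrr.
rewrite big_nat_recr //=; have := IH nm; set S := \sum_(_ <= _ < _) _ => hS.
have m0 : (0 : R) < m%:R by rewrite ltr0n (leq_trans n0).
suff : (m.+1%:R : R) ^- 2 <= m%:R^-1 - m.+1%:R^-1.
  by move: hS; set a := _ ^- 2; set b := m.+1%:R^-1; lra.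
rewrite -natr1; set x := m%:R in m0 *.
have -> : x^-1 - (x + 1)^-1 = (x * (x + 1))^-1 by field; lra.
rewrite lef_pV2 ?posrE ?mulr_gt0 ?exprn_gt0//; nra.
Qed.

Lemma rpart_cauchy x0 t n m : (0 < n)%N -> (n <= m)%N ->
  normc (rpart x0 t m - rpart x0 t n) <= 2 / n%:R.
Proof.
move=> n0 nm; rewrite /rpart -!(big_mkord xpredT (fun k => rterm x0 t k.+1)).
rewrite (@big_cat_nat _ _ _ n 0 m)//= addrAC subrr add0r.
rewrite (le_trans (normc_sum _ _ _))//.
apply: (@le_trans _ _ (\sum_(n <= k < m) 2 * (k.+1%:R : R) ^- 2)).
  by apply: ler_sum => k _; exact: normc_rterm.
rewrite -big_distrr /= ler_pM2l//= (le_trans (sum_inv_sqr n0 nm))//.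
by rewrite gerBl invr_ge0.
Qed.

(** The limit is built as the supremum of the lower bounds u n - C/n, all of which lie below every u
    m + C/m; the rate of convergence comes with it. *)
Lemma cvg_of_cauchy_bound (u : nat -> R) (C : R) :
  (forall n m, (0 < n)%N -> (n <= m)%N -> `|u m - u n| <= C / n%:R) ->
  exists l, forall n, (0 < n)%N -> `|l - u n| <= C / n%:R.
Proof.
move=> H.
pose A := [set u n.+1 - C / n.+1%:R | n in [set: nat]].
have key : forall n m, (0 < n)%N -> (0 < m)%N -> u n - C / n%:R <= u m + C / m%:R.
  move=> n m n0 m0.
  have C0 : 0 <= C by have := H 1%N 1%N isT isT; rewrite subrr normr0 divr1.
  have Cn : 0 <= C / n%:R by rewrite divr_ge0.
  have Cm : 0 <= C / m%:R by rewrite divr_ge0.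
  have [nm|mn] := leqP n m.
    by have := H _ _ n0 nm; rewrite ler_norml => /andP[]; lra.
  by have := H _ _ m0 (ltnW mn); rewrite ler_norml => /andP[]; lra.
have hA : has_sup A.
  split; first by exists (u 1%N - C / 1%:R); exists 0%N.
  by exists (u 1%N + C / 1%:R) => _ [n _ <-]; exact: key.
exists (sup A) => -[//|n] _; rewrite ler_distl.
apply/andP; split; first by apply: ub_le_sup; [case: hA|exists n].
by apply: ge_sup; [case: hA|move=> _ [m _ <-]; exact: key].
Qed.

Lemma riemann_fun_approx x0 t N : (0 < N)%N ->
  normc (riemann_fun x0 t - rpart x0 t N) <= 4 / N%:R.
Proof.
have cR n m : (0 < n)%N -> (n <= m)%N ->
    `|complex.Re (rpart x0 t m) - complex.Re (rpart x0 t n)| <= 2 / n%:R.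
  move=> n0 nm; rewrite -raddfB.
  by rewrite (le_trans (normc_Re _))// rpart_cauchy.
have cI n m : (0 < n)%N -> (n <= m)%N ->
    `|complex.Im (rpart x0 t m) - complex.Im (rpart x0 t n)| <= 2 / n%:R.
  move=> n0 nm; rewrite -raddfB.
  by rewrite (le_trans (normc_Im _))// rpart_cauchy.
have [a Ha] := cvg_of_cauchy_bound cR.
have [b Hb] := cvg_of_cauchy_bound cI.
have key n : (0 < n)%N -> normc ((a +i* b) - rpart x0 t n) <= 4 / n%:R.
  move=> n0; rewrite (le_trans (normc_le_add _))//.
  have := Ha n n0; have := Hb n n0; case: (rpart x0 t n) => c d /=.
  move=> h1 h2; rewrite (_ : 4 / n%:R = 2 / n%:R + 2 / n%:R) ?lerD//.
  by field; rewrite pnatr_eq0 -lt0n.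
suff -> : riemann_fun x0 t = a +i* b by exact: key.
rewrite /riemann_fun /sum_nonzero_int.
apply: (@cvg_lim (R[i]^o)); first exact: norm_hausdorff.
apply/cvgrPdist_le => eps; rewrite ltcE /= => /andP[/eqP eps1 eps2].
have [M HM] : exists M : nat, 4 / complex.Re eps < M%:R.
  by exists (truncn (4 / complex.Re eps)).+1; exact: truncnS_gt.
near=> n.
rewrite rpartE normC_normc.
case: eps eps1 eps2 HM => er ei /= -> er0 HM; rewrite lecR.
have n0 : (0 < n)%N by near: n; exists 1%N.
rewrite (le_trans (key _ n0))// ler_pdivrMr ?ltr0n// mulrC -ler_pdivrMr//.
rewrite (le_trans (ltW HM))// ler_nat; near: n; exists M => //.
Unshelve. all: by end_near. Qed.

Lemma normc_horner (p : {poly R[i]}) x : `|x| <= 1 ->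
  normc p.[x%:C] <= \sum_(i < size p) normc p`_i.
Proof.
move=> x1; rewrite horner_coef (le_trans (normc_sum _ _ _))//.
apply: ler_sum => i _; rewrite normcM -rmorphXn normc_real normrX.
by rewrite ler_piMr ?normc_ge0// exprn_ile1.
Qed.

Lemma powR_anti_exp x a b : 0 <= x <= 1 -> 0 < b -> b <= a -> x `^ a <= x `^ b.
Proof.
move=> /andP[]; rewrite le_eqVlt => /orP[/eqP<- _|x0 x1] b0 ba.
  by rewrite !powR0// gt_eqF// (lt_le_trans b0).
by rewrite ger_powR// x0.
Qed.

Lemma holder_intro (f : R -> R[i]) t a (c0 c1 : R[i]) (C d : R) : 0 < a ->
  c1 = 0 \/ 1 <= a -> 0 < d ->
  (forall h, `|h| < d -> normc (f (t + h) - c0 - c1 * h%:C) <= C * `|h| `^ a) ->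
  holder_at f t a.
Proof.
move=> a0 ca d0 H.
exists (c0%:P + c1 *: 'X), (`|C| + 1); split.
- have [c10|c10] := eqVneq c1 0.
    by rewrite c10 scale0r addr0 size_polyC ltW//; case: (c0 != 0).
  have a1 : 1 <= a by case: ca => // h; rewrite h eqxx in c10.
  rewrite (le_trans _ a1)// (ler_nat _ _ 1).
  have : (size (c0%:P + c1 *: 'X)%R <= 2)%N.
    rewrite (leq_trans (size_polyD _ _))// geq_max.
    by rewrite size_polyC size_scale// size_polyX andbT; case: (c0 != 0).
  by case: (size _) => [|[|[|]]].
- by rewrite ltr_wpDl.
- exists d => //= h /=; rewrite sub0r normrN => hd.
  rewrite normC_normc lecR hornerD hornerC hornerZ hornerX opprD addrA.
  rewrite (le_trans (H h hd))// ler_wpM2r ?powR_ge0//.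
  by rewrite (le_trans (ler_norm _))// lerDl.
Qed.

(** For b <= 2 the terms of degree at least 2 are O(|h|^b) and join the error, so that an affine
    polynomial remains whatever the degree of [P]. *)
Lemma holder_elim (f : R -> R[i]) t a b : 0 < b -> b <= a -> b <= 2 ->
  holder_at f t a ->
  exists (c0 c1 : R[i]) (C d : R), [/\ 0 <= C, 0 < d, d <= 1 &
    forall h, `|h| < d -> normc (f (t + h) - c0 - c1 * h%:C) <= C * `|h| `^ b].
Proof.
move=> b0 ba b2 [P [C [_ C0 [d d0 Hd]]]].
pose Q := drop_poly 2 P.
exists P`_0, P`_1, (C + \sum_(i < size Q) normc Q`_i), (minr d 1); split.
- by apply: addr_ge0; [exact: ltW|apply: sumr_ge0 => i _; exact: normc_ge0].
- by rewrite lt_min d0 ltr01.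
- by rewrite ge_min lexx orbT.
move=> h; rewrite lt_min => /andP[hd h1].
have := Hd h; rewrite /= sub0r normrN => /(_ hd); rewrite normC_normc lecR => Hh.
have PE : P.[h%:C] = P`_0 + P`_1 * h%:C + Q.[h%:C] * h%:C ^+ 2.
  rewrite -{1}(poly_take_drop 2 P) hornerD hornerM hornerXn -/Q; congr (_ + _).
  rewrite (@horner_coef_wide _ 2) ?size_take_poly//.
  by rewrite big_ord_recl big_ord1 !coef_take_poly /= expr0 mulr1 expr1.
rewrite (_ : _ - _ - _ = (f (t + h) - P.[h%:C]) + Q.[h%:C] * h%:C ^+ 2); last first.
  by rewrite PE; ring.
rewrite (le_trans (le_normcD _ _))// mulrDl lerD//.
  by rewrite (le_trans Hh)// ler_pM2l// powR_anti_exp// normr_ge0 ltW.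
rewrite normcM ler_pM ?normc_ge0 ?normc_horner ?(ltW h1)//.
rewrite -rmorphXn normc_real normrX -powR_mulrn// powR_anti_exp// normr_ge0 ltW//.
Qed.

(** A linear term is allowed even for a < 1, where it is O(|h|^a) anyway; one form thus serves all
    orders up to 2. *)
Definition affine_holder (f : R -> R[i]) t a :=
  exists (c0 c1 : R[i]) (C d : R),
  [/\ 0 <= C, 0 < d, d <= 1 &
    forall h, `|h| < d -> normc (f (t + h) - c0 - c1 * h%:C) <= C * `|h| `^ a].

(** An order above b may be lowered to the minimum of itself and 2, which is still above b; so only
    affine approximations have to be refuted. *)
Lemma holder_exponent_le (f : R -> R[i]) t b : 0 < b -> b < 2 ->
  (forall a, b < a -> a <= 2 -> ~ affine_holder f t a) ->
  (holder_exponent f t <= b%:E)%E.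
Proof.
move=> b0 b2 H; apply: ge_ereal_sup => _ [a [a0 Ha] <-]; rewrite lee_fin.
rewrite leNgt; apply/negP => ba.
apply: (H (minr a 2)); first by rewrite lt_min ba.
  by rewrite ge_min lexx orbT.
by apply: (holder_elim (a := a)); rewrite ?lt_min ?a0 ?ge_min ?lexx ?orbT//=.
Qed.

(** The larger order a' takes the place of monotonicity of [holder_at] in the order: the general
    bound has only the order 1/2 at its disposal, and the bound 3/2 only orders at least 1. *)
Lemma holder_exponent_ge (f : R -> R[i]) t b :
  (forall a, 0 < a -> a < b -> exists2 a', a <= a' & holder_at f t a') ->
  0 < b -> (b%:E <= holder_exponent f t)%E.
Proof.
move=> H b0; apply/lee_addgt0Pr => eps eps0; rewrite -leeBlDr//.
pose a := maxr (b - eps) (b / 2).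
have [|//|a' aa' Ha'] := H a; rewrite ?lt_max ?gt_max; first by lra.
  by apply/andP; split; lra.
apply: (@le_trans _ _ a'%:E).
  by rewrite -EFinB lee_fin (le_trans _ aa')// le_max lexx.
apply: ereal_sup_ubound; exists a' => //; split => //.
by rewrite (lt_le_trans _ aa')// lt_max; apply/orP; right; lra.
Qed.

(** The bound 1 <= a lets the linear terms of the summands enter the polynomial of the
    combination. *)
Lemma holder_at_comb (n : nat) (w : 'I_n -> R[i]) (g : 'I_n -> R -> R[i])
    (f : R -> R[i]) t t' a : 1 <= a ->  a <= 2 ->
  (forall h, f (t + h) = \sum_(i < n) w i * g i (t' + h)) ->
  (forall i, holder_at (g i) t' a) -> holder_at f t a.
Proof.
move=> a1 a2 E H; have a0 : 0 < a by rewrite (lt_le_trans ltr01).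
have /choice[c0 /choice[c1 /choice[C /choice[d Hd]]]] i :=
  holder_elim a0 (lexx a) a2 (H i).
pose dd := \big[minr/1]_(i < n) d i.
have dd0 : 0 < dd by rewrite /dd; elim/big_ind : _ => // [x y x0 y0|i _]; [rewrite lt_min x0 y0|case: (Hd i)].
apply: (@holder_intro f t a (\sum_i w i * c0 i) (\sum_i w i * c1 i)
  (\sum_i normc (w i) * C i) dd) => //; first by right.
move=> h hd.
rewrite E mulr_suml -!sumrB mulr_suml (le_trans (normc_sum _ _ _))//.
apply: ler_sum => i _.
rewrite -!mulrA -!mulrBr normcM ler_wpM2l ?normc_ge0//.
case: (Hd i) => _ _ _; apply; rewrite (lt_le_trans hd)//.
by rewrite /dd; apply: bigmin_le_cond.
Qed.

End Basics.

Arguments cj {R} z : simpl never.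
Arguments e {R} x : simpl never.
Arguments ee {R} x t n : simpl never.

(** * Isolating a window of frequencies *)

Section UpperBound.
Variable R : realType.
Implicit Types (x y h t a b : R) (z w : R[i]).

Lemma sum4 (S : comPzRingType) (L : nat) (f1 f2 f3 f4 : 'I_L -> S) :
  \sum_i1 \sum_i2 \sum_i3 \sum_i4 f1 i1 * f2 i2 * f3 i3 * f4 i4 =
  (\sum_i f1 i) * (\sum_i f2 i) * (\sum_i f3 i) * (\sum_i f4 i).
Proof.
rewrite -!mulrA big_distrl; apply: eq_bigr => i1 _ /=.
rewrite big_distrl big_distrr; apply: eq_bigr => i2 _ /=.
rewrite big_distrl !big_distrr; apply: eq_bigr => i3 _ /=.
by rewrite !big_distrr; apply: eq_bigr => i4 _ /=; rewrite !mulrA.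
Qed.

Definition quad L : finType := ('I_L * 'I_L * 'I_L * 'I_L)%type.
Definition wt L (i : quad L) : nat := (i.1.1.1 + i.1.1.2 + i.1.2 + i.2)%N.

Lemma big_quad (S : nmodType) (L : nat) (F : quad L -> S) :
  \sum_i F i = \sum_i1 \sum_i2 \sum_i3 \sum_i4 F (i1, i2, i3, i4).
Proof.
rewrite (pair_bigA _ (fun i1 i2 => \sum_i3 \sum_i4 F (i1, i2, i3, i4))) /=.
rewrite (pair_bigA _ (fun p i3 => \sum_i4 F (p.1, p.2, i3, i4))) /=.
rewrite (pair_bigA _ (fun p i4 => F (p.1.1, p.1.2, p.2, i4))) /=.
by apply: eq_bigr => -[[[i1 i2] i3] i4].
Qed.

Lemma wt_lt L (i : quad L) : (wt i <= 4 * L)%N.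
Proof.
case: i => [[[[a ha] [b hb]] [c hc]] [d hd]]; rewrite /wt /=; lia.
Qed.

Definition dirichlet (L : nat) h : R[i] := \sum_(i < L) e (- (i%:R * h)).
Definition ddirichlet (L : nat) h : R[i] :=
  \sum_(i < L) i%:R * e (- (i%:R * h)).

(* The weight [wt i] cancels the factor [n^-2] of the frequency [n^2 = wt i]. *)
Definition jkernel (L : nat) h : R[i] :=
  \sum_(i : quad L) (wt i)%:R * e (- ((wt i)%:R * h)).

(** Up to a constant factor the kernel is the derivative of [dirichlet L h ^+ 4], hence the product
    rule. *)
Lemma jkernelE L h : jkernel L h = 4 * dirichlet L h ^+ 3 * ddirichlet L h.
Proof.
rewrite /jkernel big_quad /wt /=.
pose a (i : 'I_L) : R[i] := e (- (i%:R * h)).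
pose b (i : 'I_L) : R[i] := i%:R * a i.
transitivity (\sum_(i1 < L) \sum_(i2 < L) \sum_(i3 < L) \sum_(i4 < L)
    (b i1 * a i2 * a i3 * a i4 + a i1 * b i2 * a i3 * a i4 +
     a i1 * a i2 * b i3 * a i4 + a i1 * a i2 * a i3 * b i4)).
  apply: eq_bigr => i1 _; apply: eq_bigr => i2 _; apply: eq_bigr => i3 _.
  apply: eq_bigr => i4 _; rewrite /b /a !natrD !mulrDl !opprD !eD; ring.
transitivity (\sum_(i1 < L) \sum_(i2 < L) \sum_(i3 < L)
    (\sum_(i4 < L) b i1 * a i2 * a i3 * a i4 + \sum_(i4 < L) a i1 * b i2 * a i3 * a i4 +
     \sum_(i4 < L) a i1 * a i2 * b i3 * a i4 + \sum_(i4 < L) a i1 * a i2 * a i3 * b i4)).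
  apply: eq_bigr => i1 _; apply: eq_bigr => i2 _; apply: eq_bigr => i3 _.
  by rewrite !big_split.
under eq_bigr => i1 _.
  under eq_bigr => i2 _ do rewrite !big_split /=.
  rewrite !big_split /=.
  over.
rewrite !big_split /= !sum4 /dirichlet /ddirichlet -/(\sum_i a i) -/(\sum_i b i).
rewrite exprS expr2; ring.
Qed.

Lemma geom_bound (m n : nat) h : `|h| <= 1 / 2 ->
  normc (\sum_(m <= i < n) e (- (i%:R * h))) * `|h| <= 1.
Proof.
move=> h2.
have [nm|mn] := leqP n m; first by rewrite big_geq// normc0 mul0r.
have E : (e (- h) - 1) * \sum_(m <= i < n) e (- (i%:R * h)) =
    e (- (n%:R * h)) - e (- (m%:R * h)).
  rewrite big_distrr /= -(telescope_sumr (fun i => e (- (i%:R * h))) (ltnW mn)).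
  apply: eq_bigr => i _.
  have -> : - (i.+1%:R * h) = - h + - (i%:R * h) by rewrite -natr1; ring.
  rewrite eD; ring.
have := normcB (e (- (n%:R * h))) (e (- (m%:R * h))).
rewrite -E normcM !normc_e => H.
have := @normc_e1_ge R (- h); rewrite normrN => /(_ h2) H2.
have := normc_ge0 (\sum_(m <= i < n) e (- (i%:R * h))).
move: H H2; set S := normc (\sum_(m <= i < n) _); set T := normc (e _ - _).
have := normr_ge0 h; nra.
Qed.

Lemma normc_dirichlet L h : normc (dirichlet L h) <= L%:R.
Proof.
rewrite (le_trans (normc_sum _ _ _))//; under eq_bigr do rewrite normc_e.
by rewrite sumr_const card_ord.
Qed.

Lemma dirichlet_decay L h : `|h| <= 1 / 2 -> normc (dirichlet L h) * `|h| <= 1.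
Proof.
by move=> h2; rewrite /dirichlet -(big_mkord xpredT (fun i => e (- (i%:R * h)))) geom_bound.
Qed.

Lemma normc_ddirichlet L h : normc (ddirichlet L h) <= L%:R ^+ 2.
Proof.
rewrite (le_trans (normc_sum _ _ _))//.
apply: (@le_trans _ _ (\sum_(i < L) L%:R)).
  apply: ler_sum => i _; rewrite normcM normc_e mulr1 normc_nat ler_nat.
  by rewrite ltnW.
by rewrite sumr_const card_ord -mulrnA expr2 natrM.
Qed.

(** Writing i as the number of k < i expresses the weighted sum by L tails of a geometric sum, each
    at most 1/|h|. *)
Lemma ddirichletE L h :
  ddirichlet L h = \sum_(k < L) \sum_(k.+1 <= i < L) e (- (i%:R * h)).
Proof.
transitivity (\sum_(k < L) \sum_(i < L | (k < i)%N) e (- (i%:R * h)) : R[i]).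
  rewrite (exchange_big_dep xpredT)//=; apply: eq_bigr => i _.
  by rewrite (big_ord_narrow (ltnW (ltn_ord i))) sumr_const card_ord mulr_natl.
apply: eq_bigr => k _.
by rewrite big_geq_mkord.
Qed.

Lemma ddirichlet_decay L h : `|h| <= 1 / 2 ->
  normc (ddirichlet L h) * `|h| <= L%:R.
Proof.
move=> h2; rewrite ddirichletE.
apply: (@le_trans _ _ (\sum_(k < L) normc (\sum_(k.+1 <= i < L) e (- (i%:R * h))) * `|h|)).
  by rewrite -big_distrl /= ler_wpM2r// normc_sum.
apply: (@le_trans _ _ (\sum_(k < L) 1)); last by rewrite sumr_const card_ord.
by apply: ler_sum => k _; exact: geom_bound.
Qed.

(** Two factors [dirichlet] are kept for Parseval. The product of the third with [ddirichlet] is at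
    most L L^2 trivially and at most (1/|h|) (L/|h|) by decay, which pays for the factor 1 + L^2
    h^2. *)
Lemma jkernel_bound L h : `|h| <= 1 / 2 ->
  normc (jkernel L h) * (1 + L%:R ^+ 2 * h ^+ 2) <=
  8 * L%:R ^+ 3 * normc (dirichlet L h) ^+ 2.
Proof.
move=> h2; rewrite jkernelE !normcM normc_nat.
have := normc_dirichlet L h; have := dirichlet_decay L h2.
have := normc_ddirichlet L h; have := ddirichlet_decay L h2.
have := normc_ge0 (dirichlet L h); have := normc_ge0 (ddirichlet L h).
rewrite -(real_normK (num_real h)).
move: (normc (dirichlet _ _)) (normc (ddirichlet _ _)) (normr_ge0 h).
set l : R := L%:R; have : 0 <= l by []; move: l (`|h|) => l u l0 d dd u0 dd0 d0 b1 b2 b3 b4.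
have -> : 4 * (d * (d * d)) * dd * (1 + l ^+ 2 * u ^+ 2) =
   4 * d ^+ 2 * (d * dd + l ^+ 2 * ((d * u) * (dd * u))) by ring.
have -> : 8 * l ^+ 3 * d ^+ 2 = 4 * d ^+ 2 * (l * l ^+ 2 + l ^+ 2 * (1 * l)) by ring.
rewrite ler_wpM2l ?mulr_ge0 ?sqr_ge0// lerD ?ler_pM// ?ler_wpM2l ?sqr_ge0// ?ler_pM ?mulr_ge0//.
Qed.

(** A full period sampled at 2M + 1 points centred at 0: means over it are exact for differences of
    frequencies in [0, M] and replace integrals. *)
Definition gridpt (M : nat) (l : nat) : R := (l%:R - M%:R) / M.*2.+1%:R.

Lemma gridpt_le M (l : 'I_M.*2.+1) : `|gridpt M l| <= 1 / 2.
Proof.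
rewrite /gridpt normrM normfV [`|_.+1%:R|]ger0_norm// ler_pdivrMr ?ltr0n//.
have : (l%:R : R) <= M.*2%:R by rewrite ler_nat -ltnS.
have : 0 <= (l%:R : R) by []; move: (l%:R : R) => x x0.
rewrite -[M.*2.+1%:R]natr1 -[M.*2]muln2 natrM => h.
by rewrite ler_norml; apply/andP; split; lra.
Qed.

Lemma sum_gridpt (M a b : nat) : (a <= M)%N -> (b <= M)%N ->
  \sum_(l < M.*2.+1) e ((a%:R - b%:R) * gridpt M l) =
  (a == b)%:R * M.*2.+1%:R.
Proof.
move=> aM bM; have [->|ab] := eqVneq a b.
  under eq_bigr do rewrite subrr mul0r e0.
  by rewrite sumr_const card_ord mul1r.
rewrite mul0r.
have Mn0 : (M.*2.+1%:R : R) != 0 by rewrite pnatr_eq0.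
pose z := e ((a%:R - b%:R) / M.*2.+1%:R : R).
have zM : z ^+ M.*2.+1 = 1.
  rewrite -eMn mulrC divfK// -(eDint _ b) subrK /=.
  by rewrite e_nat.
have zn1 : z - 1 != 0.
  apply/eqP => z1; have := @normc_e1_ge R ((a%:R - b%:R) / M.*2.+1%:R).
  rewrite -/z z1 normc0 normrM normfV [`|_.+1%:R|]ger0_norm//.
  have p : 0 < `|a%:R - b%:R| / M.*2.+1%:R :> R.
    by rewrite divr_gt0 ?ltr0n// normr_gt0 subr_eq0 eqr_nat.
  suff le : `|a%:R - b%:R| / M.*2.+1%:R <= 1 / 2 :> R.
    by move=> /(_ le); rewrite leNgt pmulr_rgt0// p.
  rewrite ler_pdivrMr ?ltr0n// -[M.*2.+1%:R]natr1 -[M.*2]muln2 natrM.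
  have : (a%:R : R) <= M%:R by rewrite ler_nat.
  have : (b%:R : R) <= M%:R by rewrite ler_nat.
  have : 0 <= (a%:R : R) by []. have : 0 <= (b%:R : R) by [].
  by move=> *; rewrite ler_norml; apply/andP; split; lra.
have E l : e ((a%:R - b%:R) * gridpt M l) = e (- ((a%:R - b%:R) * M%:R / M.*2.+1%:R)) * z ^+ l.
  by rewrite /z -eMn -eD /gridpt; congr e; field.
under eq_bigr do rewrite E.
rewrite -big_distrr /=; apply/eqP; rewrite mulf_eq0; apply/orP; right.
by have /eqP := subrX1 z M.*2.+1; rewrite zM subrr eq_sym mulf_eq0 (negbTE zn1).
Qed.


(** Parseval's identity on the grid. *)
Lemma dirichlet_mean (M L : nat) : (L <= M)%N ->
  \sum_(l < M.*2.+1) normc (dirichlet L (gridpt M l)) ^+ 2 =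
  L%:R * M.*2.+1%:R.
Proof.
move=> LM; apply: (@complexI R); rewrite rmorph_sum /=.
under eq_bigr => l _.
  rewrite normc_sqrE /dirichlet cj_sum big_distrl /=.
  under eq_bigr => i _.
    rewrite big_distrr /=.
    under eq_bigr => j _ do rewrite -eN opprK -eD addrC -mulrBl.
    over.
  over.
rewrite exchange_big /=.
under eq_bigr => i _.
  rewrite exchange_big /=.
  under eq_bigr => j _.
    rewrite sum_gridpt ?(leq_trans (ltnW (ltn_ord _)) LM)//.
    over.
  over.
transitivity (\sum_(i < L) (M.*2.+1%:R : R[i])); last first.
  by rewrite sumr_const card_ord rmorphM /= !rmorph_nat mulr_natl.
apply: eq_bigr => i _; rewrite (bigD1 i)//= eqxx mul1r big1 ?addr0// => j ji.
by rewrite (_ : (j == i :> nat) = false) ?mul0r//; exact/negbTE.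
Qed.

Lemma powR_add_le x y a : 0 < a -> a <= 2 ->
  `|x + y| `^ a <= 4 * (`|x| `^ a + `|y| `^ a).
Proof.
move=> a0 a2.
have E (u v : R) : `|u| <= `|v| -> `|u + v| `^ a <= 4 * (`|u| `^ a + `|v| `^ a).
  move=> uv; apply: (@le_trans _ _ ((2 * `|v|) `^ a)).
    apply: ge0_ler_powR; rewrite ?nnegrE ?mulr_ge0 ?(ltW a0)//.
    by rewrite (le_trans (ler_normD _ _))// mulr_natl mulr2n lerD2r.
  rewrite powRM// ler_pM ?powR_ge0//; last by rewrite lerDr powR_ge0.
  rewrite (le_trans (ler_powR _ a2))//; first by rewrite ler1n.
  by rewrite powR_mulrn//; lra.
have [h|h] := leP `|x| `|y|; first exact: E.
by rewrite addrC [`|x| `^ a + _]addrC; apply: E; exact: ltW.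
Qed.

Lemma powR_le_1Dsqr x a : 0 <= x -> 0 < a -> a <= 2 -> x `^ a <= 1 + x ^+ 2.
Proof.
move=> x0 a0 a2; have [x1|x1] := leP x 1.
  rewrite (@le_trans _ _ 1)//; last by rewrite lerDl sqr_ge0.
  have -> : (1 : R) = 1 `^ a by rewrite powR1.
  by apply: ge0_ler_powR; rewrite ?nnegrE ?(ltW a0).
rewrite (le_trans (ler_powR (ltW x1) a2))//.
by rewrite powR_mulrn// lerDr.
Qed.

(** |h0 + g|^a splits into |h0|^a and |g|^a at the cost of a factor 4, and |g|^a <= L^-a (1 + L^2
    g^2) because a <= 2; [jkernel_bound] absorbs this factor and Parseval sums what is left. *)
Lemma jkernel_mean M L a h0 : (0 < L)%N -> (L <= M)%N -> 0 < a -> a <= 2 ->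
  \sum_(l < M.*2.+1) `|h0 + gridpt M l| `^ a * normc (jkernel L (gridpt M l)) <=
  32 * L%:R ^+ 4 * (`|h0| `^ a + L%:R `^ (- a)) * M.*2.+1%:R.
Proof.
move=> L0 LM a0 a2.
have Lp : (0 : R) < L%:R by rewrite ltr0n.
pose A := `|h0| `^ a + L%:R `^ (- a).
have A0 : 0 <= A by rewrite addr_ge0 ?powR_ge0.
apply: (@le_trans _ _ (\sum_(l < M.*2.+1)
    (4 * A) * (8 * L%:R ^+ 3 * normc (dirichlet L (gridpt M l)) ^+ 2))); last first.
  rewrite -!big_distrr /= dirichlet_mean// -/A le_eqVlt; apply/orP; left.
  by apply/eqP; ring.
apply: ler_sum => l _; set g := gridpt M l.
have K0 := normc_ge0 (jkernel L g).
apply: (@le_trans _ _ (4 * A * (normc (jkernel L g) * (1 + L%:R ^+ 2 * g ^+ 2)))); last first.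
  by rewrite ler_wpM2l ?jkernel_bound ?gridpt_le// mulr_ge0.
rewrite mulrC [leRHS]mulrCA ler_wpM2l// (le_trans (powR_add_le _ _ a0 a2))//.
rewrite -mulrA ler_pM2l// mulrDl lerD//.
  by rewrite ler_peMr ?powR_ge0// lerDl mulr_ge0 ?sqr_ge0.
rewrite powRN -[leLHS](@mulKf _ (L%:R `^ a)) ?gt_eqF ?powR_gt0//.
rewrite ler_wpM2l ?invr_ge0 ?powR_ge0// -powRM//.
rewrite (le_trans (powR_le_1Dsqr _ a0 a2)) ?mulr_ge0//.
by rewrite exprMn real_normK ?num_real.
Qed.

Definition gg x0 t n : R[i] := ee x0 t n + ee (- x0) t n.

Lemma rterm_shift x0 t h n :
  rterm x0 (t + h) n = (n%:R ^- 2)%:C * gg x0 t n * e (n%:R ^+ 2 * h).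
Proof.
rewrite /rterm /gg /ee !mulrDr !eD; ring.
Qed.

(** With three entries of i fixed, the last one selects the squares in an interval of length L: this
    is a sum of L^3 window sums. *)
Definition window_sum x0 t (L J : nat) : R[i] :=
  \sum_(i : quad L) \sum_(k < J) (k.+1 ^ 2 == wt i)%N%:R * gg x0 t k.+1.

Lemma jkernel_extract M L J x0 t : (J ^ 2 <= M)%N -> (4 * L <= M)%N ->
  \sum_(l < M.*2.+1) rpart x0 (t + gridpt M l) J * jkernel L (gridpt M l) =
  window_sum x0 t L J * M.*2.+1%:R.
Proof.
move=> JM LM.
transitivity (\sum_(l < M.*2.+1) \sum_(i : quad L) \sum_(k < J)
    ((wt i)%:R * (k.+1%:R ^- 2)%:C * gg x0 t k.+1) *
     e (((k.+1 ^ 2)%N%:R - (wt i)%:R) * gridpt M l)).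
  apply: eq_bigr => l _; rewrite /jkernel big_distrr /=; apply: eq_bigr => i _.
  rewrite /rpart big_distrl /=; apply: eq_bigr => k _.
  rewrite rterm_shift mulrBl eD natrX; ring.
rewrite exchange_big /window_sum big_distrl /=; apply: eq_bigr => i _.
rewrite exchange_big big_distrl /=; apply: eq_bigr => k _.
rewrite -big_distrr /= sum_gridpt; last 2 first.
- by rewrite (leq_trans _ JM)// leq_exp2r// ltn_ord.
- by rewrite (leq_trans (wt_lt i)).
have [E|_] := eqVneq; last by rewrite !(mul0r, mulr0).
rewrite -E !mul1r; congr (_ * _).
have -> : ((k.+1 ^ 2)%N%:R : R[i]) = (k.+1%:R ^+ 2 : R)%:C.
  by rewrite rmorphXn rmorph_nat natrX.
by rewrite -rmorphM /= mulfV ?mul1r.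
Qed.

(** The only frequency that a constant can meet is 0, and its weight is 0. *)
Lemma jkernel_const M L : (4 * L <= M)%N ->
  \sum_(l < M.*2.+1) jkernel L (gridpt M l) = 0.
Proof.
move=> LM; rewrite exchange_big big1//= => i _; rewrite -big_distrr /=.
have := @sum_gridpt M 0 (wt i) isT (leq_trans (wt_lt i) LM).

under [in X in X -> _]eq_bigr => l _ do rewrite sub0r mulNr.
move=> ->; have [<-|_] := eqVneq 0%N (wt i); first by rewrite mul0r.
by rewrite mul0r mulr0.
Qed.

Lemma sum_lt2 (L : nat) : \sum_(i < L) ((i < 2)%N%:R : R) <= 2.
Proof.
have -> : \sum_(i < L) ((i < 2)%N%:R : R) = (minn L 2)%:R.
  elim: L => [|L IH]; first by rewrite big_ord0.
  rewrite big_ord_recr /= IH -natrD; congr (_%:R).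
  by case: L {IH} => [|[|L]].
by rewrite ler_nat geq_minr.
Qed.

(** Only quadruples of sum 1 survive, and their entries are below 2: hence the crude count 16 =
    2^4. *)
Lemma jkernel_freq1 M L h0 : (0 < M)%N -> (4 * L <= M)%N ->
  normc (\sum_(l < M.*2.+1) e (h0 + gridpt M l) * jkernel L (gridpt M l)) <=
  16 * M.*2.+1%:R.
Proof.
move=> M0 LM.
have -> : \sum_(l < M.*2.+1) e (h0 + gridpt M l) * jkernel L (gridpt M l) =
    \sum_(i : quad L) e h0 * (wt i)%:R * ((1%N == wt i)%:R * M.*2.+1%:R).
  transitivity (\sum_(l < M.*2.+1) \sum_(i : quad L)
     e h0 * (wt i)%:R * e ((1%:R - (wt i)%:R) * gridpt M l)).
    apply: eq_bigr => l _; rewrite /jkernel big_distrr /=; apply: eq_bigr => i _.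
    rewrite mulrBl mul1r !eD; ring.
  rewrite exchange_big /=; apply: eq_bigr => i _; rewrite -big_distrr /=.
  by rewrite sum_gridpt// (leq_trans (wt_lt i)).
rewrite (le_trans (normc_sum _ _ _))//.
apply: (@le_trans _ _ (\sum_(i : quad L)
   ((i.1.1.1 < 2)%N%:R * (i.1.1.2 < 2)%N%:R * (i.1.2 < 2)%N%:R * (i.2 < 2)%N%:R)
   * (M.*2.+1%:R : R))).
  apply: ler_sum => i _.
  have [E|_] := eqVneq 1%N (wt i); last first.
    by rewrite !(mul0r, mulr0) normc0 !mulr_ge0.
  rewrite -E mulr1 mul1r normcM normc_e mul1r normc_nat.
  have [h1 h2 h3 h4] : [/\ (i.1.1.1 < 2)%N, (i.1.1.2 < 2)%N, (i.1.2 < 2)%N & (i.2 < 2)%N].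
    by move: E; rewrite /wt => E; split; lia.
  by rewrite h1 h2 h3 h4 !mul1r.
rewrite -big_distrl /= ler_wpM2r// big_quad /= sum4.
have h := sum_lt2 L; have h0' : 0 <= \sum_(i < L) ((i < 2)%N%:R : R) by rewrite sumr_ge0.
move: (\sum_(i < L) _) h h0' => s h h0'.
by rewrite (_ : 16 = 2 * 2 * 2 * 2 :> R) ?ler_pM ?mulr_ge0//; ring.
Qed.

Lemma riemann_fun_bounded x0 t : normc (riemann_fun x0 t) <= 6.
Proof.
have := @riemann_fun_approx R x0 t 1 isT; rewrite divr1 => H.
have := normc_triangle (riemann_fun x0 t) 0 (rpart x0 t 1); rewrite !subr0.
rewrite {2}/rpart big_ord1; have := normc_rterm x0 t 1; rewrite expr1n invr1 mulr1.
lra.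
Qed.

Lemma normc_e1_taylor h :
  normc (e h - 1 - (0 +i* (2 * pi)) * h%:C) <= 128 * h ^+ 2.
Proof.
rewrite (le_trans (normc_le_add _))// /e /expi /=.
set x := 2 * pi * h.
have -> : cos x - 1 - (0 * h - 2 * pi * 0) = cos x - 1 by ring.
have -> : sin x - 0 - (0 * 0 + 2 * pi * h) = sin x - x by rewrite /x; ring.
have c1 y : `|cos y - 1| <= `|y|.
  have : cos y - 1 = - (2 * sin (y / 2) ^+ 2).
    have -> : cos y = cos ((y / 2) *+ 2) by congr cos; rewrite -mulr_natr divfK.
    by rewrite cos_mulr2n cos2sin2; ring.
  move=> ->; rewrite normrN normrM (ger0_norm (_ : 0 <= 2))//.
  rewrite normrX -(@ler_pM2l _ 2^-1) ?invr_gt0// mulrA mulVf// mul1r.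
  rewrite (@le_trans _ _ `|sin (y / 2)|)//.
    by rewrite expr2 ler_piMl ?sin_max.
  rewrite (le_trans (abs_sin_le _))// normrM [`|2^-1|]ger0_norm// mulrC//.
have c2 : `|cos x - 1| <= x ^+ 2.
  have : cos x - 1 = - (2 * sin (x / 2) ^+ 2).
    have -> : cos x = cos ((x / 2) *+ 2) by congr cos; rewrite -mulr_natr divfK.
    by rewrite cos_mulr2n cos2sin2; ring.
  move=> ->; rewrite normrN normrM (ger0_norm (_ : 0 <= 2))//.
  rewrite -[sin _ ^+ 2]real_normK ?num_real// normrX normr_id.
  have := abs_sin_le (x / 2); rewrite normrM [`|2^-1|]ger0_norm//.
  rewrite -[x ^+ 2]real_normK ?num_real//; have := normr_ge0 (sin (x / 2)).
  have := normr_ge0 x; nra.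
have c3 : `|sin x - x| <= x ^+ 2.
  have E y : 0 < y -> `|sin y - y| <= y ^+ 2.
    move=> y0.
    have dF (u : R) : is_derive u 1 (fun y : R => sin y - y) (cos u - 1).
      by apply: is_deriveB.
    have cF : {within `[0, y], continuous (fun y : R => sin y - y)}.
      apply: continuous_subspaceT => u.
      by apply: differentiable_continuous; apply/derivable1_diffP; case: (dF u).
    have [c] := MVT_segment (ltW y0) (fun u _ => dF u) cF.
    rewrite in_itv /= => /andP[cc0 cy].
    rewrite sin0 !subr0 => ->; rewrite normrM (ger0_norm (ltW y0)) expr2.
    rewrite ler_pM2r// (le_trans (c1 _))// ger0_norm//.
  have [x0|x0|->] := ltgtP x 0; last by rewrite sin0 subr0 normr0 expr0n.
    have := E (- x); rewrite sinN sqrrN -opprD normrN; apply; lra.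
  exact: E.
have : x ^+ 2 <= 64 * h ^+ 2.
  rewrite /x exprMn ler_wpM2r ?sqr_ge0//; have := pi_lt4 R; have := @pi_ge2 R; nra.
lra.
Qed.

(** Replacing h by (e h - 1)/(2 pi i) costs O(h^2), admissible for a <= 2. The approximant becomes a
    trigonometric polynomial of frequencies 0 and 1, against which the kernel is nearly orthogonal;
    being bounded like the function, it satisfies the estimate for all h, as means over a whole
    period require. *)
Lemma affine_holder_global x0 t a : 0 < a -> a <= 2 ->
  affine_holder (riemann_fun x0) t a ->
  exists (c0 c1 : R[i]) (C : R), 0 <= C /\
    forall h, normc (riemann_fun x0 (t + h) - c0 - c1 * e h) <= C * `|h| `^ a.
Proof.
move=> a0 a2 [c0 [c1 [C [d [C0 d0 d1 H]]]]].
pose w : R[i] := 0 +i* (2 * pi).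
have wn0 : w != 0.
  by apply/eqP => -[] /eqP; rewrite mulf_eq0 pnatr_eq0 /= gt_eqF ?pi_gt0.
pose b1 := c1 / w; pose b0 := c0 - b1.
have da : 0 < d `^ a by rewrite powR_gt0.
exists b0, b1, (C + 128 * normc b1 + (6 + normc b0 + normc b1) / d `^ a); split.
  rewrite addr_ge0 ?addr_ge0 ?mulr_ge0 ?normc_ge0//.
    by rewrite !addr_ge0 ?normc_ge0.
  by rewrite invr_ge0 powR_ge0.
move=> h; have [hd|hd] := ltP `|h| d.
  rewrite (@le_trans _ _ ((C + 128 * normc b1) * `|h| `^ a))//; last first.
    by rewrite ler_wpM2r ?powR_ge0// lerDl divr_ge0 ?(ltW da)// !addr_ge0 ?normc_ge0.
  have -> : riemann_fun x0 (t + h) - b0 - b1 * e h =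
     (riemann_fun x0 (t + h) - c0 - c1 * h%:C) - b1 * (e h - 1 - w * h%:C).
    rewrite /b0; have -> : c1 = b1 * w by rewrite divfK.
    ring.
  rewrite (le_trans (normcB _ _))// mulrDl lerD// ?H//.
  rewrite normcM [128 * _]mulrC -mulrA ler_wpM2l ?normc_ge0//.
  rewrite (le_trans (normc_e1_taylor _))// ler_pM2l//.
  rewrite -real_normK ?num_real// -powR_mulrn// powR_anti_exp//.
  by rewrite normr_ge0 ltW// (lt_le_trans hd).
rewrite (@le_trans _ _ ((6 + normc b0 + normc b1) / d `^ a * `|h| `^ a))//; last first.
  by rewrite ler_wpM2r ?powR_ge0// lerDr addr_ge0// mulr_ge0 ?normc_ge0.
rewrite [leRHS]mulrAC ler_pdivlMr//.
rewrite (@le_trans _ _ ((6 + normc b0 + normc b1) * d `^ a))//.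
  rewrite ler_pM2r// (le_trans (normcB _ _))// normcM normc_e mulr1 lerD2r.
  by rewrite (le_trans (normcB _ _))// lerD2r riemann_fun_bounded.
rewrite ler_wpM2l//; first by rewrite !addr_ge0 ?normc_ge0.
by apply: ge0_ler_powR; rewrite ?nnegrE ?(ltW a0) ?(ltW d0).
Qed.

Lemma jkernel_sup L h : `|h| <= 1 / 2 -> normc (jkernel L h) <= 8 * L%:R ^+ 5.
Proof.
move=> h2; have := jkernel_bound L h2 => H.
apply: (@le_trans _ _ (8 * L%:R ^+ 3 * normc (dirichlet L h) ^+ 2)).
  rewrite (le_trans _ H)// ler_peMr ?normc_ge0// lerDl mulr_ge0 ?sqr_ge0//.
rewrite (_ : _ ^+ 5 = L%:R ^+ 3 * L%:R ^+ 2); last by rewrite -exprD.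
rewrite mulrA.
rewrite ler_wpM2l ?mulr_ge0 ?exprn_ge0//.
by rewrite ler_pXn2r ?nnegrE ?normc_ge0// normc_dirichlet.
Qed.

(** The partial sum is the error of the global approximation, plus the truncation error, plus a
    combination of the frequencies 0 and 1. The kernel is summed against each of them, and only the
    first gives a contribution that grows with L. *)
Lemma window_sum_le x0 t a : 0 < a -> a <= 2 ->
  affine_holder (riemann_fun x0) t a ->
  exists C : R, 0 < C /\ forall (h0 : R) (L : nat), (0 < L)%N ->
    exists J : nat, (4 * L <= J)%N /\
      normc (window_sum x0 (t + h0) L J) <=
        C * L%:R ^+ 4 * (`|h0| `^ a + L%:R `^ (- a)).
Proof.
move=> a0 a2 /(affine_holder_global a0 a2)[c0 [c1 [C [C0 H]]]].
exists (32 * C + 16 * normc c1 + 32); split.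
  by rewrite ltr_wpDl// addr_ge0 ?mulr_ge0 ?normc_ge0.
(* The truncation error is at most 4/J and the kernel at most 8 L^5: this J keeps their product
   bounded. *)
move=> h0 L L0; pose J := (4 * L ^ 5)%N.
have LJ : (4 * L <= J)%N by rewrite leq_mul2l /= -{1}(expn1 L) leq_pexp2l.
exists J; split => //.
pose M := (J ^ 2)%N.
have J0 : (0 < J)%N by rewrite muln_gt0 expn_gt0 L0.
have JM : (J <= M)%N by rewrite -{1}(expn1 J) leq_pexp2l.
have LM : (4 * L <= M)%N by rewrite (leq_trans LJ).
have L1M : (L <= M)%N by rewrite (leq_trans _ LM)// leq_pmull.
have M0 : (0 < M)%N by rewrite (leq_trans J0).
have Mp : (0 : R) < M.*2.+1%:R by rewrite ltr0n.
have Lp : (0 : R) < L%:R by rewrite ltr0n.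
have L1 : (1 : R) <= L%:R by rewrite ler1n.
rewrite -(ler_pM2r Mp).
have -> : normc (window_sum x0 (t + h0) L J) * M.*2.+1%:R =
    normc (window_sum x0 (t + h0) L J * M.*2.+1%:R) by rewrite normcM normc_nat.
rewrite -(@jkernel_extract M L J)//.
pose F l := riemann_fun x0 (t + (h0 + gridpt M l)) - c0 - c1 * e (h0 + gridpt M l).
pose E l := rpart x0 (t + h0 + gridpt M l) J - riemann_fun x0 (t + h0 + gridpt M l).
have -> : \sum_(l < M.*2.+1) rpart x0 (t + h0 + gridpt M l) J * jkernel L (gridpt M l) =
   \sum_(l < M.*2.+1) F l * jkernel L (gridpt M l) +
   \sum_(l < M.*2.+1) E l * jkernel L (gridpt M l) +
   c1 * \sum_(l < M.*2.+1) e (h0 + gridpt M l) * jkernel L (gridpt M l) +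
   c0 * \sum_(l < M.*2.+1) jkernel L (gridpt M l).
  rewrite !big_distrr -!big_split /=; apply: eq_bigr => l _.
  rewrite /F /E addrA; ring.
rewrite jkernel_const// mulr0 addr0.
pose A := `|h0| `^ a + L%:R `^ (- a).
(* Since a <= 2, the bounded contributions of the truncation and of the frequency 1 are absorbed by
   the main bound. *)
have LA : 1 <= L%:R ^+ 4 * A.
  apply: (@le_trans _ _ (L%:R ^+ 4 * L%:R `^ (- a))).
    rewrite -powR_mulrn// -powRD; last by rewrite (gt_eqF Lp) implybT.
    rewrite -{1}(powRr0 L%:R) ler_powR//; lra.
  by rewrite ler_wpM2l ?exprn_ge0// lerDr powR_ge0.
rewrite (le_trans (le_normcD _ _))//.
have H1 : normc (\sum_(l < M.*2.+1) F l * jkernel L (gridpt M l)) <=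
    32 * C * (L%:R ^+ 4 * A) * M.*2.+1%:R.
  rewrite (le_trans (normc_sum _ _ _))//.
  apply: (@le_trans _ _ (\sum_(l < M.*2.+1) C * (`|h0 + gridpt M l| `^ a *
      normc (jkernel L (gridpt M l))))).
    apply: ler_sum => l _; rewrite normcM mulrA ler_wpM2r ?normc_ge0//.
    exact: H.
  rewrite -big_distrr /= (le_trans (ler_wpM2l C0 (jkernel_mean h0 L0 L1M a0 a2)))//.
  by rewrite le_eqVlt; apply/orP; left; apply/eqP; rewrite /A; ring.
have H2 : normc (\sum_(l < M.*2.+1) E l * jkernel L (gridpt M l)) <=
    32 * M.*2.+1%:R.
  rewrite (le_trans (normc_sum _ _ _))//.
  apply: (@le_trans _ _ (\sum_(l < M.*2.+1) 32)); last first.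
    by rewrite sumr_const card_ord mulr_natr.
  apply: ler_sum => l _; rewrite normcM normc_distC.
  apply: (@le_trans _ _ (4 / J%:R * (8 * L%:R ^+ 5))).
    by rewrite ler_pM ?normc_ge0 ?riemann_fun_approx ?jkernel_sup ?gridpt_le.
  rewrite /J natrM natrX mulrAC ler_pdivrMr ?mulr_gt0 ?exprn_gt0//.
  have : 0 <= (L%:R : R) ^+ 5 by rewrite exprn_ge0.
  lra.
have H3 : normc (c1 * \sum_(l < M.*2.+1) e (h0 + gridpt M l) * jkernel L (gridpt M l)) <=
    16 * normc c1 * M.*2.+1%:R.
  rewrite normcM (_ : _ * _ * _ = normc c1 * (16 * M.*2.+1%:R)); last by ring.
  by rewrite ler_wpM2l ?normc_ge0// jkernel_freq1.
apply: (@le_trans _ _ (32 * C * (L%:R ^+ 4 * A) * M.*2.+1%:R + 32 * M.*2.+1%:R + 16 * normc c1 * M.*2.+1%:R)).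
  by rewrite lerD// (le_trans (le_normcD _ _))// lerD.
rewrite -!mulrDl ler_pM2r// -/A -[_ * _ ^+ 4 * A]mulrA.
have := normc_ge0 c1; move: (L%:R ^+ 4 * A) LA => B B1 n1.
nra.
Qed.

End UpperBound.

(** * Weyl sums *)

Section Weyl.
Variable R : realType.
Implicit Types (x y h t a b : R) (z w : R[i]).

Lemma divn_gcd_coprime (a b : nat) : (0 < b)%N ->
  coprime (a %/ gcdn a b) (b %/ gcdn a b).
Proof.
move=> b0; have d0 : (0 < gcdn a b)%N by rewrite gcdn_gt0 b0 orbT.
by rewrite /coprime -(eqn_pmul2l d0) muln_gcdr ![(gcdn a b * _)%N]mulnC
  !divnK ?dvdn_gcdl ?dvdn_gcdr// mul1n.
Qed.

Lemma reduce_frac (p0 : int) (q0 : nat) : (0 < q0)%N ->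
  exists (p : int) (q : nat), [/\ (0 < q)%N, (q <= q0)%N, coprime `|p|%N q &
    p0%:~R / q0%:R = p%:~R / q%:R :> R].
Proof.
move=> q0p; set d := gcdn `|p0| q0.
have d0 : (0 < d)%N by rewrite gcdn_gt0 q0p orbT.
exists (p0 %/ d)%Z, (q0 %/ d)%N.
have qd : (q0 = q0 %/ d * d)%N by rewrite divnK ?dvdn_gcdr.
have pd : (p0 = (p0 %/ d)%Z * d)%R.
  by rewrite divzK// dvdzE /= dvdn_gcdl.
have q1 : (0 < q0 %/ d)%N by rewrite divn_gt0// dvdn_leq// dvdn_gcdr.
split => //; first exact: leq_div.
  have -> : `|(p0 %/ d)%Z|%N = (`|p0| %/ d)%N.
    apply/eqP; rewrite -(eqn_pmul2r d0) divnK ?dvdn_gcdl//.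
    by rewrite {2}pd abszM.
  exact: divn_gcd_coprime.
rewrite {1}pd {1}qd intrM natrM -!pmulrn.
have h1 : (q0 %/ d)%:R != 0 :> R by rewrite pnatr_eq0 -lt0n.
have h2 : d%:R != 0 :> R by rewrite pnatr_eq0 -lt0n.
by field; rewrite h1 h2.
Qed.

Lemma dirichlet_approx t (N : nat) : (0 < N)%N ->
  exists (p : int) (q : nat), [/\ (0 < q)%N, (q <= N)%N, coprime `|p|%N q &
    `|t - p%:~R / q%:R| <= 1 / (N%:R * q%:R)].
Proof.
move=> N0.
have NR : (0 : R) < N%:R by rewrite ltr0n.
pose fr (k : nat) : R := k%:R * t - (Num.floor (k%:R * t))%:~R.
have fr01 k : 0 <= fr k < 1.
  have := floor_itv (k%:R * t); rewrite intrD1 => /andP[h1 h2].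
  by rewrite /fr; apply/andP; split; lra.
have box (k : 'I_N.+1) : (truncn (N%:R * fr k) < N)%N.
  have /andP[h1 h2] := fr01 k.
  by rewrite truncn_lt_nat ?mulr_ge0// gtr_pMr.
pose f k := Ordinal (box k).
have /injectivePn[k [k' kk' ff]] : ~~ injectiveb f.
  apply/negP => /injectiveP/leq_card; rewrite !card_ord ltnn//.
wlog lt_kk' : k k' kk' ff / (k < k')%N.
  move=> W; move: (kk'); rewrite neq_ltn => /orP[|] h.
    exact: (W k k').
  by apply: (W k' k); rewrite // eq_sym.
have {}ff : truncn (N%:R * fr k) = truncn (N%:R * fr k') by case: ff.
pose q0 := (k' - k)%N.
have q0p : (0 < q0)%N by rewrite subn_gt0.
pose p0 : int := (Num.floor (k'%:R * t) - Num.floor (k%:R * t))%R.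
have q0R : (0 : R) < q0%:R by rewrite ltr0n.
have close : `|q0%:R * t - p0%:~R| < 1 / N%:R.
  have -> : q0%:R * t - p0%:~R = fr k' - fr k.
    rewrite /fr /p0 /q0 natrB ?(ltnW lt_kk')// intrB; ring.
  have /andP[a1 a2] := fr01 k; have /andP[b1 b2] := fr01 k'.
  have /andP[c1 c2] := truncn_itv (mulr_ge0 (ltW NR) a1).
  have /andP[d1 d2] := truncn_itv (mulr_ge0 (ltW NR) b1).
  rewrite -ff in d1 d2; move: c2 d2; rewrite -natr1 => c2 d2.
  rewrite ltr_pdivlMr// -[X in _ * X](ger0_norm (ltW NR)) -normrM mulrC.
  by rewrite ltr_norml mulrBr; apply/andP; split; lra.
have [p [q [qp qq0 cop E]]] := reduce_frac p0 q0p.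
have qR : (0 : R) < q%:R by rewrite ltr0n.
exists p, q; split => //.
  rewrite (leq_trans qq0)// /q0 (leq_trans (leq_subr _ _))// -ltnS//.
rewrite -E.
have -> : t - p0%:~R / q0%:R = (q0%:R * t - p0%:~R) / q0%:R.
  by field; rewrite gt_eqF.
rewrite normrM normfV (ger0_norm (ltW q0R)).
(* Reducing the fraction can only decrease the denominator, so the bound 1/(N q0) passes to 1/(N
   q). *)
rewrite invfM mulrA; apply: ler_pM; rewrite ?invr_ge0 ?(ltW q0R) ?(ltW close)//.
by rewrite lef_pV2 ?posrE// ler_nat.
Qed.

Lemma sum_triangle (N : nat) (G : nat -> nat -> R[i]) :
  \sum_(0 <= n < N) \sum_(0 <= m < n) G m n =
  \sum_(1 <= k < N) \sum_(0 <= m < N - k) G m (m + k)%N.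
Proof.
elim: N => [|N IH]; first by rewrite !big_geq.
rewrite big_nat_recr //= IH.
have [->|N0] := posnP N; first by rewrite !big_geq// addr0.
rewrite [RHS]big_nat_recr //= subSnn big_nat1 add0n.
transitivity (\sum_(1 <= k < N) (\sum_(0 <= m < N - k) G m (m + k)%N + G (N - k)%N N) + G 0%N N); last first.
  congr (_ + _); apply: eq_big_nat => k /andP[k1 kN].
  rewrite subSn 1?ltnW// big_nat_recr//= subnK// ltnW//.
rewrite big_split /= -addrA; congr (_ + _).
rewrite big_ltn// addrC; congr (_ + _).
rewrite big_nat_rev /=; apply: eq_big_nat => k /andP[k1 kN]; congr G; lia.
Qed.

(** Weyl differencing: the pairs m < n are grouped by their difference k through [sum_triangle]. *)
Lemma normc_sum_sqr (N : nat) (F : nat -> R[i]) :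
  (forall n, normc (F n) = 1) ->
  normc (\sum_(0 <= n < N) F n) ^+ 2 <=
  N%:R + 2 * \sum_(1 <= k < N) normc (\sum_(0 <= m < N - k) F (m + k)%N * cj (F m)).
Proof.
move=> F1.
have key : normc (\sum_(0 <= n < N) F n) ^+ 2 =
    N%:R + 2 * complex.Re (\sum_(0 <= n < N) \sum_(0 <= m < n) F n * cj (F m)).
  elim: N => [|N IH].
    by rewrite !big_geq// normc0 raddf0 mulr0 addr0 expr0n.
  rewrite !(big_nat_recr N)//=.
  have sq z w : normc (z + w) ^+ 2 = normc z ^+ 2 + normc w ^+ 2 + 2 * complex.Re (w * cj z).
    by rewrite !normc_sqr; case: z w => [a b] [c d] /=; rewrite /cj /=; ring.
  rewrite sq IH F1 raddfD /= -big_distrr /= cj_sum -natr1; ring.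
rewrite key lerD2l ler_pM2l// (le_trans (ler_norm _))// (le_trans (normc_Re _))//.
by rewrite sum_triangle (normc_sum _ _ _).
Qed.

Definition Hsum (n : nat) : R := \sum_(i < n) i.+1%:R^-1.

Lemma sum_blocks (M q : nat) (g : nat -> R) :
  \sum_(j < M * q) g j = \sum_(i < M) \sum_(r < q) g (i * q + r)%N.
Proof.
elim: M => [|M IH]; first by rewrite mul0n !big_ord0.
rewrite big_ord_recr /= -IH -!(big_mkord xpredT) mulSn addnC.
rewrite (@big_cat_nat _ _ _ (M * q))//= ?leq_addr//; congr (_ + _).
rewrite -{1}[(M * q)%N]add0n big_addn addnC addnK big_mkord.
by apply: eq_bigr => r _; rewrite addnC.
Qed.

Lemma geom_norm (M : nat) y : normc (\sum_(0 <= m < M) e (m%:R * y)) * normc (e y - 1) <= 2.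
Proof.
have -> : \sum_(0 <= m < M) e (m%:R * y) = \sum_(m < M) e y ^+ m.
  by rewrite big_mkord; apply: eq_bigr => m _; rewrite eMn.
rewrite mulrC -normcM -subrX1 -eMn normc_e1_le2//.
Qed.

(** * Weyl sums close to a reduced fraction *)

Section Bound.
Variables (x t : R) (p q N : nat) (b : R).
Hypotheses (q0 : (0 < q)%N) (N0 : (0 < N)%N) (cop : coprime p q).
Hypotheses (tE : t = p%:R / q%:R + b) (bN : `|b| <= 1 / (4 * N%:R * q%:R)).

Let V (k : nat) : R := normc (\sum_(0 <= m < N - k) e (m%:R * ((k * 2)%N%:R * t))).

Let resid (j : nat) : nat := ((j * p) %% q)%N.

(** At a zero residue the convention 0^-1 = 0 leaves the harmless value 2, so that c can be summed
    over full blocks of residues. *)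
Let c (j : nat) : R := 2 * q%:R * ((resid j)%:R^-1 + (q - resid j)%N%:R^-1).

Let qR : (0 : R) < q%:R. Proof. by rewrite ltr0n. Qed.
Let NR : (0 : R) < N%:R. Proof. by rewrite ltr0n. Qed.

Let c_ge0 j : 0 <= c j.
Proof. by rewrite /c mulr_ge0 ?addr_ge0 ?invr_ge0// mulr_ge0. Qed.

Lemma weyl_V_le k : V k <= N%:R.
Proof.
rewrite /V (le_trans (normc_sum _ _ _))//.
under eq_bigr do rewrite normc_e.
by rewrite sumr_const_nat subn0 ler_nat leq_subr.
Qed.

Let ejt (j : nat) : e (j%:R * t) = e ((resid j)%:R / q%:R + j%:R * b).
Proof.
rewrite tE mulrDr eD [RHS]eD; congr (_ * _).
have -> : j%:R * (p%:R / q%:R) = (resid j)%:R / q%:R + ((j * p) %/ q)%N%:R :> R.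
  rewrite mulrA -natrM {1}(divn_eq (j * p) q) natrD natrM mulrDl mulfK ?gt_eqF//.
  by rewrite addrC.
by rewrite eD e_nat mulr1.
Qed.

(** The perturbation j b, j = 2k, is at most 1/(2q), whence the 4 in the hypothesis on b. The
    fractional part r/q thus keeps at least half of its distance to 0 and to 1, and the geometric
    sum is bounded accordingly. *)
Lemma weyl_nondiv k : (k < N)%N -> (0 < resid (k * 2))%N -> V k <= c (k * 2)%N.
Proof.
move=> kN r0; set j := (k * 2)%N; set r := resid j.
have rq : (r < q)%N by rewrite ltn_mod.
have jb : `|j%:R * b| <= 1 / (2 * q%:R).
  rewrite normrM ger0_norm//.
  apply: (@le_trans _ _ ((2 * N%:R) * (1 / (4 * N%:R * q%:R)))).
    rewrite ler_pM//. by rewrite -natrM ler_nat /j; lia.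
  by rewrite le_eqVlt; apply/orP; left; apply/eqP; field; rewrite !gt_eqF.
have rR : (1 : R) <= r%:R by rewrite ler1n.
have qrR : (1 : R) <= (q - r)%N%:R by rewrite ler1n subn_gt0.
have qrE : (q - r)%N%:R = q%:R - r%:R :> R by rewrite natrB// ltnW.
have := @geom_norm (N - k) (j%:R * t); rewrite -/(V k) ejt -/r.
set u := r%:R / q%:R + j%:R * b.
have V0 : 0 <= V k by exact: normc_ge0.
move: jb; rewrite ler_norml => /andP[j1 j2].
have iq : 1 / (2 * q%:R) = q%:R^-1 / 2 :> R by field; rewrite gt_eqF.
rewrite iq in j1 j2; have iq0 : 0 < q%:R^-1 :> R by rewrite invr_gt0.
have qiq : q%:R * q%:R^-1 = 1 :> R by rewrite mulfV ?gt_eqF.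
rewrite /c -/r => HV.
have [u2|u2] := leP u (1 / 2).
  have u0 : r%:R * q%:R^-1 / 2 <= u by rewrite /u; nra.
  have uu : `|u| <= 1 / 2 by rewrite ger0_norm//; nra.
  have := normc_e1_ge uu; rewrite ger0_norm; last by nra.
  move=> H; apply: (@le_trans _ _ (2 * q%:R * r%:R^-1)); last first.
    by rewrite ler_pM2l ?mulr_gt0// lerDl invr_ge0.
  rewrite ler_pdivlMr; last by lra.
  have : V k * (r%:R * q%:R^-1) <= 2 by nra.
  by move=> h; have := ler_wpM2r (ltW qR) h; rewrite -!mulrA mulVf ?gt_eqF// mulr1.
have eu : normc (e u - 1) = normc (e (u - 1) - 1).
  by rewrite -[u in LHS](subrK 1) eD e1 mulr1.
rewrite eu in HV.
have u0 : (q - r)%N%:R * q%:R^-1 / 2 <= 1 - u by rewrite /u qrE; nra.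
have u1 : u - 1 < 0 by nra.
have uu : `|u - 1| <= 1 / 2 by rewrite ltr0_norm//; lra.
have := normc_e1_ge uu; rewrite ltr0_norm// => H.
apply: (@le_trans _ _ (2 * q%:R * (q - r)%N%:R^-1)); last first.
  by rewrite ler_pM2l ?mulr_gt0// lerDr invr_ge0.
rewrite ler_pdivlMr; last by lra.
have : V k * ((q - r)%N%:R * q%:R^-1) <= 2 by nra.
by move=> h; have := ler_wpM2r (ltW qR) h; rewrite -!mulrA mulVf ?gt_eqF// mulr1.
Qed.

Lemma weyl_div k i : (k < N)%N -> (k * 2 = i * q)%N ->
  V k * (i%:R * (q%:R * `|b|)) <= 1.
Proof.
move=> kN E.
have r0 : resid (k * 2) = 0%N by rewrite /resid E mulnAC modnMl.
have := @geom_norm (N - k) ((k * 2)%N%:R * t); rewrite -/(V k) ejt r0 mul0r add0r.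
have jb : `|(k * 2)%N%:R * b| <= 1 / 2.
  rewrite normrM ger0_norm//.
  apply: (@le_trans _ _ ((2 * N%:R) * (1 / (4 * N%:R * q%:R)))).
    rewrite ler_pM//. by rewrite -natrM ler_nat; lia.
  have : (1 : R) <= q%:R by rewrite ler1n.
  have -> : 2 * N%:R * (1 / (4 * N%:R * q%:R)) = q%:R^-1 / 2 :> R by field; rewrite !gt_eqF.
  by move=> q1; rewrite ler_pM2r// invf_le1.
move=> H; have := normc_e1_ge jb; rewrite normrM ger0_norm// E natrM => H2.
have V0 : 0 <= V k by exact: normc_ge0.
move: H H2; rewrite E natrM mulrA; set nn := normc (_ - 1).
by move: (_ * _ * `|b|) => s H H2; nra.
Qed.

(** The j below 2N are covered by blocks of length q. On each block j p runs over all residues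
    modulo q because p is coprime to q, which gives a harmonic sum per block. *)
Lemma weyl_sum_c : \sum_(j < N * 2) c j <= 4 * ((N * 2)%N%:R + q%:R) * Hsum q.
Proof.
pose M := ((N * 2) %/ q).+1.
have MN : (N * 2 <= M * q)%N by rewrite /M ltnW// ltn_ceil.
apply: (@le_trans _ _ (\sum_(j < M * q) c j)).
  rewrite -!(big_mkord xpredT) (@big_cat_nat _ _ _ (N * 2) 0 (M * q))//= lerDl.
  by rewrite sumr_ge0.
rewrite sum_blocks.
have E (i : 'I_M) : \sum_(r < q) c (i * q + r)%N = \sum_(r < q) 2 * q%:R * (r%:R^-1 + (q - r)%N%:R^-1).
  have rP (r : 'I_q) : ((r * p) %% q < q)%N by rewrite ltn_mod.
  have inj : injective (fun r : 'I_q => Ordinal (rP r)).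
    move=> r r' [] /eqP; rewrite -(eqn_modDr 0) !addn0 => rr.
    apply: val_inj => /=.
    wlog le_rr : r r' rr / (r <= r')%N.
      move=> W; have [h|h] := leqP r r'; first exact: W.
      by apply/esym/W; [rewrite eq_sym|rewrite ltnW].
    move: rr; rewrite eq_sym eqn_mod_dvd ?leq_mul2r ?le_rr ?orbT// -mulnBl.
    rewrite Gauss_dvdl; last by rewrite coprime_sym.
    move=> /dvdn_leq h; apply/eqP; rewrite eqn_leq le_rr /= leqNgt; apply/negP => lt.
    have := h; rewrite subn_gt0 lt => /(_ isT); rewrite leqNgt.
    by rewrite (leq_ltn_trans (leq_subr _ _)).
  rewrite [RHS](reindex_inj inj) /=; apply: eq_bigr => r _.
  by rewrite /c /resid mulnDl mulnAC modnMDl.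
under eq_bigr do rewrite E.
rewrite sumr_const card_ord.
have S1 : \sum_(r < q) 2 * q%:R * (r%:R^-1 + (q - r)%N%:R^-1) <= 4 * q%:R * Hsum q.
  rewrite -big_distrr /= big_split /=.
  have h1 : \sum_(i < q) i%:R^-1 <= Hsum q.
    rewrite /Hsum; case: (q) => [|n]; first by rewrite !big_ord0.
    rewrite big_ord_recl /= invr0 add0r big_ord_recr /= lerDl invr_ge0//.
  have h2 : \sum_(i < q) (q - i)%N%:R^-1 = Hsum q.
    rewrite /Hsum [RHS](reindex_inj rev_ord_inj) /=; apply: eq_bigr => i _.
    by congr (_%:R^-1); have := ltn_ord i; lia.
  rewrite h2; have h3 : 0 <= Hsum q by rewrite /Hsum sumr_ge0.
  have : 0 <= 2 * (q%:R : R) by rewrite mulr_ge0.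
  nra.
rewrite -[_ *+ M]mulr_natl.
have M0 : (0 : R) <= M%:R by [].
apply: (le_trans (ler_wpM2l M0 S1)).
have : M%:R * q%:R <= (N * 2)%N%:R + q%:R :> R.
  by rewrite -natrM -natrD ler_nat /M mulSn addnC leq_add2r leq_divM.
have h3 : 0 <= Hsum q by rewrite /Hsum sumr_ge0.
by move=> h; have := ler_wpM2r h3 h; lra.
Qed.

Lemma weyl_sum_d (D : nat -> R) : (forall i, 0 <= D i) ->
  \sum_(j < N * 2 | ((q %| j) && (0 < j))%N) D (j %/ q)%N <=
  \sum_(i < (N * 2) %/ q) D i.+1.
Proof.
move=> D0; pose M := ((N * 2) %/ q).+1.
have MN : (N * 2 <= M * q)%N by rewrite /M ltnW// ltn_ceil.
pose g j : R := if ((q %| j) && (0 < j))%N then D (j %/ q)%N else 0.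
rewrite big_mkcond /=.
apply: (@le_trans _ _ (\sum_(j < M * q) g j)).
  rewrite -(big_mkord xpredT g) -(big_mkord xpredT g).
  rewrite (@big_cat_nat _ _ _ (N * 2) 0 (M * q))//= lerDl.
  by rewrite sumr_ge0// => i _; rewrite /g; case: ifP.
rewrite sum_blocks /M big_ord_recl /=.
have E i : \sum_(r < q) g (i * q + r)%N = if i == 0%N then 0 else D i.
  rewrite (bigD1 (Ordinal q0))//= big1 ?addr0 => [|r rn0].
    by rewrite /g addn0 dvdn_mull// mulnK// muln_gt0 q0 andbT lt0n; case: (i == 0%N).
  rewrite /g dvdn_addr ?dvdn_mull// /dvdn modn_small//.
  by rewrite (_ : (r == 0%N :> nat) = false)//; apply/negbTE; exact: rn0.
by rewrite (E 0%N) add0r; under eq_bigr => i _ do rewrite E /=.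
Qed.

(** [D] leaves open how the shifts with q dividing 2k are bounded: by N for [weyl_near], by 1/(i q
    |b|) for [weyl_far]. *)
Lemma weyl_core (D : nat -> R) : (forall i, 0 <= D i) ->
  (forall k i, (k < N)%N -> (0 < i)%N -> (k * 2 = i * q)%N -> V k <= D i) ->
  normc (\sum_(0 <= n < N) ee x t n) ^+ 2 <=
  N%:R + 8 * ((N * 2)%N%:R + q%:R) * Hsum q + 2 * \sum_(i < (N * 2) %/ q) D i.+1.
Proof.
move=> D0 HD.
rewrite (le_trans (normc_sum_sqr _ (fun n => normc_ee x t n)))//.
rewrite -addrA lerD2l.
suff H : \sum_(1 <= k < N) normc (\sum_(0 <= m < N - k) ee x t (m + k) * cj (ee x t m)) <=
   \sum_(j < N * 2) c j + \sum_(j < N * 2 | ((q %| j) && (0 < j))%N) D (j %/ q)%N.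
  have := weyl_sum_c; have := weyl_sum_d D0; lra.
have EV k : normc (\sum_(0 <= m < N - k) ee x t (m + k) * cj (ee x t m)) = V k.
  rewrite -[RHS]mul1r -(normc_e (k%:R ^+ 2 * t + k%:R * x)) -normcM big_distrr /=.
  congr normc; apply: eq_bigr => m _; rewrite /ee -eN -!eD; congr e.
  rewrite natrD natrM; ring.
under eq_bigr do rewrite EV.
pose g (j : nat) : R := c j + if ((q %| j) && (0 < j))%N then D (j %/ q)%N else 0.
have g0 j : 0 <= g j by rewrite addr_ge0//; case: ifP.
(* Only the even indices j = 2k occur; the odd ones are added so that whole blocks of residues can
   be summed. *)
rewrite [X in _ <= _ + X]big_mkcond -big_split /= (@sum_blocks N 2 g).
rewrite -(big_mkord xpredT (fun i => \sum_(r < 2) g (i * 2 + r)%N)).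
rewrite [leRHS]big_ltn//= -[leLHS]add0r lerD//; first by rewrite sumr_ge0.
rewrite big_nat_cond [leRHS]big_nat_cond; apply: ler_sum => k; rewrite andbT => /andP[k1 kN].
rewrite big_ord_recl /= addn0; apply: (@le_trans _ _ (g (k * 2)%N)); last first.
  by rewrite lerDl sumr_ge0.
rewrite /g; have [qk|qk] := boolP (q %| k * 2)%N => /=.
  rewrite muln_gt0 k1 /= (le_trans (HD k ((k * 2) %/ q)%N kN _ _)) ?lerDr//.
    by rewrite divn_gt0// dvdn_leq// muln_gt0 k1.
  by rewrite divnK.
rewrite addr0 weyl_nondiv// lt0n; apply: contra qk => /eqP r0.
by move: r0; rewrite /resid => /eqP; rewrite -/(dvdn _ _) Gauss_dvdl// coprime_sym.
Qed.

(* Weyl differencing: [weyl_V_le], [weyl_nondiv] and [weyl_div] bound the inner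
   geometric sums, the shifts [k] with [q] dividing [2 k] giving the main term. *)
Lemma weyl_near : normc (\sum_(0 <= n < N) ee x t n) ^+ 2 <=
  N%:R + 8 * ((N * 2)%N%:R + q%:R) * Hsum q + 4 * (N%:R ^+ 2 / q%:R).
Proof.
apply: le_trans (@weyl_core (fun _ => N%:R) _ _) _ => //.
  by move=> k i kN _ _; exact: weyl_V_le.
rewrite lerD2l sumr_const card_ord -[N%:R *+ _]mulr_natr.
have h : ((N * 2) %/ q)%N%:R <= N%:R * 2 / q%:R :> R.
  by rewrite ler_pdivlMr// -!natrM ler_nat leq_divM.
have := ler_wpM2l (ltW NR) h.
have -> : N%:R * (N%:R * 2 / q%:R) = 2 * (N%:R ^+ 2 / q%:R) :> R by ring.
lra.
Qed.

Lemma weyl_far : b != 0 -> normc (\sum_(0 <= n < N) ee x t n) ^+ 2 <=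
  N%:R + 8 * ((N * 2)%N%:R + q%:R) * Hsum q + 2 * (Hsum (N * 2) / (q%:R * `|b|)).
Proof.
move=> bn0; have b0 : 0 < `|b| by rewrite normr_gt0.
have qb : 0 < q%:R * `|b| by rewrite mulr_gt0.
apply: le_trans (@weyl_core (fun i => (i%:R * (q%:R * `|b|))^-1) _ _) _.
- by move=> i; rewrite invr_ge0 mulr_ge0// ltW.
- move=> k i kN i0 E; rewrite -div1r ler_pdivlMr ?weyl_div//.
  by rewrite mulr_gt0// ltr0n.
rewrite lerD2l ler_pM2l//.
under eq_bigr do rewrite invfM.
rewrite -big_distrl /= ler_wpM2r ?invr_ge0 ?(ltW qb)//.
rewrite /Hsum -!(big_mkord xpredT (fun i => i.+1%:R^-1)).
rewrite [leRHS](@big_cat_nat _ _ _ ((N * 2) %/ q))//= ?leq_div// lerDl.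
by rewrite sumr_ge0.
Qed.

End Bound.
End Weyl.

(** * Regularity at badly approximable points *)

Section Regularity.
Variable R : realType.
Implicit Types (x y h t a b : R) (z w : R[i]).

Lemma Hsum_ge0 n : 0 <= Hsum R n. Proof. by rewrite sumr_ge0. Qed.

Lemma Hsum_ln n : Hsum R n.+1 <= 1 + ln n.+1%:R.
Proof.
elim: n => [|n IH]; first by rewrite /Hsum big_ord1 ln1 addr0 invr1.
rewrite /Hsum big_ord_recr -/(Hsum R n.+1) /=.
have n1 : (0 : R) < n.+1%:R by rewrite ltr0n.
have n2 : (0 : R) < n.+2%:R by rewrite ltr0n.
have E : (n.+1%:R : R) = n.+2%:R * (1 + - n.+2%:R^-1).
  by rewrite mulrDr mulrN mulfV ?gt_eqF// mulr1 -[in RHS]natr1 addrK.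
have i1 : -1 < - n.+2%:R^-1 :> R by rewrite ltrN2 invf_lt1// ltr1n.
have : ln n.+1%:R = ln n.+2%:R + ln (1 + - n.+2%:R^-1) :> R.
  by rewrite E lnM// posrE ?ltr0n// -ltrBlDl sub0r.
move=> EE; move: IH (le_ln1Dx i1); rewrite EE.
move: (ln (1 - n.+2%:R^-1)) => A; move: (ln n.+2%:R) (n.+2%:R^-1) (Hsum R n.+1).
by move=> B C D; lra.
Qed.

Lemma one_le_powR x a : 1 <= x -> 0 <= a -> 1 <= x `^ a.
Proof. by move=> x1 a0; have := ler_powR x1 a0; rewrite powRr0. Qed.

(** Logarithmic losses are recorded as arbitrarily small powers. *)
Lemma Hsum_powR a : 0 < a ->
  exists2 C : R, 0 < C & forall n, (0 < n)%N -> Hsum R n <= C * n%:R `^ a.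
Proof.
move=> a0; exists (1 + a^-1); first by rewrite addr_gt0 ?invr_gt0.
case=> // n _; rewrite (le_trans (Hsum_ln n))//.
have n1 : (1 : R) <= n.+1%:R by rewrite ler1n.
have n0 : (0 : R) < n.+1%:R by rewrite ltr0n.
have h1 : 1 <= n.+1%:R `^ a :> R by rewrite one_le_powR// ltW.
rewrite mulrDl mul1r lerD// ler_pdivlMl// -ln_powR ltW// ln_sublinear//.
Qed.

(** Takes the place of comparing the sum of n^(-a-1) with an integral; it follows from exp y >= 1 +
    y and ln ((x+1)/x) >= 1/(x+1). *)
Lemma powR_telescope x a : 0 < x -> 0 < a ->
  a * (x + 1) `^ (- a - 1) <= x `^ (- a) - (x + 1) `^ (- a).
Proof.
move=> x0 a0; have x1 : 0 < x + 1 by rewrite addr_gt0.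
have -> : x `^ (- a) = (x + 1) `^ (- a) * ((x + 1) / x) `^ a.
  rewrite powRM ?invr_ge0 ?ltW// mulrA -powRD; last by rewrite (gt_eqF x1) implybT.
  by rewrite addNr powRr0 mul1r -powR_inv1 ?ltW// -powRrM mulN1r.
have -> : (x + 1) `^ (- a - 1) = (x + 1) `^ (- a) * (x + 1)^-1.
  rewrite powRD ?(gt_eqF x1) ?implybT// powR_inv1// ltW//.
rewrite -{3}[(x + 1) `^ (- a)]mulr1 -mulrBr mulrCA ler_wpM2l ?powR_ge0//.
have xx : 0 < (x + 1) / x by rewrite divr_gt0.
rewrite /powR gt_eqF//.
have := @expR_ge1Dx R (a * ln ((x + 1) / x)).
suff : (x + 1)^-1 <= ln ((x + 1) / x).
  by move=> h; have := ler_wpM2l (ltW a0) h; lra.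
have i1 : -1 < - (x + 1)^-1 by rewrite ltrN2 invf_lt1// ltrDr.
have := le_ln1Dx i1.
have -> : 1 + - (x + 1)^-1 = ((x + 1) / x)^-1 by field; rewrite !gt_eqF.
by rewrite lnV ?posrE// lerNl opprK.
Qed.

Lemma abel_id (m n : nat) (w v : nat -> R[i]) : (m <= n)%N ->
  let A k := \sum_(0 <= j < k) v j in
  \sum_(m <= k < n) w k * v k =
  w n * A n - w m * A m + \sum_(m <= k < n) (w k - w k.+1) * A k.+1.
Proof.
move=> mn A; rewrite -(telescope_sumr (fun k => w k * A k) mn) -big_split /=.
by apply: eq_bigr => k _; rewrite /A big_nat_recr//=; ring.
Qed.

Lemma inv_sqr_diff (k : nat) : (0 < k)%N ->
  0 <= (k%:R ^- 2 - k.+1%:R ^- 2 : R) <= 8 / k.+1%:R ^+ 3.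
Proof.
move=> k0; rewrite -natr1.
have : (1 : R) <= k%:R by rewrite ler1n.
move: (k%:R : R) => u u1.
have -> : u ^- 2 - (u + 1) ^- 2 = (2 * u + 1) * (u + 1) / (u ^+ 2 * (u + 1) ^+ 3).
  by field; lra.
apply/andP; split.
  by rewrite divr_ge0 ?mulr_ge0 ?exprn_ge0//; lra.
have v0 : 0 < u + 1 by lra.
have w0 : 0 < u by lra.
rewrite ler_pdivrMr ?mulr_gt0 ?exprn_gt0//.
have -> : 8 / (u + 1) ^+ 3 * (u ^+ 2 * (u + 1) ^+ 3) = 8 * u ^+ 2 by field; lra.
nra.
Qed.

(** Summation by parts. The boundary terms give 2B; the differences of k^-2 are at most 8 (k+1)^-3,
    and the resulting powers telescope with exponent s = 1 - a >= 1/2, whose inverse costs a factor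
    2. *)
Lemma tail_bound (X J : nat) (v : nat -> R[i]) (B a : R) :
  (0 < X)%N -> (X <= J)%N -> 0 <= B -> 0 < a -> a <= 1 / 2 ->
  (forall k, (X <= k)%N -> normc (\sum_(0 <= j < k) v j) <= B * k%:R `^ (1 + a)) ->
  normc (\sum_(X <= n < J) (n%:R ^- 2)%:C * v n) <= 18 * B * X%:R `^ (a - 1).
Proof.
move=> X0 XJ B0 a0 a2 H.
have pos k : (X <= k)%N -> (0 : R) < k%:R by move=> h; rewrite ltr0n (leq_trans X0).
have sq k : (X <= k)%N -> k%:R ^- 2 * (B * k%:R `^ (1 + a)) = B * k%:R `^ (a - 1) :> R.
  move=> h; rewrite mulrCA; congr (_ * _).
  rewrite -powR_mulrn// -powRN -powRD; last by rewrite (gt_eqF (pos k h)) implybT.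
  by congr (_ `^ _); lra.
have anti k : (X <= k)%N -> k%:R `^ (a - 1) <= X%:R `^ (a - 1) :> R.
  move=> h; rewrite -[a - 1]opprK !(powRN _ (- _)).
  rewrite lef_pV2 ?posrE ?powR_gt0 ?pos// ge0_ler_powR ?nnegrE ?ler_nat//; lra.
rewrite abel_id// (le_trans (le_normcD _ _))//.
have E k : (X <= k)%N -> normc ((k%:R ^- 2)%:C * \sum_(0 <= j < k) v j) <= B * X%:R `^ (a - 1).
  move=> h; rewrite normcZ ger0_norm ?invr_ge0 ?exprn_ge0//.
  apply: (@le_trans _ _ (k%:R ^- 2 * (B * k%:R `^ (1 + a)))).
    by rewrite ler_wpM2l ?invr_ge0 ?exprn_ge0 ?H.
  by rewrite sq// ler_wpM2l// anti.
have H1 : normc ((J%:R ^- 2)%:C * \sum_(0 <= j < J) v j - (X%:R ^- 2)%:C * \sum_(0 <= j < X) v j) <= 2 * B * X%:R `^ (a - 1).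
  rewrite (le_trans (normcB _ _))//; have := E _ XJ; have := E _ (leqnn X); lra.
suff H2 : normc (\sum_(X <= k < J) ((k%:R ^- 2)%:C - (k.+1%:R ^- 2)%:C) * \sum_(0 <= j < k.+1) v j) <= 16 * B * X%:R `^ (a - 1) by lra.
rewrite (le_trans (normc_sum _ _ _))//.
pose s : R := 1 - a.
have s0 : 1 / 2 <= s by rewrite /s; lra.
have sp : 0 < s by lra.
apply: (@le_trans _ _ (\sum_(X <= k < J) 16 * B * (k%:R `^ (- s) - k.+1%:R `^ (- s)))); last first.
  rewrite -big_distrr /= ler_wpM2l ?mulr_ge0//.
  rewrite (eq_bigr (fun k => (- k.+1%:R `^ (- s)) - (- k%:R `^ (- s)))); last by move=> k _; ring.
  rewrite telescope_sumr// opprK /s opprB.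
  by rewrite addrC gerBl powR_ge0.
rewrite big_nat_cond [leRHS]big_nat_cond; apply: ler_sum => k.
rewrite andbT => /andP[Xk kJ].
have kk : (X <= k.+1)%N by rewrite (leq_trans Xk).
rewrite -rmorphB /= normcZ.
have /andP[d1 d2] := inv_sqr_diff (leq_trans X0 Xk).
rewrite ger0_norm//.
apply: (@le_trans _ _ (8 / k.+1%:R ^+ 3 * (B * k.+1%:R `^ (1 + a)))).
  by rewrite ler_pM ?normc_ge0 ?H.
have -> : 8 / k.+1%:R ^+ 3 * (B * k.+1%:R `^ (1 + a)) = 8 * B * k.+1%:R `^ (- s - 1).
  have -> : 8 / k.+1%:R ^+ 3 * (B * k.+1%:R `^ (1 + a)) = 8 * B * (k.+1%:R ^- 3 * k.+1%:R `^ (1 + a)) by ring.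
  congr (_ * _); rewrite -powR_mulrn// -powRN -powRD; last by rewrite (gt_eqF (pos _ kk)) implybT.
  by congr (_ `^ _); rewrite /s; lra.
have := powR_telescope (pos k Xk) sp; rewrite natr1 => T.
have p0 : 0 <= k.+1%:R `^ (- s - 1) :> R by exact: powR_ge0.
have -> : 16 * B = 8 * B * 2 by ring.
rewrite -[leRHS]mulrA ler_wpM2l ?mulr_ge0//; nra.
Qed.

Lemma ee_shift x t (m : int) n : ee x (t + m%:~R) n = ee x t n.
Proof.
rewrite /ee mulrDr addrAC eD.
have -> : n%:R ^+ 2 * m%:~R = (n%:Z ^+ 2 * m)%:~R :> R by rewrite intrM rmorphXn.
by rewrite e_int mulr1.
Qed.

Section AnyWeyl.
Variables (x t : R) (p : int) (q N : nat).
Hypotheses (q0 : (0 < q)%N) (N0 : (0 < N)%N) (cop : coprime `|p|%N q).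
Hypothesis (bN : `|t - p%:~R / q%:R| <= 1 / (4 * N%:R * q%:R)).

(** The Weyl sums have period 1 in t, so an integer numerator may be reduced modulo q to a natural
    one. *)
Let p' : nat := `|(p %% q)%Z|%N.

Let cop' : coprime p' q.
Proof.
have : coprimez p q by rewrite /coprimez /gcdz absz_nat.
by rewrite -[p in coprimez p]/p /coprimez -gcdz_modl /gcdz absz_nat.
Qed.

Let pE : p%:~R / q%:R = p'%:R / q%:R + ((p %/ q)%Z)%:~R :> R.
Proof.
rewrite {1}(divz_eq p q) intrD intrM mulrDl -[q%:~R]/(q%:R) mulfK ?pnatr_eq0 -?lt0n//.
rewrite addrC; congr (_ / _ + _); rewrite /p' -[RHS]/((Posz `|(p %% q)%Z|%N)%:~R).
by rewrite gez0_abs// modz_ge0// -lt0n.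
Qed.

Let SE (M : nat) : \sum_(0 <= n < M) ee x t n =
  \sum_(0 <= n < M) ee x (t - ((p %/ q)%Z)%:~R) n.
Proof.
by apply: eq_bigr => n _; rewrite -[in LHS](subrK ((p %/ q)%Z)%:~R t) ee_shift.
Qed.

Let tE : t - ((p %/ q)%Z)%:~R = p'%:R / q%:R + (t - p%:~R / q%:R).
Proof. by rewrite pE; ring. Qed.

Lemma weyl_near_int : normc (\sum_(0 <= n < N) ee x t n) ^+ 2 <=
  N%:R + 8 * ((N * 2)%N%:R + q%:R) * Hsum R q + 4 * (N%:R ^+ 2 / q%:R).
Proof. by rewrite SE; exact: (weyl_near _ q0 N0 cop' tE). Qed.

Lemma weyl_far_int : t - p%:~R / q%:R != 0 ->
  normc (\sum_(0 <= n < N) ee x t n) ^+ 2 <=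
  N%:R + 8 * ((N * 2)%N%:R + q%:R) * Hsum R q +
  2 * (Hsum R (N * 2) / (q%:R * `|t - p%:~R / q%:R|)).
Proof. by move=> bn0; rewrite SE; exact: (weyl_far _ q0 N0 cop' tE). Qed.

End AnyWeyl.

Definition badly_approx (c mu t : R) := forall (p : int) (q : nat), (0 < q)%N ->
  c * q%:R `^ (- mu) <= `|t - p%:~R / q%:R|.

(** Let p/q be the Dirichlet approximation of t + h and [be] its error, so that c q^-mu <= |be| +
    |h|. If |be| dominates, [weyl_near] serves for q >= N^(2/mu) and [weyl_far] for smaller q, both
    giving N^(2 - 2/mu). If |h| dominates, 1/q is O(|h|^(1/mu)) and [weyl_near] gives the second
    term. *)
Lemma weyl_badly (c mu t eps : R) : 0 < c -> 2 <= mu -> 0 < eps ->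
  badly_approx c mu t ->
  exists2 C : R, 0 < C & forall x h (N : nat), (0 < N)%N ->
  normc (\sum_(0 <= n < N) ee x (t + h) n) ^+ 2 <=
  C * N%:R `^ eps * (N%:R `^ (2 - 2 / mu) + N%:R ^+ 2 * `|h| `^ (mu^-1)).
Proof.
move=> c0 mu2 eps0 bad.
have mu0 : 0 < mu by lra.
have [C0 C00 HC0] := Hsum_powR eps0.
have e4 : 1 <= 4 `^ eps :> R by rewrite one_le_powR ?(ltW eps0) ?ler1n.
pose C1 := C0 * 4 `^ eps.
have C10 : 0 < C1 by rewrite mulr_gt0// powR_gt0.
pose C2 := 4 * (2 / c) `^ mu^-1.
have C20 : 0 <= C2 by rewrite mulr_ge0// powR_ge0.
pose C := 1 + 48 * C1 + 4 + 4 / c * C1 + C2.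
have C_0 : 0 < C.
  by rewrite /C; have : 0 < 4 / c * C1; [rewrite mulr_gt0// divr_gt0|lra].
exists C => // x h N N0.
have N4 : (0 < 4 * N)%N by rewrite muln_gt0.
have NR : (1 : R) <= N%:R by rewrite ler1n.
have Np : (0 : R) < N%:R by rewrite ltr0n.
have [p [q [q0 qN cop]]] := dirichlet_approx (t + h) N4.
rewrite natrM => bN.
have qp : (0 : R) < q%:R by rewrite ltr0n.
have q1 : (1 : R) <= q%:R by rewrite ler1n.
set be := t + h - p%:~R / q%:R in bN.
pose P := N%:R `^ eps : R; pose Q := N%:R `^ (2 - 2 / mu) : R.
pose S := N%:R ^+ 2 * `|h| `^ mu^-1.
have P1 : 1 <= P by rewrite one_le_powR ?(ltW eps0).
have imu : mu^-1 <= 1 / 2 by rewrite div1r lef_pV2 ?posrE.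
have imu0 : 0 < mu^-1 by rewrite invr_gt0.
have QN : N%:R <= Q.
  by rewrite -[leLHS]powRr1// ler_powR//; lra.
have Q0 : 0 < Q by lra.
have S0 : 0 <= S by rewrite mulr_ge0 ?powR_ge0 ?sqr_ge0.
have HH n : (0 < n)%N -> (n <= 4 * N)%N -> Hsum R n <= C1 * P.
  move=> n0 nN; rewrite (le_trans (HC0 n n0))// /C1 /P -mulrA -powRM//.
  rewrite ler_pM2l// ge0_ler_powR ?nnegrE ?(ltW eps0)//.
  by rewrite -natrM ler_nat.
have Hq := HH q q0 qN.
have H2N : Hsum R (N * 2) <= C1 * P.
  by apply: HH; [rewrite muln_gt0 N0|rewrite mulnC leq_pmul2r].
have base : N%:R + 8 * ((N * 2)%N%:R + q%:R) * Hsum R q <= (1 + 48 * C1) * P * Q.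
  have : (q%:R : R) <= 4 * N%:R by rewrite -natrM ler_nat.
  have Hq0 := Hsum_ge0 q; rewrite natrM => q4.
  have b1 : 8 * (N%:R * 2 + q%:R) * Hsum R q <= 48 * N%:R * (C1 * P).
    by apply: ler_pM => //; move: q4 NR; clear; lra.
  have b2 : N%:R <= P * Q by rewrite (le_trans QN)// ler_peMl// ltW.
  have b3 : N%:R * (C1 * P) <= C1 * (P * Q).
    by rewrite mulrCA ler_pM2l// mulrC ler_pM2l// (lt_le_trans ltr01).
  by move: b1 b2 b3; clear; lra.
suff main : normc (\sum_(0 <= n < N) ee x (t + h) n) ^+ 2 <=
    (1 + 48 * C1) * P * Q + 4 * Q \/
  normc (\sum_(0 <= n < N) ee x (t + h) n) ^+ 2 <=
    (1 + 48 * C1) * P * Q + 4 / c * C1 * P * Q \/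
  normc (\sum_(0 <= n < N) ee x (t + h) n) ^+ 2 <=
    (1 + 48 * C1) * P * Q + C2 * S.
  have c4 : 0 < 4 / c * C1 by rewrite mulr_gt0// divr_gt0.
  have PQ : 0 <= P * Q by rewrite mulr_ge0 ?(ltW Q0)// (le_trans ler01).
  have PS : S <= P * S by rewrite ler_peMl.
  have Q1 : Q <= P * Q by rewrite ler_peMl// ltW.
  have -> : C * N%:R `^ eps * (N%:R `^ (2 - 2 / mu) + N%:R ^+ 2 * `|h| `^ mu^-1) =
     C * (P * Q) + C * (P * S) by rewrite -/P -/Q -/S; ring.
  have P0 : 0 <= P by rewrite (le_trans ler01).
  have z1 : 0 <= C * (P * S) by rewrite mulr_ge0 ?(ltW C_0)// mulr_ge0.
  have z2 : C2 * S <= C * (P * S).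
    by apply: ler_pM => //; rewrite /C; move: C10 c4; clear; lra.
  have z3 : 0 <= C1 * (P * Q) by rewrite mulr_ge0// ltW.
  have z4 : 0 <= 4 / c * C1 * (P * Q) by rewrite mulr_ge0// ltW.
  have z5 : 0 <= C2 * (P * Q) by rewrite mulr_ge0.
  have E : C * (P * Q) = (1 + 48 * C1) * P * Q + 4 * (P * Q) + 4 / c * C1 * (P * Q) + C2 * (P * Q).
    by rewrite /C; ring.
  rewrite E.
  by case: main => [|[|]] /le_trans; apply; move: PQ Q1 z1 z2 z4 z5; clear; lra.
have tb : c * q%:R `^ (- mu) <= `|be| + `|h|.
  rewrite (le_trans (bad p q q0))//.
  by have -> : t - p%:~R / q%:R = be - h; [rewrite /be; ring|exact: ler_normB].
have near := weyl_near_int x q0 N0 cop bN.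
have [hb|hb] := leP `|h| `|be|.
  have be0 : 0 < `|be|.
    by have : 0 < c * q%:R `^ (- mu); [rewrite mulr_gt0 ?powR_gt0|move: tb hb; clear; lra].
  have [qN2|qN2] := leP (N%:R `^ (2 / mu)) (q%:R : R).
    left; rewrite (le_trans near)// lerD// ler_pM2l//.
    rewrite ler_pdivrMr// (@le_trans _ _ (Q * N%:R `^ (2 / mu)))//; last by rewrite ler_pM2l.
    rewrite /Q -powRD; last by rewrite (gt_eqF Np) implybT.
    by rewrite subrK powR_mulrn.
  right; left.
  have ben0 : t + h - p%:~R / q%:R != 0 by rewrite -normr_gt0.
  rewrite (le_trans (weyl_far_int x q0 N0 cop bN ben0))// lerD//.
  have h1 : 1 / (q%:R * `|be|) <= 2 / c * Q.
    rewrite ler_pdivrMr ?mulr_gt0//.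
    apply: (@le_trans _ _ (2 / c * Q * (q%:R * (c * q%:R `^ (- mu) / 2)))); last first.
      rewrite ler_wpM2l ?mulr_ge0 ?invr_ge0 ?(ltW c0) ?(ltW Q0)//.
      by rewrite ler_wpM2l ?(ltW qp)//; move: tb hb; clear; lra.
    have -> : 2 / c * Q * (q%:R * (c * q%:R `^ (- mu) / 2)) = Q * (q%:R * q%:R `^ (- mu)).
      by field; rewrite gt_eqF.
    have -> : q%:R * q%:R `^ (- mu) = (q%:R `^ (mu - 1))^-1 :> R.
      rewrite -powRN -{1}(@powRr1 _ q%:R) ?ltW// -powRD; last by rewrite (gt_eqF qp) implybT.
      by congr (_ `^ _); ring.
    rewrite ler_pdivlMr ?powR_gt0// mul1r.
    apply: (@le_trans _ _ ((N%:R `^ (2 / mu)) `^ (mu - 1))).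
      by apply: ge0_ler_powR; rewrite ?nnegrE ?powR_ge0 ?(ltW qN2)//; move: mu2; clear; lra.
    rewrite -powRrM le_eqVlt; apply/orP; left; apply/eqP; rewrite /Q.
    by congr (_ `^ _); field; rewrite gt_eqF.
  have -> : 4 / c * C1 * P * Q = 2 * ((C1 * P) * (2 / c * Q)) by ring.
  have -> : Hsum R (N * 2) / (q%:R * `|t + h - p%:~R / q%:R|) =
    Hsum R (N * 2) * (1 / (q%:R * `|be|)) by rewrite div1r.
  rewrite ler_pM2l//; apply: ler_pM => //; first exact: Hsum_ge0.
right; right; rewrite (le_trans near)// lerD//.
have cq : c * q%:R `^ (- mu) <= 2 * `|h| by move: tb hb; clear; lra.
have -> : C2 * S = 4 * (N%:R ^+ 2 * ((2 / c) `^ mu^-1 * `|h| `^ mu^-1)).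
  by rewrite /C2 /S; ring.
rewrite ler_pM2l//.
rewrite ler_wpM2l ?sqr_ge0//.
rewrite -powRM ?divr_ge0 ?(ltW c0)//.
have -> : q%:R^-1 = (q%:R `^ (- mu)) `^ mu^-1 :> R.
  by rewrite -powRrM mulNr mulfV ?gt_eqF// powR_inv1 ?ltW.
apply: ge0_ler_powR; rewrite ?nnegrE ?powR_ge0 ?mulr_ge0 ?invr_ge0 ?(ltW c0) ?(ltW imu0)//.
  exact: ltW.
by rewrite mulrAC ler_pdivlMr// mulrC.
Qed.

(** The weight n^-2 (e(n^2 h) - 1) is O(|h|) and varies by O(|h|/n) from one n to the next, so
    summation by parts costs just a harmonic sum. *)
Lemma head_bound (X : nat) x t h (B s : R) : (0 < X)%N -> 0 <= B -> 0 <= s ->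
  (forall k, (0 < k)%N -> normc (\sum_(0 <= j < k) ee x t j) <= B * k%:R `^ s) ->
  normc (\sum_(1 <= n < X) (n%:R ^- 2)%:C * (ee x (t + h) n - ee x t n)) <=
  `|h| * (48 * B * X%:R `^ s * (1 + Hsum R X)).
Proof.
move=> X0 B0 s0 H.
pose f (n : nat) : R[i] := e (n%:R ^+ 2 * h) - 1.
pose w (n : nat) : R[i] := (n%:R ^- 2)%:C * f n.
have -> : \sum_(1 <= n < X) (n%:R ^- 2)%:C * (ee x (t + h) n - ee x t n) =
    \sum_(1 <= n < X) w n * ee x t n.
  apply: eq_bigr => n _; rewrite /w /f /ee -mulrA; congr (_ * _).
  rewrite mulrDr addrAC eD; ring.
have wn (n : nat) : (0 < n)%N -> normc (w n) <= 8 * `|h|.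
  move=> n0; rewrite normcZ ger0_norm ?invr_ge0 ?exprn_ge0//.
  rewrite ler_pdivrMl ?exprn_gt0 ?ltr0n//.
  rewrite (le_trans (normc_e1_le8 _))// normrM ger0_norm ?exprn_ge0//.
  by rewrite le_eqVlt; apply/orP; left; apply/eqP; ring.
have dw (n : nat) : (0 < n)%N -> normc (w n - w n.+1) <= 32 * `|h| / n.+1%:R.
  move=> n0.
  have -> : w n - w n.+1 = (n%:R ^- 2 - n.+1%:R ^- 2)%:C * f n +
      (n.+1%:R ^- 2)%:C * (f n - f n.+1).
    by rewrite /w rmorphB /=; ring.
  rewrite (le_trans (le_normcD _ _))// !normcZ.
  rewrite [`|_ ^- 2|]ger0_norm ?invr_ge0 ?exprn_ge0//.
  have /andP[d1 _] := inv_sqr_diff n0.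
  rewrite [`|_ - _|]ger0_norm//.
  have f1 : normc (f n) <= 8 * (n%:R ^+ 2 * `|h|).
    by rewrite (le_trans (normc_e1_le8 _))// normrM [`|n%:R ^+ 2|]ger0_norm ?exprn_ge0.
  have f2 : normc (f n - f n.+1) <= 8 * ((2 * n%:R + 1) * `|h|).
    have -> : f n - f n.+1 = e (n%:R ^+ 2 * h) - e (n.+1%:R ^+ 2 * h) by rewrite /f; ring.
    rewrite normc_eB (le_trans (normc_e1_le8 _))// ler_pM2l//.
    have -> : n%:R ^+ 2 * h - n.+1%:R ^+ 2 * h = - ((2 * n%:R + 1) * h) by rewrite -natr1; ring.
    by rewrite normrN normrM [`|2 * _ + _|]ger0_norm// addr_ge0// mulr_ge0.
  apply: (@le_trans _ _ ((n%:R ^- 2 - n.+1%:R ^- 2) * (8 * (n%:R ^+ 2 * `|h|)) +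
     n.+1%:R ^- 2 * (8 * ((2 * n%:R + 1) * `|h|)))).
    by rewrite lerD// ler_wpM2l// invr_ge0 exprn_ge0.
  rewrite -natr1; have : (1 : R) <= n%:R by rewrite ler1n.
  have := normr_ge0 h; move: (n%:R : R) (`|h|) => u v v0 u1.
  have -> : (u ^- 2 - (u + 1) ^- 2) * (8 * (u ^+ 2 * v)) +
      (u + 1) ^- 2 * (8 * ((2 * u + 1) * v)) = 16 * (2 * u + 1) / (u + 1) ^+ 2 * v.
    by field; lra.
  have u0 : 0 < u + 1 by lra.
  rewrite -subr_ge0.
  have -> : 32 * v / (u + 1) - 16 * (2 * u + 1) / (u + 1) ^+ 2 * v = 16 * v / (u + 1) ^+ 2.
    by field; lra.
  by rewrite divr_ge0 ?exprn_ge0 ?(ltW u0) ?mulr_ge0.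
have AX k : (0 < k)%N -> (k <= X)%N -> normc (\sum_(0 <= j < k) ee x t j) <= B * X%:R `^ s.
  move=> k0 kX; rewrite (le_trans (H k k0))// ler_wpM2l//.
  by apply: ge0_ler_powR; rewrite ?nnegrE ?ler_nat.
have BX : 0 <= B * X%:R `^ s by rewrite mulr_ge0 ?powR_ge0.
rewrite abel_id//.
have h1 : normc (w X * \sum_(0 <= j < X) ee x t j) <= 8 * `|h| * (B * X%:R `^ s).
  by rewrite normcM ler_pM ?normc_ge0 ?wn ?AX.
have h2 : normc (w 1%N * \sum_(0 <= j < 1) ee x t j) <= 8 * `|h| * (B * X%:R `^ s).
  by rewrite normcM ler_pM ?normc_ge0 ?wn ?AX.
have h3 : normc (\sum_(1 <= k < X) (w k - w k.+1) * \sum_(0 <= j < k.+1) ee x t j) <=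
    32 * `|h| * (B * X%:R `^ s) * Hsum R X.
  rewrite (le_trans (normc_sum _ _ _))//.
  apply: (@le_trans _ _ (\sum_(1 <= k < X) 32 * `|h| * (B * X%:R `^ s) * k.+1%:R^-1)).
    rewrite big_nat_cond [leRHS]big_nat_cond; apply: ler_sum => k.
    rewrite andbT => /andP[k1 kX].
    rewrite normcM mulrAC; apply: ler_pM; rewrite ?normc_ge0 ?dw ?AX//.
  rewrite -big_distrr /= ler_wpM2l//; first by rewrite mulr_ge0 ?mulr_ge0.
  rewrite /Hsum -(big_mkord xpredT (fun i => i.+1%:R^-1)) [leRHS]big_ltn//=.
  by rewrite lerDr invr_ge0.
rewrite (le_trans (le_normcD _ _))//.
have := normcB (w X * \sum_(0 <= j < X) ee x t j) (w 1%N * \sum_(0 <= j < 1) ee x t j).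
have Hg := Hsum_ge0 X.
have -> : `|h| * (48 * B * X%:R `^ s * (1 + Hsum R X)) =
  48 * `|h| * (B * X%:R `^ s) + 48 * `|h| * (B * X%:R `^ s) * Hsum R X by ring.
have hB : 0 <= `|h| * (B * X%:R `^ s) by rewrite mulr_ge0.
have hBH : 0 <= `|h| * (B * X%:R `^ s) * Hsum R X by rewrite mulr_ge0.
by move: h1 h2 h3; rewrite -!mulrA; move: hB hBH; rewrite -!mulrA; lra.
Qed.

Lemma normc_le_sqrt z (C y s : R) : 0 <= C ->
  normc z ^+ 2 <= C * y `^ (s * 2) -> normc z <= Num.sqrt C * y `^ s.
Proof.
move=> C0; rewrite powRrM powR_mulrn ?powR_ge0// => h.
rewrite -(@ler_pXn2r _ 2)// ?nnegrE ?normc_ge0 ?mulr_ge0 ?sqrtr_ge0 ?powR_ge0//.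
by rewrite exprMn sqr_sqrtr.
Qed.

(** The place where n^2 |h| reaches 1: smaller n contribute through increments, larger n through the
    separate sizes of the sums at t and t + h. *)
Definition cutoff h : nat := (truncn (`|h| `^ (- 1 / 2))).+1.

Lemma cutoff_bounds h : 0 < `|h| -> `|h| <= 1 ->
  `|h| `^ (- 1 / 2) <= (cutoff h)%:R <= 2 * `|h| `^ (- 1 / 2).
Proof.
move=> h0 h1.
have one : 1 <= `|h| `^ (- 1 / 2).
  have -> : - 1 / 2 = - (1 / 2) :> R by ring.
  rewrite powRN invf_ge1 ?powR_gt0//.
  have E : (1 : R) `^ (1 / 2) = 1 by rewrite powR1.
  by rewrite -[leRHS]E; apply: ge0_ler_powR; rewrite ?nnegrE.
rewrite /cutoff; have /andP[a1 a2] := truncn_itv (le_trans ler01 one).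
by apply/andP; split; [exact: ltW|rewrite -natr1; lra].
Qed.

(** Head and tail both come out as |h|^(1/2 + m/2), m = 1/mu, up to small powers: |h| X^(1-m) for
    the head and |h|^(m/2) X^-1 for the tail, with X about |h|^(-1/2). *)
Lemma oneside_badly (c mu t a : R) : 0 < c -> 2 <= mu ->
  badly_approx c mu t -> 0 < a -> a < 1 / 2 + 1 / (2 * mu) ->
  exists2 C : R, 0 < C & forall x h J, 0 < `|h| -> `|h| <= 1 -> (cutoff h <= J)%N ->
  normc (\sum_(1 <= n < J) (n%:R ^- 2)%:C * (ee x (t + h) n - ee x t n)) <=
  C * `|h| `^ a.
Proof.
move=> c0 mu2 bad a0 am.
have mu0 : 0 < mu by lra.
pose m := mu^-1.
have m0 : 0 < m by rewrite invr_gt0.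
have m2 : m <= 1 / 2 by rewrite div1r lef_pV2 ?posrE.
have mE : 1 / (2 * mu) = m / 2 by rewrite /m; field; rewrite gt_eqF.
rewrite mE in am.
pose eps := minr (1 / 2 + m / 2 - a) (1 / 4).
have eps0 : 0 < eps by rewrite lt_min; apply/andP; split; lra.
have e1 : eps <= 1 / 2 + m / 2 - a by rewrite ge_min lexx.
have e2 : eps <= 1 / 4 by rewrite ge_min lexx orbT.
have [C C0 HC] := weyl_badly c0 mu2 eps0 bad.
have [D D0 HD] := Hsum_powR eps0.
pose s := eps / 2 + 1 - m.
have s0 : 0 <= s by rewrite /s; lra.
pose E1 := 48 * Num.sqrt C * (1 + D) * 4.
pose E2 := 18 * Num.sqrt (2 * C).
have E10 : 0 <= E1 by rewrite !mulr_ge0 ?sqrtr_ge0//; lra.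
have E20 : 0 <= E2 by rewrite !mulr_ge0 ?sqrtr_ge0//.
exists (E1 + 2 * E2 + 1); first by lra.
move=> x h J h0 h1 XJ; set X := cutoff h in XJ.
have /andP[X1 X2] := cutoff_bounds h0 h1; rewrite -/X in X1 X2.
have X0 : (0 < X)%N by [].
have Xp : (0 : R) < X%:R by rewrite ltr0n.
have hle y : a <= y -> `|h| `^ y <= `|h| `^ a.
  by move=> ay; rewrite powR_anti_exp// (ltW h0).
have head : normc (\sum_(1 <= n < X) (n%:R ^- 2)%:C * (ee x (t + h) n - ee x t n)) <= E1 * `|h| `^ a.
  rewrite (le_trans (head_bound h X0 (sqrtr_ge0 C) s0 _))//.
    move=> k k0; apply: normc_le_sqrt; first exact: ltW.
    have := HC x 0 k k0; rewrite addr0 normr0 powR0 ?gt_eqF// mulr0 addr0 => /le_trans; apply.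
    rewrite -mulrA ler_pM2l// -powRD; last by rewrite pnatr_eq0 -lt0n k0 implybT.
    rewrite le_eqVlt; apply/orP; left; apply/eqP; congr (_ `^ _).
    by rewrite /s /m; field; rewrite gt_eqF.
  have HX : 1 + Hsum R X <= (1 + D) * X%:R `^ eps.
    rewrite mulrDl mul1r lerD ?HD// one_le_powR ?ler1n ?(ltW eps0)//.
  apply: (@le_trans _ _ (`|h| * (48 * Num.sqrt C * X%:R `^ s * ((1 + D) * X%:R `^ eps)))).
    rewrite ler_wpM2l// ler_wpM2l// ?mulr_ge0 ?sqrtr_ge0 ?powR_ge0//.
  have -> : `|h| * (48 * Num.sqrt C * X%:R `^ s * ((1 + D) * X%:R `^ eps)) =
     48 * Num.sqrt C * (1 + D) * (`|h| * X%:R `^ (s + eps)).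
    rewrite [X%:R `^ (s + eps)]powRD; last by rewrite (gt_eqF Xp) implybT.
    ring.
  rewrite /E1 -[leRHS]mulrA ler_wpM2l//.
    by rewrite !mulr_ge0 ?sqrtr_ge0//; move: D0; clear; lra.
  apply: (@le_trans _ _ (`|h| * (2 * `|h| `^ (- 1 / 2)) `^ (s + eps))).
    rewrite ler_wpM2l//; apply: ge0_ler_powR; rewrite ?nnegrE ?mulr_ge0 ?powR_ge0//.
    by rewrite addr_ge0// ltW.
  rewrite powRM ?powR_ge0// -powRrM mulrCA.
  apply: ler_pM; rewrite ?powR_ge0 ?mulr_ge0 ?powR_ge0//.
    apply: (@le_trans _ _ (2 `^ 2)); first by rewrite ler_powR ?ler1n// /s; move: e2 m0; clear; lra.
    by rewrite powR_mulrn// -natrX.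
  rewrite -{1}[`|h|]powRr1// -powRD; last by rewrite (gt_eqF h0) implybT.
  by apply: hle; rewrite /s; move: e1 eps0; clear; lra.
have tail y : (y = t + h \/ y = t) ->
    normc (\sum_(X <= n < J) (n%:R ^- 2)%:C * ee x y n) <= E2 * `|h| `^ a.
  move=> yE.
  pose B := Num.sqrt (2 * C) * `|h| `^ (m / 2).
  have B0 : 0 <= B by rewrite mulr_ge0 ?sqrtr_ge0 ?powR_ge0.
  rewrite (le_trans (@tail_bound X J _ B (eps / 2) _ _ _ _ _ _))//;
    [by move: eps0; clear; lra|by move: e2; clear; lra| |].
    move=> k Xk; have k0 : (0 < k)%N by rewrite (leq_trans X0).
    have kp : (0 : R) < k%:R by rewrite ltr0n.
    (* Beyond the cutoff k^-2 <= |h|, so the second term of [weyl_badly] dominates the first. *)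
    have km : k%:R `^ (2 - 2 / mu) <= k%:R ^+ 2 * `|h| `^ m.
      rewrite powRD; last by rewrite (gt_eqF kp) implybT.
      rewrite powR_mulrn// ler_wpM2l ?exprn_ge0// powRN.
      rewrite -[leRHS]invrK lef_pV2 ?posrE ?invr_gt0 ?powR_gt0//.
      have -> : (`|h| `^ m)^-1 = (`|h| `^ (- 1 / 2)) `^ (2 / mu).
        by rewrite -powRrM -powRN; congr (_ `^ _); rewrite /m; field; rewrite gt_eqF.
      apply: ge0_ler_powR; rewrite ?nnegrE ?powR_ge0 ?divr_ge0 ?(ltW mu0)//.
      by rewrite (le_trans X1)// ler_nat.
    have S2 : normc (\sum_(0 <= j < k) ee x y j) ^+ 2 <=
        2 * C * (`|h| `^ m * (k%:R ^+ 2 * k%:R `^ eps)).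
      have P0 : 0 <= C * k%:R `^ eps by rewrite mulr_ge0 ?powR_ge0// ltW.
      apply: (@le_trans _ _ (C * k%:R `^ eps * (2 * (k%:R ^+ 2 * `|h| `^ m)))); last first.
        by rewrite le_eqVlt; apply/orP; left; apply/eqP; ring.
      case: yE => ->.
        rewrite (le_trans (HC x h k k0))// ler_wpM2l// -/m; move: km; clear; lra.
      have := HC x 0 k k0; rewrite addr0 => /le_trans; apply.
      rewrite ler_wpM2l// normr0 powR0 ?gt_eqF// mulr0 addr0.
      by rewrite (le_trans km)// ler_peMl ?ler1n// mulr_ge0 ?exprn_ge0 ?powR_ge0.
    rewrite -(@ler_pXn2r _ 2)// ?nnegrE ?normc_ge0 ?mulr_ge0 ?powR_ge0//.
    rewrite (le_trans S2)// /B !exprMn sqr_sqrtr ?mulr_ge0 ?(ltW C0)//.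
    rewrite le_eqVlt; apply/orP; left; apply/eqP.
    have -> : (`|h| `^ (m / 2)) ^+ 2 = `|h| `^ m.
      by rewrite -powR_mulrn ?powR_ge0// -powRrM divfK.
    have -> : (k%:R `^ (1 + eps / 2)) ^+ 2 = k%:R ^+ 2 * k%:R `^ eps :> R.
      rewrite -powR_mulrn ?powR_ge0// -powRrM -(@powR_mulrn _ k%:R)//.
      rewrite -powRD; last by rewrite (gt_eqF kp) implybT.
      by congr (_ `^ _); field.
    by rewrite !mulrA.
  rewrite /B /E2 -!mulrA ler_pM2l// ler_wpM2l ?sqrtr_ge0//.
  apply: (@le_trans _ _ (`|h| `^ (m / 2) * `|h| `^ ((1 - eps / 2) / 2))).
    rewrite ler_wpM2l ?powR_ge0//.
    have -> : X%:R `^ (eps / 2 - 1) = (X%:R `^ (1 - eps / 2))^-1 :> R.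
      by rewrite -powRN opprB.
    have -> : `|h| `^ ((1 - eps / 2) / 2) = ((`|h| `^ (- 1 / 2)) `^ (1 - eps / 2))^-1.
      by rewrite -powRrM -powRN; congr (_ `^ _); field.
    rewrite lef_pV2 ?posrE ?powR_gt0 ?powR_gt0//.
    by apply: ge0_ler_powR; rewrite ?nnegrE ?powR_ge0//; move: e2; clear; lra.
  rewrite -powRD; last by rewrite (gt_eqF h0) implybT.
  by apply: hle; move: e1 eps0; clear; lra.
rewrite (big_cat_nat _ (n := X))//=.
rewrite (le_trans (le_normcD _ _))// -addrA mulrDl lerD//.
have -> : \sum_(X <= i < J) (i%:R ^- 2)%:C * (ee x (t + h) i - ee x t i) =
  \sum_(X <= i < J) (i%:R ^- 2)%:C * ee x (t + h) i -
  \sum_(X <= i < J) (i%:R ^- 2)%:C * ee x t i.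
  by rewrite -sumrB; apply: eq_bigr => i _; rewrite mulrBr.
rewrite (le_trans (normcB _ _))//.
have := tail (t + h) (or_introl erefl); have := tail t (or_intror erefl).
by have := powR_ge0 `|h| a; clear; lra.
Qed.

Lemma rpartE_nat x0 t J :
  rpart x0 t J = \sum_(1 <= n < J.+1) (n%:R ^- 2)%:C * ee x0 t n +
    \sum_(1 <= n < J.+1) (n%:R ^- 2)%:C * ee (- x0) t n.
Proof.
rewrite -big_split /rpart big_add1 /= big_mkord; apply: eq_bigr => k _.
by rewrite /rterm mulrDr.
Qed.

Lemma riemann_increment x0 t h (Cb a : R) : 0 < a -> a <= 1 ->
  0 < `|h| -> `|h| <= 1 ->
  (forall x J, (cutoff h <= J)%N ->
    normc (\sum_(1 <= n < J) (n%:R ^- 2)%:C * (ee x (t + h) n - ee x t n)) <=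
    Cb * `|h| `^ a) ->
  normc (riemann_fun x0 (t + h) - riemann_fun x0 t) <= (2 * Cb + 1) * `|h| `^ a.
Proof.
move=> a0 a1 h0 h1 H.
pose J := (cutoff h + (truncn (8 / `|h|)).+1)%N.
have J0 : (0 < J)%N by rewrite /J addnS.
have JX : (cutoff h <= J.+1)%N by rewrite /J leqW// leq_addr.
have J8 : 8 / J%:R <= `|h|.
  rewrite ler_pdivrMr ?ltr0n// mulrC -ler_pdivrMr//.
  by rewrite (le_trans (ltW (truncnS_gt _)))// ler_nat leq_addl.
have ha : `|h| <= `|h| `^ a.
  by rewrite -{1}[`|h|]powRr1// powR_anti_exp// (ltW h0).
have := riemann_fun_approx x0 (t + h) J0; have := riemann_fun_approx x0 t J0.
set f1 := riemann_fun x0 t; set f2 := riemann_fun x0 (t + h) => A1 A2.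
have -> : f2 - f1 = (f2 - rpart x0 (t + h) J) - (f1 - rpart x0 t J) +
   (rpart x0 (t + h) J - rpart x0 t J) by ring.
rewrite (le_trans (le_normcD _ _))//.
have D : normc (rpart x0 (t + h) J - rpart x0 t J) <= 2 * (Cb * `|h| `^ a).
  have -> : rpart x0 (t + h) J - rpart x0 t J =
     \sum_(1 <= n < J.+1) (n%:R ^- 2)%:C * (ee x0 (t + h) n - ee x0 t n) +
     \sum_(1 <= n < J.+1) (n%:R ^- 2)%:C * (ee (- x0) (t + h) n - ee (- x0) t n).
    rewrite !rpartE_nat opprD addrACA -!sumrB.
    by congr (_ + _); apply: eq_bigr => i _; rewrite mulrBr.
  rewrite (le_trans (le_normcD _ _))//.
  have := H x0 _ JX; have := H (- x0) _ JX; lra.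
have D2 : normc (f2 - rpart x0 (t + h) J - (f1 - rpart x0 t J)) <= 8 / J%:R.
  rewrite (le_trans (normcB _ _))//.
  have -> : 8 / J%:R = 4 / J%:R + 4 / J%:R :> R by ring.
  by rewrite lerD.
lra.
Qed.

Lemma holder_badly (c mu x0 t a : R) : 0 < c -> 2 <= mu ->
  badly_approx c mu t -> 0 < a -> a < 1 / 2 + 1 / (2 * mu) ->
  holder_at (riemann_fun x0) t a.
Proof.
move=> c0 mu2 bad a0 am.
have a1 : a <= 1.
  have : mu^-1 <= 1 / 2 by rewrite div1r lef_pV2 ?posrE//; lra.
  by move: am; rewrite div1r invfM; lra.
have [C C0 HC] := oneside_badly c0 mu2 bad a0 am.
apply: (@holder_intro R _ t a (riemann_fun x0 t) 0 (2 * C + 1) 1) => //.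
  by left.
move=> h hh; rewrite mul0r subr0.
have [->|hn0] := eqVneq h 0.
  by rewrite addr0 subrr normc0 mulr_ge0 ?powR_ge0//; lra.
apply: riemann_increment => //; rewrite ?normr_gt0 ?(ltW hh)//.
by move=> x J JX; apply: HC; rewrite ?normr_gt0 ?(ltW hh).
Qed.

(** No cancellation is used: each of the first |h|^(-1/2) terms moves by O(|h|), and the rest is
    O(|h|^(1/2)). *)
Lemma holder_half x0 t : holder_at (riemann_fun x0) t (1 / 2).
Proof.
apply: (@holder_intro R _ t (1 / 2) (riemann_fun x0 t) 0 40 1) => //.
  by left.
move=> h hh; rewrite mul0r subr0.
have [->|hn0] := eqVneq h 0.
  by rewrite addr0 subrr normc0 mulr_ge0 ?powR_ge0.
have h0 : 0 < `|h| by rewrite normr_gt0.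
have /andP[X1 X2] := cutoff_bounds h0 (ltW hh).
set X := cutoff h in X1 X2.
have X0 : (0 < X)%N by [].
have := riemann_fun_approx x0 (t + h) X0; have := riemann_fun_approx x0 t X0.
set f1 := riemann_fun x0 t; set f2 := riemann_fun x0 (t + h) => A1 A2.
have -> : f2 - f1 = (f2 - rpart x0 (t + h) X) - (f1 - rpart x0 t X) +
   (rpart x0 (t + h) X - rpart x0 t X) by ring.
have D : normc (rpart x0 (t + h) X - rpart x0 t X) <= 16 * `|h| * X%:R.
  rewrite /rpart -sumrB (le_trans (normc_sum _ _ _))//.
  apply: (@le_trans _ _ (\sum_(k < X) 16 * `|h|)); last first.
    by rewrite sumr_const card_ord mulr_natr.
  apply: ler_sum => k _; rewrite /rterm -mulrBr normcZ ger0_norm ?invr_ge0 ?exprn_ge0//.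
  rewrite ler_pdivrMl ?exprn_gt0 ?ltr0n//.
  have E x : normc (ee x (t + h) k.+1 - ee x t k.+1) <= 8 * (k.+1%:R ^+ 2 * `|h|).
    rewrite /ee normc_eB (le_trans (normc_e1_le8 _))// ler_pM2l//.
    rewrite (_ : _ - _ = k.+1%:R ^+ 2 * h); last by ring.
    by rewrite normrM [`|_ ^+ 2|]ger0_norm ?exprn_ge0.
  have -> : ee x0 (t + h) k.+1 + ee (- x0) (t + h) k.+1 - (ee x0 t k.+1 + ee (- x0) t k.+1) =
    (ee x0 (t + h) k.+1 - ee x0 t k.+1) + (ee (- x0) (t + h) k.+1 - ee (- x0) t k.+1) by ring.
  rewrite (le_trans (le_normcD _ _))//; have := E x0; have := E (- x0); lra.
have hs : `|h| * `|h| `^ (- 1 / 2) = `|h| `^ (1 / 2).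
  rewrite -{1}[`|h|]powRr1// -powRD; last by rewrite (gt_eqF h0) implybT.
  by congr (_ `^ _); field.
have X4 : 4 / X%:R <= 4 * `|h| `^ (1 / 2).
  rewrite ler_pM2l//.
  have -> : `|h| `^ (1 / 2) = (`|h| `^ (- 1 / 2))^-1.
    by rewrite -powRN; congr (_ `^ _); field.
  by rewrite lef_pV2 ?posrE ?powR_gt0 ?ltr0n.
have D2 : normc (f2 - rpart x0 (t + h) X - (f1 - rpart x0 t X)) <= 4 / X%:R + 4 / X%:R.
  by rewrite (le_trans (normcB _ _))// lerD.
have D3 : `|h| * X%:R <= 2 * `|h| `^ (1 / 2).
  by rewrite -hs mulrCA ler_wpM2l.
rewrite (le_trans (le_normcD _ _))//.
by move: D; rewrite -mulrA; lra.
Qed.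

End Regularity.

(** * Regularity at the origin *)

Section QuasiLipschitz.
Variable R : realType.
Implicit Types (x y h t a b s r : R) (z w : R[i]).

(** Cutting [0, h] into m + 1 equal steps makes the quadratic errors add up to K h^2/(m + 1). This
    acts as a mean value inequality in which K may be arbitrarily large. *)
Lemma quasi_lipschitz (f : R -> R[i]) h (A K : R) : 0 <= K ->
  (forall s r, `|s| <= `|h| -> `|s + r| <= `|h| ->
     normc (f (s + r) - f s) <= A * `|r| + K * r ^+ 2) ->
  normc (f h - f 0) <= A * `|h|.
Proof.
move=> K0 H.
have step (m : nat) : normc (f h - f 0) <= A * `|h| + K * h ^+ 2 / m.+1%:R.
  have m0 : (0 : R) < m.+1%:R by rewrite ltr0n.
  pose g (i : nat) := f (i%:R * (h / m.+1%:R)).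
  have -> : f h - f 0 = \sum_(0 <= i < m.+1) (g i.+1 - g i).
    rewrite telescope_sumr// /g mul0r; congr (f _ - _); field.
    by rewrite addrC natr1 gt_eqF.
  rewrite (le_trans (normc_sum _ _ _))//.
  apply: (@le_trans _ _ (\sum_(0 <= i < m.+1) (A * `|h| + K * h ^+ 2 / m.+1%:R) / m.+1%:R)); last first.
    by rewrite sumr_const_nat subn0 -[_ *+ m.+1]mulr_natr divfK ?gt_eqF.
  have le i : (i <= m.+1)%N -> `|i%:R * (h / m.+1%:R)| <= `|h|.
    move=> im; rewrite mulrCA normrM ler_piMr// ger0_norm ?divr_ge0//.
    by rewrite ler_pdivrMr// mul1r ler_nat.
  rewrite big_nat_cond [leRHS]big_nat_cond; apply: ler_sum => i.
  rewrite andbT => /andP[_ im].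
  have E : i.+1%:R * (h / m.+1%:R) = i%:R * (h / m.+1%:R) + h / m.+1%:R.
    by rewrite -[i.+1%:R]natr1; ring.
  have h1 := le i (ltnW im); have h2 := le i.+1 im.
  rewrite E in h2.
  rewrite /g E (le_trans (H _ _ h1 h2))// normrM normfV (ger0_norm (ltW m0)).
  rewrite le_eqVlt; apply/orP; left; apply/eqP.
  by field; rewrite addrC natr1 gt_eqF.
apply/ler_addgt0Pr => eps eps0.
have := step (truncn (K * h ^+ 2 / eps)).
have T := truncnS_gt (K * h ^+ 2 / eps).
move=> /le_trans; apply; rewrite lerD2l ler_pdivrMr ?ltr0n//.
by rewrite -ler_pdivrMl// [leLHS]mulrC ltW.
Qed.

Lemma tail_const (X J : nat) (v : nat -> R[i]) (B : R) :
  (0 < X)%N -> (X <= J)%N -> 0 <= B ->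
  (forall k, normc (\sum_(0 <= j < k) v j) <= B) ->
  normc (\sum_(X <= n < J) (n%:R ^- 2)%:C * v n) <= 2 * B * X%:R ^- 2.
Proof.
move=> X0 XJ B0 H.
have E k : normc ((k%:R ^- 2)%:C * \sum_(0 <= j < k) v j) <= k%:R ^- 2 * B.
  by rewrite normcZ ger0_norm ?invr_ge0 ?exprn_ge0// ler_wpM2l ?invr_ge0 ?exprn_ge0.
rewrite abel_id// (le_trans (le_normcD _ _))//.
have h1 := le_trans (normcB _ _) (lerD (E J) (E X)).
have h2 : normc (\sum_(X <= k < J) ((k%:R ^- 2)%:C - (k.+1%:R ^- 2)%:C) * \sum_(0 <= j < k.+1) v j) <= (X%:R ^- 2 - J%:R ^- 2) * B.
  rewrite (le_trans (normc_sum _ _ _))//.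
  have -> : X%:R ^- 2 - J%:R ^- 2 = \sum_(X <= k < J) (k%:R ^- 2 - k.+1%:R ^- 2) :> R.
    rewrite (eq_bigr (fun k => (- k.+1%:R ^- 2) - (- k%:R ^- 2))); last by move=> k _; ring.
    by rewrite telescope_sumr// opprK addrC.
  rewrite big_distrl /= big_nat_cond [leRHS]big_nat_cond; apply: ler_sum => k.
  rewrite andbT => /andP[Xk _]; rewrite -rmorphB /= normcZ.
  have /andP[d1 _] := @inv_sqr_diff R k (leq_trans X0 Xk).
  by rewrite ger0_norm// ler_wpM2l.
have -> : 2 * B * X%:R ^- 2 = (J%:R ^- 2 * B + X%:R ^- 2 * B) + (X%:R ^- 2 - J%:R ^- 2) * B by ring.
exact: lerD.
Qed.

End QuasiLipschitz.

(** * Low frequencies at the origin: sums of e(n^2 s + n y) without stationary phase *)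

Section Head.
Variable R : realType.
Implicit Types (x h t a b s r : R) (z w : R[i]).
Variables (y tau : R).
Hypotheses (tau0 : 0 < tau) (tauE : normc (1 - e y) = tau).

(** The ratio of the consecutive terms [E n.+1 s] and [E n s]; it stays away from 1 as long as n |s|
    is small compared with tau. *)
Let u (n : nat) s : R[i] := e (y + (2 * n%:R + 1) * s).
Let D (n : nat) s : R[i] := (1 - u n s)^-1.
Let B : R := 2 / tau.
Let E (n : nat) s : R[i] := ee y s n.

Let B0 : 0 < B. Proof. by rewrite divr_gt0. Qed.

Let ES n s : E n.+1 s = E n s * u n s.
Proof. by rewrite /E /ee /u -eD -natr1; congr e; ring. Qed.

Let E1n n s : normc (E n s) = 1. Proof. exact: normc_e. Qed.

Variables (X : nat) (h : R).
Hypotheses (X0 : (0 < X)%N) (Xh : 80 * X%:R * `|h| <= tau) (hX : tau <= 80 * X.+1%:R * `|h|).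


(** For n <= X + 1 one has 2n + 1 <= 5X, so the ratio moves away from e y by at most 40 X |h|; the
    constant 80 makes this at most tau/2. *)
Let ulow n s : (n <= X.+1)%N -> `|s| <= `|h| -> tau / 2 <= normc (1 - u n s).
Proof.
move=> nX sh.
have XR : 1 <= X%:R :> R by rewrite ler1n.
have : normc (e y - u n s) <= 8 * (5 * X%:R * `|s|).
  rewrite normc_eB (le_trans (normc_e1_le8 _))// ler_pM2l//.
  have -> : y - (y + (2 * n%:R + 1) * s) = - ((2 * n%:R + 1) * s) by ring.
  rewrite normrN normrM ler_wpM2r// ger0_norm ?addr_ge0 ?mulr_ge0//.
  have : (n%:R : R) <= X%:R + 1 by rewrite natr1 ler_nat.
  lra.
have := normc_triangle 1 (e y) (u n s); rewrite tauE [normc (u n s - _)]normc_distC.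
have : X%:R * `|s| <= X%:R * `|h| by rewrite ler_wpM2l.
by have := Xh; lra.
Qed.

Let un0 n s : (n <= X.+1)%N -> `|s| <= `|h| -> 1 - u n s != 0.
Proof.
move=> nX sh; apply/eqP => E0; have := ulow nX sh; rewrite E0 normc0; have := tau0; lra.
Qed.

Let Dle n s : (n <= X.+1)%N -> `|s| <= `|h| -> normc (D n s) <= B.
Proof.
move=> nX sh; have := ulow nX sh => H.
rewrite /D normcV /B -[2 / tau]invrK invf_div lef_pV2 ?posrE//; last first.
  by rewrite divr_gt0.
by rewrite (lt_le_trans _ H)// divr_gt0.
Qed.

Let DB n m s r : (n <= X.+1)%N -> (m <= X.+1)%N -> `|s| <= `|h| -> `|r| <= `|h| ->
  D n s - D m r = (u n s - u m r) * D n s * D m r.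
Proof.
move=> nX mX sh rh; rewrite /D; have h1 := un0 nX sh; have h2 := un0 mX rh.
by field; rewrite h1 h2.
Qed.

Let uS n s : u n.+1 s - u n s = u n s * (e (2 * s) - 1).
Proof.
rewrite /u mulrBr mulr1 -eD -natr1; congr (e _ - _); ring.
Qed.

Let uSle n s : normc (u n.+1 s - u n s) <= 16 * `|s|.
Proof.
rewrite uS normcM normc_e mul1r (le_trans (normc_e1_le8 _))//.
by rewrite normrM ger0_norm// mulrA le_eqVlt; apply/orP; left; apply/eqP; ring.
Qed.

Let dle n s : (n.+1 <= X.+1)%N -> `|s| <= `|h| -> normc (D n.+1 s - D n s) <= B ^+ 2 * (16 * `|s|).
Proof.
move=> nX sh; rewrite DB ?(ltnW nX)// !normcM.
have -> : B ^+ 2 * (16 * `|s|) = 16 * `|s| * B * B by ring.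
have h1 := Dle nX sh; have h2 := Dle (ltnW nX) sh; have h3 := uSle n s.
by do !(apply: ler_pM; rewrite ?mulr_ge0 ?normc_ge0//).
Qed.

Let ddle n s : (n.+2 <= X.+1)%N -> `|s| <= `|h| ->
  normc ((D n.+1 s - D n s) - (D n.+2 s - D n.+1 s)) <=
  256 * B ^+ 2 * (1 + 2 * B) * s ^+ 2.
Proof.
move=> nX sh; have nX1 := ltnW nX; have nX0 := ltnW nX1.
have -> : (D n.+1 s - D n s) - (D n.+2 s - D n.+1 s) =
  - (D n.+1 s * ((u n.+2 s - u n.+1 s - (u n.+1 s - u n s)) * D n.+2 s +
     (u n.+1 s - u n s) * ((D n.+2 s - D n.+1 s) + (D n.+1 s - D n s)))).
  rewrite [D n.+2 s - D n.+1 s]DB// [D n.+1 s - D n s]DB//.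
  rewrite /D; have a1 := un0 nX sh; have a2 := un0 nX1 sh; have a3 := un0 nX0 sh.
  by field; rewrite a1 a2 a3.
rewrite normcN normcM.
have uu : normc (u n.+2 s - u n.+1 s - (u n.+1 s - u n s)) <= 256 * `|s| ^+ 2.
  rewrite !uS.
  have -> : u n.+1 s * (e (2 * s) - 1) - u n s * (e (2 * s) - 1) =
    (u n.+1 s - u n s) * (e (2 * s) - 1) by ring.
  have e2 : normc (e (2 * s) - 1) <= 16 * `|s|.
    rewrite (le_trans (normc_e1_le8 _))// normrM ger0_norm// mulrA.
    by rewrite le_eqVlt; apply/orP; left; apply/eqP; ring.
  have -> : 256 * `|s| ^+ 2 = (16 * `|s|) * (16 * `|s|) by ring.
  by rewrite normcM ler_pM ?normc_ge0 ?uSle.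
have h1 := Dle nX sh; have h2 := Dle nX1 sh; have h3 := uSle n s.
have h4 := dle nX sh; have h5 := dle nX1 sh.
rewrite -(real_normK (num_real s)).
have -> : 256 * B ^+ 2 * (1 + 2 * B) * `|s| ^+ 2 =
  B * (256 * `|s| ^+ 2 * B + (16 * `|s|) * (B ^+ 2 * (16 * `|s|) + B ^+ 2 * (16 * `|s|))) by ring.
apply: ler_pM; rewrite ?normc_ge0//.
rewrite (le_trans (le_normcD _ _))// !normcM lerD//.
  by apply: ler_pM; rewrite ?normc_ge0.
apply: ler_pM; rewrite ?normc_ge0//.
by rewrite (le_trans (le_normcD _ _))// lerD.
Qed.

Let Tid m s : (0 < m)%N -> (m <= X)%N -> `|s| <= `|h| ->
  \sum_(1 <= n < m.+1) E n s = E 1 s * D 1 s - E m.+1 s * D m s +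
   \sum_(1 <= n < m) (D n.+1 s - D n s) * E n.+1 s.
Proof.
case: m => // m _; elim: m => [|m IH] mX sh.
  rewrite big_nat1 big_geq// addr0 -mulrBl (ES 1).
  have := un0 (isT : (1 <= X.+1)%N) sh; rewrite /D => n0.
  by rewrite -{2}[E 1 s]mulr1 -mulrBr mulfK.
rewrite big_nat_recr//= IH ?(ltnW mX)// [in RHS]big_nat_recr//=.
have n0 := un0 (ltnW mX : (m.+2 <= X.+1)%N) sh.
have uD : u m.+2 s * D m.+2 s = D m.+2 s - 1 by rewrite /D; field.
by rewrite [E m.+3 s]ES -[E m.+2 s * _ * _]mulrA uD; ring.
Qed.

Let Xs s : `|s| <= `|h| -> X%:R * `|s| * B <= 1 / 40.
Proof.
move=> sh; have : X%:R * `|s| <= X%:R * `|h| by rewrite ler_wpM2l.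
move=> H; rewrite /B mulrA ler_pdivrMr//; have := Xh; lra.
Qed.

Let Tle m s : (m <= X)%N -> `|s| <= `|h| -> normc (\sum_(1 <= n < m.+1) E n s) <= 3 * B.
Proof.
have [->|m0] := posnP m; first by move=> _ _; rewrite big_geq// normc0 mulr_ge0 ?(ltW B0).
move=> mX sh; rewrite Tid// (le_trans (le_normcD _ _))//.
have h1 : normc (E 1 s * D 1 s - E m.+1 s * D m s) <= B + B.
  rewrite (le_trans (normcB _ _))// !normcM !E1n !mul1r lerD ?Dle//.
  by rewrite (leq_trans mX).
have h2 : normc (\sum_(1 <= n < m) (D n.+1 s - D n s) * E n.+1 s) <= X%:R * (B ^+ 2 * (16 * `|s|)).
  rewrite (le_trans (normc_sum _ _ _))//.
  apply: (@le_trans _ _ (\sum_(1 <= n < m) B ^+ 2 * (16 * `|s|))).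
    rewrite big_nat_cond [leRHS]big_nat_cond; apply: ler_sum => n.
    rewrite andbT => /andP[n1 nm]; rewrite normcM E1n mulr1 dle// ltnS.
    by rewrite ltnW// (leq_trans nm).
  rewrite sumr_const_nat -[_ *+ _]mulr_natl ler_wpM2r//.
    by rewrite mulr_ge0 ?sqr_ge0// mulr_ge0.
  by rewrite ler_nat (leq_trans (leq_subr _ _)).
have := Xs sh; have := B0; move: h1 h2.
have -> : X%:R * (B ^+ 2 * (16 * `|s|)) = 16 * (X%:R * `|s| * B) * B by ring.
by move: (X%:R * `|s| * B) => v; nra.
Qed.

Let CV : R := 3 * B * (32 * B ^+ 2 + 7 * B * (1 + 2 * B)).

(** The differences of [D], each O(|s|), add up to O(1) only. A second summation by parts gains the
    missing factor |s|: the second differences are O(s^2) and the partial sums of [E] are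
    bounded. *)
Let Vle s : `|s| <= `|h| ->
  normc (\sum_(1 <= n < X) (D n.+1 s - D n s) * E n.+1 s) <= CV * `|s|.
Proof.
move=> sh.
have A k : (k <= X)%N -> normc (\sum_(0 <= j < k) E j.+1 s) <= 3 * B.
  by move=> kX; have := Tle kX sh; rewrite big_add1.
rewrite (abel_id (fun n => D n.+1 s - D n s))//.
have h1 : normc ((D X.+1 s - D X s) * \sum_(0 <= j < X) E j.+1 s) <= B ^+ 2 * (16 * `|s|) * (3 * B).
  by rewrite normcM; apply: ler_pM; rewrite ?normc_ge0 ?dle ?A.
have h2 : normc ((D 2 s - D 1 s) * \sum_(0 <= j < 1) E j.+1 s) <= B ^+ 2 * (16 * `|s|) * (3 * B).
  by rewrite normcM; apply: ler_pM; rewrite ?normc_ge0 ?dle ?A.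
have h3 : normc (\sum_(1 <= k < X) (D k.+1 s - D k s - (D k.+2 s - D k.+1 s)) * \sum_(0 <= j < k.+1) E j.+1 s)
   <= X%:R * (256 * B ^+ 2 * (1 + 2 * B) * s ^+ 2 * (3 * B)).
  rewrite (le_trans (normc_sum _ _ _))//.
  apply: (@le_trans _ _ (\sum_(1 <= k < X) 256 * B ^+ 2 * (1 + 2 * B) * s ^+ 2 * (3 * B))).
    rewrite big_nat_cond [leRHS]big_nat_cond; apply: ler_sum => n.
    rewrite andbT => /andP[n1 nm]; rewrite normcM.
    by apply: ler_pM; rewrite ?normc_ge0 ?ddle ?A.
  have Bg := ltW B0.
  have W0 : 0 <= 256 * B ^+ 2 * (1 + 2 * B) * s ^+ 2 * (3 * B).
    by clear -Bg; pos.
  rewrite sumr_const_nat -[_ *+ _]mulr_natl; apply: (ler_wpM2r W0).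
  by rewrite ler_nat leq_subr.
have := normcB ((D X.+1 s - D X s) * \sum_(0 <= j < X) E j.+1 s) ((D 2 s - D 1 s) * \sum_(0 <= j < 1) E j.+1 s).
move=> h4; rewrite (le_trans (le_normcD _ _))//.
have h5 : X%:R * (256 * B ^+ 2 * (1 + 2 * B) * s ^+ 2 * (3 * B)) <=
    7 * B * (1 + 2 * B) * (3 * B) * `|s|.
  rewrite -(real_normK (num_real s)).
  have -> : X%:R * (256 * B ^+ 2 * (1 + 2 * B) * `|s| ^+ 2 * (3 * B)) =
    256 * (X%:R * `|s| * B) * (B * (1 + 2 * B) * (3 * B) * `|s|) by ring.
  have Bg := ltW B0.
  have P : 0 <= B * (1 + 2 * B) * (3 * B) * `|s| by pos.
  have := Xs sh; move: (X%:R * `|s| * B) => v.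
  have -> : 7 * B * (1 + 2 * B) * (3 * B) * `|s| = 7 * (B * (1 + 2 * B) * (3 * B) * `|s|) by ring.
  by move: P; move: (B * (1 + 2 * B) * (3 * B) * `|s|) => P; nra.
have -> : CV * `|s| = B ^+ 2 * (16 * `|s|) * (3 * B) + B ^+ 2 * (16 * `|s|) * (3 * B)
   + 7 * B * (1 + 2 * B) * (3 * B) * `|s| by rewrite /CV; ring.
lra.
Qed.

(** The value e(y)/(1 - e(y)) which Abel summation gives to the divergent sum of e(n y) over n >=
    1. *)
Let c0 : R[i] := E 1 0 * D 1 0.

Let C1 : R := CV + 8 * B + 24 * B ^+ 2.

Let CV0 : 0 <= CV.
Proof.
have Bg := ltW B0.
by rewrite /CV; pos.
Qed.

Let Tmain s : `|s| <= `|h| ->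
  normc (\sum_(1 <= n < X.+1) E n s - c0 + E X.+1 s * D X s) <= C1 * `|s|.
Proof.
move=> sh; rewrite Tid//.
have z0 : `|0 : R| <= `|h| by rewrite normr0.
have -> : E 1 s * D 1 s - E X.+1 s * D X s + \sum_(1 <= n < X) (D n.+1 s - D n s) * E n.+1 s - c0 + E X.+1 s * D X s =
  \sum_(1 <= n < X) (D n.+1 s - D n s) * E n.+1 s + (E 1 s - E 1 0) * D 1 s + E 1 0 * (D 1 s - D 1 0).
  by rewrite /c0; ring.
have -> : C1 * `|s| = CV * `|s| + 8 * B * `|s| + 24 * B ^+ 2 * `|s| by rewrite /C1; ring.
rewrite (le_trans (le_normcD _ _))// lerD//; last first.
  rewrite normcM E1n mul1r DB// !normcM.
  have u1 : normc (u 1 s - u 1 0) <= 24 * `|s|.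
    rewrite /u normc_eB (le_trans (normc_e1_le8 _))//.
    have -> : y + (2 * 1%:R + 1) * s - (y + (2 * 1%:R + 1) * 0) = 3 * s by ring.
    by rewrite normrM ger0_norm// mulrA le_eqVlt; apply/orP; left; apply/eqP; ring.
  have -> : 24 * B ^+ 2 * `|s| = 24 * `|s| * B * B by ring.
  have := Dle (isT : (1 <= X.+1)%N) sh; have := Dle (isT : (1 <= X.+1)%N) z0 => a1 a2.
  by do !(apply: ler_pM; rewrite ?mulr_ge0 ?normc_ge0//).
rewrite (le_trans (le_normcD _ _))// lerD ?Vle// normcM.
have -> : 8 * B * `|s| = 8 * `|s| * B by ring.
apply: ler_pM; rewrite ?normc_ge0 ?Dle//.
rewrite /E /ee normc_eB (le_trans (normc_e1_le8 _))//.
by rewrite expr1n !mul1r add0r addrK.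
Qed.

Let w2 : R[i] := 0 +i* (2 * pi).

Let w2n : normc w2 <= 8.
Proof.
rewrite (le_trans (normc_le_add _))//= normr0 add0r ger0_norm ?mulr_ge0 ?pi_ge0//.
by have := pi_lt4 R; lra.
Qed.

(** A correction of size O(X^-2) = O(h^2), whose leading derivative cancels the boundary term of
    [Tid]. *)
Let Z s : R[i] := (X.+1%:R ^- 2)%:C * (E X.+1 s * D X s).
Let F s : R[i] := \sum_(1 <= n < X.+1) (n%:R ^- 2)%:C * (E n s - E n 0).

Let C2 : R := 8 * C1 + 640 * B ^+ 3.

(* Kuzmin-Landau in the form of an exact telescoping: with
   [D n s = 1 / (1 - u n s)] one has [E n s = E n s * D n s - E n.+1 s * D n s],
   so the derivative of [F + Z] stays within [O(|s|)] of a constant. *)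
Lemma head_linear : normc (F h - w2 * c0 * h%:C) <= (C2 + 3200 * B ^+ 3) * h ^+ 2.
Proof.
have Bg := ltW B0.
have N0 : (0 : R) < X.+1%:R by rewrite ltr0n.
have N1 : (1 : R) <= X.+1%:R by rewrite ler1n.
(* That X is as large as possible enters here. *)
have Nh : X.+1%:R^-1 <= 40 * B * `|h|.
  rewrite -div1r ler_pdivrMr// /B.
  have -> : 40 * (2 / tau) * `|h| * X.+1%:R = (80 * X.+1%:R * `|h|) / tau by ring.
  by rewrite ler_pdivlMr// mul1r.
pose psi s := F s + Z s - w2 * c0 * s%:C.
(* This constant grows with X, which [quasi_lipschitz] allows. *)
pose K := \sum_(1 <= n < X.+1) 128 * (n%:R : R) ^+ 2 + 128 * X.+1%:R ^+ 2 * B.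
have K0 : 0 <= K.
  apply: addr_ge0; last by pos.
  by apply: sumr_ge0 => n _; pos.
have Einc n s r : E n (s + r) = E n s * e (n%:R ^+ 2 * r).
  by rewrite /E /ee -eD; congr e; ring.
have H : forall s r, `|s| <= `|h| -> `|s + r| <= `|h| ->
     normc (psi (s + r) - psi s) <= C2 * `|h| * `|r| + K * r ^+ 2.
  move=> s r sh srh.
  pose tay n := e (n%:R ^+ 2 * r) - 1 - w2 * (n%:R ^+ 2 * r)%:C.
  have tayle n : normc (tay n) <= 128 * (n%:R ^+ 2 * n%:R ^+ 2 * r ^+ 2).
    rewrite (le_trans (normc_e1_taylor _))// le_eqVlt; apply/orP; left; apply/eqP; ring.
  have -> : psi (s + r) - psi s =
     w2 * r%:C * (\sum_(1 <= n < X.+1) E n s - c0 + E X.+1 s * D X s)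
    + \sum_(1 <= n < X.+1) (n%:R ^- 2)%:C * (E n s * tay n)
    + (X.+1%:R ^- 2)%:C * (E X.+1 s * tay X.+1 * D X s)
    + (X.+1%:R ^- 2)%:C * (E X.+1 (s + r) * (D X (s + r) - D X s)).
    have FE : F (s + r) - F s = w2 * r%:C * (\sum_(1 <= n < X.+1) E n s) +
       \sum_(1 <= n < X.+1) (n%:R ^- 2)%:C * (E n s * tay n).
      rewrite /F big_distrr /= -sumrB -big_split /=.
      rewrite big_nat_cond [RHS]big_nat_cond; apply: eq_bigr => n.
      rewrite andbT => /andP[n1 _]; rewrite Einc /tay.
      have : (n%:R ^- 2)%:C * (n%:R ^+ 2 * r)%:C = r%:C :> R[i].
        by rewrite -rmorphM /= mulKf// expf_neq0// pnatr_eq0 -lt0n.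
      by move=> <-; ring.
    have N2 : (X.+1%:R ^- 2)%:C * (X.+1%:R ^+ 2 * r)%:C = r%:C :> R[i].
      by rewrite -rmorphM /= mulKf// expf_neq0// pnatr_eq0.
    rewrite /psi rmorphD /=.
    have -> : F (s + r) + Z (s + r) - w2 * c0 * (s%:C + r%:C) - (F s + Z s - w2 * c0 * s%:C) =
       (F (s + r) - F s) + (Z (s + r) - Z s) - w2 * c0 * r%:C by ring.
    have ZE : Z (s + r) - Z s =
        w2 * ((X.+1%:R ^- 2)%:C * (X.+1%:R ^+ 2 * r)%:C) * (E X.+1 s * D X s) +
        (X.+1%:R ^- 2)%:C * (E X.+1 s * tay X.+1 * D X s) +
        (X.+1%:R ^- 2)%:C * (E X.+1 (s + r) * (D X (s + r) - D X s)).
      by rewrite /Z Einc /tay; ring.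
    rewrite FE ZE N2; ring.
  rewrite -addrA (le_trans (le_normcD _ _))//.
  have a1 : normc (w2 * r%:C * (\sum_(1 <= n < X.+1) E n s - c0 + E X.+1 s * D X s)) <=
      8 * C1 * `|h| * `|r|.
    rewrite !normcM normc_real.
    have -> : 8 * C1 * `|h| * `|r| = 8 * `|r| * (C1 * `|h|) by ring.
    apply: ler_pM; rewrite ?mulr_ge0 ?normc_ge0 ?ler_wpM2r//.
    rewrite (le_trans (Tmain sh))// ler_wpM2l// /C1.
    pos.
  have a2 : normc (\sum_(1 <= n < X.+1) (n%:R ^- 2)%:C * (E n s * tay n)) <=
     (\sum_(1 <= n < X.+1) 128 * (n%:R : R) ^+ 2) * r ^+ 2.
    rewrite (le_trans (normc_sum _ _ _))// mulr_suml.
    rewrite big_nat_cond [leRHS]big_nat_cond; apply: ler_sum => n.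
    rewrite andbT => /andP[n1 _]; rewrite normcZ normcM E1n mul1r.
    rewrite ger0_norm ?invr_ge0 ?exprn_ge0// ler_pdivrMl ?exprn_gt0 ?ltr0n//.
    rewrite (le_trans (tayle n))// le_eqVlt; apply/orP; left; apply/eqP; ring.
  have a3 : normc ((X.+1%:R ^- 2)%:C * (E X.+1 s * tay X.+1 * D X s)) <=
      128 * X.+1%:R ^+ 2 * B * r ^+ 2.
    rewrite normcZ !normcM E1n mul1r.
    rewrite ger0_norm ?invr_ge0 ?exprn_ge0// ler_pdivrMl ?exprn_gt0//.
    have -> : X.+1%:R ^+ 2 * (128 * X.+1%:R ^+ 2 * B * r ^+ 2) =
      128 * (X.+1%:R ^+ 2 * X.+1%:R ^+ 2 * r ^+ 2) * B by ring.
    by apply: ler_pM; rewrite ?normc_ge0 ?Dle ?tayle.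
  have a4 : normc ((X.+1%:R ^- 2)%:C * (E X.+1 (s + r) * (D X (s + r) - D X s))) <=
      640 * B ^+ 3 * `|h| * `|r|.
    rewrite normcZ normcM E1n mul1r DB// !normcM.
    have ul : normc (u X (s + r) - u X s) <= 16 * X.+1%:R * `|r|.
      rewrite /u normc_eB (le_trans (normc_e1_le8 _))//.
      have -> : y + (2 * X%:R + 1) * (s + r) - (y + (2 * X%:R + 1) * s) = (2 * X%:R + 1) * r by ring.
      rewrite normrM mulrA ler_wpM2r// ger0_norm ?addr_ge0 ?mulr_ge0//.
      by rewrite -natr1; lra.
    have d1 := Dle (leqnSn X) srh; have d2 := Dle (leqnSn X) sh.
    rewrite ger0_norm ?invr_ge0 ?exprn_ge0//.
    apply: (@le_trans _ _ (X.+1%:R ^- 2 * (16 * X.+1%:R * `|r| * B * B))).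
      rewrite ler_wpM2l ?invr_ge0 ?exprn_ge0//.
      by do !(apply: ler_pM; rewrite ?mulr_ge0 ?normc_ge0//).
    have -> : X.+1%:R ^- 2 * (16 * X.+1%:R * `|r| * B * B) = 16 * B ^+ 2 * `|r| * X.+1%:R^-1.
      by field; rewrite addrC natr1 gt_eqF.
    have -> : 640 * B ^+ 3 * `|h| * `|r| = 16 * B ^+ 2 * `|r| * (40 * B * `|h|) by ring.
    by apply: ler_wpM2l => //; pos.
  have := le_normcD (\sum_(1 <= n < X.+1) (n%:R ^- 2)%:C * (E n s * tay n))
    ((X.+1%:R ^- 2)%:C * (E X.+1 s * tay X.+1 * D X s)).
  have -> : C2 * `|h| * `|r| + K * r ^+ 2 = 8 * C1 * `|h| * `|r| + 640 * B ^+ 3 * `|h| * `|r|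
     + ((\sum_(1 <= n < X.+1) 128 * (n%:R : R) ^+ 2) * r ^+ 2 + 128 * X.+1%:R ^+ 2 * B * r ^+ 2).
    by rewrite /C2 /K; ring.
  move: a1 a2 a3 a4.
  set n1 := normc _; set n2 := normc _; set n3 := normc _; set n4 := normc _.
  move=> a1 a2 a3 a4.
  have := le_normcD (w2 * r%:C * (\sum_(1 <= n < X.+1) E n s - c0 + E X.+1 s * D X s))
    (\sum_(1 <= n < X.+1) (n%:R ^- 2)%:C * (E n s * tay n)).
  have := le_normcD ((X.+1%:R ^- 2)%:C * (E X.+1 s * tay X.+1 * D X s))
    ((X.+1%:R ^- 2)%:C * (E X.+1 (s + r) * (D X (s + r) - D X s))).
  rewrite -/n1 -/n2 -/n3 -/n4; lra.
have := quasi_lipschitz K0 H.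
have -> : psi h - psi 0 = (F h - w2 * c0 * h%:C) + (Z h - Z 0).
  rewrite /psi /F; under [X in _ - (X + _ - _)]eq_bigr do rewrite subrr mulr0.
  rewrite big1_eq rmorph0; ring.
have Zle s : `|s| <= `|h| -> normc (Z s) <= 1600 * B ^+ 3 * h ^+ 2.
  move=> sh; rewrite /Z normcZ normcM E1n mul1r ger0_norm ?invr_ge0 ?exprn_ge0//.
  apply: (@le_trans _ _ ((40 * B * `|h|) ^+ 2 * B)).
    apply: ler_pM; rewrite ?invr_ge0 ?exprn_ge0 ?normc_ge0 ?Dle//.
    rewrite -exprVn; apply: lerXn2r => //; rewrite nnegrE; pos.
  have -> : (40 * B * `|h|) ^+ 2 * B = 1600 * B ^+ 3 * `|h| ^+ 2 by ring.
  by rewrite (real_normK (num_real h)).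
have := Zle h (lexx _); have := Zle 0; rewrite normr0 => /(_ (normr_ge0 _)).
have : C2 * `|h| * `|h| = C2 * h ^+ 2 by rewrite -mulrA -expr2 real_normK ?num_real.
move=> -> z1 z2 z3.
have := normc_subr_ge (F h - w2 * c0 * h%:C) (- (Z h - Z 0)).
rewrite opprK normcN; have := normcB (Z h) (Z 0).
have -> : (C2 + 3200 * B ^+ 3) * h ^+ 2 = C2 * h ^+ 2 + 2 * (1600 * B ^+ 3 * h ^+ 2) by ring.
lra.
Qed.

End Head.

(** * High frequencies at the origin, and regularity of every order below 3/2 *)

Section ZeroRegular.
Variable R : realType.
Implicit Types (x y h t a b c s r tau : R) (z w : R[i]).

(** If the Dirichlet approximation of h is 0/1, [weyl_far_int] gives 1/|h|, which is O(N^2 |h|) as N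
    |h| >= c. Otherwise |p/q| >= 1/q forces 1/q <= 2 |h|, and [weyl_near_int] applies. *)
Lemma weyl_zero eps c : 0 < eps -> 0 < c -> c <= 1 ->
  exists2 C : R, 0 < C & forall x h (N : nat), (0 < N)%N -> h != 0 -> c <= N%:R * `|h| ->
  normc (\sum_(0 <= n < N) ee x h n) ^+ 2 <= C * N%:R `^ eps * (N%:R ^+ 2 * `|h|).
Proof.
move=> eps0 c0 c1.
have [C0 C00 HC0] := Hsum_powR eps0.
pose C1 := C0 * 4 `^ eps.
have C10 : 0 < C1 by rewrite mulr_gt0// powR_gt0.
pose C := (1 + 48 * C1) / c + 4 * C1 / c ^+ 2 + 8.
have C_0 : 0 < C.
  by rewrite /C addr_gt0// addr_gt0// divr_gt0 ?exprn_gt0 ?mulr_gt0 ?addr_gt0 ?mulr_gt0.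
exists C => // x h N N0 hn0 cN.
have N4 : (0 < 4 * N)%N by rewrite muln_gt0.
have NR : (1 : R) <= N%:R by rewrite ler1n.
have Np : (0 : R) < N%:R by rewrite ltr0n.
have h0 : 0 < `|h| by rewrite normr_gt0.
have [p [q [q0 qN cop]]] := dirichlet_approx h N4.
rewrite natrM => bN.
have qp : (0 : R) < q%:R by rewrite ltr0n.
have q1 : (1 : R) <= q%:R by rewrite ler1n.
pose P := N%:R `^ eps : R; rewrite -/P.
have P1 : 1 <= P by rewrite one_le_powR ?(ltW eps0).
have HH n : (0 < n)%N -> (n <= 4 * N)%N -> Hsum R n <= C1 * P.
  move=> n0 nN; rewrite (le_trans (HC0 n n0))// /C1 /P -mulrA -powRM//.
  rewrite ler_pM2l// ge0_ler_powR ?nnegrE ?(ltW eps0)//.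
  by rewrite -natrM ler_nat.
have Hq := HH q q0 qN.
have H2N : Hsum R (N * 2) <= C1 * P.
  by apply: HH; [rewrite muln_gt0 N0|rewrite mulnC leq_pmul2r].
pose S := N%:R ^+ 2 * `|h|; rewrite -/S.
have S0 : 0 < S by rewrite mulr_gt0 ?exprn_gt0.
have NS : N%:R <= S / c.
  rewrite ler_pdivlMr// /S expr2 -mulrA; exact: ler_wpM2l.
have hS : `|h|^-1 <= S / c ^+ 2.
  rewrite ler_pdivlMr ?exprn_gt0// mulrC ler_pdivrMr//.
  have -> : S * `|h| = (N%:R * `|h|) ^+ 2 by rewrite /S; ring.
  by rewrite lerXn2r ?nnegrE ?mulr_ge0 ?(ltW c0).
have base : N%:R + 8 * ((N * 2)%N%:R + q%:R) * Hsum R q <= (1 + 48 * C1) * P * N%:R.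
  have q4 : (q%:R : R) <= 4 * N%:R by rewrite -natrM ler_nat.
  have Hq0 := @Hsum_ge0 R q; rewrite natrM.
  have b1 : 8 * (N%:R * 2 + q%:R) * Hsum R q <= 48 * N%:R * (C1 * P).
    by apply: ler_pM => //; move: q4; clear; lra.
  have b2 : N%:R <= P * N%:R by rewrite ler_peMl// (ltW Np).
  have -> : (1 + 48 * C1) * P * N%:R = P * N%:R + 48 * N%:R * (C1 * P) by ring.
  exact: lerD.
have base2 : N%:R + 8 * ((N * 2)%N%:R + q%:R) * Hsum R q <= (1 + 48 * C1) / c * P * S.
  rewrite (le_trans base)//.
  have -> : (1 + 48 * C1) / c * P * S = (1 + 48 * C1) * P * (S / c) by ring.
  by rewrite ler_wpM2l// mulr_ge0 ?(le_trans ler01 P1)// addr_ge0// mulr_ge0// ltW.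
have -> : C * P * S = (1 + 48 * C1) / c * P * S + 4 * C1 / c ^+ 2 * P * S + 8 * P * S.
  by rewrite /C; ring.
have t2 : 0 <= 4 * C1 / c ^+ 2 * P * S.
  have C1' := ltW C10; have S' := ltW S0; have P' := le_trans ler01 P1; pos.
have t3 : 0 <= 8 * P * S.
  have S' := ltW S0; have P' := le_trans ler01 P1; pos.
have bN' : `|h - p%:~R / q%:R| <= 1 / (4 * N%:R * q%:R) by [].
have [p0|pn0] := eqVneq p 0.
  have q1' : q = 1%N by move: cop; rewrite p0 /coprime /= gcd0n => /eqP.
  move: bN' Hq base2; rewrite p0 q1' mul0r subr0 => bN' Hq base2.
  have := @weyl_far_int R x h 0 1 N isT N0 isT.
  rewrite mul0r subr0 => /(_ bN' hn0) W.
  apply: (le_trans W); apply: (@le_trans _ _ ((1 + 48 * C1) / c * P * S + 4 * C1 / c ^+ 2 * P * S)); last by rewrite lerDl.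
  apply: lerD => //; rewrite mul1r.
  have -> : 4 * C1 / c ^+ 2 * P * S = 2 * ((2 * C1 * P) * (S / c ^+ 2)) by ring.
  rewrite ler_pM2l//; apply: ler_pM; rewrite ?Hsum_ge0 ?invr_ge0//.
  have : 0 <= C1 * P by rewrite mulr_ge0 ?(ltW C10)// (le_trans ler01 P1).
  by move: H2N; rewrite -mulrA; clear; lra.
have W := @weyl_near_int R x h p q N q0 N0 cop bN'.
apply: (le_trans W); apply: (@le_trans _ _ ((1 + 48 * C1) / c * P * S + 8 * P * S)); last first.
  by rewrite [leRHS]addrAC lerDl.
apply: lerD => //.
have qh : q%:R^-1 <= 2 * `|h|.
  have p1 : 1 <= `|p%:~R : R| by rewrite -intr_norm -[1]/(1%:~R) ler_int -gtz0_ge1 normr_gt0.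
  have : 1 / q%:R <= `|p%:~R / q%:R : R|.
    by rewrite normrM normfV (ger0_norm (ltW qp)) ler_pM2r ?invr_gt0.
  have := ler_normB h (h - p%:~R / q%:R).
  rewrite subKr.
  have : 1 / (4 * N%:R * q%:R) <= 1 / 4 * q%:R^-1 :> R.
    rewrite invfM mulrA ler_pM2r ?invr_gt0// ler_pM2l// lef_pV2 ?posrE ?mulr_gt0//.
    by move: NR; clear; lra.
  by move: bN' h0; rewrite !mul1r; clear; lra.

apply: (@le_trans _ _ (8 * S)); last by rewrite ler_wpM2r ?(ltW S0)//; move: P1; clear; lra.
have -> : 8 * S = 4 * (N%:R ^+ 2 * (2 * `|h|)) by rewrite /S; ring.
by rewrite ler_pM2l// ler_wpM2l ?sqr_ge0.
Qed.

Lemma head_linear_ex y : e y != 1 -> exists (c1 : R[i]) (K : R), 0 <= K /\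
  forall (X : nat) h, (0 < X)%N -> 80 * X%:R * `|h| <= normc (1 - e y) ->
   normc (1 - e y) <= 80 * X.+1%:R * `|h| ->
  normc (\sum_(1 <= n < X.+1) (n%:R ^- 2)%:C * (ee y h n - ee y 0 n) - c1 * h%:C)
    <= K * h ^+ 2.
Proof.
move=> y1.
have tau0 : 0 < normc (1 - e y).
  rewrite lt_neqAle normc_ge0 andbT eq_sym; apply: contra_neq y1 => /eq0_normc H.
  by rewrite -[RHS](subrK (e y)) H add0r.
have H X h := @head_linear R y _ tau0 erefl X h.
have [c1 [K HK]] : exists (c1 : R[i]) (K : R), forall (X : nat) h, (0 < X)%N ->
   80 * X%:R * `|h| <= normc (1 - e y) -> normc (1 - e y) <= 80 * X.+1%:R * `|h| ->
   normc (\sum_(1 <= n < X.+1) (n%:R ^- 2)%:C * (ee y h n - ee y 0 n) - c1 * h%:C) <= K * h ^+ 2.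
  by eexists; eexists; exact: H.
exists c1, `|K|; split=> // X h X0 h1 h2; apply: (le_trans (HK X h X0 h1 h2)).
by rewrite ler_wpM2r ?sqr_ge0//; exact: ler_norm.
Qed.

(** The cut is at X about c/|h|. Below it [head_linear] leaves O(h^2). Above it the sum at 0 is
    geometric and contributes O(X^-2), and the sum at h is O(|h|^(1/2) X^(a'-1)) by [weyl_zero]; as
    X is about c/|h|, the choice a' = 3/2 - a makes the latter O(|h|^a). *)
Lemma one_sided_zero y a : e y != 1 -> 1 <= a -> a < 3 / 2 ->
  exists (c1 : R[i]) (C d : R), [/\ 0 <= C, 0 < d, d <= 1 &
   forall h, h != 0 -> `|h| < d -> exists J0 : nat, forall J, (J0 <= J)%N ->
   normc (\sum_(1 <= n < J) (n%:R ^- 2)%:C * (ee y h n - ee y 0 n) - c1 * h%:C)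
    <= C * `|h| `^ a].
Proof.
move=> y1 a1 a2.
have [c1 [K [K0 HK]]] := head_linear_ex y1.
set tau := normc (1 - e y) in HK.
have tau0 : 0 < tau.
  rewrite lt_neqAle normc_ge0 andbT eq_sym; apply: contra_neq y1 => /eq0_normc H.
  by rewrite -[RHS](subrK (e y)) H add0r.
have tau2 : tau <= 2 by rewrite /tau normc_distC normc_e1_le2.
pose a' := 3 / 2 - a.
have a'0 : 0 < a' by rewrite /a'; lra.
have a'2 : a' <= 1 / 2 by rewrite /a'; lra.
pose c : R := tau / 80.
have c0 : 0 < c by rewrite divr_gt0.
have cle : c <= 1 by rewrite /c; lra.
have [|Cw Cw0 HW] := @weyl_zero (a' * 2) c _ c0 cle; first by rewrite mulr_gt0.
pose B0 := sqrtr Cw.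
pose C := K + 18 * B0 * c `^ (a' - 1) + 4 / tau * c ^- 2.
have C_0 : 0 <= C.
  have tau0' := ltW tau0; have c0' := ltW c0; rewrite /C; pos.
exists c1, C, c; split => // h hn0 hc.
have h0 : 0 < `|h| by rewrite normr_gt0.
pose X := truncn (c / `|h|).
have X1 : (0 < X)%N by rewrite /X truncn_gt0 ler_pdivlMr// mul1r ltW.
have Xl : X%:R * `|h| <= c.
  by rewrite -ler_pdivlMr// truncn_le// divr_ge0// ltW.
have Xu : c <= X.+1%:R * `|h|.
  by rewrite -ler_pdivrMr// ltW// truncnS_gt.
have := HK X h X1; rewrite -/tau => HK1.
have h1 : 80 * X%:R * `|h| <= tau by move: Xl; rewrite /c; clear; lra.
have h2 : tau <= 80 * X.+1%:R * `|h| by move: Xu; rewrite /c; clear; lra.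
have {h1 h2 HK1} Hh := HK1 h1 h2.
exists X.+1 => J XJ.
have S1 : (0 : R) < X.+1%:R by rewrite ltr0n.
have pw1 : h ^+ 2 <= `|h| `^ a.
  rewrite -(real_normK (num_real h)) -powR_mulrn ?normr_ge0// powR_anti_exp//;
    [|by move: a1; clear; lra|by move: a2; clear; lra].
  by rewrite normr_ge0 ltW// (lt_le_trans hc).
have T0 : normc (\sum_(X.+1 <= n < J) (n%:R ^- 2)%:C * ee y 0 n) <= 4 / tau * c ^- 2 * `|h| `^ a.
  have := @tail_const R X.+1 J (ee y 0) (2 / tau) isT XJ.
  have e1 : 0 <= 2 / tau by rewrite divr_ge0// ltW.
  have G k : normc (\sum_(0 <= j < k) ee y 0 j) <= 2 / tau.
    rewrite ler_pdivlMr//; have := geom_norm k y.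
    rewrite [normc (e y - 1)]normc_distC -/tau; congr (normc _ * _ <= _).
    by apply: eq_bigr => j _; rewrite /ee mulr0 add0r.
  move=> /(_ e1 G) /le_trans; apply.
  have -> : 2 * (2 / tau) = 4 / tau by ring.
  rewrite -mulrA ler_wpM2l ?divr_ge0 ?(ltW tau0)//.
  apply: (@le_trans _ _ (c ^- 2 * h ^+ 2)); last by rewrite ler_wpM2l ?invr_ge0 ?sqr_ge0.
  rewrite -(real_normK (num_real h)) -[c ^- 2]exprVn -exprMn -exprVn.
  apply: lerXn2r; rewrite ?nnegrE ?invr_ge0 ?mulr_ge0 ?invr_ge0 ?(ltW c0)//.
  by rewrite ler_pdivlMl// ler_pdivrMr// [`|h| * _]mulrC.
have T1 : normc (\sum_(X.+1 <= n < J) (n%:R ^- 2)%:C * ee y h n) <= 18 * B0 * c `^ (a' - 1) * `|h| `^ a.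
  have := @tail_bound R X.+1 J (ee y h) (B0 * `|h| `^ (1 / 2)) a' isT XJ.
  have e1 : 0 <= B0 * `|h| `^ (1 / 2) by rewrite /B0; pos.
  have G k : (X.+1 <= k)%N -> normc (\sum_(0 <= j < k) ee y h j) <= B0 * `|h| `^ (1 / 2) * k%:R `^ (1 + a').
    move=> Xk; have k0 : (0 < k)%N by exact: leq_trans Xk.
    have ck : c <= k%:R * `|h|.
      by rewrite (le_trans Xu)// ler_wpM2r// ler_nat.
    have W := HW y h k k0 hn0 ck.
    have kp : (0 : R) < k%:R by rewrite ltr0n.
    have E : k%:R `^ (a' * 2) * (k%:R ^+ 2 * `|h|) = `|h| * k%:R `^ ((1 + a') * 2).
      rewrite -powR_mulrn ?ler0n// mulrA -powRD; last by rewrite (gt_eqF kp) implybT.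
      by rewrite mulrC; congr (_ * _ `^ _); rewrite -[2]/(2%:R); ring.
    move: W; rewrite -mulrA E mulrA => W.
    have := @normc_le_sqrt R _ _ _ _ (mulr_ge0 (ltW Cw0) (ltW h0)) W.
    by rewrite sqrtrM ?(ltW Cw0)// -[sqrtr `|h|]powR12_sqrt ?normr_ge0// div1r.
  move=> /(_ e1 a'0 a'2 G) /le_trans; apply.
  have E : X.+1%:R `^ (a' - 1) <= c `^ (a' - 1) * `|h| `^ (1 - a').
    have -> : a' - 1 = - (1 - a') by ring.
    rewrite !powRN ler_pdivlMl ?powR_gt0// -ler_pdivlMr ?invr_gt0 ?powR_gt0// invrK mulrC -powRM//.
    have a'1 : 0 <= 1 - a' by move: a'2; clear; lra.
    by apply: ge0_ler_powR; rewrite ?nnegrE ?mulr_ge0// ltW.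
  have hE : `|h| `^ a = `|h| `^ (1 / 2) * `|h| `^ (1 - a').
    rewrite -powRD; last by rewrite (gt_eqF h0) implybT.
    by congr (_ `^ _); rewrite /a'; field.
  rewrite hE.
  have -> : 18 * B0 * c `^ (a' - 1) * (`|h| `^ (1 / 2) * `|h| `^ (1 - a')) =
    18 * (B0 * `|h| `^ (1 / 2)) * (c `^ (a' - 1) * `|h| `^ (1 - a')) by ring.
  by rewrite ler_wpM2l// mulr_ge0.
rewrite (big_cat_nat (n := X.+1))//=.
have -> : \sum_(X.+1 <= n < J) (n%:R ^- 2)%:C * (ee y h n - ee y 0 n) =
  \sum_(X.+1 <= n < J) (n%:R ^- 2)%:C * ee y h n - \sum_(X.+1 <= n < J) (n%:R ^- 2)%:C * ee y 0 n.
  by rewrite -sumrB; apply: eq_bigr => n _; rewrite mulrBr.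
rewrite addrAC (le_trans (le_normcD _ _))//.
have -> : C * `|h| `^ a = K * `|h| `^ a + (18 * B0 * c `^ (a' - 1) * `|h| `^ a + 4 / tau * c ^- 2 * `|h| `^ a).
  by rewrite /C; ring.
rewrite lerD//; first by rewrite (le_trans Hh)// ler_wpM2l.
by rewrite (le_trans (normcB _ _))// lerD.
Qed.

Lemma holder_zero (w a : R) : e w != 1 -> 1 <= a -> a < 3 / 2 -> holder_at (riemann_fun w) 0 a.
Proof.
move=> w1 a1 a2.
have JN (i j k : nat) : (i <= (i + j + k).+2)%N /\ (j <= (i + j + k).+2)%N by lia.
have w1' : e (- w) != 1.
  apply: contra_neq w1 => E; by rewrite -[LHS]mul1r -[X in X * _]E mulrC eK.
have [c1 [C1 [d1 [C10 d10 d11 H1]]]] := one_sided_zero w1 a1 a2.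
have [c2 [C2 [d2 [C20 d20 d21 H2]]]] := one_sided_zero w1' a1 a2.
apply: (@holder_intro R _ 0 a (riemann_fun w 0) (c1 + c2) (C1 + C2 + 8) (minr d1 d2)).
- lra.
- by right.
- by rewrite lt_min d10.
move=> h; rewrite lt_min => /andP[hd1 hd2]; rewrite add0r.
have [->|hn0] := eqVneq h 0.
  by rewrite subrr mulr0 subr0 normc0 mulr_ge0 ?powR_ge0// !addr_ge0.
have h0 : 0 < `|h| by rewrite normr_gt0.
have [J1 {}H1] := H1 h hn0 hd1; have [J2 {}H2] := H2 h hn0 hd2.
have p0 : 0 < `|h| `^ a by rewrite powR_gt0.
pose N := (J1 + J2 + truncn (`|h| `^ a)^-1).+1.
have N0 : (0 < N)%N by [].
have A1 := riemann_fun_approx w h N0; have A0 := riemann_fun_approx w 0 N0.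
have Nb : N%:R^-1 <= `|h| `^ a.
  rewrite -[leRHS]invrK lef_pV2 ?posrE ?invr_gt0// ltW// (lt_le_trans (truncnS_gt _))//.
  by rewrite ler_nat /N ltnS leq_addl.
have {}H1 := H1 N.+1 (JN _ _ _).1; have {}H2 := H2 N.+1 (JN _ _ _).2.
have D x : \sum_(1 <= n < N.+1) (n%:R ^- 2)%:C * (ee x h n - ee x 0 n) =
  \sum_(1 <= n < N.+1) (n%:R ^- 2)%:C * ee x h n - \sum_(1 <= n < N.+1) (n%:R ^- 2)%:C * ee x 0 n.
  by rewrite -sumrB; apply: eq_bigr => n _; rewrite mulrBr.
rewrite !D in H1 H2.
set F := riemann_fun w h in A1 *; set F0 := riemann_fun w 0 in A0 *.
have -> : F - F0 - (c1 + c2) * h%:C = (F - rpart w h N) - (F0 - rpart w 0 N) +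
  ((rpart w h N - rpart w 0 N) - (c1 + c2) * h%:C) by ring.
rewrite (le_trans (le_normcD _ _))// addrC.
have -> : (C1 + C2 + 8) * `|h| `^ a = (C1 * `|h| `^ a + C2 * `|h| `^ a) + 8 * `|h| `^ a by ring.
rewrite lerD//; last first.
  by rewrite (le_trans (normcB _ _))//; move: A1 A0 Nb; clear; lra.
rewrite !rpartE_nat.
set s1 := \sum_(1 <= n < _) _ in H1 *; set s2 := \sum_(1 <= n < _) _ in H1 *.
set s3 := \sum_(1 <= n < _) _ in H2 *; set s4 := \sum_(1 <= n < _) _ in H2 *.
have -> : s1 + s3 - (s2 + s4) - (c1 + c2) * h%:C = (s1 - s2 - c1 * h%:C) + (s3 - s4 - c2 * h%:C) by ring.
by rewrite (le_trans (le_normcD _ _))// lerD.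
Qed.

End ZeroRegular.

(** * Windows of squares *)

Fixpoint ceil_sqrt (s : nat) : nat :=
  if s is s'.+1 then (if (ceil_sqrt s' ^ 2 < s)%N then (ceil_sqrt s').+1 else ceil_sqrt s') else 0%N.

(** In this form a condition s <= n^2 < s + L becomes an interval of n. *)
Lemma ceil_sqrtP s n : (n < ceil_sqrt s)%N = (n ^ 2 < s)%N.
Proof.
elim: s n => [|s IH] n //=.
have c1 : (s <= ceil_sqrt s ^ 2)%N by rewrite leqNgt -IH ltnn.
case: ifPn => H; last first.
  rewrite IH ltnS [RHS]leq_eqVlt; case: eqP => //= E.
  move: H; rewrite -leqNgt -E ltn_exp2r// => H.
  by move: H; rewrite E IH E ltnn.
rewrite ltnS leq_eqVlt IH ltnS [RHS]leq_eqVlt; congr orb.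
have E : (ceil_sqrt s ^ 2 = s)%N by apply/eqP; rewrite eqn_leq c1 andbT -ltnS.
by rewrite -[in RHS]E eqn_exp2r.
Qed.

Section LowerBound.
Variable R : realType.
Implicit Types (x y h t a b c s r tau : R) (z w : R[i]).

(** The maximum with 1 excludes n = 0, since the sums run over n = k + 1. *)
Lemma sum_indicator (F : nat -> R[i]) (s L J : nat) : (s + L <= J)%N ->
  \sum_(i < L) \sum_(k < J) (k.+1 ^ 2 == s + i)%N%:R * F k.+1 =
  \sum_(maxn 1 (ceil_sqrt s) <= n < ceil_sqrt (s + L)) F n.
Proof.
move=> sJ; rewrite exchange_big /=.
have cJ : (ceil_sqrt (s + L) <= J.+1)%N.
  rewrite leqNgt ceil_sqrtP -leqNgt (leq_trans sJ)// -[X in (X <= _)%N]expn1.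
  by rewrite (leq_trans (leqnSn _))// expn1 -{1}[J.+1]expn1 leq_pexp2l.
rewrite (big_nat_widen _ _ J.+1)// (big_nat_widenl _ 1) ?leq_maxl//.
rewrite big_mkcond /= big_add1 /= big_mkord; apply: eq_bigr => k _.
rewrite -mulr_suml.
have -> : (ceil_sqrt (s + L) > k.+1)%N && (maxn 1 (ceil_sqrt s) <= k.+1)%N = (s <= k.+1 ^ 2 < s + L)%N.
  by rewrite ceil_sqrtP andbC geq_max /= [(ceil_sqrt s <= _)%N]leqNgt ceil_sqrtP -leqNgt.
case: ifPn => [/andP[h1 h2]|H].
  have iL : (k.+1 ^ 2 - s < L)%N by rewrite ltn_subLR.
  rewrite (bigD1 (Ordinal iL)) //= subnKC// eqxx big1 ?addr0 ?mul1r// => j jn.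
  case: eqP => // E; case/negP: jn; apply/eqP/val_inj => /=; rewrite E; lia.
rewrite big1 ?mul0r// => j _; case: eqP => // E; case/negP: H.
by rewrite E leq_addr ltn_add2l ltn_ord.
Qed.

Lemma sqrt_window (s L : nat) : (s <= 3 * L)%N -> (0 < L)%N ->
  sqrtr L%:R / 4 - 1 <= (ceil_sqrt (s + L) - maxn 1 (ceil_sqrt s))%N%:R :> R /\
  (maxn 1 (ceil_sqrt s) <= ceil_sqrt (s + L))%N.
Proof.
move=> sL L0.
have u2 : (s + L <= ceil_sqrt (s + L) ^ 2)%N by rewrite leqNgt -ceil_sqrtP ltnn.
set u := ceil_sqrt (s + L) in u2 *.
have v2 : ((maxn 1 (ceil_sqrt s)).-1 ^ 2 <= s)%N.
  case: (ceil_sqrt s) (ceil_sqrtP s) => [|c'] H; first by rewrite maxn0.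
  have -> : maxn 1 c'.+1 = c'.+1 by apply/maxn_idPr.
  by rewrite ltnW// -H /=.
have m0 : (0 < maxn 1 (ceil_sqrt s))%N by rewrite leq_max.
set v := (maxn 1 (ceil_sqrt s)).-1 in v2.
have vE : maxn 1 (ceil_sqrt s) = v.+1 by rewrite prednK.
rewrite vE.
have vu : (v < u)%N by rewrite -ltn_sqr (leq_ltn_trans v2)// (leq_trans _ u2)//; lia.
split => //; rewrite natrB// -[v.+1%:R]natr1.
have := sqrtr_ge0 (L%:R : R); have := @sqr_sqrtr R L%:R (ler0n _ _).
set r := sqrtr _ => r2 r0.
have u2' : s%:R + L%:R <= u%:R ^+ 2 :> R by rewrite -natrD -natrX ler_nat.
have v2' : v%:R ^+ 2 <= s%:R :> R by rewrite -natrX ler_nat.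
have s3 : s%:R <= 3 * L%:R :> R by rewrite -natrM ler_nat.
have u0 : 0 <= u%:R :> R by []. have v0 : 0 <= v%:R :> R by [].
rewrite -r2 in u2' s3.
(* 7/4 exceeds the square root of 3; and since 7/8 + 1/16 < 1, u < v + r/4 would force u^2 < s +
   L. *)
have v7 : v%:R <= 7 / 4 * r.
  rewrite -(ler_sqr (R := R)) ?nnegrE ?mulr_ge0//.
  have := sqr_ge0 r; move: v2' s3; clear; nra.
suff : r / 4 <= u%:R - v%:R by clear; lra.
rewrite leNgt; apply/negP => H.
have {H} : (u%:R : R) < v%:R + r / 4 by move: H; clear; lra.
rewrite -(ltr_sqr (R := R)) ?nnegrE ?addr_ge0 ?divr_ge0// => H.
have r0' : 0 < r by rewrite sqrtr_gt0 ltr0n.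
have : v%:R * r <= 7 / 4 * r ^+ 2 by rewrite expr2 mulrA ler_wpM2r.
have : 0 < r ^+ 2 by rewrite exprn_gt0.
have E : (v%:R + r / 4) ^+ 2 = v%:R ^+ 2 + v%:R * r / 2 + r ^+ 2 / 16 by field.
rewrite E in H.
by move: H u2' v2' s3; clear; lra.
Qed.

(** Each of the L^3 windows is a difference of two partial sums, hence its length times g up to 2B;
    by [sqrt_window] that length is at least sqrt L/4 - 1. *)
Lemma window_sum_lower x0 t (L J : nat) (g : R[i]) (B : R) : (0 < L)%N -> (4 * L <= J)%N ->
  (forall m : nat, (0 < m)%N -> (m.-1 ^ 2 < 4 * L)%N ->
     normc (\sum_(1 <= n < m) gg x0 t n - m.-1%:R * g) <= B) ->
  L%:R ^+ 3 * (normc g * (sqrtr L%:R / 4 - 1) - 2 * B) <= normc (window_sum x0 t L J).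
Proof.
move=> L0 LJ H.
pose lo (j : 'I_L * 'I_L * 'I_L) := maxn 1 (ceil_sqrt (j.1.1 + j.1.2 + j.2)).
pose hi (j : 'I_L * 'I_L * 'I_L) := ceil_sqrt (j.1.1 + j.1.2 + j.2 + L).
have E : window_sum x0 t L J = \sum_j \sum_(lo j <= n < hi j) gg x0 t n.
  rewrite /window_sum big_quad pair_bigA pair_bigA /=; apply: eq_bigr => -[[i1 i2] i3] _ /=.
  rewrite /lo /hi /= -(@sum_indicator _ _ _ J)//.
  have := ltn_ord i1; have := ltn_ord i2; have := ltn_ord i3; lia.
have W j : sqrtr L%:R / 4 - 1 <= (hi j - lo j)%N%:R :> R /\ (lo j <= hi j)%N.
  apply: sqrt_window => //.
  have := ltn_ord j.1.1; have := ltn_ord j.1.2; have := ltn_ord j.2; lia.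
have D j : normc ((hi j - lo j)%N%:R * g - \sum_(lo j <= n < hi j) gg x0 t n) <= 2 * B.
  have [_ lh] := W j.
  have lo0 : (0 < lo j)%N by rewrite leq_max.
  have hi0 : (0 < hi j)%N by exact: leq_trans lh.
  have hi4 : ((hi j).-1 ^ 2 < 4 * L)%N.
    have : ((hi j).-1 < hi j)%N by rewrite prednK.
    rewrite {2}/hi ceil_sqrtP.
    have := ltn_ord j.1.1; have := ltn_ord j.1.2; have := ltn_ord j.2; lia.
  have lo4 : ((lo j).-1 ^ 2 < 4 * L)%N.
    rewrite (leq_ltn_trans _ hi4)// leq_sqr; move: lh; clear.
    by case: (lo j) (hi j) => [|?] [].
  have := lerD (H _ hi0 hi4) (H _ lo0 lo4).
  have := normcB (\sum_(1 <= n < lo j) gg x0 t n - (lo j).-1%:R * g) (\sum_(1 <= n < hi j) gg x0 t n - (hi j).-1%:R * g).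
  have -> : (hi j - lo j)%N%:R = (hi j).-1%:R - (lo j).-1%:R :> R[i].
    by rewrite -natrB; [congr _%:R|]; move: lo0 lh; clear; case: (lo j) (hi j) => [|m] [|n]//= _; rewrite ?subSS.
  rewrite (big_cat_nat (n := lo j) (p := hi j))//=.
  set s1 := \sum_(1 <= n < lo j) _; set s2 := \sum_(lo j <= n < _) _.
  have -> : s1 - (lo j).-1%:R * g - (s1 + s2 - (hi j).-1%:R * g) = ((hi j).-1%:R - (lo j).-1%:R) * g - s2 by ring.
  by clear; lra.
have card : \sum_(j : 'I_L * 'I_L * 'I_L) (1 : R) = L%:R ^+ 3.
  by rewrite sumr_const !card_prod !card_ord -natrX; congr _%:R; rewrite !expnS; lia.
pose N : R := \sum_j (hi j - lo j)%N%:R.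
have NL : L%:R ^+ 3 * (sqrtr L%:R / 4 - 1) <= N.
  rewrite -card mulr_suml; apply: ler_sum => j _; rewrite mul1r; exact: (W j).1.
have ND : normc (N%:C * g - window_sum x0 t L J) <= L%:R ^+ 3 * (2 * B).
  rewrite E /N rmorph_sum mulr_suml -sumrB (le_trans (normc_sum _ _ _))// -card mulr_suml.
  by apply: ler_sum => j _; rewrite mul1r rmorph_nat.
have N0 : 0 <= N by apply: sumr_ge0.
have := normc_subr_ge (N%:C * g) (N%:C * g - window_sum x0 t L J).
rewrite subKr normcZ (ger0_norm N0).
have : normc g * (L%:R ^+ 3 * (sqrtr L%:R / 4 - 1)) <= normc g * N by rewrite ler_wpM2l ?normc_ge0.
have -> : L%:R ^+ 3 * (normc g * (sqrtr L%:R / 4 - 1) - 2 * B) =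
  normc g * (L%:R ^+ 3 * (sqrtr L%:R / 4 - 1)) - L%:R ^+ 3 * (2 * B) by ring.
by move: ND; rewrite [N * normc g]mulrC; clear; lra.
Qed.

(** Every upper bound for an exponent comes from contradicting this inequality, whose left side
    grows like |g| sqrt L. *)
Lemma window_sum_key x0 t a : 0 < a -> a <= 2 -> affine_holder (riemann_fun x0) t a ->
  exists2 C : R, 0 < C & forall h0 (L : nat) (g : R[i]) (B : R), (0 < L)%N ->
  (forall m : nat, (0 < m)%N -> (m.-1 ^ 2 < 4 * L)%N ->
     normc (\sum_(1 <= n < m) gg x0 (t + h0) n - m.-1%:R * g) <= B) ->
  normc g * (sqrtr L%:R / 4 - 1) - 2 * B <= C * L%:R * (`|h0| `^ a + L%:R `^ (- a)).
Proof.
move=> a0 a2 /(window_sum_le a0 a2)[C [C0 H]]; exists C => // h0 L g B L0 HB.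
have [J [LJ HJ]] := H h0 L L0.
have := le_trans (window_sum_lower L0 LJ HB) HJ.
have L3 : (0 : R) < L%:R ^+ 3 by rewrite exprn_gt0 ?ltr0n.
have -> : C * L%:R ^+ 4 * (`|h0| `^ a + L%:R `^ (- a)) = L%:R ^+ 3 * (C * L%:R * (`|h0| `^ a + L%:R `^ (- a))) by ring.
by rewrite ler_pM2l.
Qed.

End LowerBound.

(** * Gauss sums *)

Section Periodic.
Variable R : realType.
Implicit Types (x y h t a b c s r tau : R) (z w : R[i]).

Lemma periodic_mod (T : Type) (d : nat -> T) (q n : nat) :
  (forall n, d (n + q)%N = d n) -> d (n %% q)%N = d n.
Proof.
move=> per; rewrite {2}(divn_eq n q); elim: (n %/ q)%N => [|k IH]; first by rewrite mul0n.
by rewrite mulSn -addnA addnC per.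
Qed.

Lemma sum_periodic_shift (d : nat -> R[i]) (q j : nat) :
  (forall n, d (n + q)%N = d n) ->
  \sum_(0 <= n < q) d (n + j)%N = \sum_(0 <= n < q) d n.
Proof.
move=> per; elim: j => [|j IH]; first by apply: eq_bigr => n _; rewrite addn0.
rewrite -[RHS]IH; case: q per {IH} => [|q] per; first by rewrite !big_geq.
rewrite big_nat_recr//= [RHS]big_nat_recl//= add0n addrC.
congr (_ + _); first by rewrite addnS -addSn addnC per.
by apply: eq_bigr => n _; rewrite addnS addSn.
Qed.

Lemma sum_periodic (d : nat -> R[i]) (q m : nat) :
  (forall n, d (n + q)%N = d n) -> \sum_(0 <= n < q) d n = 0 ->
  \sum_(0 <= n < m) d n = \sum_(0 <= n < m %% q) d n.
Proof.
move=> per z; rewrite {1}(divn_eq m q) addnC.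
elim: (m %/ q)%N => [|k IH]; first by rewrite mul0n addn0.
rewrite mulSn addnCA addnC (big_cat_nat (n := (m %% q + k * q)%N)) ?leq_addr//= IH.
set M := (m %% q + k * q)%N.
have -> : \sum_(M <= i < M + q) d i = \sum_(0 <= i < q) d (i + M)%N.
  by rewrite -{1}[M]add0n big_addn addKn.
by rewrite (sum_periodic_shift _ per) z addr0.
Qed.

Lemma e_frac_neq1 x : 0 < x -> x < 1 -> e x != 1.
Proof.
move=> x0 x1; apply/eqP => E; have := normc_e1E x; rewrite E subrr normc0 => /esym/eqP.
rewrite mulf_eq0 pnatr_eq0/= normr_eq0 gt_eqF// sin_gt0_pi//.
by rewrite mulr_gt0 ?pi_gt0//= -[ltRHS]mulr1 ltr_pM2l ?pi_gt0.
Qed.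

Lemma e_int_frac (k : int) (q : nat) : (0 < q)%N ->
  e (k%:~R / q%:R : R) = e ((`|(k %% q)%Z|%N)%:R / q%:R).
Proof.
move=> q0; have qn0 : (q%:R : R) != 0 by rewrite pnatr_eq0 -lt0n.
rewrite {1}(divz_eq k q) intrD intrM mulrDl mulfK// addrC eDint; congr (e (_ / _)).
have : (0 <= k %% q)%Z by rewrite modz_ge0// -lt0n.
by move=> H; rewrite -[in LHS](gez0_abs H).
Qed.

Lemma e_int_frac_eq1 (k : int) (q : nat) : (0 < q)%N ->
  (e (k%:~R / q%:R : R) == 1) = (q %| k)%Z.
Proof.
move=> q0; rewrite e_int_frac//; apply/eqP/idP => [|/dvdz_mod0P ->]; last first.
  by rewrite absz0 mul0r e0.
move=> E; apply/dvdz_mod0P/eqP; apply: contra_eqT E => kn0.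
have r0 : (0 < `|(k %% q)%Z|)%N by rewrite absz_gt0.
apply: e_frac_neq1; first by rewrite divr_gt0 ?ltr0n.
rewrite ltr_pdivrMr ?ltr0n// mul1r ltr_nat.
by rewrite -ltz_nat gez0_abs ?modz_ge0 ?ltz_mod// -lt0n.
Qed.

Lemma sum_e_int_frac (k : int) (q : nat) : (0 < q)%N ->
  \sum_(0 <= n < q) e (n%:R * (k%:~R / q%:R)) = if (q %| k)%Z then q%:R else 0 :> R[i].
Proof.
move=> q0; rewrite -e_int_frac_eq1//; set y := k%:~R / q%:R.
under eq_bigr do rewrite eMn.
case: eqP => [->|/eqP y1]; first by under eq_bigr do rewrite expr1n; rewrite sumr_const_nat subn0.
have y1' : e y - 1 != 0 by rewrite subr_eq0.
apply: (mulfI y1'); rewrite mulr0 big_mkord -subrX1 -eMn.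
have -> : q%:R * y = k%:~R by rewrite /y mulrC divfK// pnatr_eq0 -lt0n.
by rewrite e_int subrr.
Qed.

Lemma normc_sum_le (F : nat -> R[i]) (m n : nat) (K : R) : (forall k, normc (F k) <= K) ->
  normc (\sum_(m <= k < n) F k) <= (n - m)%N%:R * K.
Proof.
move=> H; rewrite (le_trans (normc_sum _ _ _))//.
apply: (@le_trans _ _ (\sum_(m <= k < n) K)); first exact: ler_sum.
by rewrite sumr_const_nat mulr_natl.
Qed.

(* The values [e (p n^2 / q + n m / q)], indexed by [n mod q]. *)
Definition gq (p m : int) (q n : nat) : R[i] := ee (m%:~R / q%:R) (p%:~R / q%:R) n.

Lemma gqE p m q n : gq p m q n = e ((p * n%:Z ^+ 2 + m * n%:Z)%:~R / q%:R).
Proof.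
by rewrite /gq /ee; congr e; rewrite expr2 intrD !intrM -!pmulrn; ring.
Qed.

Lemma gq_periodic p m q n : (0 < q)%N -> gq p m q (n + q)%N = gq p m q n.
Proof.
move=> q0; rewrite !gqE.
have qn0 : (q%:R : R) != 0 by rewrite pnatr_eq0 -lt0n.
rewrite -[RHS](eDint _ (p * (n%:Z *+ 2 + q%:Z) + m)); congr e.
rewrite PoszD -[X in _ = _ + X](mulfK qn0) -mulrDl; congr (_ / _).
rewrite [q%:R]pmulrn -intrM -intrD; congr (_%:~R).
rewrite -mulr_natr; ring.
Qed.

Definition gmean (p m : int) (q : nat) : R[i] := (\sum_(0 <= n < q) gq p m q n) / q%:R.

(** The reflection n -> q - n. It makes the means attached to x0 and to -x0 equal, so that in [gg]
    they add up instead of cancelling. *)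
Lemma gmean_opp p m q : (0 < q)%N -> gmean p (- m) q = gmean p m q.
Proof.
move=> q0; congr (_ / _).
have per n := gq_periodic p m n q0.
rewrite -(sum_periodic_shift 1 per) big_nat_rev /= add0n.
rewrite big_nat_cond [RHS]big_nat_cond; apply: eq_bigr => n; rewrite andbT => /andP[_ nq].
rewrite addn1 !gqE; have qn0 : (q%:R : R) != 0 by rewrite pnatr_eq0 -lt0n.
rewrite -[RHS](eDint _ (p * (q%:Z - n.+1%:Z *+ 2) - m)); congr e.
rewrite -[X in _ = _ + X](mulfK qn0) -mulrDl; congr (_ / _).
rewrite [q%:R]pmulrn -intrM -intrD; congr (_%:~R).
rewrite -subzn// -mulr_natr; ring.
Qed.

(** In the squared modulus the inner sum leaves only the k with q | 2k, namely 0 and q/2. The term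
    at q/2 equals 1 because 4 | q and m is even; for other q or m it may cancel the term at 0. *)
Lemma gauss_norm (p m : int) (q : nat) : (0 < q)%N -> (4 %| q)%N -> coprime `|p| q ->
  (2 %| m)%Z -> normc (gmean p m q) ^+ 2 = 2 / q%:R.
Proof.
move=> q0 q4 cop m2.
have qn0 : (q%:R : R) != 0 by rewrite pnatr_eq0 -lt0n.
have per n := gq_periodic p m n q0.
pose G := \sum_(0 <= n < q) gq p m q n.
suff E : normc G ^+ 2 = 2 * q%:R.
  by rewrite /gmean normcM exprMn -/G E normcV normc_nat; field.
apply: (@complexI R); rewrite normc_sqrE.
have -> : G * cj G = \sum_(0 <= k < q) gq p m q k * \sum_(0 <= n < q) e (n%:R * ((2 * p * k%:Z)%:~R / q%:R)).
  rewrite {2}/G cj_sum mulr_sumr.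
  transitivity (\sum_(0 <= n < q) \sum_(0 <= k < q) gq p m q k * e (n%:R * ((2 * p * k%:Z)%:~R / q%:R))).
    apply: eq_bigr => n _; rewrite /G -(sum_periodic_shift n per) mulr_suml.
    apply: eq_bigr => k _; rewrite !gqE -eN -!eD; congr e.
    rewrite PoszD !(intrD, intrM, exprS, expr0) -!pmulrn; ring.
  by rewrite exchange_big /=; apply: eq_bigr => k _; rewrite mulr_sumr.
have dv k : (q %| 2 * p * k%:Z)%Z = (q %| 2 * k)%N.
  by rewrite dvdzE /= !abszM /= mulnAC Gauss_dvdl// coprime_sym.
under eq_bigr => k _ do rewrite sum_e_int_frac// dv.
have [r qr] : exists r : nat, q = (4 * r)%N by exists (q %/ 4)%N; rewrite mulnC divnK.
have r0 : (0 < r)%N by move: q0; rewrite qr muln_gt0.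
rewrite big_mkord.
have k0 : (0 < q)%N by [].
have k1 : (2 * r < q)%N by rewrite qr ltn_pmul2r.
rewrite (bigD1 (Ordinal k0))//= muln0 dvdn0 (bigD1 (Ordinal k1))/=; last first.
  by rewrite -val_eqE /= muln_eq0 negb_or /= -lt0n.
have -> : (2 * (2 * r) = q)%N by rewrite qr mulnA.
rewrite dvdnn big1 ?addr0; last first.
  move=> k /andP[]; rewrite -!val_eqE /= => kn0 kn1.
  case: ifPn => [/dvdnP[l H]|_]; last by rewrite mulr0.
  exfalso; move: (nat_of_ord k) (ltn_ord k) H kn0 kn1 => {}k kq; rewrite qr => H kn0 kn1.
  rewrite qr in kq.
  have l2 : (l < 2)%N.
    rewrite ltnNge; apply/negP => l2.
    have : (2 * (4 * r) <= l * (4 * r))%N by rewrite leq_mul2r l2 orbT.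
    lia.
  by case: l l2 H => [|[|]]//= _; lia.
have g0 : gq p m q 0 = 1 by rewrite gqE -[in RHS]e0; congr e; rewrite expr0n !mulr0 mul0r.
have g1 : gq p m q (2 * r)%N = 1.
  rewrite gqE; apply/eqP; rewrite e_int_frac_eq1// qr.
  have /dvdzP[m' ->] := m2.
  apply/dvdzP; exists (p * r%:Z + m'); rewrite !PoszM; ring.
by rewrite g0 g1 !mul1r [RHS]rmorphM /= !rmorph_nat -mulr2n mulr_natl.
Qed.

Lemma gq_incomplete eps : 0 < eps -> exists2 C : R, 0 < C &
  forall (p m : int) (q r : nat), (0 < q)%N -> coprime `|p| q -> (r <= q)%N ->
  normc (\sum_(0 <= n < r) gq p m q n) <= C * q%:R `^ (1 / 2 + eps).
Proof.
move=> eps0; have [|C0 C00 HC0] := @Hsum_powR R (2 * eps); first by rewrite mulr_gt0.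
pose C := sqrtr (5 + 24 * C0).
have C_0 : 0 < C by rewrite sqrtr_gt0 addr_gt0// mulr_gt0.
exists C => // p m q r q0 cop rq.
have [->|r0] := posnP r; first by rewrite big_geq// normc0 mulr_ge0 ?powR_ge0 ?(ltW C_0).
have qp : (0 : R) < q%:R by rewrite ltr0n.
apply: normc_le_sqrt; first by rewrite addr_ge0// mulr_ge0// ltW.
have W := @weyl_near_int R (m%:~R / q%:R) (p%:~R / q%:R) p q r q0 r0 cop.
rewrite /gq; apply: le_trans (W _) _.
  by rewrite subrr normr0 divr_ge0// !mulr_ge0.
have rq' : r%:R <= q%:R :> R by rewrite ler_nat.
have r2 : r%:R ^+ 2 / q%:R <= q%:R :> R.
  by rewrite ler_pdivrMr// expr2 ler_pM.
have -> : q%:R `^ ((1 / 2 + eps) * 2) = q%:R * q%:R `^ (2 * eps) :> R.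
  rewrite -{2}[q%:R]powRr1 ?(ltW qp)// -powRD; last by rewrite (gt_eqF qp) implybT.
  by congr (_ `^ _); field.
have P1 : 1 <= q%:R `^ (2 * eps) :> R by rewrite one_le_powR ?ler1n// mulr_ge0// ltW.
have H := HC0 q q0; have Hs := @Hsum_ge0 R q.
have h1 : 8 * ((r * 2)%N%:R + q%:R) * Hsum R q <= 24 * q%:R * (C0 * q%:R `^ (2 * eps)).
  apply: ler_pM => //; rewrite natrM; move: rq'; clear; lra.
have h2 : q%:R <= q%:R * q%:R `^ (2 * eps) :> R by rewrite ler_peMr// ltW.
have -> : (5 + 24 * C0) * (q%:R * q%:R `^ (2 * eps)) = 5 * (q%:R * q%:R `^ (2 * eps)) + 24 * q%:R * (C0 * q%:R `^ (2 * eps)) by ring.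
by move: h1 h2 r2 rq'; clear; lra.
Qed.

(** Minus its mean the sequence has zero sum over a period, so only the last, incomplete period
    counts. *)
Lemma gq_partial eps : 0 < eps -> exists2 C : R, 0 < C &
  forall (p m : int) (q M : nat), (0 < q)%N -> coprime `|p| q ->
  normc (\sum_(0 <= n < M) gq p m q n - M%:R * gmean p m q) <= C * q%:R `^ (1 / 2 + eps).
Proof.
move=> /gq_incomplete[C C0 HC]; exists (C + C); first by rewrite addr_gt0.
move=> p m q M q0 cop.
have qn0 : (q%:R : R[i]) != 0 by rewrite pnatr_eq0 -lt0n.
have Esub (n : nat) : \sum_(0 <= k < n) gq p m q k - n%:R * gmean p m q =
    \sum_(0 <= k < n) (gq p m q k - gmean p m q).
  by rewrite sumrB sumr_const_nat subn0 mulr_natl.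
rewrite Esub (@sum_periodic _ q)//; last 2 first.
- by move=> n; rewrite gq_periodic.
- by rewrite -Esub /gmean mulrC divfK// subrr.
rewrite -Esub (le_trans (normcB _ _))// mulrDl lerD//.
  by apply: HC => //; rewrite ltnW// ltn_pmod.
rewrite /gmean mulrCA normcM (le_trans _ (HC p m q q q0 cop (leqnn _)))//.
rewrite ler_piMr ?normc_ge0// normcM normcV !normc_nat ler_pdivrMr ?ltr0n// mul1r ler_nat.
by rewrite ltnW// ltn_pmod.
Qed.

Lemma gmean_le1 p m q : (0 < q)%N -> normc (gmean p m q) <= 1.
Proof.
move=> q0; rewrite normcM normcV normc_nat ler_pdivrMr ?ltr0n// mul1r.
have := @normc_sum_le (gq p m q) 0 q 1; rewrite subn0 mulr1; apply.
by move=> k; rewrite normc_ee.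
Qed.

(** Summation by parts against e(n de), with n up to 3s. The closeness 1/4800 makes 48 s |de| at
    most 1/100, so that replacing x0 by m/q loses only 3/100 of s |g|. *)
Lemma ee_near_frac x0 (p m : int) (q M : nat) (B s : R) : (0 < q)%N -> 1 <= s ->
  `|x0 - m%:~R / q%:R| * s <= 1 / 4800 -> 0 <= B ->
  (forall k, normc (\sum_(0 <= n < k) gq p m q n - k%:R * gmean p m q) <= B) ->
  (0 < M)%N -> M%:R <= 3 * s ->
  normc (\sum_(1 <= n < M) ee x0 (p%:~R / q%:R) n - M.-1%:R * gmean p m q) <=
   3 / 100 * s * normc (gmean p m q) + 2 * B + 2.
Proof.
move=> q0 s1 ds B0 HB M0 Ms.
set de := x0 - _ in ds; set g := gmean p m q in HB *.
have E n : ee x0 (p%:~R / q%:R) n = e (n%:R * de) * gq p m q n.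
  by rewrite /gq /ee -eD; congr e; rewrite /de; ring.
pose A k := \sum_(0 <= j < k) gq p m q j.
have Ale k : (k <= M)%N -> normc (A k) <= 3 * s * normc g + B.
  move=> kM; have -> : A k = k%:R * g + (A k - k%:R * g) by ring.
  rewrite (le_trans (le_normcD _ _))// lerD ?HB// normcM normc_nat.
  by apply: ler_wpM2r; rewrite ?normc_ge0// (le_trans _ Ms)// ler_nat.
have A1 : normc (\sum_(0 <= n < M) ee x0 (p%:~R / q%:R) n - A M) <= 16 * M%:R * `|de| * (3 * s * normc g + B).
  under eq_bigr do rewrite E.
  have := @abel_id R 0 M (fun n => e (n%:R * de)) (gq p m q) (leq0n M); rewrite /= -/(A M).
  rewrite (big_geq (leqnn 0)) mulr0 subr0 => ->.
  have -> : e (M%:R * de) * A M + \sum_(0 <= k < M) (e (k%:R * de) - e (k.+1%:R * de)) * A k.+1 - A M =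
    (e (M%:R * de) - 1) * A M + \sum_(0 <= k < M) (e (k%:R * de) - e (k.+1%:R * de)) * A k.+1 by ring.
  have K0 : 0 <= 3 * s * normc g + B by rewrite (le_trans (normc_ge0 _) (Ale _ (leqnn M))).
  have -> : 16 * M%:R * `|de| * (3 * s * normc g + B) = 8 * (M%:R * `|de|) * (3 * s * normc g + B)
    + M%:R * (8 * `|de| * (3 * s * normc g + B)) by ring.
  rewrite (le_trans (le_normcD _ _))// lerD//.
    rewrite normcM; apply: ler_pM; rewrite ?normc_ge0 ?Ale//.
    by rewrite (le_trans (normc_e1_le8 _))// normrM ger0_norm.
  rewrite (le_trans (normc_sum _ _ _))//.
  apply: (@le_trans _ _ (\sum_(0 <= k < M) 8 * `|de| * (3 * s * normc g + B))); last first.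
    by rewrite sumr_const_nat subn0 -[_ *+ M]mulr_natl.
  rewrite big_nat_cond [leRHS]big_nat_cond; apply: ler_sum => k; rewrite andbT => /andP[_ kM].
  rewrite normcM; apply: ler_pM; rewrite ?normc_ge0 ?Ale//.
  rewrite normc_distC normc_eB (le_trans (normc_e1_le8 _))//.
  by have -> : k.+1%:R * de - k%:R * de = de by rewrite -natr1; ring.
have g1 : normc g <= 1 := gmean_le1 p m q0.
have -> : \sum_(1 <= n < M) ee x0 (p%:~R / q%:R) n - M.-1%:R * g =
  (\sum_(0 <= n < M) ee x0 (p%:~R / q%:R) n - A M) + (A M - M%:R * g) + (g - 1).
  have -> : \sum_(0 <= n < M) ee x0 (p%:~R / q%:R) n = 1 + \sum_(1 <= n < M) ee x0 (p%:~R / q%:R) n.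
    by rewrite big_ltn//; congr (_ + _); rewrite /ee expr0n !mul0r addr0 e0.
  have -> : M%:R = M.-1%:R + 1 :> R[i] by rewrite natr1 prednK.
  ring.
rewrite (le_trans (le_normcD _ _))//; have := le_normcD (\sum_(0 <= n < M) ee x0 (p%:~R / q%:R) n - A M) (A M - M%:R * g).
have := HB M; rewrite -/(A M).
have := normcB g 1; rewrite normc1.
have : 16 * M%:R * `|de| * (3 * s * normc g + B) <= 1 / 100 * (3 * s * normc g + B).
  rewrite ler_wpM2r//; first by rewrite (le_trans (normc_ge0 _) (Ale _ (leqnn M))).
  have : M%:R * `|de| <= 3 * s * `|de| by rewrite ler_wpM2r.
  by move: ds; clear; lra.
by move: A1 B0 g1; clear; lra.
Qed.

(* When [4 %| q] and [m] is even, the Gauss sum of [p n^2 + m n] modulo [q] does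
   not vanish and has modulus [sqrt (2 q)]. *)
Definition nice (p m : int) (q : nat) : bool :=
  [&& (0 < q)%N, (4 %| q)%N, coprime `|p| q & (2 %| m)%Z].

(** By [gauss_norm] |g| is at least q^(-1/2), so [window_sum_key], applied at p/q in place of t,
    bounds sqrt L. The squares involved are below 4L, which keeps n in the range of [ee_near_frac]
    with s = sqrt L. *)
Lemma nice_bound x0 t a eps : 0 < a -> a <= 2 -> 0 < eps ->
  affine_holder (riemann_fun x0) t a -> exists2 C : R, 0 < C &
  forall (p m : int) (q L : nat), nice p m q -> (0 < L)%N ->
   `|x0 - m%:~R / q%:R| * sqrtr L%:R <= 1 / 4800 ->
   sqrtr L%:R <= q%:R `^ (1 / 2) * (C * q%:R `^ (1 / 2 + eps) +
     C * L%:R * (`|t - p%:~R / q%:R| `^ a + L%:R `^ (- a))).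
Proof.
move=> a0 a2 eps0 /(window_sum_key a0 a2)[C1 C10 H1].
have [C2 C20 H2] := gq_partial eps0.
pose C := 4 * C1 + 32 * C2 + 40.
have C_0 : 0 < C by rewrite /C !addr_gt0 ?mulr_gt0.
exists C => // p m q L /and4P[q0 q4 cop m2] L0 dL.
set s := sqrtr L%:R in dL *.
have qp : (0 : R) < q%:R by rewrite ltr0n.
have s1 : 1 <= s by rewrite -sqrtr1 ler_sqrt ?ler1n.
pose B := C2 * q%:R `^ (1 / 2 + eps).
have B0 : 0 <= B by rewrite mulr_ge0 ?powR_ge0 ?ltW.
set g := gmean p m q.
have m2' : (2 %| - m)%Z by rewrite dvdzE abszN -dvdzE.
have := H1 (p%:~R / q%:R - t) L (2 * g) (2 * (3 / 100 * s * normc g + 2 * B + 2)) L0.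
have -> : t + (p%:~R / q%:R - t) = p%:~R / q%:R by ring.
have N1 : forall M : nat, (0 < M)%N -> (M.-1 ^ 2 < 4 * L)%N ->
     normc (\sum_(1 <= n < M) gg x0 (p%:~R / q%:R) n - M.-1%:R * (2 * g)) <= 2 * (3 / 100 * s * normc g + 2 * B + 2).
  move=> M M0 ML.
  have Ms : M%:R <= 3 * s.
    have : M.-1%:R ^+ 2 <= (2 * s) ^+ 2.
      by rewrite exprMn sqr_sqrtr// -!natrX -natrM ler_nat ltnW.
    rewrite ler_sqr ?nnegrE ?mulr_ge0 ?sqrtr_ge0// => h.
    have -> : M%:R = M.-1%:R + 1 :> R by rewrite natr1 prednK.
    by move: h s1; clear; lra.
  have a1 := @ee_near_frac x0 p m q M B s q0 s1 dL B0 (fun k => H2 p m q k q0 cop) M0 Ms.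
  have := @ee_near_frac (- x0) p (- m) q M B s q0 s1 _ B0 (fun k => H2 p (- m) q k q0 cop) M0 Ms.
  rewrite gmean_opp// -/g rmorphN /= mulNr -opprD normrN => /(_ dL) a2'.
  have -> : \sum_(1 <= n < M) gg x0 (p%:~R / q%:R) n - M.-1%:R * (2 * g) =
   (\sum_(1 <= n < M) ee x0 (p%:~R / q%:R) n - M.-1%:R * g) + (\sum_(1 <= n < M) ee (- x0) (p%:~R / q%:R) n - M.-1%:R * g).
    rewrite /gg big_split /=; ring.
  by rewrite (le_trans (le_normcD _ _))//; move: a1 a2'; rewrite -/g; clear; lra.
move=> /(_ N1).
have -> : `|p%:~R / q%:R - t| = `|t - p%:~R / q%:R| by rewrite distrC.
set Z := `|_| `^ a + _.
have Z0 : 0 <= Z by rewrite addr_ge0 ?powR_ge0.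
have ng : q%:R `^ (- (1 / 2)) <= normc g.
  rewrite -(ler_sqr (R := R)) ?nnegrE ?normc_ge0 ?powR_ge0// gauss_norm//.
  rewrite -powR_mulrn ?powR_ge0// -powRrM.
  have -> : - (1 / 2) * 2%:R = -1 :> R by field.
  rewrite powR_inv1 ?(ltW qp)// ler_peMl ?invr_ge0//.
  by rewrite ler1n.
have g1 : normc g <= 1 := gmean_le1 p m q0.
rewrite normcM normc_nat => H.
(* The main term is s |g|/2, of which the replacement of x0 by m/q takes 12/100 s |g|. *)
have K : s * normc g <= 4 * C1 * L%:R * Z + 32 * B + 40.
  have X0 : 0 <= C1 * L%:R * Z by rewrite !mulr_ge0 ?(ltW C10).
  by move: H B0 g1 X0 (mulr_ge0 (le_trans ler01 s1) (normc_ge0 g)); rewrite -/s; clear; lra.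
have Q1 : 1 <= q%:R `^ (1 / 2 + eps).
  by rewrite one_le_powR ?ler1n// addr_ge0// ltW.
rewrite -ler_pdivrMl ?powR_gt0// -powRN.
apply: (@le_trans _ _ (s * normc g)).
  by rewrite mulrC ler_wpM2l// sqrtr_ge0.
apply: (le_trans K).
rewrite /C /B.
have LZ : 0 <= L%:R * Z by rewrite mulr_ge0.
have p2 : 0 <= (32 * C2 + 40) * (L%:R * Z) by rewrite mulr_ge0// addr_ge0 ?mulr_ge0 ?ltW.
have p3 : 0 <= 4 * C1 * q%:R `^ (1 / 2 + eps) by rewrite !mulr_ge0 ?powR_ge0 ?ltW.
have -> : (4 * C1 + 32 * C2 + 40) * q%:R `^ (1 / 2 + eps) + (4 * C1 + 32 * C2 + 40) * L%:R * Z =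
  4 * C1 * q%:R `^ (1 / 2 + eps) + 32 * (C2 * q%:R `^ (1 / 2 + eps)) + 40 * q%:R `^ (1 / 2 + eps) +
  (4 * C1 * L%:R * Z + (32 * C2 + 40) * (L%:R * Z)) by ring.
by move: p2 p3 Q1; clear; lra.
Qed.

(** L is taken about q^la. In [nice_bound] the left side then has the exponent la/2 in q, the right
    side 1 + eps, 1/2 + la - mu a and 1/2 + la - la a; the three hypotheses on la make each of them
    smaller. As sqrt L <= 2 q^(la/2), the constant 4800 becomes 9600. *)
Lemma nice_not_holder x0 t a (la mu K : R) : 0 < a -> a <= 2 -> 2 < la ->
  1 < la * (2 * a - 1) -> la < 2 * mu * a - 1 -> 0 <= K ->
  (forall Q0 : nat, exists (p m : int) (q : nat), [/\ nice p m q, (Q0 <= q)%N,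
     `|t - p%:~R / q%:R| <= K * q%:R `^ (- mu) &
     `|x0 - m%:~R / q%:R| * q%:R `^ (la / 2) <= 1 / 9600]) ->
  ~ affine_holder (riemann_fun x0) t a.
Proof.
move=> a0 a2 la2 la1 lamu K0 H hold.
pose eps := (la - 2) / 4.
have eps0 : 0 < eps by rewrite divr_gt0// subr_gt0.
have [C C0 HC] := nice_bound a0 a2 eps0 hold.
(* Every exponent on the right is at most la/2 - d, and q^d exceeds the constants once q is
   large. *)
pose d := minr eps (minr ((la * (2 * a - 1) - 1) / 2) ((2 * mu * a - 1 - la) / 2)).
have d0 : 0 < d by rewrite !lt_min !divr_gt0 ?subr_gt0.
pose C' := C + 2 * C * (K `^ a + 1).
have C'0 : 0 < C' by rewrite /C' addr_gt0// !mulr_gt0// ltr_wpDl ?powR_ge0.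
have [p [m [q [nc Qq tq xq]]]] := H (truncn (C' `^ d^-1)).+1.
have /and4P[q0 _ _ _] := nc.
have qp : (0 : R) < q%:R by rewrite ltr0n.
have q1 : (1 : R) <= q%:R by rewrite ler1n.
have qC : C' < q%:R `^ d.
  have : C' `^ d^-1 < q%:R.
    by rewrite (lt_le_trans (truncnS_gt _))// ler_nat.
  move=> /(@gt0_ltr_powR R d d0 _ _) ; rewrite !nnegrE powR_ge0 => /(_ isT (ltW qp)).
  by rewrite -powRrM mulVf ?gt_eqF// powRr1// ltW.
pose P b := q%:R `^ b : R.
have P0 b : 0 < P b by rewrite powR_gt0.
have PD b c : P (b + c) = P b * P c by rewrite /P powRD// (gt_eqF qp) implybT.
have Ple b c : b <= c -> P b <= P c by move=> bc; rewrite /P ler_powR.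
pose L := (truncn (P la)).+1.
have L1 : P la < L%:R by exact: truncnS_gt.
have L2 : L%:R <= 2 * P la.
  have : 1 <= P la by rewrite /P one_le_powR//; move: la2; clear; lra.
  have : (truncn (P la))%:R <= P la by rewrite truncn_le// ltW.
  by rewrite /L -[X in _ -> _ -> X <= _]natr1; clear; lra.
have Lp : (0 : R) < L%:R by rewrite ltr0n.
have sL1 : P (la / 2) <= sqrtr L%:R.
  rewrite -(ler_sqr (R := R)) ?nnegrE ?sqrtr_ge0 ?(ltW (P0 _))// sqr_sqrtr// expr2 -PD.
  have -> : la / 2 + la / 2 = la by field.
  exact: ltW.
have sL2 : sqrtr L%:R <= 2 * P (la / 2).
  rewrite -(ler_sqr (R := R)) ?nnegrE ?sqrtr_ge0 ?mulr_ge0 ?(ltW (P0 _))// sqr_sqrtr// exprMn [P _ ^+ 2]expr2 -PD.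
  have -> : la / 2 + la / 2 = la by field.
  by move: L2 (P0 la); clear; lra.
have dL : `|x0 - m%:~R / q%:R| * sqrtr L%:R <= 1 / 4800.
  apply: (@le_trans _ _ (`|x0 - m%:~R / q%:R| * (2 * P (la / 2)))); first by rewrite ler_wpM2l.
  by move: xq; rewrite -/(P _) mulrCA; clear; lra.
have := le_trans sL1 (HC p m q L nc isT dL).
have Z1 : `|t - p%:~R / q%:R| `^ a <= K `^ a * P (- mu * a).
  rewrite /P powRrM -powRM ?powR_ge0//.
  by apply: ge0_ler_powR; rewrite ?nnegrE ?mulr_ge0 ?powR_ge0 ?(ltW a0).
have Z2 : L%:R `^ (- a) <= P (- la * a).
  rewrite mulNr /P powRN powRN powRrM lef_pV2 ?posrE ?powR_gt0//.
  by apply: ge0_ler_powR; rewrite ?nnegrE ?powR_ge0 ?(ltW a0) ?(ltW L1) ?(ltW Lp).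
set Z := `|_| `^ a + _.
have ZZ : Z <= K `^ a * P (- mu * a) + P (- la * a) by exact: lerD.
have Z0 : 0 <= Z by rewrite addr_ge0 ?powR_ge0.
move=> HH.
have {HH} : P (la / 2) <= C * P (1 + eps) + 2 * C * (K `^ a * P (1 / 2 + la - mu * a) + P (1 / 2 + la - la * a)).
  apply: (le_trans HH); rewrite mulrDr lerD//.
    rewrite -/(P _) -/(P _) mulrCA -PD.
    by have -> : 1 / 2 + (1 / 2 + eps) = 1 + eps by field.
  rewrite -/(P _).
  apply: (@le_trans _ _ (P (1 / 2) * (C * (2 * P la) * (K `^ a * P (- mu * a) + P (- la * a))))).
    rewrite ler_wpM2l ?(ltW (P0 _))//; apply: ler_pM => //.
      by rewrite mulr_ge0 ?(ltW C0) ?(ltW Lp).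
    by rewrite ler_wpM2l ?(ltW C0).
  have -> : 1 / 2 + la - mu * a = 1 / 2 + (la + - mu * a) by ring.
  have -> : 1 / 2 + la - la * a = 1 / 2 + (la + - la * a) by ring.
  by rewrite !PD le_eqVlt; apply/orP; left; apply/eqP; ring.
have := Ple (1 + eps) (la / 2 - d).
have := Ple (1 / 2 + la - mu * a) (la / 2 - d).
have := Ple (1 / 2 + la - la * a) (la / 2 - d).
have d1 : d <= eps by rewrite /d ge_min lexx.
have d2 : d <= (la * (2 * a - 1) - 1) / 2 by rewrite /d !ge_min lexx orbT.
have d3 : d <= (2 * mu * a - 1 - la) / 2 by rewrite /d !ge_min lexx !orbT.
have i1 : 1 + eps <= la / 2 - d by move: d1; rewrite /eps; clear; lra.
have i2 : 1 / 2 + la - mu * a <= la / 2 - d by move: d3; clear; lra.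
have i3 : 1 / 2 + la - la * a <= la / 2 - d by move: d2; clear; lra.
move=> /(_ i3) j3 /(_ i2) j2 /(_ i1) j1.
have E : P (la / 2) = P (la / 2 - d) * P d by rewrite -PD; congr P; ring.
rewrite E => HH.
have : C' * P (la / 2 - d) < P (la / 2 - d) * P d by rewrite mulrC ltr_pM2l.
rewrite ltNge => /negP; apply; apply: (le_trans HH).
have -> : C' * P (la / 2 - d) = C * P (la / 2 - d) + 2 * C * (K `^ a * P (la / 2 - d) + P (la / 2 - d)).
  by rewrite /C'; ring.
apply: lerD; first by rewrite ler_wpM2l ?(ltW C0).
rewrite ler_wpM2l ?mulr_ge0 ?(ltW C0)//.
by apply: lerD => //; rewrite ler_wpM2l ?powR_ge0.
Qed.

End Periodic.

Arguments gq {R} p m q n.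
Arguments gmean {R} p m q.

(** * Exponents at rational points *)

Section RationalPoints.
Variable R : realType.
Implicit Types (x y h t a b c s tau : R) (z w : R[i]).

Lemma rational_frac x : rational x -> exists (p : int) (q : nat), (0 < q)%N /\ x = p%:~R / q%:R.
Proof.
move=> [r _ <-]; exists (numq r), `|denq r|%N; split; first by rewrite absz_gt0 denq_neq0.
by rewrite /ratr; congr (_ / _); rewrite -[denq r in LHS]absz_denq.
Qed.

Lemma frac_rational (p : int) (q : nat) : rational (p%:~R / q%:R : R).
Proof. by exists (p%:~R / q%:R) => //; rewrite fmorph_div /= ratr_int ratr_nat. Qed.

Lemma common_frac x t : rational x -> rational t -> exists (a b : int) (q : nat),
  [/\ (0 < q)%N, t = a%:~R / q%:R & x = b%:~R / q%:R].
Proof.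
move=> /rational_frac[p [q [q0 ->]]] /rational_frac[p' [q' [q0' ->]]].
exists (p' * q%:Z), (p * q'%:Z), (q * q')%N; split; first by rewrite muln_gt0 q0.
  by rewrite natrM intrM -pmulrn; field; rewrite !pnatr_eq0 -!lt0n q0 q0'.
by rewrite natrM intrM -pmulrn; field; rewrite !pnatr_eq0 -!lt0n q0 q0'.
Qed.

Section FracPoint.
Variables (p m : int) (q : nat).
Hypothesis q0 : (0 < q)%N.
Let x0 : R := m%:~R / q%:R.
Let t : R := p%:~R / q%:R.

Let qn0 : (q%:R : R) != 0. Proof. by rewrite pnatr_eq0 -lt0n. Qed.

Lemma gq_mean_bound (m' : int) (M : nat) :
  normc (\sum_(0 <= n < M) gq p m' q n - M%:R * gmean p m' q : R[i]) <= 2 * q%:R.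
Proof.
have qn0' : (q%:R : R[i]) != 0 by rewrite pnatr_eq0 -lt0n.
have Esub (n : nat) : \sum_(0 <= k < n) gq p m' q k - n%:R * gmean p m' q =
    \sum_(0 <= k < n) (gq p m' q k - gmean p m' q) :> R[i].
  by rewrite sumrB sumr_const_nat subn0 mulr_natl.
rewrite Esub (@sum_periodic _ _ q)//; last 2 first.
- by move=> n; rewrite gq_periodic.
- by rewrite -Esub /gmean mulrC divfK// subrr.
rewrite (le_trans (@normc_sum_le _ _ _ _ 2 _))//.
  move=> k; rewrite (le_trans (normcB _ _))//; have := gmean_le1 R p m' q0.
  by rewrite normc_ee; lra.
by rewrite subn0 mulrC ler_pM2l// ler_nat ltnW// ltn_pmod.
Qed.

(** Here q is fixed and only L grows: the main term |g| sqrt L outgrows L^(1-a) as soon as a >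
    1/2. *)
Lemma exponent_le_half : gmean p m q != 0 :> R[i] ->
  (holder_exponent (riemann_fun x0) t <= (1 / 2)%:E)%E.
Proof.
move=> gn0; apply: holder_exponent_le => //; first by lra.
move=> a ha a2 hold.
have a0 : 0 < a by move: ha; lra.
have [C C0 H] := window_sum_key a0 a2 hold.
set g : R[i] := gmean p m q in gn0.
have g0 : 0 < normc g.
  by rewrite lt_neqAle normc_ge0 andbT eq_sym; apply: contra_neq gn0 => /eq0_normc.
pose B : R := 2 * (2 * q%:R + 2).
have HB M : (0 < M)%N -> normc (\sum_(1 <= n < M) gg x0 (t + 0) n - M.-1%:R * (2 * g)) <= B.
  move=> M0; rewrite addr0.
  have one (m' : int) : normc (\sum_(1 <= n < M) ee (m'%:~R / q%:R) t n - M.-1%:R * gmean p m' q) <= 2 * q%:R + 2.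
    have E : \sum_(0 <= n < M) gq p m' q n = 1 + \sum_(1 <= n < M) ee (m'%:~R / q%:R) t n.
      by rewrite big_ltn//; congr (_ + _); rewrite /gq /ee expr0n !mul0r addr0 e0.
    have := gq_mean_bound m' M; rewrite E; have := gmean_le1 R p m' q0.
    set s := \sum_(1 <= n < M) _; set g' := gmean p m' q.
    have -> : s - M.-1%:R * g' = (1 + s - M%:R * g') + (g' - 1).
      by have -> : M%:R = M.-1%:R + 1 :> R[i]; [rewrite natr1 prednK|ring].
    move=> h1 h2; rewrite (le_trans (le_normcD _ _))// lerD//.
    by rewrite (le_trans (normcB _ _))// normc1; move: h1; lra.
  have := one (- m); rewrite gmean_opp// rmorphN /= mulNr -/x0 -/g => o2.
  have := one m; rewrite -/x0 -/g => o1.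
  have -> : \sum_(1 <= n < M) gg x0 t n - M.-1%:R * (2 * g) =
   (\sum_(1 <= n < M) ee x0 t n - M.-1%:R * g) + (\sum_(1 <= n < M) ee (- x0) t n - M.-1%:R * g).
    rewrite /gg big_split /=; ring.
  by rewrite (le_trans (le_normcD _ _))// /B; move: o1 o2; lra.
set k := normc g in g0.
pose Y := maxr ((16 * C / k) `^ (a - 1 / 2)^-1) ((8 * (1 + B / k)) ^+ 2).
pose L := (truncn Y).+1.
have LY : Y < L%:R by exact: truncnS_gt.
have Lp : (0 : R) < L%:R by rewrite ltr0n.
have := H 0 L (2 * g) B isT (fun M M0 _ => HB M M0).
rewrite normr0 powR0 ?(gt_eqF a0)// add0r normcM normc_nat -/k.
have B0 : 0 <= B by rewrite /B mulr_ge0// addr_ge0// mulr_ge0.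
have L1 : 8 * (1 + B / k) < sqrtr L%:R.
  have Y0 : 0 <= 8 * (1 + B / k) by rewrite mulr_ge0// addr_ge0// divr_ge0// ltW.
  rewrite -(ltr_sqr (R := R)) ?nnegrE ?sqrtr_ge0// sqr_sqrtr// (le_lt_trans _ LY)//.
  by rewrite /Y le_max lexx orbT.
have L2 : 16 * C / k < L%:R `^ (a - 1 / 2).
  have d0 : 0 < a - 1 / 2 by move: ha; lra.
  have : (16 * C / k) `^ (a - 1 / 2)^-1 < L%:R by rewrite (le_lt_trans _ LY)// /Y le_max lexx.
  move=> /(@gt0_ltr_powR R _ d0 _ _) ; rewrite !nnegrE powR_ge0 => /(_ isT (ltW Lp)).
  by rewrite -powRrM mulVf ?gt_eqF// powRr1// divr_ge0 ?mulr_ge0 ?(ltW C0) ?(ltW g0).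
have E : C * L%:R * L%:R `^ (- a) = C * sqrtr L%:R / L%:R `^ (a - 1 / 2).
  rewrite -powR12_sqrt ?(ltW Lp)// -powRN -!mulrA; congr (_ * _).
  rewrite -{1}[L%:R]powRr1 ?(ltW Lp)// -!powRD; try by rewrite (gt_eqF Lp) implybT.
  by congr (_ `^ _); field.
rewrite E; set s := sqrtr L%:R in L1 *.
have s0 : 0 < s by rewrite sqrtr_gt0.
have : C * s / L%:R `^ (a - 1 / 2) <= s * k / 16.
  rewrite ler_pdivrMr ?powR_gt0//.
  have : C <= k / 16 * L%:R `^ (a - 1 / 2).
    by move: L2; rewrite ltr_pdivrMr// => /ltW; lra.
  move=> /(ler_wpM2l (ltW s0)); rewrite [s * C]mulrC => /le_trans; apply.
  by rewrite le_eqVlt; apply/orP; left; apply/eqP; ring.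
have : 8 * (k + B) < s * k.
  by move: L1; rewrite -(ltr_pM2r g0); have -> : 8 * (1 + B / k) * k = 8 * (k + B) by field; rewrite gt_eqF.
by move: B0 g0; lra.
Qed.

(** Multiplying p and q by c and then adding 1 to the numerator gives fractions satisfying [nice]
    whose distance to t is the inverse of the new denominator, of which x0 is still a multiple; so
    mu = 1. With la = a + 1/2 the conditions amount to a > 3/2. *)
Lemma exponent_le_32 : (holder_exponent (riemann_fun x0) t <= (3 / 2)%:E)%E.
Proof.
apply: holder_exponent_le => //; first by lra.
move=> a ha a2; apply: (@nice_not_holder R x0 t a (a + 1 / 2) 1 1) => //.
- by move: ha; lra.
- by move: ha; lra.
- by move: ha; nra.
- by move: ha; lra.
move=> Q0; pose B := (4 * q)%N.
have B1 : (1 < B)%N by rewrite /B; move: q0; case: (q) => //= k; lia.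
(* The new denominator q c is a power of B = 4q, and B divides c, so p c + 1 is coprime to it. *)
pose c : int := (4 * B ^ Q0.+1)%N%:Z.
have qE : ((B ^ Q0.+2)%N%:R : R) = q%:R * c%:~R.
  by rewrite /c -pmulrn -natrM expnS /B; congr _%:R; lia.
have Qn0 : ((B ^ Q0.+2)%N%:R : R) != 0 by rewrite pnatr_eq0 -lt0n expn_gt0 (ltnW B1).
have cn0 : (c%:~R : R) != 0 by move: Qn0; rewrite qE mulf_eq0 negb_or => /andP[].
exists (p * c + 1), (m * c), (B ^ Q0.+2)%N; split.
- apply/and4P; split.
  + by rewrite expn_gt0 (ltnW B1).
  + by rewrite expnS /B -mulnA dvdn_mulr.
  + rewrite coprimeXr//.
    have : coprimez (p * c + 1) B%:Z.
      apply/coprimezP; exists (1, - (p * (4 * B ^ Q0)%N%:Z)) => /=.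
      by rewrite /c expnS !PoszM; ring.
    by rewrite coprimezE.
  + by rewrite dvdz_mull// /c PoszM dvdz_mulr.
- by rewrite (leq_trans _ (ltnW (ltn_expl _ B1)))// leqW.
- rewrite powR_inv1// mul1r.
  have -> : t - (p * c + 1)%:~R / (B ^ Q0.+2)%N%:R = - (B ^ Q0.+2)%N%:R^-1.
    rewrite /t intrD intrM qE; move: (c%:~R : R) cn0 => C cn0.
    by field; rewrite qn0 cn0.
  by rewrite normrN ger0_norm.
- have -> : x0 - (m * c)%:~R / (B ^ Q0.+2)%N%:R = 0.
    rewrite /x0 intrM qE; move: (c%:~R : R) cn0 => C cn0.
    by field; rewrite qn0 cn0.
  by rewrite normr0 mul0r divr_ge0 ?ler01 ?ler0n.
Qed.

(** Discrete Fourier coefficients of [gq p m q]; the one at k = 0 is [gmean p m q]. *)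
Let gh (k : nat) : R[i] := (\sum_(0 <= j < q) gq p m q j * e (- (j%:R * (k%:R / q%:R)))) / q%:R.

Let gq_inv n : gq p m q n = \sum_(k < q) gh k * e (n%:R * (k%:R / q%:R)).
Proof.
have qn0' : (q%:R : R[i]) != 0 by rewrite pnatr_eq0 -lt0n.
transitivity (\sum_(0 <= k < q) \sum_(0 <= j < q) gq p m q j / q%:R * e (k%:R * ((n%:Z - j%:Z)%:~R / q%:R)) : R[i]).
  rewrite exchange_big /=.
  under eq_bigr => j _ do rewrite -mulr_sumr sum_e_int_frac//.
  rewrite big_mkord (bigD1 (Ordinal (ltn_pmod n q0)))//= big1 ?addr0.
    rewrite -eqz_mod_dvd -modz_nat modz_mod eqxx divfK// periodic_mod// => k.
    by rewrite gq_periodic.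
  move=> j jn; case: ifPn => [|_]; last by rewrite mulr0.
  rewrite -eqz_mod_dvd !modz_nat eqz_nat (modn_small (ltn_ord j)) => /eqP E.
  by case/negP: jn; apply/eqP/val_inj.
rewrite big_mkord; apply: eq_bigr => k _; rewrite /gh mulr_suml mulr_suml.
apply: eq_bigr => j _.
have -> : e (k%:R * ((n%:Z - j%:Z)%:~R / q%:R)) = e (- (j%:R * (k%:R / q%:R))) * e (n%:R * (k%:R / q%:R)) :> R[i].
  by rewrite -eD; congr e; rewrite intrB -!pmulrn; ring.
ring.
Qed.

(** Modulo q, the natural number n (q - 1) stands for -n. *)
Let gq_neg n : gq p (- m) q n = gq p m q (n * q.-1)%N :> R[i].
Proof.
rewrite !gqE.
rewrite -[LHS](eDint _ (p * (n%:Z ^+ 2 * q%:Z - n%:Z ^+ 2 *+ 2) + m * n%:Z)); congr e.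
rewrite -[X in _ + X = _](mulfK qn0) -mulrDl; congr (_ / _).
rewrite [q%:R]pmulrn -intrM -intrD; congr (_%:~R).
rewrite PoszM -subn1 -subzn// -mulr_natr; ring.
Qed.

Lemma rterm_comb h n : rterm x0 (t + h) n = \sum_(k < q) gh k * rterm (k%:R / q%:R) h n.
Proof.
have E1 : ee x0 (t + h) n = \sum_(k < q) gh k * ee (k%:R / q%:R) h n.
  have -> : ee x0 (t + h) n = gq p m q n * e (n%:R ^+ 2 * h).
    by rewrite /gq /ee -eD; congr e; rewrite /x0 /t; ring.
  rewrite gq_inv mulr_suml; apply: eq_bigr => k _; rewrite -mulrA -eD /ee.
  by congr (_ * e _); rewrite addrC.
have E2 : ee (- x0) (t + h) n = \sum_(k < q) gh k * ee (- (k%:R / q%:R)) h n.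
  have -> : ee (- x0) (t + h) n = gq p (- m) q n * e (n%:R ^+ 2 * h).
    by rewrite /gq /ee -eD; congr e; rewrite /x0 /t rmorphN /=; ring.
  rewrite gq_neg gq_inv mulr_suml; apply: eq_bigr => k _; rewrite -mulrA -eD /ee.
  congr (_ * _); rewrite -[RHS](eDint _ (n%:Z * k%:Z)); congr e.
  have -> : (n * q.-1)%N%:R = n%:R * q%:R - n%:R :> R.
    by rewrite natrM -subn1 natrB// mulrBr mulr1.
  by rewrite intrM -!pmulrn; field.
rewrite /rterm E1 E2 -big_split mulr_sumr; apply: eq_bigr => k _ /=.
by rewrite -mulrDr mulrCA.
Qed.

Lemma riemann_comb h : riemann_fun x0 (t + h) = \sum_(k < q) gh k * riemann_fun (k%:R / q%:R) h.
Proof.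
set f := riemann_fun _ _; set F := \sum_(k < q) _.
pose K := 4 + \sum_(k < q) normc (gh k) * 4.
have K0 : 0 < K.
  by rewrite /K ltr_wpDr// sumr_ge0// => k _; rewrite mulr_ge0 ?normc_ge0.
have H N : (0 < N)%N -> normc (f - F) <= K / N%:R.
  move=> N0; have E : rpart x0 (t + h) N = \sum_(k < q) gh k * rpart (k%:R / q%:R) h N.
    rewrite /rpart; under eq_bigr do rewrite rterm_comb.
    by rewrite exchange_big /=; apply: eq_bigr => k _; rewrite mulr_sumr.
  have -> : f - F = (f - rpart x0 (t + h) N) - (F - \sum_(k < q) gh k * rpart (k%:R / q%:R) h N).
    by rewrite E; ring.
  rewrite (le_trans (normcB _ _))// mulrDl lerD ?riemann_fun_approx//.
  rewrite /F -sumrB (le_trans (normc_sum _ _ _))// mulr_suml; apply: ler_sum => k _.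
  by rewrite -mulrBr normcM -mulrA ler_wpM2l ?normc_ge0 ?riemann_fun_approx.
apply/eqP; rewrite -subr_eq0; apply/eqP/eq0_normc/eqP; rewrite eq_le normc_ge0 andbT.
apply/ler_addgt0Pr => eps eps0; rewrite add0r.
rewrite (le_trans (H (truncn (K / eps)).+1 isT))// ler_pdivrMr ?ltr0n//.
by rewrite -ler_pdivrMl// mulrC ltW// truncnS_gt.
Qed.

Lemma exponent_ge_32 : gmean p m q = 0 :> R[i] ->
  ((3 / 2)%:E <= holder_exponent (riemann_fun x0) t)%E.
Proof.
move=> g0; apply: holder_exponent_ge => // a a0 a32.
exists (maxr a 1); first by rewrite le_max lexx.
(* The term k = 0 has coefficient 0, so its function may be replaced by R_{1/2}, which is regular at
   the origin like the others. *)
pose G (i : 'I_q) := if val i == 0%N then riemann_fun (1 / 2 : R) else riemann_fun (i%:R / q%:R).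
have m1 : 1 <= maxr a 1 by rewrite le_max lexx orbT.
have m2 : maxr a 1 < 3 / 2 by rewrite gt_max a32 /=; lra.
apply: (@holder_at_comb R q (fun i => gh i) G _ t 0) => //.
- by move: m2; lra.
- move=> h; rewrite riemann_comb add0r; apply: eq_bigr => i _; rewrite /G.
  case: eqP => [i0|//]; suff -> : gh i = 0 by rewrite !mul0r.
  rewrite /gh i0 -[RHS]g0; congr (_ / _); apply: eq_bigr => j _.
  by rewrite mul0r mulr0 oppr0 e0 mulr1.
- move=> i; rewrite /G; case: eqP => [_|/eqP i0]; apply: holder_zero => //; apply: e_frac_neq1.
  + by [].
  + by lra.
  + by rewrite divr_gt0 ?ltr0n// lt0n.
  + by rewrite ltr_pdivrMr ?ltr0n// mul1r ltr_nat.
Qed.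

End FracPoint.

Lemma exponent_ge_half x0 t : ((1 / 2)%:E <= holder_exponent (riemann_fun x0) t)%E.
Proof.
apply: holder_exponent_ge => // a a0 a12; exists (1 / 2); [exact: ltW|exact: holder_half].
Qed.

Lemma exponent_rational x0 t : rational x0 -> rational t ->
  holder_exponent (riemann_fun x0) t = (1 / 2)%:E \/ holder_exponent (riemann_fun x0) t = (3 / 2)%:E.
Proof.
move=> rx rt; have [a [b [q [q0 -> ->]]]] := common_frac rx rt.
have [g0|gn0] := eqVneq (gmean a b q : R[i]) 0.
  by right; apply/eqP; rewrite eq_le exponent_le_32 ?exponent_ge_32.
by left; apply/eqP; rewrite eq_le exponent_le_half ?exponent_ge_half.
Qed.

Lemma exists_exponent_half x0 : rational x0 -> exists t, holder_exponent (riemann_fun x0) t = (1 / 2)%:E.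
Proof.
move=> /rational_frac[w [v [v0 ->]]].
pose q := (4 * v)%N; pose m := w * 4.
have q0 : (0 < q)%N by rewrite muln_gt0.
have -> : w%:~R / v%:R = m%:~R / q%:R :> R.
  by rewrite /m /q natrM intrM; field; rewrite pnatr_eq0 -lt0n.
exists (1%:~R / q%:R); apply/eqP; rewrite eq_le exponent_ge_half andbT exponent_le_half//.
have := @gauss_norm R 1 m q q0 (dvdn_mulr _ (dvdnn _)) (coprime1n _) (dvdz_mull w (isT : (2 %| 4)%Z)).
move=> H; apply/eqP => E; move: H; rewrite E normc0 expr0n /= => /eqP.
by rewrite eq_sym gt_eqF// divr_gt0 ?ltr0n.
Qed.

(** If x0 is not an integer take t = 0, where the mean of e(n x0) vanishes; if it is, take t = 1/2,
    where e(n^2/2) alternates in sign. *)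
Lemma exists_exponent_32 x0 : rational x0 -> exists t, holder_exponent (riemann_fun x0) t = (3 / 2)%:E.
Proof.
move=> /rational_frac[w [v [v0 ->]]].
have [vw|vw] := boolP (v %| w)%Z.
  have /dvdzP[k wE] := vw.
  have -> : w%:~R / v%:R = (k * 2)%:~R / 2%:R :> R.
    by rewrite wE !intrM -pmulrn !mulfK// pnatr_eq0// -lt0n.
  exists (1%:~R / 2%:R); apply/eqP; rewrite eq_le exponent_le_32//= exponent_ge_32//.
  rewrite /gmean !big_nat_recr//= big_geq// add0r.
  have -> : gq 1 (k * 2) 2 0 = 1 :> R[i] by rewrite gqE -[RHS]e0; congr e; rewrite expr0n !mulr0 mul0r.
  have -> : gq 1 (k * 2) 2 1 = -1 :> R[i].
    rewrite gqE expr1n !mulr1 intrD mulrDl intrM mulfK ?pnatr_eq0// eDint.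
    have -> : 1%:~R / 2%:R = 1 / 2 :> R by [].
    rewrite /e /expi; have -> : 2 * pi * (1 / 2) = pi :> R by field.
    by rewrite cospi sinpi; apply/eqP; rewrite eq_complex /= oppr0 !eqxx.
  by rewrite subrr mul0r.
exists (0%:~R / v%:R); apply/eqP; rewrite eq_le exponent_le_32//= exponent_ge_32//.
rewrite /gmean; have -> : \sum_(0 <= n < v) gq 0 w v n = 0 :> R[i]; last by rewrite mul0r.
have H := @sum_e_int_frac R w v v0; rewrite (negbTE vw) in H; rewrite -[RHS]H.
by apply: eq_bigr => n _; rewrite gqE mul0r add0r intrM -pmulrn mulrAC mulrC.
Qed.

Lemma not_rational_sep t (Q : nat) : ~ rational t ->
  exists2 c : R, 0 < c & forall (p : int) (q : nat), (0 < q)%N -> (q <= Q)%N ->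
    c <= `|q%:R * t - p%:~R|.
Proof.
move=> nr; elim: Q => [|Q [c c0 IH]].
  by exists 1 => // p q q0; rewrite leqn0 => /eqP E; rewrite E in q0.
pose y := Q.+1%:R * t; pose f := Num.floor y.
have fy : f%:~R < y.
  rewrite lt_neqAle floor_le_tmp andbT; apply/eqP => E; apply: nr.
  have -> : t = f%:~R / Q.+1%:R by rewrite E /y mulrC mulKf// pnatr_eq0.
  exact: frac_rational.
have yf : y < (f + 1)%:~R by exact: floorD1_gt.
exists (minr c (minr (y - f%:~R) ((f + 1)%:~R - y))).
  by rewrite !lt_min c0 !subr_gt0 fy.
move=> p q q0; rewrite leq_eqVlt => /orP[/eqP ->|qQ]; last first.
  by rewrite ge_min IH.
rewrite -/y ge_min; apply/orP; right; rewrite ge_min.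
have [pf|fp] := leP p f.
  apply/orP; left; rewrite ger0_norm; last first.
    by rewrite subr_ge0 (le_trans _ (ltW fy))// ler_int.
  by rewrite lerD2l lerN2 ler_int.
have fp' : (f + 1 <= p)%R by rewrite addrC lez1D.
apply/orP; right; rewrite distrC ger0_norm; last first.
  by rewrite subr_ge0 (le_trans (ltW yf))// ler_int.
by rewrite lerD2r ler_int.
Qed.

(** By [not_rational_sep] the fractions with q <= Q cannot come close enough, so a fine Dirichlet
    approximation has a larger denominator. *)
Lemma dirichlet_irrational t (Q : nat) : ~ rational t -> exists (p : int) (q : nat),
  [/\ (0 < q)%N, (Q <= q)%N, coprime `|p| q & `|t - p%:~R / q%:R| <= q%:R ^- 2].
Proof.
move=> nr; have [c c0 H] := not_rational_sep Q nr.
pose N := (truncn c^-1).+1.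
have [p [q [q0 qN cop bd]]] := dirichlet_approx t (isT : (0 < N)%N).
have qp : (0 : R) < q%:R by rewrite ltr0n.
have Np : (0 : R) < N%:R by rewrite ltr0n.
exists p, q; split => //; last first.
  rewrite (le_trans bd)// mul1r lef_pV2 ?posrE ?exprn_gt0 ?mulr_gt0//.
  by rewrite expr2 ler_pM2r// ler_nat.
rewrite leqNgt; apply/negP => /ltnW qQ.
have := H p q q0 qQ.
have -> : q%:R * t - p%:~R = q%:R * (t - p%:~R / q%:R) by field; rewrite gt_eqF.
rewrite normrM (ger0_norm (ltW qp)) leNgt => /negP; apply.
apply: (@le_lt_trans _ _ N%:R^-1).
  apply: (le_trans (ler_wpM2l (ltW qp) bd)).
  by rewrite le_eqVlt; apply/orP; left; apply/eqP; field; rewrite !gt_eqF.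
by rewrite -[ltRHS]invrK ltf_pV2 ?posrE ?invr_gt0// truncnS_gt.
Qed.

(** k is the part of L prime to p1. A prime of L that divides p1 divides neither k nor p0, and one
    that does not divide p1 divides k; in both cases it divides exactly one of p1 and k p0. *)
Lemma coprime_shift (L p0 p1 : nat) : (0 < L)%N -> (0 < p1)%N -> coprime p0 p1 ->
  exists k, [/\ (0 < k)%N, (k <= L)%N & coprime (p1 + k * p0) L].
Proof.
move=> L0 p10 cop; pose k := (L`_(\pi(p1)^'))%N.
have k0 : (0 < k)%N by exact: part_gt0.
exists k; split => //; first by rewrite dvdn_leq// dvdn_part.
rewrite /coprime; set g := gcdn _ _.
have g0 : (0 < g)%N by rewrite gcdn_gt0 L0 orbT.
rewrite eqn_leq g0 andbT leqNgt; apply/negP => g1.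
have pr := pdiv_prime g1; have dg := pdiv_dvd g.
set l := pdiv g in pr dg.
have lL : (l %| L)%N := dvdn_trans dg (dvdn_gcdr _ _).
have ls : (l %| p1 + k * p0)%N := dvdn_trans dg (dvdn_gcdl _ _).
have lk : (l %| k)%N = ~~ (l %| p1)%N.
  have := primes_part (\pi(p1)^')%N L => /(congr1 (fun r : seq nat => l \in r)).
  by rewrite mem_filter !mem_primes pr L0 k0 lL !inE /= mem_primes pr p10 /= andbT.
have [lp|lp] := boolP (l %| p1)%N.
  move: ls; rewrite dvdn_addr// Euclid_dvdM// lk lp /= => lp0.
  have : (l %| gcdn p0 p1)%N by rewrite dvdn_gcd lp0.
  by rewrite (eqP cop) dvdn1 => /eqP l1; rewrite l1 in pr.
by move: ls; rewrite dvdn_addl ?(negbTE lp)// dvdn_mulr// lk.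
Qed.

(* A Dirichlet approximation [p0 / q0] of [L t] and the neighbour [p1 / q1] with
   [p1 q0 - p0 q1 = 1] give the coprime pairs [p1 + k p0], [q1 + k q0], among
   which one with [k <= L] has a numerator coprime to [L]. *)
Lemma approx_multiple t (L : nat) : (0 < L)%N -> ~ rational t -> forall Q : nat,
  exists (p : int) (q : nat), [/\ (0 < q)%N, (L %| q)%N, coprime `|p| q, (Q <= q)%N &
    `|t - p%:~R / q%:R| <= 2 * (L%:R + 1) ^+ 2 * L%:R * q%:R ^- 2].
Proof.
move=> L0 nr Q.
pose n := (truncn `|t|).+2.
have tn : 1 < t + n%:R.
  have : `|t| < (truncn `|t|).+1%:R by exact: truncnS_gt.
  have := ler_norm (- t); rewrite normrN /n -[_.+2%:R]natr1; lra.
(* Approximating L (t + n) by P/r puts t near P/(L r) - n, a fraction over a multiple of L; the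
   shift by n makes the numerators positive. *)
pose s := L%:R * (t + n%:R).
have Lp : (0 : R) < L%:R by rewrite ltr0n.
have L1 : (1 : R) <= L%:R by rewrite ler1n.
have s1 : 1 < s.
  apply: (lt_le_trans tn); rewrite /s ler_peMl//; lra.
have nrs : ~ rational s.
  move=> /rational_frac[a [b [b0 E]]]; apply: nr.
  have -> : t = (a - n%:Z * L%:Z * b%:Z)%:~R / (L * b)%N%:R.
    have -> : t = s / L%:R - n%:R by rewrite /s mulrC mulKf ?gt_eqF// addrK.
    rewrite E natrM intrB !intrM -!pmulrn; field.
    by rewrite !pnatr_eq0 -!lt0n b0 L0.
  exact: frac_rational.
have [p0 [q0 [q00 Qq cop bd]]] := dirichlet_irrational Q nrs.
have qp : (0 : R) < q0%:R by rewrite ltr0n.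
have q1 : (1 : R) <= q0%:R by rewrite ler1n.
have p0pos : (0 < p0)%R.
  rewrite ltNge; apply/negP => H.
  have : p0%:~R / q0%:R <= 0 :> R by rewrite ler_pdivrMr// mul0r -[0]/(0%:~R) ler_int.
  have : q0%:R ^- 2 <= 1 :> R by rewrite invf_le1 ?exprn_gt0// exprn_ege1.
  have := ler_norm (s - p0%:~R / q0%:R); move: bd s1; lra.
have [a p0E] : exists a : nat, p0 = a%:Z by exists `|p0|%N; rewrite gtz0_abs.
rewrite {}p0E /= -pmulrn in cop bd p0pos.
have [km kn Km Hk] := egcdnP a q00.
have g1 : gcdn q0 a = 1%N by apply/eqP; rewrite -/(coprime q0 a) coprime_sym.
rewrite g1 in Km Hk; rewrite muln1 in Hk.
have km0 : (0 < km)%N by move: Km; case: km Hk => //; rewrite mul0n addn1.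
have copa : coprime a km.
  rewrite /coprime -dvdn1; have <- : (km * q0 - kn * a = 1)%N by rewrite Km addKn.
  by apply: dvdn_sub; [exact: dvdn_mulr (dvdn_gcdr _ _)|exact: dvdn_mull (dvdn_gcdl _ _)].
have [k [k0 kL copL]] := coprime_shift L0 km0 copa.
pose r := (kn + k * q0)%N; pose P := (km + k * a)%N.
have PE : (P * q0 = a * r + 1)%N.
  by rewrite /P /r mulnDl mulnDr Km; lia.
have r0 : (0 < r)%N by rewrite addn_gt0 muln_gt0 k0 q00 orbT.
have q0r : (q0 <= r)%N by rewrite /r (leq_trans _ (leq_addl _ _))// leq_pmull.
(* This is the origin of (L + 1)^2 in the bound. *)
have rL : (r <= (L + 1) * q0)%N.
  rewrite /r mulnDl mul1n addnC leq_add//; [by rewrite leq_mul2r kL orbT|exact: ltnW].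
have copr : coprime P r.
  rewrite /coprime -dvdn1; have <- : (P * q0 - a * r = 1)%N by rewrite PE addKn.
  by apply: dvdn_sub; [exact: dvdn_mulr (dvdn_gcdl _ _)|exact: dvdn_mull (dvdn_gcdr _ _)].
have rp : (0 : R) < r%:R by rewrite ltr0n.
exists (P%:Z - (n * (L * r))%N%:Z), (L * r)%N; split.
- by rewrite muln_gt0 L0.
- by rewrite dvdn_mulr.
- have : coprimez (P%:Z - (n * (L * r))%N%:Z) (L * r)%N%:Z.
    have : coprimez P%:Z (L * r)%N%:Z by rewrite coprimezE /= coprimeMr copL.
    move=> /coprimezP[[u v] /= E]; apply/coprimezP; exists (u, v + u * n%:Z) => /=.
    by rewrite -E PoszM; ring.
  by rewrite coprimezE.
- by rewrite (leq_trans Qq)// (leq_trans q0r)// leq_pmull.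
have -> : t - (P%:Z - (n * (L * r))%N%:Z)%:~R / (L * r)%N%:R = (s - P%:R / r%:R) / L%:R.
  rewrite /s intrB -!pmulrn !natrM; field; rewrite !gt_eqF//.
have : `|s - P%:R / r%:R| <= 2 * q0%:R ^- 2.
  have -> : s - P%:R / r%:R = (s - a%:R / q0%:R) - (P%:R / r%:R - a%:R / q0%:R) by ring.
  have -> : P%:R / r%:R - a%:R / q0%:R = (q0%:R * r%:R)^-1 :> R.
    have : P%:R * q0%:R = a%:R * r%:R + 1 :> R by rewrite -!natrM PE natrD.
    move=> E; have -> : P%:R = (a%:R * r%:R + 1) / q0%:R :> R by rewrite -E mulfK// gt_eqF.
    by field; rewrite !gt_eqF.
  rewrite (le_trans (ler_normB _ _))// [`|(_ * _)^-1|]ger0_norm ?invr_ge0 ?mulr_ge0//.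
  have : (q0%:R * r%:R)^-1 <= q0%:R ^- 2 :> R.
    by rewrite lef_pV2 ?posrE ?exprn_gt0 ?mulr_gt0// expr2 ler_pM2l// ler_nat.
  move: bd; lra.
rewrite normrM normfV (ger0_norm (ltW Lp)) ler_pdivrMr// => /le_trans; apply.
have -> : 2 * (L%:R + 1) ^+ 2 * L%:R / (L * r)%:R ^+ 2 * L%:R = 2 * ((L%:R + 1) ^+ 2 / r%:R ^+ 2) :> R.
  by rewrite natrM; field; rewrite !gt_eqF.
rewrite ler_pM2l// ler_pdivlMr ?exprn_gt0// mulrC ler_pdivrMr ?exprn_gt0// -exprMn.
apply: lerXn2r; rewrite ?nnegrE ?mulr_ge0 ?addr_ge0//.
by have := rL; rewrite -(ler_nat R) natrM natrD.
Qed.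

(** Denominators divisible by 4v make x0 equal to m/q with m even, and [approx_multiple] provides
    them with mu = 2; for la = 2a + 1/2 the conditions amount to a > 3/4. *)
Lemma exponent_le_34 x0 t : rational x0 -> ~ rational t ->
  (holder_exponent (riemann_fun x0) t <= (3 / 4)%:E)%E.
Proof.
move=> /rational_frac[w [v [v0 xE]]] nr.
apply: holder_exponent_le; [lra|lra|] => a ha a2.
have L0 : (0 < 4 * v)%N by rewrite muln_gt0.
pose K : R := 2 * ((4 * v)%N%:R + 1) ^+ 2 * (4 * v)%N%:R.
apply: (@nice_not_holder R x0 t a ((4 * a + 1) / 2) 2 K) => //.
- by lra.
- by lra.
- by nra.
- by lra.
- by rewrite /K !mulr_ge0 ?sqr_ge0.
move=> Q; have [p [q [q0 Lq cop Qq bd]]] := approx_multiple L0 nr Q.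
have /dvdnP[c qE] := Lq.
exists p, (w * (4 * c)%N%:Z), q; split => //.
- apply/and4P; split => //; first by rewrite (dvdn_trans _ Lq)// dvdn_mulr.
  by rewrite dvdz_mull// PoszM dvdz_mulr.
- rewrite powRN -[2]/(2%:R) powR_mulrn//.
have -> : x0 - (w * (4 * c)%N%:Z)%:~R / q%:R = 0.
  have c0 : (0 < c)%N by move: q0; rewrite qE muln_gt0 => /andP[].
  by rewrite xE qE intrM -pmulrn !natrM; field; rewrite !pnatr_eq0 -!lt0n c0 v0.
by rewrite normr0 mul0r divr_ge0 ?ler01 ?ler0n.
Qed.

End RationalPoints.

(** * Hausdorff measure *)

Section Hausdorff.
Variable R : realType.
Implicit Types (x y h t a b c r s tau mu eps delta : R) (U A : set R).

Lemma diameter_pow_ge0 s U : (0 <= diameter_pow s U)%E.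
Proof. by rewrite /diameter_pow; case: ifP => // _; exact: poweR_ge0. Qed.

Lemma diameter_pow0 s : diameter_pow s set0 = 0%E :> \bar R.
Proof. by rewrite /diameter_pow eqxx. Qed.

Lemma diameter_ge0 U x : U x -> (0 <= diameter U)%E.
Proof.
move=> Ux; apply: ereal_sup_ubound; exists (x, x); first by [].
by rewrite /= subrr normr0.
Qed.

Lemma diameter_le U r : (forall x y, U x -> U y -> `|x - y| <= r) -> (diameter U <= r%:E)%E.
Proof.
by move=> H; apply: ge_ereal_sup => _ [[x y] [/= Ux Uy] <-]; rewrite lee_fin H.
Qed.

Lemma diameter_set0 : (diameter (set0 : set R) = -oo)%E.
Proof.
rewrite /diameter; have -> : [set `|z.1 - z.2|%:E | z in (set0 : set R) `*` set0] = set0.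
  by apply/seteqP; split => // _ [[x y] [[]]].
exact: ereal_sup0.
Qed.

Lemma diameter_pow_le s U r : 0 <= s -> 0 <= r -> (diameter U <= r%:E)%E ->
  (diameter_pow s U <= (r `^ s)%:E)%E.
Proof.
move=> s0 r0 dr; rewrite /diameter_pow; case: eqP => [_|/eqP/set0P[x Ux]].
  by rewrite lee_fin powR_ge0.
rewrite -poweR_EFin; apply: gt0_ler_poweR => //.
  by rewrite in_itv/= (diameter_ge0 Ux) leey.
by rewrite in_itv/= lee_fin r0 leey.
Qed.

Lemma nneseries_le (f : nat -> \bar R) (K : \bar R) : (forall n, 0 <= f n)%E ->
  (forall n, \sum_(0 <= k < n) f k <= K)%E -> (\sum_(0 <= k <oo) f k <= K)%E.
Proof.
move=> f0 H; apply: lime_le; first by apply: is_cvg_nneseries => n _ _; exact: f0.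
exact: nearW.
Qed.

Lemma hausdorff_measure_cover s A eps delta : hausdorff_measure s A = 0%E -> 0 < eps -> 0 < delta ->
  exists U : nat -> set R, [/\ A `<=` \bigcup_k U k, (forall k, diameter (U k) <= delta%:E)%E
    & (\sum_(0 <= k <oo) diameter_pow s (U k) <= eps%:E)%E].
Proof.
move=> H eps0 d0.
have : (hausdorff_premeasure s delta A < eps%:E)%E.
  apply: (@le_lt_trans _ _ (hausdorff_measure s A)); last by rewrite H lte_fin.
  by apply: ereal_sup_ubound; exists delta.
by move=> /ereal_inf_lt[_ [U [AU dU] <-] /ltW H1]; exists U; split.
Qed.

Lemma hausdorff_measure_null s A : (forall eps delta, 0 < eps -> 0 < delta ->
  exists U : nat -> set R, [/\ A `<=` \bigcup_k U k, (forall k, diameter (U k) <= delta%:E)%E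
    & (\sum_(0 <= k <oo) diameter_pow s (U k) <= eps%:E)%E]) ->
  hausdorff_measure s A = 0%E.
Proof.
move=> H; apply/eqP; rewrite eq_le; apply/andP; split.
  apply: ge_ereal_sup => _ [delta d0 <-]; apply/lee_addgt0Pr => eps eps0; rewrite add0e.
  have [U [AU dU sU]] := H eps delta eps0 d0.
  by apply: le_trans sU; apply: ereal_inf_lbound; exists U.
apply: (@le_trans _ _ (hausdorff_premeasure s 1 A)); last first.
  by apply: ereal_sup_ubound; exists 1 => //=; exact: ltr01.
apply: le_ereal_inf_tmp => _ [U _ <-]; apply: nneseries_ge0 => k _ _; exact: diameter_pow_ge0.
Qed.

Lemma double_cover (U : nat -> nat -> set R) s : exists V : nat -> set R,
  [/\ forall i k, U i k `<=` \bigcup_n V n, forall n, exists i k, V n = U i k &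
   (\sum_(0 <= n <oo) diameter_pow s (V n) = \sum_(0 <= i <oo) \sum_(0 <= k <oo) diameter_pow s (U i k))%E].
Proof.
have /card_esym/ppcard_eqP[f] := card_nat2.
have dp0 := diameter_pow_ge0 s.
exists (fun n => U (f n).1 (f n).2); split.
- move=> i k x Ux; exists (f^-1%FUN (i, k)) => //=.
  by rewrite invK ?inE.
- by move=> n; exists (f n).1, (f n).2.
rewrite nneseries_esumT//.
transitivity (\esum_(j in [set: nat * nat]) diameter_pow s (U j.1 j.2)).
  by rewrite (reindex_esum setT setT f)//; exact: bij.
have -> : [set: nat * nat] = [set: nat] `*`` (fun=> [set: nat]) by apply/seteqP; split.
rewrite -(@esum_esum R nat nat setT (fun=> setT) (fun i k => diameter_pow s (U i k)))//.
rewrite nneseries_esumT; last by move=> i; apply: nneseries_ge0 => *; exact: dp0.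
by apply: eq_esum => i _; rewrite nneseries_esumT.
Qed.

Lemma hausdorff_null_bigcup s (A : nat -> set R) : (forall i, hausdorff_measure s (A i) = 0%E) ->
  hausdorff_measure s (\bigcup_i A i) = 0%E.
Proof.
move=> H; apply: hausdorff_measure_null => eps delta eps0 d0.
have [U HU] : {U : nat -> nat -> set R & forall i, [/\ A i `<=` \bigcup_k U i k,
    (forall k, diameter (U i k) <= delta%:E)%E &
    (\sum_(0 <= k <oo) diameter_pow s (U i k) <= (eps / (2 ^ i.+1)%:R)%:E)%E]}.
  apply: (@choice _ _ (fun i (U : nat -> set R) => [/\ A i `<=` \bigcup_k U k,
    (forall k, diameter (U k) <= delta%:E)%E &
    (\sum_(0 <= k <oo) diameter_pow s (U k) <= (eps / (2 ^ i.+1)%:R)%:E)%E])) => i.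
  by apply: hausdorff_measure_cover => //; rewrite divr_gt0 ?ltr0n ?expn_gt0.
have [V [UV VU sV]] := double_cover U s; exists V; split.
- move=> x [i _ Aix]; have [AU _ _] := HU i; have [k _ Uk] := AU x Aix.
  exact: UV Uk.
- by move=> n; have [i [k ->]] := VU n; have [_ dU _] := HU i.
rewrite sV; apply: le_trans (epsilon_trick0 xpredT (ltW eps0)).
apply: lee_nneseries => [i *|i *]; last by have [_ _] := HU i.
by apply: nneseries_ge0 => *; exact: diameter_pow_ge0.
Qed.

Lemma hausdorff_null_subset s A B : A `<=` B -> hausdorff_measure s B = 0%E ->
  hausdorff_measure s A = 0%E.
Proof.
move=> AB HB; apply: hausdorff_measure_null => eps delta eps0 d0.
have [U [BU dU sU]] := hausdorff_measure_cover HB eps0 d0.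
by exists U; split => //; exact: subset_trans BU.
Qed.

Lemma powR_small b eps : 0 < b -> 0 < eps -> exists N : nat, forall n : nat, (N <= n)%N ->
  (n%:R : R) `^ (- b) <= eps.
Proof.
move=> b0 eps0; exists (truncn (eps^-1 `^ b^-1)).+1 => n Nn.
have n0 : (0 : R) < n%:R by rewrite ltr0n (leq_trans _ Nn).
have H : eps^-1 `^ b^-1 < n%:R by rewrite (lt_le_trans (truncnS_gt _))// ler_nat.
rewrite powRN -[leRHS]invrK lef_pV2 ?posrE ?powR_gt0 ?invr_gt0//.
have := @gt0_ltr_powR R b b0 (eps^-1 `^ b^-1) n%:R.
rewrite !nnegrE powR_ge0 => /(_ isT (ltW n0) H).
by rewrite -powRrM mulVf ?gt_eqF// powRr1 ?invr_ge0 ?(ltW eps0)//; exact: ltW.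
Qed.

(* The fractions are not required to be reduced, so every rational belongs to
   every [well_approx mu]. *)
Definition well_approx mu : set R := [set t | forall Q : nat, exists (p : int) (q : nat),
  [/\ (0 < q)%N, (Q <= q)%N & `|t - p%:~R / q%:R| < q%:R `^ (- mu)]].

Lemma well_approx_rational mu t : rational t -> well_approx mu t.
Proof.
move=> /rational_frac[p [q [q0 ->]]] Q; exists (p * Q.+1%:Z), (q * Q.+1)%N; split.
- by rewrite muln_gt0 q0.
- by rewrite (leq_trans (leqnSn Q))// leq_pmull.
rewrite natrM intrM -pmulrn -mulf_div divff ?pnatr_eq0// mulr1 subrr normr0.
by rewrite powR_gt0// mulr_gt0 ?ltr0n.
Qed.

(** For q >= Q the failure of approximation is the bound with constant 1; the finitely many smaller
    q are handled by irrationality. *)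
Lemma well_approx_badly mu t : ~ well_approx mu t -> exists2 c, 0 < c & badly_approx c mu t.
Proof.
move=> nW.
have nr : ~ rational t by move=> /(well_approx_rational mu).
have [Q HQ] : exists Q : nat, forall (p : int) (q : nat), (0 < q)%N -> (Q <= q)%N ->
    q%:R `^ (- mu) <= `|t - p%:~R / q%:R|.
  move: nW => /existsNP[Q HQ]; exists Q => p q q0 Qq; rewrite leNgt; apply/negP => H.
  by apply: HQ; exists p, q.
have [c c0 Hc] := not_rational_sep Q nr.
pose c' := minr 1 (c / (Q%:R + 1) / (Q%:R + 1) `^ `|mu|).
have Q1 : (0 : R) < Q%:R + 1 by rewrite ltr_wpDl.
have c'0 : 0 < c' by rewrite lt_min ltr01 !divr_gt0 ?powR_gt0.
exists c' => // p q q0.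
have qp : (0 : R) < q%:R by rewrite ltr0n.
have [Qq|qQ] := leqP Q q.
  by rewrite (le_trans _ (HQ p q q0 Qq))// ler_piMl ?powR_ge0// /c' ge_min lexx.
have := Hc p q q0 (ltnW qQ).
have -> : q%:R * t - p%:~R = q%:R * (t - p%:~R / q%:R) by field; rewrite gt_eqF.
rewrite normrM (ger0_norm (ltW qp)) mulrC -ler_pdivrMr// => /(le_trans _); apply.
have qQ' : q%:R <= Q%:R + 1 :> R by rewrite natr1 ler_nat ltnW// ltnW.
apply: (@le_trans _ _ (c / (Q%:R + 1))); last first.
  by rewrite ler_pM2l// lef_pV2 ?posrE.
apply: (@le_trans _ _ (c / (Q%:R + 1) / (Q%:R + 1) `^ `|mu| * (Q%:R + 1) `^ `|mu|)); last first.
  by rewrite divfK// gt_eqF// powR_gt0.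
apply: ler_pM; rewrite ?powR_ge0 ?(ltW c'0)//.
  by rewrite /c' ge_min lexx orbT.
apply: (@le_trans _ _ (q%:R `^ `|mu|)).
  by rewrite ler_powR ?ler1n// -normrN ler_norm.
by apply: ge0_ler_powR; rewrite ?nnegrE ?normr_ge0 ?(ltW qp) ?(ltW Q1).
Qed.

Lemma sum_indicator_le (N n : nat) b : 0 <= b ->
  (\sum_(0 <= k < n) (if (k < N)%N then b%:E else 0) <= (N%:R * b)%:E)%E.
Proof.
move=> b0; apply: (@le_trans _ _ ((minn n N)%:R * b)%:E); last first.
  by rewrite lee_fin ler_wpM2r// ler_nat geq_minr.
elim: n => [|n IH]; first by rewrite big_geq// lee_fin min0n mul0r.
rewrite big_nat_recr//=; apply: le_trans (leeD2r _ IH) _.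
case: ifPn => [nN|]; rewrite ?adde0 -?EFinD lee_fin.
  have -> : minn n N = n by apply/minn_idPl; exact: ltnW.
  have -> : minn n.+1 N = n.+1 by apply/minn_idPl.
  by rewrite -natr1 mulrDl mul1r.
by move=> _; rewrite ler_wpM2r// ler_nat leq_min geq_minr (leq_trans (geq_minl _ _)).
Qed.

Lemma sum_tail_le (K sg : R) (Q n : nat) : 0 <= K -> 0 < sg -> (1 < Q)%N ->
  (\sum_(0 <= q < n) (if (Q <= q)%N then (K * q%:R `^ (- sg - 1))%:E else 0) <=
   (K / sg * Q.-1%:R `^ (- sg))%:E)%E.
Proof.
move=> K0 sg0 Q1.
have Ks : 0 <= K / sg by rewrite divr_ge0// ltW.
apply: (@le_trans _ _ (K / sg * (Q.-1%:R `^ (- sg) - (maxn n Q).-1%:R `^ (- sg)))%:E); last first.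
  by rewrite lee_fin ler_wpM2l// gerBl powR_ge0.
elim: n => [|n IH]; first by rewrite big_geq// lee_fin max0n subrr mulr0.
rewrite big_nat_recr//=; apply: le_trans (leeD2r _ IH) _.
case: ifPn => [Qn|]; rewrite ?adde0 -?EFinD lee_fin; last first.
  rewrite -ltnNge => nQ.
  have -> : maxn n Q = Q by apply/maxn_idPr; exact: ltnW.
  by have -> : maxn n.+1 Q = Q by apply/maxn_idPr.
have -> : maxn n Q = n by apply/maxn_idPl.
have -> : maxn n.+1 Q = n.+1 by apply/maxn_idPl; exact: leqW.
have n1 : (0 < n.-1)%N by move: Q1 Qn; case: n {IH} => [|[|n]]//; case: Q => [|[|Q]].
have := @powR_telescope R n.-1%:R sg; rewrite ltr0n => /(_ n1 sg0).
have -> : n.-1%:R + 1 = n%:R :> R by rewrite natr1 prednK// (leq_trans n1)// leq_pred.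
move=> H /=.
have -> : K * n%:R `^ (- sg - 1) = K / sg * (sg * n%:R `^ (- sg - 1)) by field; rewrite gt_eqF.
by rewrite -mulrDr ler_wpM2l//; move: H; lra.
Qed.

Lemma well_approx_bounded_null mu s (M : nat) : 0 < mu -> 2 / mu < s ->
  hausdorff_measure s (well_approx mu `&` [set t | `|t| <= M%:R]) = 0%E.
Proof.
move=> mu0 smu.
have aux (a : nat) (z : int) : (z <= a%:Z)%R -> (z + a%:Z < (2 * a + 1)%N%:Z)%R by lia.
have s0 : 0 < s by rewrite (lt_trans _ smu)// divr_gt0.
have sg0 : 0 < s * mu - 2 by move: smu; rewrite ltr_pdivrMr// subr_gt0.
set sg := s * mu - 2 in sg0.
pose K : R := (2 * M.+1 + 1)%N%:R * 2 `^ s.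
have K0 : 0 <= K by rewrite mulr_ge0// powR_ge0.
apply: hausdorff_measure_null => eps delta eps0 d0.
have [N1 H1] := powR_small mu0 (divr_gt0 d0 (ltr0Sn R 1)).
have e' : 0 < eps / (K / sg + 1) by rewrite divr_gt0// ltr_wpDl// divr_ge0// ltW.
have [N2 H2] := powR_small sg0 e'.
pose Q := (N1 + N2).+2.
(* Numerators of fractions close to [-M, M] lie within (M + 1) q of 0 and are written k - (M + 1) q
   with k natural. *)
pose U (q k : nat) : set R := if (Q <= q)%N && (k < 2 * M.+1 * q + 1)%N
  then [set t | `|t - (k%:Z - (M.+1 * q)%N%:Z)%:~R / q%:R| < q%:R `^ (- mu)] else set0.
have dU q k : (diameter (U q k) <= (2 * q%:R `^ (- mu))%:E)%E.
  rewrite /U; case: ifP => _; last by rewrite diameter_set0 leNye.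
  apply: diameter_le => x y /= hx hy.
  have := ler_distD ((k%:Z - (M.+1 * q)%N%:Z)%:~R / q%:R) x y.
  rewrite [`|_ / _ - y|]distrC; move: hx hy; lra.
have [V [UV VU sV]] := double_cover U s; exists V; split.
- move=> t [tW /= tM]; have [p [q [q0 Qq bd]]] := tW Q.
  have qp : (0 : R) < q%:R by rewrite ltr0n.
  have pq : `|p%:~R| <= M.+1%:R * q%:R :> R.
    rewrite -ler_pdivrMr// -[q%:R in leLHS]ger0_norm// -normf_div.
    have : q%:R `^ (- mu) <= 1 :> R.
      by rewrite powRN invf_le1 ?powR_gt0// one_le_powR ?ler1n// ltW.
    have := ler_distD t (p%:~R / q%:R) 0; rewrite !subr0 distrC -natr1.
    move: bd tM; lra.
  have [p1 p2] : (- (M.+1 * q)%N%:Z <= p)%R /\ (p <= (M.+1 * q)%N%:Z)%R.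
    move: pq; rewrite ler_norml -natrM pmulrn -rmorphN /= !ler_int => /andP[]. by [].
  apply: (UV q (absz (p + (M.+1 * q)%N%:Z))).
  rewrite /U; have pk : (absz (p + (M.+1 * q)%N%:Z))%:Z = p + (M.+1 * q)%N%:Z :> int.
    by rewrite gez0_abs// -lerBlDr sub0r.
  rewrite Qq /=; have -> : (absz (p + (M.+1 * q)%N%:Z)%R < 2 * M.+1 * q + 1)%N.
    by rewrite -mulnA -ltz_nat pk; exact: aux p2.
  by rewrite /= pk addrK.
- move=> n; have [q [k ->]] := VU n.
  rewrite /U; case: ifPn => [/andP[Qq kq]|_]; last by rewrite diameter_set0 leNye.
  have := dU q k; rewrite /U Qq kq /= => /le_trans; apply; rewrite lee_fin.
  have : q%:R `^ (- mu) <= delta / 2 by apply: H1; rewrite (leq_trans _ Qq)// /Q -addn2 -addnA leq_addr.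
  by move=> H; rewrite mulrC -ler_pdivlMr.
rewrite sV.
apply: (@le_trans _ _ (K / sg * Q.-1%:R `^ (- sg))%:E); last first.
  rewrite lee_fin; have := H2 Q.-1; rewrite /Q /= => /(_ (leqW (leq_addl _ _))).
  rewrite ler_pdivlMr ?ltr_wpDl// ?divr_ge0 ?(ltW sg0)// => H.
  apply: le_trans H; rewrite mulrC mulrDr mulr1 lerDl; exact: powR_ge0.
apply: nneseries_le => [q|n]; first by apply: nneseries_ge0 => *; exact: diameter_pow_ge0.
apply: le_trans (sum_tail_le n K0 sg0 (isT : (1 < Q)%N)).
apply: lee_sum => q _; case: ifPn => [Qq|nQq]; last first.
  apply: nneseries_le => [k|m]; first exact: diameter_pow_ge0.
  by rewrite big1// => k _; rewrite /U (negbTE nQq) diameter_pow0.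
have qp : (0 : R) < q%:R by rewrite ltr0n (leq_trans _ Qq).
apply: nneseries_le => [k|m]; first exact: diameter_pow_ge0.
pose b := 2 `^ s * q%:R `^ (- (s * mu)) : R.
have b0 : 0 <= b by rewrite mulr_ge0 ?powR_ge0.
apply: (@le_trans _ _ ((2 * M.+1 * q + 1)%N%:R * b)%:E).
  apply: le_trans (sum_indicator_le _ m b0); apply: lee_sum => k _.
  case: ifPn => [kq|kq]; last by rewrite /U (negbTE kq) andbF diameter_pow0.
  have -> : b = (2 * q%:R `^ (- mu)) `^ s.
    by rewrite /b powRM ?powR_ge0// -powRrM mulNr [s * mu]mulrC.
  by apply: diameter_pow_le; rewrite ?mulr_ge0 ?powR_ge0 ?(ltW s0).
rewrite lee_fin.
have -> : K * q%:R `^ (- sg - 1) = (2 * M.+1 + 1)%N%:R * q%:R * b.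
  have -> : - sg - 1 = 1 + - (s * mu) by rewrite /sg; ring.
  rewrite powRD; last by rewrite (gt_eqF qp) implybT.
  by rewrite powRr1 ?(ltW qp)// /K /b; ring.
rewrite ler_wpM2r// -natrM ler_nat mulnDl mul1n leq_add2l.
by rewrite (leq_trans _ Qq).
Qed.

Lemma well_approx_null mu s : 0 < mu -> 2 / mu < s -> hausdorff_measure s (well_approx mu) = 0%E.
Proof.
move=> mu0 smu.
apply: (hausdorff_null_subset _ (hausdorff_null_bigcup (fun M => @well_approx_bounded_null mu s M mu0 smu))).
move=> t Wt; exists (truncn `|t|).+1 => //; split => //=.
by rewrite ltW// truncnS_gt.
Qed.

Lemma hausdorff_dim_le A s : 0 <= s -> hausdorff_measure s A = 0%E -> (hausdorff_dim A <= s%:E)%E.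
Proof. by move=> s0 H; apply: ereal_inf_lbound; exists s. Qed.

Lemma hausdorff_dim_ge0 A : (0 <= hausdorff_dim A)%E.
Proof. by apply: le_ereal_inf_tmp => _ [s [s0 _] <-]; rewrite lee_fin. Qed.

Lemma negligible_cover d (T : measurableType d) (lam : {measure set T -> \bar R}) (N : set T) :
  (forall eps : R, 0 < eps -> exists I : nat -> set T, [/\ forall k, measurable (I k),
     N `<=` \bigcup_k I k & (\sum_(0 <= k <oo) lam (I k) <= eps%:E)%E]) ->
  lam.-negligible N.
Proof.
move=> H.
have [B HB] : {B : nat -> set T & forall n, [/\ measurable (B n), N `<=` B n &
    (lam (B n) <= (n.+1%:R^-1)%:E)%E]}.
  apply: (@choice _ _ (fun n (B : set T) => [/\ measurable B, N `<=` B &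
    (lam B <= (n.+1%:R^-1)%:E)%E])) => n.
  have e0 : 0 < n.+1%:R^-1 :> R by rewrite invr_gt0 ltr0n.
  have [I [mI NI sI]] := H _ e0.
  exists (\bigcup_k I k); split => //; first exact: bigcupT_measurable.
  by apply: le_trans sI; apply: generalized_Boole_inequality => //; exact: bigcupT_measurable.
exists (\bigcap_n B n); split.
- by apply: bigcapT_measurable => n; have [] := HB n.
- apply/eqP; rewrite eq_le measure_ge0 andbT.
  apply/lee_addgt0Pr => eps eps0; rewrite add0e.
  pose n := truncn eps^-1.
  have [mB _ HBn] := HB n.
  apply: (@le_trans _ _ (lam (B n))).
    apply: le_measure; rewrite ?inE//.
      by apply: bigcapT_measurable => k; have [] := HB k.
    by move=> x; apply.
  apply: (le_trans HBn); rewrite lee_fin -[leRHS]invrK lef_pV2 ?posrE ?invr_gt0 ?ltr0n//.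
  by rewrite ltW// truncnS_gt.
- by move=> x Hx n _; have [_ HN _] := HB n; apply: HN.
Qed.

Lemma exists_not_negligible d (T : measurableType d) (lam : {measure set T -> \bar R}) (S : set T)
  (N : nat -> set T) : measurable S -> lam S <> 0%E -> (forall n, lam.-negligible (N n)) ->
  exists x : T, S x /\ forall n, ~ N n x.
Proof.
move=> mS S0 HN; apply: contrapT => H; apply: S0.
have sub : S `<=` \bigcup_n N n.
  move=> x Sx; apply: contrapT => nN; apply: H; exists x; split => // n Nx.
  by apply: nN; exists n.
by have /negligibleP := negligibleS sub (negligible_bigcup HN); apply.
Qed.

(** The points of [0, 1) that G sends into one set U of a cover lie in an interval of length 2 C
    (diam U)^s; so a cover of A with small s-sum pulls back to one of small total length. *)
Lemma preimage_cover (G : R -> R) s C A eps : 0 <= s -> 0 <= C -> 0 < eps ->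
  (forall x y, 0 <= x -> x < y -> y < 1 -> y - x <= C * `|G y - G x| `^ s) ->
  hausdorff_measure s A = 0%E ->
  exists I : nat -> set R, [/\ forall k, exists a b, I k = `[a, b]%classic,
     [set x | 0 <= x < 1 /\ A (G x)] `<=` \bigcup_k I k &
     (\sum_(0 <= k <oo) lebesgue_measure (I k) <= eps%:E)%E].
Proof.
move=> s0 C0 eps0 HG HA.
have loc U : (diameter U <= 1%:E)%E -> exists I : set R, [/\ exists a b, I = `[a, b]%classic,
   (forall x, 0 <= x < 1 -> U (G x) -> I x) &
   (lebesgue_measure I <= (2 * C)%:E * diameter_pow s U)%E].
  move=> d1.
  have [[x [x01 Ux]]|nx] := pselect (exists x, 0 <= x < 1 /\ U (G x)); last first.
    (* An empty interval, for a set U that G does not meet on [0, 1). *)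
    exists `[1, 0]%classic; split; first by exists 1, 0.
      by move=> x x01 Ux; exfalso; apply: nx; exists x.
    rewrite lebesgue_measure_itv /= lte_fin ltr10.
    by rewrite mule_ge0 ?diameter_pow_ge0// lee_fin mulr_ge0.
  have dge := diameter_ge0 Ux.
  pose d := fine (diameter U).
  have dE : diameter U = d%:E.
    by rewrite fineK// ge0_fin_numE// (le_lt_trans d1) ?ltey.
  have d0 : 0 <= d by rewrite -lee_fin -dE.
  have U0 : U != set0 by apply/set0P; exists (G x).
  have dist y : U (G y) -> `|G y - G x| <= d.
    move=> Uy; rewrite -lee_fin -dE; apply: ereal_sup_ubound; exists (G y, G x) => //.
  exists `[x - C * d `^ s, x + C * d `^ s]%classic; split.
  - by exists (x - C * d `^ s), (x + C * d `^ s).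
  - move=> y y01 Uy; rewrite /= in_itv /=.
    have Cd : C * `|G y - G x| `^ s <= C * d `^ s.
      rewrite ler_wpM2l//; apply: ge0_ler_powR; rewrite ?nnegrE//; exact: dist.
    have Cd0 : 0 <= C * d `^ s by rewrite mulr_ge0 ?powR_ge0.
    move/andP: x01 => [x0 x1]; move/andP: y01 => [y0 y1].
    have [xy|yx|E] := ltgtP x y.
    + have := HG x y x0 xy y1; move: Cd Cd0 xy; lra.
    + have := HG y x y0 yx x1; rewrite distrC; move: Cd Cd0 yx; lra.
    + by rewrite -E; move: Cd0; lra.
  - rewrite lebesgue_measure_itv /= lte_fin /diameter_pow (negbTE U0) dE poweR_EFin -EFinM.
    case: ifP => _; last by rewrite lee_fin !mulr_ge0 ?powR_ge0.
    by rewrite -EFinD lee_fin; lra.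
have e0 : 0 < eps / (2 * C + 1) by rewrite divr_gt0// ltr_wpDl// mulr_ge0.
have [U [AU dU sU]] := hausdorff_measure_cover HA e0 ltr01.
have [I HI] : {I : nat -> set R & forall k, [/\ exists a b, I k = `[a, b]%classic,
   (forall x, 0 <= x < 1 -> U k (G x) -> I k x) &
   (lebesgue_measure (I k) <= (2 * C)%:E * diameter_pow s (U k))%E]}.
  apply: (@choice _ _ (fun k (I : set R) => [/\ exists a b, I = `[a, b]%classic,
   (forall x, 0 <= x < 1 -> U k (G x) -> I x) &
   (lebesgue_measure I <= (2 * C)%:E * diameter_pow s (U k))%E])) => k.
  exact: loc.
exists I; split.
- by move=> k; have [] := HI k.
- move=> x /= [x01 Ax]; have [k _ Ukx] := AU _ Ax; exists k => //.
  by have [_ H _] := HI k; apply: H.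
- apply: (@le_trans _ _ (\sum_(0 <= k <oo) (2 * C)%:E * diameter_pow s (U k))%E).
    by apply: lee_nneseries => [k *|k *] //; have [] := HI k.
  rewrite nneseriesZl; last by move=> k _; exact: diameter_pow_ge0.
  apply: le_trans (lee_wpmul2l _ sU) _; first by rewrite lee_fin mulr_ge0.
  rewrite -EFinM lee_fin mulrCA ler_piMr ?(ltW eps0)//.
  by rewrite ler_pdivrMr ?ltr_wpDl ?mulr_ge0// mul1r lerDl.
Qed.

Lemma avoid_null (G : R -> R) (D : R) (A : nat -> set R) :
  (forall s, 0 <= s -> s < D -> exists2 C, 0 <= C & forall x y, 0 <= x -> x < y -> y < 1 ->
     y - x <= C * `|G y - G x| `^ s) ->
  (forall n, exists s, [/\ 0 <= s, s < D & hausdorff_measure s (A n) = 0%E]) ->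
  exists x, 0 <= x < 1 /\ forall n, ~ A n (G x).
Proof.
move=> HG HA.
have [|||x [x01 Hx]] := @exists_not_negligible _ _ (@lebesgue_measure R) `[0, 1[%classic
    (fun n => [set x | 0 <= x < 1 /\ A n (G x)]).
- exact: measurable_itv.
- have H1 : (lebesgue_measure ([set` `[0%R, 1%R[] : set R) = 1)%E.
    by rewrite lebesgue_measure_itv /= lte_fin ltr01 oppr0 adde0.
  by move=> E; have /eqP := etrans (esym H1) E; rewrite eqe oner_eq0.
- move=> n; have [s [s0 sD HAs]] := HA n; have [C C0 HC] := HG s s0 sD.
  apply: negligible_cover => eps eps0.
  have [I [mI NI sI]] := preimage_cover s0 C0 eps0 HC HAs.
  exists I; split => // k; have [a [b ->]] := mI k; exact: measurable_itv.
- by move: x01; rewrite /= in_itv /= => x01; exists x; split => // n An; apply: (Hx n).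
Qed.

Lemma hausdorff_dim_ge (G : R -> R) (D : R) (E : set R) (A : nat -> set R) :
  (forall s, 0 <= s -> s < D -> exists2 C, 0 <= C & forall x y, 0 <= x -> x < y -> y < 1 ->
     y - x <= C * `|G y - G x| `^ s) ->
  (forall n, exists s, [/\ 0 <= s, s < D & hausdorff_measure s (A n) = 0%E]) ->
  (forall x, 0 <= x < 1 -> (forall n, ~ A n (G x)) -> E (G x)) ->
  (D%:E <= hausdorff_dim E)%E.
Proof.
move=> HG HA HE; rewrite leNgt; apply/negP => /ereal_inf_lt[_ [s [s0 Hs] <-]].
rewrite lte_fin => sD.
(* E itself joins the sets to be avoided: were it null for some s < D, a point of E would avoid
   E. *)
have [|x [x01 Hx]] := @avoid_null G D (fun n => if n is n'.+1 then A n' else E) HG.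
  by case=> [|n]; [exists s|exact: HA].
by apply: (Hx 0%N); apply: HE => // n; exact: (Hx n.+1).
Qed.

End Hausdorff.

(** * A Cantor-like embedding of [0, 1) *)

Section Tree.
Variable R : realType.
Implicit Types (x y h t a b s l : R).

Lemma powR_le1 x a : 0 <= x <= 1 -> 0 <= a -> x `^ a <= 1.
Proof.
move=> /andP[x0 x1] a0; have E : (1 : R) `^ a = 1 by rewrite powR1.
by rewrite -[leRHS]E ge0_ler_powR ?nnegrE.
Qed.

(* One step of the construction of a map [F] on [0, 1): every interval of length
   [l] contains [m] separated intervals of length [l'] on which [G] holds, spread
   evenly enough for the digit [j / m] to be Hoelder in the position [c j]. *)
Definition stage (G : R -> Prop) (l s : R) (m : nat) (l' : R) : Prop :=
  [/\ (2 <= m)%N, 0 < l', l' <= l, m%:R^-1 <= l' `^ s &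
   forall a : R, exists c : nat -> R,
    (forall j : nat, (j < m)%N -> [/\ a <= c j, c j + l' <= a + l &
       forall t, c j <= t <= c j + l' -> G t]) /\
    (forall i j : nat, (i < j)%N -> (j < m)%N -> 2 * l' <= c j - c i /\
       forall s', 0 <= s' -> s' <= s ->
       (j - i)%N%:R / m%:R <= 32 * l `^ (- s') * (c j - c i) `^ s')].

(** x is expanded in the mixed radix m 0, m 1, ...; its digits select nested intervals, and F x lies
    in all of them. If x < y first differ at the digit N, then y - x is at most twice the difference
    of these digits over [M N.+1], while F x and F y lie in two separated intervals of stage N. *)
Lemma tree_map (G : nat -> R -> Prop) (D : R) : 0 < D ->
  (forall n l s, 0 < l -> l <= 1 -> 0 <= s -> s < D -> exists m l', stage (G n) l s m l') ->
  exists F : R -> R,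
  (forall s, 0 <= s -> s < D -> exists2 C, 0 <= C & forall x y, 0 <= x -> x < y -> y < 1 ->
     y - x <= C * `|F y - F x| `^ s) /\
  (forall x n, 0 <= x < 1 -> G n (F x)).
Proof.
move=> D0 H.
(* These exponents increase to D, so that a single map serves every s < D: only finitely many of
   them are below s. *)
pose sn (n : nat) : R := D * (1 - n.+1%:R^-1).
have sn0 n : 0 <= sn n by rewrite mulr_ge0 ?(ltW D0)// subr_ge0 invf_le1 ?ltr0n// ler1n.
have snD n : sn n < D by rewrite /sn gtr_pMr// gtrBl invr_gt0 ltr0n.
have [f Hf] : {f : nat * R -> nat * R & forall p, 0 < p.2 -> p.2 <= 1 ->
    stage (G p.1) p.2 (sn p.1) (f p).1 (f p).2}.
  apply: (@choice _ _ (fun p fp => 0 < p.2 -> p.2 <= 1 -> stage (G p.1) p.2 (sn p.1) fp.1 fp.2)).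
  move=> [n l] /=.
  have [l01|nl] := pselect (0 < l /\ l <= 1).
    by have [m [l' Hm]] := H n l (sn n) l01.1 l01.2 (sn0 n) (snD n); exists (m, l').
  by exists (0%N, 0) => l0 l1; case: nl.
pose fix l (n : nat) : R := if n is n'.+1 then (f (n', l n')).2 else 1.
pose m (n : nat) : nat := (f (n, l n)).1.
have l01 n : 0 < l n /\ l n <= 1.
  elim: n => [|n [l0 l1]] /=; first by rewrite ltr01 lexx.
  have [_ h1 h2 _ _] := Hf (n, l n) l0 l1; split => //; exact: le_trans l1.
have St n : stage (G n) (l n) (sn n) (m n) (l n.+1).
  by have [l0 l1] := l01 n; exact: (Hf (n, l n) l0 l1).
have m2 n : (2 <= m n)%N by have [] := St n.
have mp n : (0 : R) < (m n)%:R by rewrite ltr0n (leq_trans _ (m2 n)).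
have lS n : l n.+1 <= l n by have [] := St n.
have lmono n k : l (n + k)%N <= l n.
  by elim: k => [|k IH]; [rewrite addn0|rewrite addnS (le_trans (lS _))].
have [c Hc] : {c : nat * R -> nat -> R & forall p : nat * R,
    (forall j : nat, (j < m p.1)%N -> [/\ p.2 <= c p j, c p j + l p.1.+1 <= p.2 + l p.1 &
       forall t, c p j <= t <= c p j + l p.1.+1 -> G p.1 t]) /\
    (forall i j : nat, (i < j)%N -> (j < m p.1)%N -> 2 * l p.1.+1 <= c p j - c p i /\
       forall s', 0 <= s' -> s' <= sn p.1 ->
       (j - i)%N%:R / (m p.1)%:R <= 32 * l p.1 `^ (- s') * (c p j - c p i) `^ s')}.
  apply: (@choice _ _ (fun (p : nat * R) (c : nat -> R) =>
    (forall j : nat, (j < m p.1)%N -> [/\ p.2 <= c j, c j + l p.1.+1 <= p.2 + l p.1 &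
       forall t, c j <= t <= c j + l p.1.+1 -> G p.1 t]) /\
    (forall i j : nat, (i < j)%N -> (j < m p.1)%N -> 2 * l p.1.+1 <= c j - c i /\
       forall s', 0 <= s' -> s' <= sn p.1 ->
       (j - i)%N%:R / (m p.1)%:R <= 32 * l p.1 `^ (- s') * (c j - c i) `^ s'))).
  by move=> [n a]; have [_ _ _ _ /(_ a)] := St n.
pose fix r x (n : nat) : R := if n is n'.+1 then
  (m n')%:R * r x n' - (truncn ((m n')%:R * r x n'))%:R else x.
pose d x n := truncn ((m n)%:R * r x n).
pose fix A x (n : nat) : R := if n is n'.+1 then c (n', A x n') (d x n') else 0.
have r01 x n : 0 <= x < 1 -> 0 <= r x n < 1.
  move=> x01; elim: n => [|n /andP[r0 r1]] //=.
  have p0 : 0 <= (m n)%:R * r x n by rewrite mulr_ge0.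
  have := truncnS_gt ((m n)%:R * r x n); rewrite -natr1 => t1.
  have t2 : (truncn ((m n)%:R * r x n))%:R <= (m n)%:R * r x n by rewrite truncn_le.
  by apply/andP; split; move: t1 t2; lra.
have dm x n : 0 <= x < 1 -> (d x n < m n)%N.
  move=> x01; have /andP[r0 r1] := r01 x n x01.
  rewrite -(ltr_nat R) (@le_lt_trans _ _ ((m n)%:R * r x n))// ?truncn_le ?mulr_ge0//.
  by rewrite gtr_pMr.
have AS x n : 0 <= x < 1 -> A x n <= A x n.+1 /\ A x n.+1 + l n.+1 <= A x n + l n.
  by move=> x01; have [/(_ _ (dm x n x01))[h1 h2 _] _] := Hc (n, A x n).
have Amono x n k : 0 <= x < 1 -> A x n <= A x (n + k)%N /\ A x (n + k)%N + l (n + k)%N <= A x n + l n.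
  move=> x01; elim: k => [|k [h1 h2]]; first by rewrite addn0.
  have [h3 h4] := AS x (n + k)%N x01; rewrite addnS; split; [exact: le_trans h3|exact: le_trans h2].
pose F x := sup (range (A x)).
have Fin x n : 0 <= x < 1 -> A x n <= F x <= A x n + l n.
  move=> x01.
  have ub n0 : ubound (range (A x)) (A x n0 + l n0).
    move=> _ [k _ <-]; have [nk|kn] := leqP n0 k.
      have [_] := Amono x n0 (k - n0)%N x01; rewrite subnKC//; apply: le_trans.
      by rewrite lerDl; case: (l01 k) => /ltW.
    have [+ _] := Amono x k (n0 - k)%N x01; rewrite subnKC ?(ltnW kn)// => /le_trans; apply.
    by rewrite lerDl; case: (l01 n0) => /ltW.
  have hs : has_sup (range (A x)).
    by split; [exists (A x 0), 0%N|exists (A x 0 + l 0); exact: ub].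
  apply/andP; split; first by apply: sup_upper_bound => //; exists n.
  by apply: ge_sup; [case: hs|exact: ub].
exists F; split; last first.
  move=> x n x01; have [/(_ _ (dm x n x01))[_ _ h] _] := Hc (n, A x n).
  by apply: h; exact: (Fin x n.+1).
move=> s s0 sD.
pose M (n : nat) : R := \prod_(k < n) (m k)%:R.
have M0 n : 0 < M n by rewrite prodr_gt0.
have MS n : M n.+1 = M n * (m n)%:R by rewrite /M big_ord_recr.
have M1 n : 1 <= M n.
  elim: n => [|n IH]; first by rewrite /M big_ord0.
  by rewrite MS mulr_ege1// ler1n (leq_trans _ (m2 n)).
have M2 n : n%:R <= M n.
  elim: n => [|n IH]; first exact: ltW.
  rewrite MS; apply: (@le_trans _ _ (M n * 2)); last by rewrite ler_pM2l// ler_nat.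
  by rewrite -natr1; have := M1 n; move: IH; lra.
have [n0 Hn0] : exists n0 : nat, forall n, (n0 <= n)%N -> s <= sn n.
  exists (truncn (D / (D - s))) => n Hn.
  have Ds : 0 < D - s by rewrite subr_gt0.
  have : D / (D - s) < n.+1%:R by rewrite (lt_le_trans (truncnS_gt _))// ler_nat ltnS.
  rewrite ltr_pdivrMr// => h; rewrite /sn mulrBr mulr1 lerBrDr addrC -lerBrDr.
  by rewrite ler_pdivrMr ?ltr0n// mulrC ltW.
(* The second summand covers the stages n <= n0, where the gaps are at least [2 * l n0.+1]. *)
pose C0 : R := 32 + (2 * l n0.+1) `^ (- s).
have C00 : 0 <= C0 by rewrite addr_ge0 ?powR_ge0.
have key n a (i j : nat) : (i < j)%N -> (j < m n)%N ->
    (j - i)%N%:R / M n.+1 <= C0 * (c (n, a) j - c (n, a) i) `^ s /\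
    l n.+1 <= (c (n, a) j - c (n, a) i) / 2.
  move=> ij jm; have [_ /(_ i j ij jm)[/= h1 h2]] := Hc (n, a).
  set dd := _ - _ in h1 h2 *.
  have [l0 l1] := l01 n.+1.
  split; last by rewrite ler_pdivlMr// mulrC.
  have dd0 : 0 < dd by rewrite (lt_le_trans _ h1)// mulr_gt0.
  have [nn|nn] := leqP n0.+1 n; last first.
    have ln : l n0.+1 <= l n.+1 by rewrite -(subnKC nn) lmono.
    have h3 : (2 * l n0.+1) `^ s <= dd `^ s.
      apply: ge0_ler_powR; rewrite ?nnegrE ?mulr_ge0 ?(ltW dd0) ?(ltW (l01 _).1)//.
      by rewrite (le_trans _ h1)// ler_pM2l.
    apply: (@le_trans _ _ 1).
      rewrite ler_pdivrMr// mul1r (@le_trans _ _ (m n)%:R)// ?ler_nat.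
        by rewrite (leq_trans (leq_subr _ _))// ltnW.
      by rewrite MS ler_peMl.
    have p0 : 0 < (2 * l n0.+1) `^ s by rewrite powR_gt0// mulr_gt0// (l01 _).1.
    apply: (@le_trans _ _ ((2 * l n0.+1) `^ (- s) * dd `^ s)).
      by rewrite powRN ler_pdivlMl// mulr1.
    by rewrite ler_wpM2r ?powR_ge0// lerDr.
  have sn1 : s <= sn n by apply: Hn0; exact: ltnW.
  have {h2} := h2 s s0 sn1 => h2.
  (* The preceding stage is used: 1/M n <= 1/m (n-1) <= (l n)^s, which is why n has to exceed n0. *)
  have Ml : (M n)^-1 <= l n `^ s.
    case: n nn {a sn1 h1 h2 dd dd0 l0 l1 jm} => // n nn.
    have [_ _ _ h3 _] := St n.
    have [l0 l1] := l01 n.+1.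
    apply: (@le_trans _ _ (l n.+1 `^ sn n)).
      by apply: le_trans h3; rewrite lef_pV2 ?posrE// MS ler_peMl//.
    have [s00|sp] := eqVneq s 0.
      by rewrite s00 powRr0 powR_le1 ?(ltW l0)// (ltW l0).
    apply: powR_anti_exp; rewrite ?(ltW l0) ?l1//.
      by rewrite lt_neqAle eq_sym sp.
    exact: Hn0.
  rewrite MS invfM mulrCA.
  have [ln0 ln1] := l01 n.
  apply: (@le_trans _ _ (l n `^ s * (32 * l n `^ (- s) * dd `^ s))).
    by apply: ler_pM => //; rewrite invr_ge0 ltW.
  have E : l n `^ s * l n `^ (- s) = 1.
    by rewrite powRN mulfV// gt_eqF// powR_gt0.
  have -> : l n `^ s * (32 * l n `^ (- s) * dd `^ s) = 32 * (l n `^ s * l n `^ (- s)) * dd `^ s by ring.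
  by rewrite E mulr1 ler_wpM2r ?powR_ge0// lerDl powR_ge0.
exists (2 * C0 * 2 `^ s); first by rewrite !mulr_ge0 ?powR_ge0.
move=> x y x0 xy y1.
have x01 : 0 <= x < 1 by rewrite x0 (lt_trans xy).
have y01 : 0 <= y < 1 by rewrite y1 (le_trans x0 (ltW xy)).
have agree n : (forall k, (k < n)%N -> d x k = d y k) ->
    A x n = A y n /\ r y n - r x n = M n * (y - x).
  elim: n => [|n IH] Hd; first by rewrite /M big_ord0 mul1r.
  have [E1 E2] := IH (fun k kn => Hd k (ltnW kn)).
  have E3 := Hd n (ltnSn n); split; first by rewrite /= E1 E3.
  rewrite MS mulrAC -E2 /= -/(d x n) -/(d y n) E3; ring.
have [n dn] : exists n, d x n != d y n.
  apply: contrapT => /forallNP Hd.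
  pose n := (truncn (y - x)^-1).+1.
  have [|_ E] := agree n; first by move=> k _; apply/eqP; move: (Hd k) => /negP; rewrite negbK.
  have /andP[_ ry] := r01 y n y01; have /andP[rx _] := r01 x n x01.
  have yx : 0 < y - x by rewrite subr_gt0.
  have : M n * (y - x) < 1 by rewrite -E; move: rx ry; lra.
  rewrite ltNge => /negP; apply.
  rewrite -ler_pdivrMr// div1r (le_trans _ (M2 n))// ltW//; exact: truncnS_gt.
have exn : exists n, d x n != d y n by exists n.
pose N := ex_minn exn.
have [dN minN] : d x N != d y N /\ forall k, (k < N)%N -> d x k = d y k.
  rewrite /N; case: ex_minnP => k dk mk; split => // i ik.
  by apply/eqP; apply: contraLR ik => /mk; rewrite -leqNgt.
have [EA Er] := agree N minN.
have /andP[rx0 rx1] := r01 x N x01; have /andP[ry0 ry1] := r01 y N y01.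
have rxy : r x N < r y N.
  by rewrite -subr_gt0 Er mulr_gt0 ?subr_gt0.
have dxy : (d x N < d y N)%N.
  rewrite ltn_neqAle dN le_truncn// ler_pM2l//; exact: ltW.
have [k1 k2] := key N (A x N) _ _ dxy (dm y N y01).
have /andP[fy1 fy2] := Fin y N.+1 y01; have /andP[fx1 fx2] := Fin x N.+1 x01.
rewrite /= -EA in fy1 fy2; rewrite /= in fx1 fx2.
set cy := c _ _ in fy1 fy2 k1 k2; set cx := c _ _ in fx1 fx2 k1 k2.
(* The gap between the left ends is at least twice the length of the intervals, so half of it
   survives. *)
have dist : (cy - cx) / 2 <= F y - F x by move: k2 fy1 fx2; clear; lra.
have lp := (l01 N.+1).1.
have cc : 0 < cy - cx by move: k2 lp; clear; lra.
have dd1 : (cy - cx) `^ s <= 2 `^ s * `|F y - F x| `^ s.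
  rewrite -powRM// ge0_ler_powR ?nnegrE ?mulr_ge0 ?(ltW cc)//.
  by have := ler_norm (F y - F x); move: dist; clear; lra.
(* As the digits differ by at least 1, the remaining fractional parts cost at most a factor 2. *)
have MM : M N.+1 * (y - x) <= 2 * (d y N - d x N)%N%:R.
  rewrite MS mulrAC -Er natrB ?(ltnW dxy)//.
  have t1 : (m N)%:R * r y N < (d y N).+1%:R by exact: truncnS_gt.
  have t2 : (d x N)%:R <= (m N)%:R * r x N by rewrite truncn_le// mulr_ge0.
  have t3 : (d x N).+1%:R <= (d y N)%:R :> R by rewrite ler_nat.
  rewrite -natr1 in t1; rewrite -natr1 in t3; by move: t1 t2 t3; clear; lra.
have : y - x <= 2 * ((d y N - d x N)%N%:R / M N.+1).
  by rewrite mulrA ler_pdivlMr// mulrC.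
move=> /le_trans; apply.
rewrite -!mulrA ler_pM2l// (le_trans k1)// ler_wpM2l//.
Qed.

End Tree.

(** * Counting reduced fractions *)

Section CoprimeCount.
Variable R : realType.
Implicit Types (a b eps u v : R).

Definition sifted (s : seq nat) (n : nat) : bool := all (fun p => ~~ (p %| n)%N) s.

Definition sifted_count (s : seq nat) (N : nat) : nat := (\sum_(0 <= n < N) sifted s n)%N.

(** (N + p - 1) / p is N/p rounded up, the number of multiples of p below N with 0 included. *)
Lemma sifted_count_multiples (p : nat) (s : seq nat) (N : nat) : prime p -> all prime s ->
  p \notin s ->
  (\sum_(0 <= n < N) ((p %| n) && sifted s n) = sifted_count s ((N + p.-1) %/ p))%N.
Proof.
move=> pp sp ps; have p0 := prime_gt0 pp.
have siftM m : sifted s (p * m)%N = sifted s m.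
  apply: eq_in_all => l ls; have lp := allP sp l ls.
  rewrite Euclid_dvdM// (dvdn_prime2 lp pp).
  by case: eqP => // E; rewrite E in ls; rewrite ls in ps.
elim: N => [|N IH].
  by rewrite big_geq// /sifted_count add0n divn_small ?big_geq// prednK.
rewrite big_nat_recr//= IH; case: (boolP (p %| N)%N) => [/dvdnP[m ->]|pN].
  have -> : ((m * p + p.-1) %/ p = m)%N by rewrite divnMDl// divn_small ?addn0// prednK.
  have -> : (((m * p).+1 + p.-1) %/ p = m.+1)%N by rewrite addSnnS prednK// divnMDl// divnn p0 addn1.
  by rewrite mulnC siftM /sifted_count big_nat_recr.
rewrite addn0; congr (sifted_count _ _).
rewrite addSnnS prednK// [((N + p) %/ p)%N]divnDr ?dvdnn// divnn p0.
rewrite {1}(divn_eq N p) -addnA divnMDl//.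
have r0 : (0 < N %% p)%N by rewrite lt0n.
have -> : (N %% p + p.-1 = (N %% p).-1 + p)%N by rewrite -{1}(prednK r0) addSn -addnS prednK.
rewrite divnDr ?dvdnn// divnn p0; have -> : ((N %% p).-1 %/ p = 0)%N.
  by rewrite divn_small// (leq_ltn_trans (leq_pred _))// ltn_pmod.
by rewrite add0n.
Qed.

(** Legendre's sieve by induction on the primes: a new prime doubles the error and adds 1, and each
    factor 1 - 1/p is at least 1/2. *)
Lemma sifted_bound (s : seq nat) (N : nat) : uniq s -> all prime s ->
  `|(sifted_count s N)%:R - N%:R * \prod_(p <- s) (1 - p%:R^-1 : R)| <= 2 ^+ size s - 1 /\
  2 ^- size s <= \prod_(p <- s) (1 - p%:R^-1 : R) <= 1.
Proof.
have aux (i j k : nat) : (i + j < j.+1 + k)%N -> (i <= k)%N by rewrite addSn ltnS addnC leq_add2l.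
elim: s N => [|p s IH] N.
  move=> _ _; rewrite big_nil mulr1 expr0 invr1 lexx /=; split => //.
  rewrite /sifted_count; under eq_bigr do rewrite /sifted /=.
  by rewrite sum_nat_const_nat subn0 muln1 !subrr normr0.
move=> /= /andP[ps us] /andP[pp sp].
have p0 := prime_gt0 pp; have p2 := prime_gt1 pp.
have pR : (0 : R) < p%:R by rewrite ltr0n.
have [IHN /andP[P1 P2]] := IH N us sp.
have [IHM _] := IH ((N + p.-1) %/ p)%N us sp.
rewrite big_cons; set P := \prod_(_ <- s) _ in IHN IHM P1 P2 *.
have pi2 : p%:R^-1 <= 1 / 2 :> R by rewrite div1r lef_pV2 ?posrE ?ler_nat.
have pi0 : 0 < p%:R^-1 :> R by rewrite invr_gt0.
have P0 : 0 < P by apply: lt_le_trans P1; rewrite invr_gt0 exprn_gt0.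
split; last first.
  apply/andP; split; last by rewrite mulr_ile1//; move: pi2 pi0 P0 P2; lra.
  rewrite exprS invfM; apply: ler_pM => //; rewrite ?invr_ge0 ?exprn_ge0//.
  by move: pi2; lra.
have E : (sifted_count (p :: s) N + sifted_count s ((N + p.-1) %/ p) = sifted_count s N)%N.
  rewrite -sifted_count_multiples// /sifted_count -big_split /=.
  by apply: eq_bigr => n _; rewrite /sifted /=; case: (p %| n)%N; case: all.
have {E} -> : (sifted_count (p :: s) N)%:R = (sifted_count s N)%:R - (sifted_count s ((N + p.-1) %/ p))%:R :> R.
  by rewrite -E natrD addrK.
set M := ((N + p.-1) %/ p)%N in IHM *.
have MN : `|M%:R - N%:R / p%:R| <= 1 :> R.
  have h1 : (M * p <= N + p.-1)%N by exact: leq_divM.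
  have h2 : (N + p.-1 < M.+1 * p)%N by exact: ltn_ceil.
  have h1' : M%:R * p%:R <= N%:R + p%:R :> R.
    by rewrite -natrM -natrD ler_nat (leq_trans h1)// leq_add2l leq_pred.
  have h2' : N%:R <= M%:R * p%:R :> R.
    rewrite -natrM ler_nat; apply: (@aux _ p.-1).
    by rewrite prednK// -mulSn.
  rewrite ger0_norm; last by rewrite subr_ge0 ler_pdivrMr.
  by rewrite lerBlDr -(ler_pM2r pR) mulrDl mul1r divfK ?gt_eqF// addrC.
have -> : (sifted_count s N)%:R - (sifted_count s M)%:R - N%:R * ((1 - p%:R^-1) * P) =
  ((sifted_count s N)%:R - N%:R * P) - ((sifted_count s M)%:R - M%:R * P) - (M%:R - N%:R / p%:R) * P.
  by ring.
rewrite (le_trans (ler_normB _ _))//.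
have : `|(M%:R - N%:R / p%:R) * P| <= 1.
  by rewrite normrM (ger0_norm (ltW P0)) mulr_ile1// ltW.
have := ler_normB ((sifted_count s N)%:R - N%:R * P) ((sifted_count s M)%:R - M%:R * P).
by rewrite exprS; move: IHN IHM; lra.
Qed.

Lemma sifted_coprime (q n : nat) : (0 < q)%N -> sifted (primes q) n -> coprime n q.
Proof.
move=> q0 /allP H; rewrite /coprime eqn_leq gcdn_gt0 q0 orbT andbT leqNgt; apply/negP => g1.
have pr := pdiv_prime g1; have dg := pdiv_dvd (gcdn n q).
have := H (pdiv (gcdn n q)); rewrite mem_primes pr q0 (dvdn_trans dg (dvdn_gcdr _ _)).
by move=> /(_ isT); rewrite (dvdn_trans dg (dvdn_gcdl _ _)).
Qed.

Lemma prod_primes_dvd (s : seq nat) (q : nat) : uniq s -> all prime s -> all (fun p => (p %| q)%N) s ->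
  (\prod_(p <- s) p %| q)%N.
Proof.
elim: s => [|p s IH] /=; first by rewrite big_nil dvd1n.
move=> /andP[ps us] /andP[pp sp] /andP[pq sq]; rewrite big_cons Gauss_dvd ?pq ?IH//.
rewrite prime_coprime// Euclid_dvd_prod// big_has; apply/hasPn => l ls.
have lp := allP sp l ls; rewrite (dvdn_prime2 pp lp).
by apply: contraNneq ps => ->.
Qed.

(** The primes of q with p >= Y satisfy 2 <= p^eps and account together for at most q^eps; there are
    at most Y smaller ones. *)
Lemma two_pow_omega eps : 0 < eps -> exists2 C : R, 1 <= C & forall q : nat, (0 < q)%N ->
  2 ^+ size (primes q) <= C * q%:R `^ eps.
Proof.
move=> eps0; pose Y := (truncn ((2 : R) `^ eps^-1)).+1.
have HY (p : nat) : (Y <= p)%N -> 2 <= (p%:R : R) `^ eps.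
  move=> Yp; have h : (2 : R) `^ eps^-1 <= p%:R.
    by rewrite ltW// (lt_le_trans (truncnS_gt _))// ler_nat.
  have := @ge0_ler_powR R eps (ltW eps0) _ _ _ _ h.
  rewrite !nnegrE powR_ge0 ler0n => /(_ isT isT).
  by rewrite -powRrM mulVf ?gt_eqF// powRr1.
exists (2 ^+ Y); first by rewrite exprn_ege1// ler1n.
move=> q q0.
pose s1 := [seq p <- primes q | (p < Y)%N]; pose s2 := [seq p <- primes q | ~~ (p < Y)%N].
have -> : size (primes q) = (size s1 + size s2)%N.
  by rewrite !size_filter; rewrite -(count_predC (fun p => (p < Y)%N)).
have sz1 : (size s1 <= Y)%N.
  rewrite -[leqRHS](size_iota 0); apply: uniq_leq_size; first by rewrite filter_uniq// primes_uniq.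
  by move=> p; rewrite mem_filter mem_iota add0n => /andP[].
rewrite exprD; apply: ler_pM; rewrite ?exprn_ge0//.
  by rewrite ler_weXn2l// ler1n.
have pq : (\prod_(p <- s2) p)%N%:R <= (q%:R : R).
  rewrite ler_nat dvdn_leq// prod_primes_dvd//.
  - by rewrite filter_uniq// primes_uniq.
  - by apply/allP => p; rewrite mem_filter mem_primes => /andP[_ /andP[]].
  - by apply/allP => p; rewrite mem_filter mem_primes => /andP[_ /and3P[]].
apply: (@le_trans _ _ ((\prod_(p <- s2) p)%N%:R `^ eps)); last first.
  by apply: ge0_ler_powR; rewrite ?nnegrE ?(ltW eps0).
have : all (fun p => Y <= p)%N s2 by apply/allP => p; rewrite mem_filter -leqNgt => /andP[].
elim: s2 {pq} => [|p s IH] /=; first by rewrite big_nil powR1.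
move=> /andP[pY sY]; rewrite big_cons natrM powRM// exprS.
by apply: ler_pM; rewrite ?exprn_ge0 ?HY ?IH.
Qed.

(** The density of the integers coprime to q is at least 2^-omega(q), and the sieve errs by less
    than 2^omega(q) at each end, where 2^omega(q) is O(q^eps). *)
Lemma coprime_count eps : 0 < eps -> exists2 C : R, 1 <= C & forall q a b : nat, (0 < q)%N -> (a <= b)%N ->
  (b - a)%N%:R / (C * q%:R `^ eps) - 2 * C * q%:R `^ eps <=
  (size [seq n <- iota a (b - a) | coprime n q])%:R.
Proof.
move=> /two_pow_omega[C C1 HC]; exists C => // q a b q0 ab.
have := HC q q0; set W := 2 ^+ _ => WC.
have W0 : 0 < W by rewrite exprn_gt0.
have sp : all prime (primes q) by apply/allP => p; rewrite mem_primes => /and3P[].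
have [Hb /andP[P1 P2]] := sifted_bound b (primes_uniq q) sp.
have [Ha _] := sifted_bound a (primes_uniq q) sp.
set P := \prod_(_ <- _) _ in Ha Hb P1 P2; rewrite -/W in Ha Hb P1.
have E : (sifted_count (primes q) b = sifted_count (primes q) a + \sum_(a <= n < b) sifted (primes q) n)%N.
  by rewrite /sifted_count (big_cat_nat (n := a)).
have le : (\sum_(a <= n < b) sifted (primes q) n <= size [seq n <- iota a (b - a) | coprime n q])%N.
  rewrite size_filter -sum1_count /index_iota big_mkcond [leqRHS]big_mkcond /=.
  apply: leq_sum => n _; case: ifP => //; case: (boolP (sifted _ _)) => // sn.
  by rewrite (sifted_coprime q0 sn).
apply: (@le_trans _ _ (\sum_(a <= n < b) sifted (primes q) n)%N%:R); last by rewrite ler_nat.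
have ba : b%:R = a%:R + (b - a)%N%:R :> R by rewrite -natrD subnKC.
set T := (\sum_(a <= n < b) _)%N in E le *.
rewrite E natrD ba in Hb.
have lo : (b - a)%N%:R * P - 2 * W <= T%:R.
  by move: Ha Hb; rewrite !ler_norml => /andP[h1 h2] /andP[h3 h4]; lra.
have CW : 0 < C * q%:R `^ eps by exact: lt_le_trans WC.
apply: le_trans lo; apply: lerB.
  rewrite ler_wpM2l// (le_trans _ P1)// lef_pV2 ?posrE//.
by rewrite -mulrA ler_pM2l.
Qed.

Definition fval (f : nat * nat) : R := f.1%:R / f.2%:R.

Lemma fval_sep (f g : nat * nat) (Q : nat) : (0 < f.2 <= Q)%N -> (0 < g.2 <= Q)%N ->
  coprime f.1 f.2 -> coprime g.1 g.2 -> f != g -> fval f <= fval g ->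
  Q%:R ^- 2 <= fval g - fval f.
Proof.
case: f g => [p q] [p' q'] /= /andP[q0 qQ] /andP[q0' qQ'] cf cg fg.
rewrite /fval /= => le.
have qp : (0 : R) < q%:R by rewrite ltr0n. have qp' : (0 : R) < q'%:R by rewrite ltr0n.
have Qp : (0 : R) < Q%:R by rewrite ltr0n (leq_trans q0).
have lt : (p * q' < p' * q)%N.
  have le' : (p * q' <= p' * q)%N.
    by move: le; rewrite ler_pdivrMr// mulrAC ler_pdivlMr// -!natrM ler_nat.
  rewrite ltn_neqAle le' andbT; apply: contra fg => /eqP E.
  have d1 : (q %| q')%N by rewrite -(Gauss_dvdr q' (m := q) (n := p)) 1?coprime_sym// E dvdn_mull.
  have d2 : (q' %| q)%N by rewrite -(Gauss_dvdr q (m := q') (n := p')) 1?coprime_sym// -E dvdn_mull.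
  have qq : q = q' by apply/eqP; rewrite eqn_dvd d1.
  by move: E; rewrite qq => /eqP; rewrite eqn_pmul2r// => /eqP ->.
have -> : p'%:R / q'%:R - p%:R / q%:R = (p'%:R * q%:R - p%:R * q'%:R) / (q%:R * q'%:R) :> R.
  by field; rewrite !gt_eqF.
rewrite ler_pdivlMr ?mulr_gt0// mulrC ler_pdivrMr ?exprn_gt0//.
apply: (@le_trans _ _ (Q%:R ^+ 2)); first by rewrite expr2 ler_pM ?ler_nat.
by rewrite ler_peMl ?exprn_ge0// -!natrM lerBrDr addrC natr1 ler_nat.
Qed.

(** The reduced fractions found in [u, v] with denominators in S are sorted by value; two different
    ones are at least Q^-2 apart. *)
Lemma cell_fractions (u v N : R) (S : seq nat) (Q : nat) : uniq S ->
  (forall q, q \in S -> (0 < q <= Q)%N) -> 0 <= u ->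
  (forall q, q \in S -> let a := (truncn (u * q%:R)).+1 in
     N <= (size [seq n <- iota a (truncn (v * q%:R) - a) | coprime n q])%:R) ->
  exists c : nat -> nat * nat,
   (forall j : nat, j%:R < (size S)%:R * N ->
     [/\ u <= fval (c j), fval (c j) <= v, (c j).2 \in S & coprime (c j).1 (c j).2]) /\
   (forall i j : nat, (i <= j)%N -> j%:R < (size S)%:R * N ->
     (j - i)%N%:R / Q%:R ^+ 2 <= fval (c j) - fval (c i)).
Proof.
move=> uS SQ u0 HN.
pose T q := let a := (truncn (u * q%:R)).+1 in
  [seq n <- iota a (truncn (v * q%:R) - a) | coprime n q].
pose L := [seq (n, q) | q <- S, n <- T q].
have Luniq : uniq L.
  apply: allpairs_uniq_dep => //.
    by move=> q _; rewrite filter_uniq// iota_uniq.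
  by move=> [q n] [q' n'] _ _ /= [-> ->].
have LT f : f \in L -> [/\ u <= fval f, fval f <= v, f.2 \in S & coprime f.1 f.2].
  move=> /allpairsPdep[q [n [qS nT ->]]] /=.
  have /andP[q0 _] := SQ q qS.
  have qp : (0 : R) < q%:R by rewrite ltr0n.
  move: nT; rewrite mem_filter mem_iota => /andP[cop /andP[an nb]].
  have nv : (n < truncn (v * q%:R))%N.
    move: an nb; case: (leqP (truncn (u * q%:R)).+1 (truncn (v * q%:R))) => [h|h].
      by rewrite subnKC.
    have -> : (truncn (v * q%:R) - (truncn (u * q%:R)).+1 = 0)%N by apply/eqP; rewrite subn_eq0 ltnW.
    by rewrite addn0 => h1 h2; move: (leq_ltn_trans h1 h2); rewrite ltnn.
  have vq : 0 <= v * q%:R.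
    have : (0 < truncn (v * q%:R))%N by exact: leq_ltn_trans nv.
    by rewrite truncn_gt0; exact: le_trans.
  split => //.
    rewrite /fval /= ler_pdivlMr// ltW// (lt_le_trans (truncnS_gt _))//.
    by rewrite ler_nat.
  rewrite /fval /= ler_pdivrMr// (@le_trans _ _ (truncn (v * q%:R))%:R)//.
    by rewrite ler_nat ltnW.
  by rewrite truncn_le.
have Lsize : (size S)%:R * N <= (size L)%:R.
  rewrite size_allpairs_dep; elim: S uS SQ HN {L Luniq LT} => [|q S IH] /=.
    by rewrite mul0r.
  move=> /andP[_ uS] SQ HN; rewrite natrD -[(size S).+1%:R]natr1 mulrDl mul1r addrC lerD//.
    by apply: (HN q); rewrite mem_head.
  by apply: IH => // r rS; [apply: SQ|apply: HN]; rewrite in_cons rS orbT.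
pose leT (f g : nat * nat) := fval f <= fval g.
pose s := sort leT L.
have tot : total leT by move=> f g; exact: le_total.
have tr : transitive leT by move=> f g h; exact: le_trans.
have ss : sorted leT s by exact: sort_sorted.
have szs : size s = size L by rewrite size_sort.
exists (nth (0%N, 0%N) s); split.
  move=> j /lt_le_trans /(_ Lsize); rewrite ltr_nat => jL.
  by apply: LT; rewrite -(mem_sort leT) mem_nth// szs.
move=> i j ij /lt_le_trans /(_ Lsize); rewrite ltr_nat -szs.
elim: j ij => [|j IH].
  by rewrite leqn0 => /eqP -> _; rewrite subnn mul0r subrr.
rewrite leq_eqVlt => /orP[/eqP -> _|]; first by rewrite subnn mul0r subrr.
rewrite ltnS => ij js; rewrite subSn// -natr1 mulrDl.
have -> : fval (nth (0%N, 0%N) s j.+1) - fval (nth (0%N, 0%N) s i) =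
  (fval (nth (0%N, 0%N) s j) - fval (nth (0%N, 0%N) s i)) +
  (fval (nth (0%N, 0%N) s j.+1) - fval (nth (0%N, 0%N) s j)) by ring.
rewrite lerD ?IH ?(ltnW js)// mul1r.
have m1 : nth (0%N, 0%N) s j \in L by rewrite -(mem_sort leT) mem_nth// ltnW.
have m2 : nth (0%N, 0%N) s j.+1 \in L by rewrite -(mem_sort leT) mem_nth.
have [_ _ S1 c1] := LT _ m1; have [_ _ S2 c2] := LT _ m2.
apply: fval_sep; rewrite ?SQ//.
  by rewrite nth_uniq ?(ltnW js) ?sort_uniq// ltn_eqF.
by apply: (sorted_ltn_nth tr) => //; rewrite inE// ltnW.
Qed.

End CoprimeCount.

(** * Nice fractions in short intervals *)

Section Stage.
Variable R : realType.
Implicit Types (a b eps u v l s th la mu : R).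

Definition nice_near (x0 la mu : R) (n : nat) (t : R) : Prop :=
  exists (p m : int) (q : nat), [/\ nice p m q, (n <= q)%N,
    `|t - p%:~R / q%:R| <= q%:R `^ (- mu) &
    `|x0 - m%:~R / q%:R| * q%:R `^ (la / 2) <= 1 / 9600].

(* At every scale [Q] there are at least [Q^th] denominators which can be used in
   [nice_near]. *)
Definition admissible (x0 la th : R) : Prop :=
  exists Q1 : nat, forall Q : nat, (Q1 <= Q)%N -> exists S : seq nat,
   [/\ uniq S, Q%:R `^ th <= (size S)%:R &
     forall q, q \in S -> [/\ Q%:R `^ th <= q%:R, (q <= Q)%N, (4 %| q)%N &
       exists m : int, (2 %| m)%Z /\
         `|x0 - m%:~R / q%:R| * q%:R `^ (la / 2) <= 1 / 9600]].

Lemma truncn_ge_half a : 1 <= a -> a / 2 <= (truncn a)%:R :> R.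
Proof.
move=> a1; have t1 := truncnS_gt a; have : (1 : R) <= (truncn a)%:R.
  by rewrite ler1n truncn_gt0.
by move: t1; rewrite -natr1; lra.
Qed.

Lemma le_powR_frac a b : 0 <= a <= 1 -> 0 <= b <= 1 -> a <= a `^ b.
Proof.
move=> a01 /andP[b0 b1].
have [->|bn] := eqVneq b 0; first by rewrite powRr0; case/andP: a01.
rewrite -{1}[a]powRr1; last by case/andP: a01.
by apply: powR_anti_exp => //; rewrite lt_neqAle eq_sym bn.
Qed.

(** The interval receives [mA], about l Q^(1/2), cells of width w = Q^(-1/2), and [mB] fractions are
    chosen in each. A cell holds about w q >= Q^(th - 1/2) numerators per denominator, enough for
    the sieve since th > 1/2. Across cells the digits are Hoelder because the cells are evenly
    spaced; inside a cell only the separation Q^-2 is known, and D (5/2 - 2 th) < 1/2 makes it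
    suffice. *)
Lemma stage_nice (x0 la mu th D : R) (n : nat) (l s : R) : admissible x0 la th ->
  1 / 2 < th -> th <= 1 -> 2 < mu -> 0 < D -> D <= 1 -> D * mu <= 2 * th ->
  D * (5 / 2 - 2 * th) < 1 / 2 -> 0 < l -> l <= 1 -> 0 <= s -> s < D ->
  exists m l', stage (nice_near x0 la mu n) l s m l'.
Proof.
move=> [Q1 HQ1] th1 th2 mu2 D0 D1 Dmu Dth l0 l1 s0 sD.
have smu : s * mu < 2 * th.
  by apply: lt_le_trans Dmu; rewrite ltr_pM2r//; move: mu2; clear; lra.
(* A loss small against the strict inequalities at hand; Q is then taken so large that Q^e exceeds
   the constants collected in X. *)
pose e := minr (minr ((th - 1 / 2) / 8) ((2 * th - s * mu) / 8))
  (minr ((1 / 2 - D * (5 / 2 - 2 * th)) / 8) (minr (mu - 2) (1 / 8))).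
have e1 : e <= (th - 1 / 2) / 8 by rewrite /e !ge_min lexx.
have e2 : e <= (2 * th - s * mu) / 8 by rewrite /e !ge_min lexx orbT.
have e3 : e <= (1 / 2 - D * (5 / 2 - 2 * th)) / 8 by rewrite /e !ge_min lexx !orbT.
have e4 : e <= mu - 2 by rewrite /e !ge_min lexx !orbT.
have e5 : e <= 1 / 8 by rewrite /e !ge_min lexx !orbT.
have e0 : 0 < e.
  have q1 : 0 < (th - 1 / 2) / 8 by rewrite divr_gt0// subr_gt0.
  have q2 : 0 < (2 * th - s * mu) / 8 by rewrite divr_gt0// subr_gt0.
  have q3 : 0 < (1 / 2 - D * (5 / 2 - 2 * th)) / 8 by rewrite divr_gt0// subr_gt0.
  have q4 : 0 < mu - 2 by rewrite subr_gt0.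
  have q5 : 0 < 1 / 8 :> R by rewrite divr_gt0.
  by rewrite /e !lt_min q1 q2 q3 q4 q5.
move: (e) e0 e1 e2 e3 e4 e5 => {}e e0 e1 e2 e3 e4 e5.
have [C C1 HC] := coprime_count e0.
have C0 : 0 < C by exact: lt_le_trans C1.
pose X := 8 * C + 16 / l + n%:R + 8.
have l16 : 16 <= 16 / l by rewrite ler_pdivlMr// ler_piMr.
have X0 : 0 < X by rewrite /X; have := ler0n R n; move: C1 l16; clear; lra.
have [N2 HN2] := powR_small e0 (divr_gt0 ltr01 X0).
pose Q := (Q1 + N2).+1.
have [S [uS sS HS]] := HQ1 Q (leq_trans (leq_addr _ _) (leqnSn _)).
have Qp : (0 : R) < Q%:R by [].
have Q1' : (1 : R) <= Q%:R by rewrite ler1n.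
pose P b := Q%:R `^ b : R.
have P0 b : 0 < P b by rewrite powR_gt0.
have PD b c : P (b + c) = P b * P c by rewrite /P powRD// (gt_eqF Qp) implybT.
have PN b : P (- b) = (P b)^-1 by rewrite /P powRN.
have Ple b c : b <= c -> P b <= P c by move=> bc; rewrite /P ler_powR.
have PeX : X <= P e.
  have := HN2 Q (leq_trans (leq_addl _ _) (leqnSn _)).
  by rewrite powRN -/(P e) div1r lef_pV2 ?posrE.
have PX b : e <= b -> X <= P b by move=> eb; rewrite (le_trans PeX)// Ple.
have Xn : n%:R <= X by rewrite /X; move: C1 l16; clear; lra.
have X8C : 8 * C <= X by rewrite /X; have := ler0n R n; move: l16; clear; lra.
have X16 : 16 / l <= X by rewrite /X; have := ler0n R n; move: C1; clear; lra.
have X8 : 8 <= X by rewrite /X; have := ler0n R n; move: C1 l16; clear; lra.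
pose w := P (- (1 / 2)); pose l' := P (- mu).
have w0 : 0 < w by exact: P0.
have l'0 : 0 < l' by exact: P0.
have l'w : l' <= w / 8.
  rewrite ler_pdivlMr// mulrC /l' /w.
  have -> : - (1 / 2) = (mu - 1 / 2) + - mu by ring.
  by rewrite PD ler_pM2r// (le_trans X8)// PX//; move: e4; clear; lra.
have wP : w * P (1 / 2) = 1 by rewrite /w PN mulVf// gt_eqF.
pose mA := truncn (l * P (1 / 2) / 4).
have lP : 16 <= l * P (1 / 2).
  have : 16 / l <= P (1 / 2) by rewrite (le_trans X16)// PX//; move: e5; clear; lra.
  by rewrite ler_pdivrMr// mulrC.
have mA1 : l * P (1 / 2) / 8 <= mA%:R.
  have := @truncn_ge_half (l * P (1 / 2) / 4); rewrite -/mA.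
  have h : 1 <= l * P (1 / 2) / 4 by move: lP; clear; lra.
  by move=> /(_ h); clear; lra.
have mA2 : mA%:R <= l * P (1 / 2) / 4 by rewrite truncn_le; move: lP; clear; lra.
have mAp : (0 : R) < mA%:R by move: mA1 lP; clear; lra.
(* Q^th denominators with Q^(th - 1/2 - 2e) numerators each. *)
pose mB := truncn (P (2 * th - 1 / 2 - 2 * e)).
have PB8 : 8 <= P (2 * th - 1 / 2 - 2 * e).
  by rewrite (le_trans X8)// PX//; move: e1 th1; clear; lra.
have mB1 : P (2 * th - 1 / 2 - 2 * e) / 2 <= mB%:R.
  by apply: truncn_ge_half; move: PB8; clear; lra.
have mB2 : mB%:R <= P (2 * th - 1 / 2 - 2 * e) by rewrite truncn_le ltW.
have mBp : (0 : R) < mB%:R by move: mB1 PB8; clear; lra.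
have mB0 : (0 < mB)%N by rewrite -(ltr0n R).
have mBQ : mB%:R <= P 2 by rewrite (le_trans mB2)// Ple//; move: th2 e0; clear; lra.
have P2E : P 2 = Q%:R ^+ 2 by rewrite /P -powR_mulrn.
have mmR : l * P (2 * th - 2 * e) / 16 <= mA%:R * mB%:R.
  have -> : l * P (2 * th - 2 * e) / 16 = (l * P (1 / 2) / 8) * (P (2 * th - 1 / 2 - 2 * e) / 2).
    have -> : 2 * th - 2 * e = 1 / 2 + (2 * th - 1 / 2 - 2 * e) by field.
    by rewrite PD; field.
  apply: ler_pM => //; first by rewrite divr_ge0// mulr_ge0// ltW.
  by rewrite divr_ge0// ltW.
exists (mA * mB)%N, l'; split.
- rewrite -(ler_nat R) natrM (@le_trans _ _ (2 * 4))//; first by rewrite ler_peMr// ler1n.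
  by apply: ler_pM => //; [move: mA1 lP; clear; lra|move: mB1 PB8; clear; lra].
- exact: P0.
- apply: (le_trans l'w); have : w * P (1 / 2) <= l * P (1 / 2) by rewrite wP; move: lP; clear; lra.
  by rewrite ler_pM2r//; move: w0; clear; lra.
- rewrite natrM /l' -powRrM mulNr -/(P _) PN lef_pV2 ?posrE ?mulr_gt0//.
  apply: le_trans mmR.
  have -> : 2 * th - 2 * e = mu * s + (2 * th - 2 * e - mu * s) by ring.
  rewrite PD; have : 16 / l <= P (2 * th - 2 * e - mu * s).
    by rewrite (le_trans X16)// PX//; move: e2 e0; rewrite [mu * s]mulrC; clear; lra.
  rewrite ler_pdivrMr// => h; have := P0 (mu * s); move: h.
  move: (P (mu * s)) (P (2 * th - 2 * e - mu * s)) => y z h y0.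
  have -> : l * (y * z) / 16 = y * (z * l / 16) by ring.
  by rewrite ler_peMr ?(ltW y0)//; move: h; clear; lra.
(* The integer part of a is set aside because [cell_fractions] works with natural numerators; it is
   added back to the fractions. *)
move=> a; pose z := Num.floor a; pose a' := a - z%:~R.
have a'0 : 0 <= a' by rewrite subr_ge0 floor_le_tmp.
(* Left ends are 2w apart for cells of width w, so that points k cells apart are at distance at
   least k w. *)
pose u (A : nat) := a' + 2 * w * A%:R.
have u0 A : 0 <= u A by rewrite addr_ge0// !mulr_ge0// ltW.
pose N := P (th - 1 / 2 - 2 * e).
have HSq q : q \in S -> (0 < q <= Q)%N.
  move=> /HS[h1 h2 _ _]; rewrite h2 andbT -(ltr0n R); exact: lt_le_trans h1.
have cells A : exists c : nat -> nat * nat,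
   (forall j : nat, (j < mB)%N ->
     [/\ u A <= fval R (c j), fval R (c j) <= u A + w - l', (c j).2 \in S & coprime (c j).1 (c j).2]) /\
   (forall i j : nat, (i <= j)%N -> (j < mB)%N ->
     (j - i)%N%:R / Q%:R ^+ 2 <= fval R (c j) - fval R (c i)).
  (* The right end is lowered by l' so that the whole interval starting at a fraction stays inside
     the cell. *)
  have [|c [c1 c2]] := @cell_fractions R (u A) (u A + w - l') N S Q uS HSq (u0 A).
    move=> q qS; have /andP[q0 qQ] := HSq q qS; have [qth _ _ _] := HS q qS.
    set aq := truncn (u A * q%:R); set bq := truncn ((u A + w - l') * q%:R) => /=.
    have qp : (0 : R) < q%:R by rewrite ltr0n.
    have uq0 : 0 <= u A * q%:R by rewrite mulr_ge0// ltW.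
    have k1 : aq%:R <= u A * q%:R by rewrite truncn_le.
    have k2 : (u A + w - l') * q%:R < bq.+1%:R by exact: truncnS_gt.
    have wq : P (th - 1 / 2) <= w * q%:R.
      have -> : th - 1 / 2 = - (1 / 2) + th by ring.
      by rewrite PD ler_pM2l.
    have P8 : 8 <= P (th - 1 / 2) by rewrite (le_trans X8)// PX//; move: e1 e0; clear; lra.
    have l'q : l' * q%:R <= w / 8 * q%:R by rewrite ler_pM2r.
    have k3 : P (th - 1 / 2) / 2 <= bq%:R - aq.+1%:R.
      move: k1 k2 wq P8 l'q; rewrite -[bq.+1%:R]natr1 -[aq.+1%:R]natr1.
      have -> : (u A + w - l') * q%:R = u A * q%:R + w * q%:R - l' * q%:R by ring.
      rewrite [w / 8 * _]mulrAC.
      by clear; lra.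
    have ab : (aq.+1 <= bq)%N.
      rewrite -(ler_nat R) -subr_ge0 (le_trans _ k3)// divr_ge0//; exact: ltW.
    have := HC q aq.+1 bq q0 ab; rewrite natrB// => /(le_trans _); apply.
    have qe : q%:R `^ e <= P e.
      by apply: ge0_ler_powR; rewrite ?nnegrE ?(ltW e0) ?ler_nat.
    have qe0 : 0 < q%:R `^ e by rewrite powR_gt0.
    have r1 : P (th - 1 / 2 - e) / (2 * C) <= (bq%:R - aq.+1%:R) / (C * q%:R `^ e).
      rewrite ler_pdivlMr ?mulr_gt0//; apply: le_trans k3.
      have -> : P (th - 1 / 2) = P (th - 1 / 2 - e) * P e by rewrite -PD; congr P; ring.
      have -> : P (th - 1 / 2 - e) / (2 * C) * (C * q%:R `^ e) = P (th - 1 / 2 - e) * q%:R `^ e / 2.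
        by field; rewrite gt_eqF.
      by rewrite ler_pM2r ?invr_gt0// ler_pM2l.
    have r2 : 2 * C * q%:R `^ e <= 2 * C * P e by rewrite ler_pM2l// mulr_gt0.
    have r3 : 8 * C * N <= P (th - 1 / 2 - e).
      have -> : th - 1 / 2 - e = e + (th - 1 / 2 - 2 * e) by ring.
      by rewrite PD /N ler_pM2r// (le_trans X8C).
    have r4 : 64 * C ^+ 2 * P e <= P (th - 1 / 2 - e).
      have : P (e + e + e) <= P (th - 1 / 2 - e) by apply: Ple; move: e1 e0; clear; lra.
      apply: le_trans; rewrite !PD ler_pM2r//.
      have -> : 64 * C ^+ 2 = (8 * C) * (8 * C) by ring.
      by apply: ler_pM; rewrite ?mulr_ge0 ?(ltW C0)// (le_trans X8C).
    have r5 : N + 2 * C * P e <= P (th - 1 / 2 - e) / (2 * C).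
      rewrite ler_pdivlMr ?mulr_gt0//.
      have -> : (N + 2 * C * P e) * (2 * C) = (8 * C * N) / 4 + (64 * C ^+ 2 * P e) / 16.
        by clear; field.
      by move: r3 r4; have := P0 (th - 1 / 2 - e); clear; lra.
    by move: r1 r2 r5; clear; lra.
  have lt j : (j < mB)%N -> j%:R < (size S)%:R * N.
    move=> jB; apply: (@lt_le_trans _ _ mB%:R); first by rewrite ltr_nat.
    apply: (le_trans mB2); have -> : 2 * th - 1 / 2 - 2 * e = th + (th - 1 / 2 - 2 * e) by ring.
    by rewrite PD ler_pM2r.
  by exists c; split => [j /lt /c1|i j ij /lt /(c2 i j ij)].
have [c Hc] := @choice _ _ _ cells.
pose f j := fval R (c (j %/ mB)%N (j %% mB)%N).
have fin j : (j < mA * mB)%N -> [/\ u (j %/ mB)%N <= f j, f j <= u (j %/ mB)%N + w - l' & (j %/ mB < mA)%N].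
  move=> jm; have [/(_ (j %% mB)%N (ltn_pmod _ mB0))[h1 h2 _ _] _] := Hc (j %/ mB)%N.
  by split => //; rewrite ltn_divLR.
exists (fun j => z%:~R + f j); split.
  move=> j jm; have [f1 f2 jA] := fin j jm.
  have aE : a = z%:~R + a' by rewrite /a' addrC subrK.
  have wA : 2 * w * (j %/ mB)%N%:R + w <= l.
    have : 2 * w * (j %/ mB).+1%:R <= 2 * w * mA%:R by rewrite ler_pM2l ?mulr_gt0// ler_nat.
    have : 2 * w * mA%:R <= 2 * w * (l * P (1 / 2) / 4) by rewrite ler_pM2l ?mulr_gt0.
    have -> : 2 * w * (l * P (1 / 2) / 4) = l / 2 * (w * P (1 / 2)).
      by clear; field.
    by rewrite wP -[(j %/ mB)%N.+1%:R]natr1; move: w0 l0; clear; lra.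
  split.
  - rewrite {1}aE lerD2l (le_trans _ f1)// /u lerDl !mulr_ge0//; exact: ltW.
  - by rewrite aE; move: f2 wA; rewrite /u; clear; lra.
  move=> t /andP[t1 t2].
  have [/(_ (j %% mB)%N (ltn_pmod _ mB0))[_ _ qS cop] _] := Hc (j %/ mB)%N.
  set p := (c (j %/ mB)%N (j %% mB)%N).1 in cop; set q := (c _ _).2 in qS cop.
  have [qth qQ q4 [m [m2 mx]]] := HS q qS.
  have /andP[q0 _] := HSq q qS.
  have qp : (0 : R) < q%:R by rewrite ltr0n.
  exists (z * q%:Z + p%:Z), m, q; split => //.
  - apply/and4P; split => //.
    have : coprimez (z * q%:Z + p%:Z) q%:Z.
      have : coprimez p%:Z q%:Z by rewrite coprimezE.
      move=> /coprimezP[[y y'] /= E]; apply/coprimezP; exists (y, y' - y * z) => /=.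
      by rewrite -E; ring.
    by rewrite coprimezE.
  - rewrite -(ler_nat R) (le_trans Xn)// (le_trans _ qth)// PX//.
    by move: e5 th1; clear; lra.
  have E : (z * q%:Z + p%:Z)%:~R / q%:R = z%:~R + f j.
    by rewrite intrD intrM -!pmulrn mulrDl mulfK ?gt_eqF.
  rewrite E ger0_norm; last by rewrite subr_ge0.
  apply: (@le_trans _ _ l'); first by move: t2; clear; lra.
  rewrite /l' /P !powRN lef_pV2 ?posrE ?powR_gt0//.
  by apply: ge0_ler_powR; rewrite ?nnegrE ?ler_nat//; move: mu2; clear; lra.
move=> i j ij jm.
have im := ltn_trans ij jm.
have [fi1 fi2 iA] := fin i im; have [fj1 fj2 jA] := fin j jm.
have -> : z%:~R + f j - (z%:~R + f i) = f j - f i by ring.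
have Qp2 : 0 < Q%:R ^+ 2 :> R by rewrite exprn_gt0.
have AA : (i %/ mB <= j %/ mB)%N by rewrite leq_div2r// ltnW.
rewrite natrM.
have [EA|neA] := eqVneq (i %/ mB)%N (j %/ mB)%N.
  have iE := divn_eq i mB; have jE := divn_eq j mB; rewrite -EA in jE.
  have ijB : (i %% mB < j %% mB)%N by have := ij; rewrite {1}iE {1}jE ltn_add2l.
  have kE : (j - i = j %% mB - i %% mB)%N by rewrite {1}iE {1}jE subnDl.
  have [_ /(_ (i %% mB)%N (j %% mB)%N (ltnW ijB) (ltn_pmod _ mB0))] := Hc (j %/ mB)%N.
  rewrite -kE -/(f j) -{1}EA -/(f i) => d1.
  set k := (j - i)%N in kE d1 *; set d := f j - f i in d1 *.
  have k0 : (1 : R) <= k%:R by rewrite ler1n kE subn_gt0.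
  have kB : k%:R <= mB%:R :> R.
    by rewrite ler_nat kE (leq_trans (leq_subr _ _))// ltnW// ltn_pmod.
  have kp : (0 : R) < k%:R by exact: lt_le_trans k0.
  have d0 : 0 < d by apply: lt_le_trans d1; rewrite divr_gt0.
  split.
    apply: le_trans d1; apply: (@le_trans _ _ (1 / Q%:R ^+ 2)); last by rewrite ler_pM2r ?invr_gt0.
    rewrite div1r -P2E -PN /l'; have -> : - 2 = (mu - 2) + - mu :> R by ring.
    by rewrite PD ler_pM2r// (@le_trans _ _ 8)//; [rewrite ler_nat|rewrite (le_trans X8)// PX].
  move=> s' s'0 s's.
  have s'1 : s' <= 1 by move: s's sD D1; clear; lra.
  have kk : k%:R / mB%:R <= d `^ s' * (Q%:R ^+ 2 / mB%:R) `^ s.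
    apply: (@le_trans _ _ ((k%:R / mB%:R) `^ s')).
      by apply: le_powR_frac; rewrite ?divr_ge0//= ?ler_pdivrMr// ?mul1r// s'0.
    have -> : k%:R / mB%:R = (k%:R / Q%:R ^+ 2) * (Q%:R ^+ 2 / mB%:R) :> R.
      by field; rewrite !gt_eqF.
    rewrite powRM ?divr_ge0 ?exprn_ge0//; apply: ler_pM; rewrite ?powR_ge0//.
      by apply: ge0_ler_powR; rewrite ?nnegrE ?divr_ge0 ?exprn_ge0 ?(ltW d0).
    by rewrite ler_powR// ler_pdivlMr// mul1r -P2E.
  have QB : (Q%:R ^+ 2 / mB%:R) `^ s <= 2 * P (s * (5 / 2 - 2 * th + 2 * e)).
    have h : Q%:R ^+ 2 / mB%:R <= 2 * P (5 / 2 - 2 * th + 2 * e).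
      rewrite ler_pdivrMr// -P2E.
      have -> : P 2 = 2 * P (5 / 2 - 2 * th + 2 * e) * (P (2 * th - 1 / 2 - 2 * e) / 2).
        have -> : P 2 = P (5 / 2 - 2 * th + 2 * e) * P (2 * th - 1 / 2 - 2 * e).
          by rewrite -PD; congr P; field.
        by field.
      by rewrite ler_pM2l// mulr_gt0.
    apply: (@le_trans _ _ ((2 * P (5 / 2 - 2 * th + 2 * e)) `^ s)).
      by apply: ge0_ler_powR; rewrite ?nnegrE ?divr_ge0 ?exprn_ge0 ?mulr_ge0 ?(ltW (P0 _)).
    rewrite powRM ?(ltW (P0 _))// /P -powRrM [(_ - _ + _) * s]mulrC ler_pM2r ?powR_gt0//.
    by rewrite -[leRHS]powRr1// ler_powR ?ler1n//; move: sD D1; clear; lra.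
  have fin2 : 2 * P (s * (5 / 2 - 2 * th + 2 * e)) <= mA%:R.
    apply: le_trans mA1.
    have : 16 / l * P (s * (5 / 2 - 2 * th + 2 * e)) <= P (1 / 2).
      apply: (@le_trans _ _ (P e * P (s * (5 / 2 - 2 * th + 2 * e)))).
        by rewrite ler_pM2r// (le_trans X16).
      rewrite -PD; apply: Ple.
      have : s * (5 / 2 - 2 * th) <= D * (5 / 2 - 2 * th) by rewrite ler_wpM2r ?(ltW sD)//; move: th2; clear; lra.
      have : s * e <= 1 * e by rewrite ler_pM2r//; move: sD D1; clear; lra.
      by move: e3 e0; clear; lra.
    by rewrite mulrAC ler_pdivrMr//; move: (P (s * _)) (P (1 / 2)) => y y'; clear; lra.
  have ls : 1 <= l `^ (- s').
    by rewrite powRN invf_ge1 ?powR_gt0// powR_le1// (ltW l0).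
  have ds0 : 0 <= d `^ s' by exact: powR_ge0.
  apply: (@le_trans _ _ (d `^ s')).
    rewrite invfM mulrCA [leLHS]mulrC ler_pdivrMr// (le_trans kk)// ler_wpM2l//.
    exact: le_trans QB fin2.
  by rewrite ler_peMl// mulr_ege1// ler1n.
have lA : (i %/ mB < j %/ mB)%N by rewrite ltn_neqAle neA.
set k := (j %/ mB - i %/ mB)%N.
have k1 : (0 < k)%N by rewrite subn_gt0.
have k1R : (1 : R) <= k%:R by rewrite ler1n.
have kE : k%:R = (j %/ mB)%N%:R - (i %/ mB)%N%:R :> R by rewrite natrB// ltnW.
have kmA : k%:R <= mA%:R :> R by rewrite ler_nat (leq_trans (leq_subr _ _))// ltnW.
have dge : k%:R * w <= f j - f i.
  have : k%:R * w >= w by rewrite ler_peMl// ltW.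
  by move: fi2 fj1 l'0; rewrite /u kE mulrBl; clear; lra.
have d0 : 0 < f j - f i by apply: lt_le_trans dge; rewrite mulr_gt0// (lt_le_trans ltr01).
split.
  apply: le_trans dge; apply: (@le_trans _ _ w); last by rewrite ler_peMl// ltW.
  by move: l'w w0; clear; lra.
move=> s' s'0 s's.
have s'1 : s' <= 1 by move: s's sD D1; clear; lra.
set d := f j - f i in dge d0 *.
have kj : (j - i)%N%:R <= 2 * k%:R * mB%:R :> R.
  have : (j - i <= k.+1 * mB)%N.
    rewrite leq_subLR; apply: ltnW; apply: (leq_trans (ltn_ceil j mB0)).
    have -> : ((j %/ mB).+1 = i %/ mB + k.+1)%N by rewrite addnS subnKC// ltnW.
    by rewrite mulnDl leq_add2r leq_divM.
  rewrite -(ler_nat R) natrM => /le_trans; apply; rewrite ler_pM2r// -[k.+1%:R]natr1.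
  by move: k1R; clear; lra.
have ls0 : 0 <= l `^ (- s') * d `^ s' by rewrite mulr_ge0 ?powR_ge0.
apply: (@le_trans _ _ (2 * (k%:R / mA%:R))).
  rewrite ler_pdivrMr ?mulr_gt0//.
  have -> : 2 * (k%:R / mA%:R) * (mA%:R * mB%:R) = 2 * k%:R * mB%:R :> R by field; rewrite gt_eqF.
  exact: kj.
have kk : k%:R / mA%:R <= 8 * (l `^ (- s') * d `^ s').
  apply: (@le_trans _ _ ((k%:R / mA%:R) `^ s')).
    by apply: le_powR_frac; rewrite ?divr_ge0//= ?ler_pdivrMr// ?mul1r// s'0.
  have h : k%:R / mA%:R <= 8 * (l^-1 * d).
    rewrite ler_pdivrMr//.
    have h1 : 8 * (l^-1 * d) * (l * P (1 / 2) / 8) <= 8 * (l^-1 * d) * mA%:R.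
      by rewrite ler_wpM2l// !mulr_ge0 ?invr_ge0 ?(ltW l0) ?(ltW d0).
    apply: le_trans h1.
    have -> : 8 * (l^-1 * d) * (l * P (1 / 2) / 8) = d * P (1 / 2) by field; rewrite gt_eqF.
    have : k%:R * w * P (1 / 2) <= d * P (1 / 2) by rewrite ler_pM2r.
    by rewrite -mulrA wP mulr1.
  apply: (@le_trans _ _ ((8 * (l^-1 * d)) `^ s')).
    by apply: ge0_ler_powR; rewrite ?nnegrE ?divr_ge0 ?mulr_ge0 ?invr_ge0 ?(ltW l0) ?(ltW d0).
  have li : 0 <= l^-1 by rewrite invr_ge0 ltW.
  rewrite powRM ?mulr_ge0 ?(ltW d0)// powRM ?(ltW d0)//.
  have -> : l^-1 `^ s' = l `^ (- s').
    by rewrite -powR_inv1 ?(ltW l0)// -powRrM mulN1r.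
  rewrite ler_wpM2r//.
  by rewrite -[leRHS]powRr1// ler_powR ?ler1n//; move: s's sD D1; clear; lra.
by rewrite -mulrA; move: kk ls0; move: (l `^ (- s') * d `^ s') => y; clear; lra.
Qed.

End Stage.

(** * Supply of denominators adapted to x0 *)

Section Admissible.
Variable R : realType.
Implicit Types (x y t a b s l th la mu eps : R).

Lemma size_filter_ge (s : seq nat) b : 0 <= b -> uniq s -> all (fun q => 0 < q)%N s ->
  (size s)%:R - b <= (size [seq q <- s | b <= q%:R])%:R.
Proof.
move=> b0 us sp.
have le : (size [seq q <- s | ~~ (b <= q%:R)%R] <= truncn b)%N.
  rewrite -[leqRHS](size_iota 1); apply: uniq_leq_size; first by rewrite filter_uniq.
  move=> q; rewrite mem_filter -ltNge mem_iota => /andP[qb qs].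
  have q0 : (0 < q)%N := allP sp q qs; rewrite q0 add1n ltnS /=.
  by rewrite truncn_ge_nat// ltW.
have -> : (size s = size [seq q <- s | (b <= q%:R)%R] + size [seq q <- s | ~~ (b <= q%:R)%R])%N.
  by rewrite !size_filter; rewrite -(count_predC (fun q => b <= q%:R)).
rewrite natrD lerBlDr lerD2l (@le_trans _ _ (truncn b)%:R) ?ler_nat//.
by rewrite truncn_le.
Qed.

Lemma powR_large b c : 0 < b -> exists N : nat, forall n : nat, (N <= n)%N -> c <= (n%:R : R) `^ b.
Proof.
move=> b0; have [|N HN] := @powR_small R b (`|c| + 1)^-1 b0; first by rewrite invr_gt0 ltr_wpDl.
exists N.+1 => n Nn; have := HN n (ltnW Nn).
have n0 : (0 : R) < n%:R by rewrite ltr0n (leq_trans _ Nn).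
rewrite powRN lef_pV2 ?posrE ?powR_gt0 ?ltr_wpDl// => /(le_trans _); apply.
by rewrite (le_trans (ler_norm _))// lerDl.
Qed.

(** The multiples of 4v qualify, v being a denominator of x: then x equals m/q with m even, whatever
    la is. *)
Lemma admissible_rational x la th : rational x -> 0 < th -> th < 1 -> admissible x la th.
Proof.
move=> /rational_frac[w [v [v0 xE]]] th0 th1.
have d0 : 0 < 1 - th by rewrite subr_gt0.
have [N HN] := powR_large (3 * (4 * v)%N%:R) d0.
exists N.+1 => Q NQ.
have Qp : (0 : R) < Q%:R by rewrite ltr0n (leq_trans _ NQ).
have Q1 : (1 : R) <= Q%:R by rewrite ler1n -(ltr0n R).
have L0 : (0 < 4 * v)%N by rewrite muln_gt0.
have Lp : (0 : R) < (4 * v)%N%:R by rewrite ltr0n.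
pose s0 := [seq (4 * v * r)%N | r <- iota 1 (Q %/ (4 * v))].
exists [seq q <- s0 | Q%:R `^ th <= q%:R]; split.
- rewrite filter_uniq// map_inj_uniq ?iota_uniq// => r r' /eqP.
  by rewrite eqn_pmul2l// => /eqP.
- have us : uniq s0.
    by rewrite map_inj_uniq ?iota_uniq// => r r' /eqP; rewrite eqn_pmul2l// => /eqP.
  have sp : all (fun q => 0 < q)%N s0.
    by apply/allP => q /mapP[r]; rewrite mem_iota => /andP[r0 _] ->; rewrite muln_gt0 L0.
  apply: le_trans (size_filter_ge (powR_ge0 Q%:R th) us sp).
  rewrite size_map size_iota lerBrDr.
  have h : Q%:R < (Q %/ (4 * v)).+1%:R * (4 * v)%N%:R :> R.
    by rewrite -natrM ltr_nat ltn_ceil.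
  have E : Q%:R = Q%:R `^ th * Q%:R `^ (1 - th) :> R.
    rewrite -powRD; last by rewrite (gt_eqF Qp) implybT.
    by rewrite addrC subrK powRr1// ltW.
  have P1 : 1 <= Q%:R `^ th by rewrite one_le_powR// ltW.
  have : Q%:R `^ th * (3 * (4 * v)%N%:R) < (Q %/ (4 * v)).+1%:R * (4 * v)%N%:R.
    apply: le_lt_trans h; rewrite [leRHS]E ler_wpM2l ?powR_ge0// HN//; exact: ltnW.
  by rewrite mulrA ltr_pM2r// -[(Q %/ _).+1%:R]natr1; move: P1; clear; lra.
move=> q; rewrite mem_filter => /andP[qth /mapP[r]]; rewrite mem_iota add1n ltnS => /andP[r0 rQ] qE.
split => //.
- by rewrite qE mulnC (leq_trans (leq_mul rQ (leqnn _)))// leq_divM.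
- by rewrite qE -mulnA dvdn_mulr.
exists (w * (4 * r)%N%:Z); split; first by rewrite dvdz_mull// PoszM dvdz_mulr.
have -> : x - (w * (4 * r)%N%:Z)%:~R / q%:R = 0.
  by rewrite xE qE intrM -pmulrn !natrM; field; rewrite !pnatr_eq0 -!lt0n r0 v0.
by rewrite normr0 mul0r divr_ge0 ?ler01 ?ler0n.
Qed.

Lemma pigeonhole (N K : nat) (box : nat -> nat) : (0 < K)%N -> (forall n, (box n < K)%N) ->
  exists i, (N <= K * size [seq n <- iota 0 N | box n == i])%N.
Proof.
move=> K0 HK; apply: contrapT => /forallNP H.
have E : (\sum_(i < K) size [seq n <- iota 0 N | box n == i] = N)%N.
  elim: N {H} => [|N IH]; first by rewrite big1.
  have -> : iota 0 N.+1 = iota 0 N ++ [:: N] by rewrite -addn1 iotaD.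
  under eq_bigr do rewrite filter_cat size_cat /=.
  rewrite big_split /= IH (bigD1 (Ordinal (HK N)))//= eqxx big1 ?addn0 ?addn1// => i.
  by rewrite -val_eqE /= eq_sym => /negbTE ->.
have : (K * N < K * N)%N.
  have : (\sum_(i < K) K * size [seq n <- iota 0 N | box n == i] < \sum_(i < K) N)%N.
    rewrite (bigD1 (Ordinal K0))//= [ltnRHS](bigD1 (Ordinal K0))//= -addSn leq_add//.
      by move: (H 0%N) => /negP; rewrite -ltnNge.
    apply: leq_sum => i _; move: (H i) => /negP; rewrite -ltnNge; exact: ltnW.
  by rewrite -big_distrr /= E sum_nat_const card_ord.
by rewrite ltnn.
Qed.

(* Pigeonhole: the fractional parts of [n * 2 x0] are sorted into boxes, and
   differences within a box are the required half-denominators. *)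
Lemma admissible_any x la th : 2 < la -> 0 < th -> th < 2 - la / 2 -> admissible x la th.
Proof.
have aux (j k : nat) : (j < k.+1 * 4)%N -> (1 <= k)%N -> (j <= 8 * k)%N by lia.
move=> la2 th0 th1.
have d0 : 0 < 2 - la / 2 - th by rewrite subr_gt0.
have [c [c1 cE]] : exists c : R, 1 <= c /\ 1 / 9600 = 2 / c.
  exists (2 * 9600%:R); split; last by field.
  have : (1 : R) <= 9600%:R by rewrite ler1n.
  by clear; lra.
rewrite /admissible cE.
have cp : 0 < c by exact: lt_le_trans c1.
have [N0 HN0] := powR_large (64 * c) d0.
exists (N0 + 8)%N => Q NQ.
have Q8 : (8 <= Q)%N by rewrite (leq_trans _ NQ)// leq_addl.
have Qp : (0 : R) < Q%:R by rewrite ltr0n (leq_trans _ Q8).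
have Q1 : (1 : R) <= Q%:R by rewrite ler1n -(ltr0n R).
pose P b := Q%:R `^ b : R.
have P0 b : 0 < P b by rewrite powR_gt0.
have PD b b' : P (b + b') = P b * P b' by rewrite /P powRD// (gt_eqF Qp) implybT.
have P1 b : 0 <= b -> 1 <= P b by move=> b0; rewrite /P one_le_powR.
have la1 : 0 < la / 2 - 1 by move: la2; clear; lra.
have cP : 1 <= c * P (la / 2 - 1) by rewrite mulr_ege1// P1// ltW.
(* K boxes give |q x - m| <= 2/K, and q <= Q turns this into the bound 2/c; the fullest box still
   holds about Q^(2 - la/2) elements, hence the condition on th. *)
pose K := (truncn (c * P (la / 2 - 1))).+1.
have K1 : c * P (la / 2 - 1) <= K%:R by rewrite ltW// truncnS_gt.
have K2 : K%:R <= 2 * (c * P (la / 2 - 1)).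
  have : (truncn (c * P (la / 2 - 1)))%:R <= c * P (la / 2 - 1).
    by rewrite truncn_le (le_trans ler01).
  by rewrite /K -[_.+1%:R]natr1; move: cP; clear; lra.
have Kp : (0 : R) < K%:R by rewrite ltr0n.
(* Doubling x makes m even when q is 4 (n - n1). *)
pose y := 2 * x.
pose fr (n : nat) : R := n%:R * y - (Num.floor (n%:R * y))%:~R.
have fr0 n : 0 <= fr n by rewrite subr_ge0 floor_le_tmp.
have fr1 n : fr n < 1.
  have := floorD1_gt (n%:R * y); rewrite intrD /fr; clear; lra.
pose box n := truncn (K%:R * fr n).
have boxK n : (box n < K)%N.
  rewrite -(ltr_nat R) (@le_lt_trans _ _ (K%:R * fr n))//.
    by rewrite truncn_le mulr_ge0.
  by rewrite gtr_pMr.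
pose N := (Q %/ 4)%N.
have [i Hi] := pigeonhole N (isT : (0 < K)%N) boxK.
set B := [seq n <- iota 0 N | box n == i] in Hi.
have NQ8 : Q%:R <= 8 * N%:R :> R.
  by rewrite -natrM ler_nat aux ?ltn_ceil// divn_gt0// (leq_trans _ Q8).
have sB : sorted ltn B by rewrite sorted_filter ?iota_ltn_sorted//; exact: ltn_trans.
have memB n : n \in B -> (n < N)%N /\ box n = i.
  by rewrite mem_filter mem_iota add0n => /andP[/eqP -> /andP[_ ->]].
have th1P : 1 <= P th by rewrite P1// ltW.
have Bsz : 4 * P th <= (size B)%:R.
  have h1 : N%:R <= K%:R * (size B)%:R :> R by rewrite -natrM ler_nat.
  have QE : Q%:R = P (la / 2 - 1) * P th * P (2 - la / 2 - th).
    rewrite -!PD; have -> : la / 2 - 1 + th + (2 - la / 2 - th) = 1 by ring.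
    by rewrite /P powRr1// ltW.
  have big : 64 * c <= P (2 - la / 2 - th) by apply: HN0; rewrite (leq_trans _ NQ)// leq_addr.
  have h2 : Q%:R <= 8 * (2 * (c * P (la / 2 - 1)) * (size B)%:R).
    by apply: (le_trans NQ8); rewrite ler_pM2l// (le_trans h1)// ler_wpM2r.
  have h3 : P (la / 2 - 1) * P th * (64 * c) <= Q%:R.
    by rewrite QE ler_pM2l// mulr_gt0.
  have := le_trans h3 h2.
  have -> : P (la / 2 - 1) * P th * (64 * c) = 16 * c * P (la / 2 - 1) * (4 * P th) by ring.
  have -> : 8 * (2 * (c * P (la / 2 - 1)) * (size B)%:R) = 16 * c * P (la / 2 - 1) * (size B)%:R by ring.
  by rewrite ler_pM2l// !mulr_gt0.
case EB : B => [|n1 rest]; first by move: Bsz; rewrite EB /=; have := th1P; clear; lra.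
have n1B : n1 \in B by rewrite EB mem_head.
have restB n : n \in rest -> n \in B by move=> h; rewrite EB in_cons h orbT.
have gt n : n \in rest -> (n1 < n)%N.
  have := sB; rewrite EB /= => /(order_path_min ltn_trans)/allP; exact.
pose s0 := [seq (4 * (n - n1))%N | n <- rest].
have us : uniq s0.
  rewrite map_inj_in_uniq.
    have := filter_uniq (fun n => box n == i) (iota_uniq 0 N).
    by rewrite -/B EB /= => /andP[].
  move=> n n' /gt h /gt h' /eqP; rewrite eqn_pmul2l// => /eqP E.
  by rewrite -(subnK (ltnW h)) E subnK// ltnW.
have sp : all (fun q => 0 < q)%N s0.
  by apply/allP => q /mapP[n /gt h ->]; rewrite muln_gt0 subn_gt0.
exists [seq q <- s0 | P th <= q%:R]; split.
- by rewrite filter_uniq.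
- apply: le_trans (size_filter_ge (ltW (P0 th)) us sp).
  move: Bsz; rewrite EB /= size_map -[(size rest).+1%:R]natr1 -/(P th).
  by move: th1P; clear; lra.
move=> q; rewrite mem_filter => /andP[qth /mapP[n nr qE]].
have [nN nbox] := memB n (restB n nr); have [_ n1box] := memB n1 n1B.
have n1n := gt n nr.
have q0 : (0 < q)%N by rewrite qE muln_gt0 subn_gt0.
have qQ : (q <= Q)%N.
  rewrite qE (leq_trans (leq_mul (leqnn 4) (leq_subr n1 n)))// (leq_trans (leq_mul (leqnn 4) (ltnW nN)))//.
  by rewrite mulnC leq_divM.
split => //; first by rewrite qE dvdn_mulr.
exists (2 * (Num.floor (n%:R * y) - Num.floor (n1%:R * y))); split; first exact: dvdz_mulr.
set m := 2 * _.
have qp : (0 : R) < q%:R by rewrite ltr0n.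
have E : q%:R * x - m%:~R = 2 * (fr n - fr n1).
  rewrite qE natrM natrB ?(ltnW n1n)// /m intrM intrB /fr /y.
  have -> : (2 : int)%:~R = 2 :> R by [].
  ring.
have bd : `|fr n - fr n1| <= K%:R^-1.
  have t1 : (box n)%:R <= K%:R * fr n by rewrite truncn_le mulr_ge0.
  have t2 : K%:R * fr n < (box n).+1%:R by exact: truncnS_gt.
  have t3 : (box n1)%:R <= K%:R * fr n1 by rewrite truncn_le mulr_ge0.
  have t4 : K%:R * fr n1 < (box n1).+1%:R by exact: truncnS_gt.
  rewrite -div1r ler_pdivlMr// -[X in _ * X](ger0_norm (ltW Kp)) -normrM mulrC mulrBr.
  rewrite nbox -[i.+1%:R]natr1 in t1 t2; rewrite n1box -[i.+1%:R]natr1 in t3 t4.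
  by rewrite ler_norml; apply/andP; split; move: t1 t2 t3 t4; clear; lra.
have -> : `|x - m%:~R / q%:R| = `|q%:R * x - m%:~R| / q%:R.
  rewrite -[X in _ = _ / X](ger0_norm (ltW qp)) -normf_div; congr `|_|.
  by field; rewrite gt_eqF.
rewrite E normrM [`|2|]ger0_norm//.
have -> : la / 2 = 1 + (la / 2 - 1) by ring.
rewrite powRD; last by rewrite (gt_eqF qp) implybT.
rewrite powRr1 ?(ltW qp)// mulrA divfK ?gt_eqF//.
have qP : q%:R `^ (la / 2 - 1) <= P (la / 2 - 1).
  by apply: ge0_ler_powR; rewrite ?nnegrE ?(ltW la1) ?ler_nat.
rewrite ler_pdivlMr//.
apply: (@le_trans _ _ (2 * K%:R^-1 * P (la / 2 - 1) * c)).
  rewrite ler_pM2r//; apply: ler_pM; rewrite ?mulr_ge0 ?powR_ge0//.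
  by rewrite ler_pM2l.
have -> : 2 * K%:R^-1 * P (la / 2 - 1) * c = 2 * ((c * P (la / 2 - 1)) / K%:R) by ring.
by rewrite ler_piMr// ler_pdivrMr// mul1r.
Qed.

End Admissible.

(** * Level sets of the exponent *)

Section Exponents.
Variable R : realType.
Implicit Types (x y t a b s l th la mu eps : R).

(** Beyond 1/2 + 1/(2 la) the order satisfies la (2a - 1) > 1, from which the condition linking la
    to mu follows as la <= mu. *)
Lemma exponent_le_nice x0 t la mu : 2 < la -> la <= mu -> (forall n, nice_near x0 la mu n t) ->
  (holder_exponent (riemann_fun x0) t <= (1 / 2 + 1 / (2 * la))%:E)%E.
Proof.
move=> la2 lamu H.
have lap : 0 < la by move: la2; clear; lra.
have ila : 1 / (2 * la) < 1 / 4.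
  by rewrite !div1r ltf_pV2 ?posrE ?mulr_gt0//; move: la2; clear; lra.
have ila0 : 0 < 1 / (2 * la) by rewrite divr_gt0// mulr_gt0.
apply: holder_exponent_le; [by move: ila0; clear; lra|by move: ila; clear; lra|].
move=> a ha a2.
have a0 : 0 < a by move: ha ila0; clear; lra.
have h1 : 1 < la * (2 * a - 1).
  have : 1 / (2 * la) < a - 1 / 2 by move: ha; clear; lra.
  by rewrite ltr_pdivrMr ?mulr_gt0//; clear; lra.
apply: (@nice_not_holder R x0 t a la mu 1) => //.
  have : la * a <= mu * a by rewrite ler_wpM2r// ltW.
  by move: h1; clear; lra.
move=> Q0; have [p [m [q [nc nq tq xq]]]] := H Q0.
by exists p, m, q; split => //; rewrite mul1r.
Qed.

Lemma exponent_ge_badly x0 t mu : 2 <= mu -> ~ well_approx mu t ->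
  ((1 / 2 + 1 / (2 * mu))%:E <= holder_exponent (riemann_fun x0) t)%E.
Proof.
move=> mu2 /well_approx_badly[c c0 bad].
have mup : 0 < mu by move: mu2; clear; lra.
apply: holder_exponent_ge.
  by move=> a a0 ha; exists a => //; exact: (holder_badly x0 c0 mu2 bad).
by rewrite addr_gt0// divr_gt0// mulr_gt0.
Qed.

Lemma near_34 x0 eps : 0 < eps -> exists t (al : R),
  [/\ holder_exponent (riemann_fun x0) t = al%:E, 3 / 4 - eps < al & al < 3 / 4].
Proof.
move=> eps0.
pose k := minr 1 eps.
have k0 : 0 < k by rewrite lt_min ltr01.
have k1 : k <= 1 by rewrite ge_min lexx.
have ke : k <= eps by rewrite ge_min lexx orbT.
move: (k) k0 k1 ke => {}k k0 k1 ke.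
(* The exponent will lie between 1/2 + 1/(2 mu') and 1/2 + 1/(2 la), with mu' = 2 + 60 eta. The 20
   in mu ensures D (5/2 - 2 th) < 1/2, and mu' is large enough for 2/mu' < D, so that the points
   approximated to the order mu' can be avoided. *)
pose eta : R := k / 60; pose la : R := 2 + 2 * eta; pose th : R := 1 - 2 * eta.
have eta0 : 0 < eta by rewrite divr_gt0.
have eta1 : eta <= 1 / 60 by rewrite /eta; move: k1; clear; lra.
pose mu : R := 2 + 20 * eta; pose D : R := 2 * th / mu.
have mup : 0 < mu by rewrite /mu; move: eta0; clear; lra.
have adm : admissible x0 la th.
  apply: admissible_any; rewrite /la /th; move: eta0 eta1; clear; lra.
have D0 : 0 < D by rewrite divr_gt0// mulr_gt0// /th; move: eta1; clear; lra.
have Dmu : D * mu = 2 * th by rewrite /D divfK// gt_eqF.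
have D1 : D <= 1 by rewrite ler_pdivrMr// mul1r /th /mu; move: eta0; clear; lra.
have Dth : D * (5 / 2 - 2 * th) < 1 / 2.
  rewrite /D mulrAC ltr_pdivrMr// /th /mu; move: eta0 eta1; clear; nra.
have [n l s l0 l1 s0 sD|F [HF HG]] := @tree_map R (nice_near x0 la mu) D D0.
  apply: (@stage_nice R x0 la mu th D n l s) => //.
  - by rewrite /th; move: eta1; clear; lra.
  - by rewrite /th; move: eta0; clear; lra.
  - by rewrite /mu; move: eta0; clear; lra.
  - by rewrite Dmu.
pose mu' : R := 2 + k.
have mu'0 : 0 < mu' by rewrite /mu'; move: k0; clear; lra.
have Dmu' : 2 / mu' < D.
  rewrite /D ltr_pdivrMr// mulrAC ltr_pdivlMr// /mu' /mu /th /eta; move: k0 k1; clear; nra.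
have [s [s1 s2]] : exists s, 2 / mu' < s /\ s < D.
  exists ((2 / mu' + D) / 2); move: Dmu'; clear; lra.
have s0 : 0 <= s by rewrite (le_trans _ (ltW s1))// divr_ge0// ltW.
have [x [x01 Hx]] := @avoid_null R F D (fun _ => well_approx mu') HF
  (fun _ => ex_intro _ s (And3 s0 s2 (well_approx_null mu'0 s1))).
have up : (holder_exponent (riemann_fun x0) (F x) <= (1 / 2 + 1 / (2 * la))%:E)%E.
  apply: (@exponent_le_nice x0 (F x) la mu); rewrite /la /mu; [move: eta0; clear; lra|move: eta0; clear; lra|].
  by move=> n; exact: (HG x n x01).
have lo := @exponent_ge_badly x0 (F x) mu' ltac:(rewrite /mu'; move: k0; clear; lra) (Hx 0%N).
have fin : holder_exponent (riemann_fun x0) (F x) \is a fin_num.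
  by rewrite fin_numE; apply/andP; split; apply/eqP => E; [rewrite E in lo|rewrite E in up].
exists (F x), (fine (holder_exponent (riemann_fun x0) (F x))); rewrite fineK//; split => //.
  rewrite -lte_fin fineK//; apply: lt_le_trans lo; rewrite lte_fin.
  have : 1 / 4 - k / 8 <= 1 / (2 * mu').
    rewrite ler_pdivlMr ?mulr_gt0// /mu'; move: k0; clear; nra.
  by move: k0 ke; clear; lra.
rewrite -lte_fin fineK//; apply: le_lt_trans up _; rewrite lte_fin.
have : 1 / (2 * la) < 1 / 4.
  by rewrite !div1r ltf_pV2 ?posrE ?mulr_gt0// /la; move: eta0; clear; lra.
by clear; lra.
Qed.

(** A finite set of exponents would miss some interval (3/4 - eps, 3/4), against [near_34]. *)
Lemma multifractal_riemann x0 : multifractal (riemann_fun x0).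
Proof.
move=> /finite_seqP[s sE].
have [eps eps0 H] : exists2 eps : R, 0 < eps & forall al : R, al%:E \in s -> 3 / 4 - eps < al -> 3 / 4 <= al.
  elim: s {sE} => [|v s [eps eps0 IH]]; first by exists 1.
  have [[al [vE al34]]|nv] := pselect (exists al : R, v = al%:E /\ al < 3 / 4).
    exists (minr eps (3 / 4 - al)); first by rewrite lt_min eps0 subr_gt0.
    move=> b; rewrite in_cons => /orP[/eqP bv|bs] hb.
      move: bv; rewrite vE => -[bE]; move: hb; rewrite bE ltrBlDr => hb.
      have : minr eps (3 / 4 - al) <= 3 / 4 - al by rewrite ge_min lexx orbT.
      by move: hb; clear; lra.
    apply: IH => //; apply: le_lt_trans hb; rewrite lerD2l lerN2 ge_min lexx //.
  exists eps => // b; rewrite in_cons => /orP[/eqP vE|bs] hb; last exact: IH.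
  by rewrite leNgt; apply/negP => b34; apply: nv; exists b.
have [t [al [tE al1 al2]]] := near_34 x0 eps0.
have : range (holder_exponent (riemann_fun x0)) al%:E by exists t.
rewrite sE /= => als; have := H al als al1.
by rewrite leNgt al2.
Qed.

Lemma exponent_irrational x0 t : rational x0 -> ~ rational t ->
  ((1 / 2)%:E <= holder_exponent (riemann_fun x0) t <= (3 / 4)%:E)%E.
Proof. by move=> rx nt; rewrite exponent_ge_half exponent_le_34. Qed.

(** Outside [well_approx mu] the exponent is at least 1/2 + 1/(2 mu) > al when mu >= 2; for mu < 2
    every irrational is inside by Dirichlet, as the rationals always are. *)
Lemma level_subset x0 al mu : rational x0 -> 1 / 2 <= al -> al <= 3 / 4 -> 0 < mu ->
  mu * (2 * al - 1) < 1 ->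
  [set t | holder_exponent (riemann_fun x0) t = al%:E] `<=` well_approx mu.
Proof.
move=> rx al1 al2 mu0 mual t /= tE; apply: contrapT => nW.
have nr : ~ rational t by move=> /(well_approx_rational mu).
have [mu2|mu2] := leP 2 mu.
  have := @exponent_ge_badly x0 t mu mu2 nW; rewrite tE lee_fin.
  have : al - 1 / 2 < 1 / (2 * mu).
    by rewrite ltr_pdivlMr ?mulr_gt0//; move: mual; clear; lra.
  by clear; lra.
apply: nW => Q.
have [p [q [q0 Qq _ bd]]] := dirichlet_irrational Q.+2 nr.
have q1 : (1 : R) < q%:R by rewrite ltr1n (leq_trans _ Qq).
exists p, q; split => //; first by rewrite (leq_trans _ Qq)// leqW.
apply: le_lt_trans bd _.
rewrite -powR_mulrn ?ler0n// -powRN.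
have -> : - mu = - 2%:R + (2 - mu) by ring.
have qn0 : (q%:R : R) != 0 by rewrite pnatr_eq0 -lt0n.
rewrite powRD; last by rewrite qn0 implybT.
rewrite ltr_pMr ?powR_gt0// ?(lt_trans ltr01)//.
have := @gt0_ltr_powR R (2 - mu) _ 1 q%:R.
by rewrite powR1; apply; rewrite ?nnegrE ?subr_gt0.
Qed.

Lemma hausdorff_dim_le_lim (A : set R) d : 0 <= d ->
  (forall s, d < s -> hausdorff_measure s A = 0%E) -> (hausdorff_dim A <= d%:E)%E.
Proof.
move=> d0 H; apply/lee_addgt0Pr => eps eps0; rewrite -EFinD.
apply: hausdorff_dim_le; first by rewrite addr_ge0// ltW.
by apply: H; rewrite ltrDl.
Qed.

Lemma dim_level_le x0 al : rational x0 -> 1 / 2 <= al -> al <= 3 / 4 ->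
  (hausdorff_dim [set t | holder_exponent (riemann_fun x0) t = al%:E] <= (4 * al - 2)%:E)%E.
Proof.
move=> rx al1 al2; apply: hausdorff_dim_le_lim; first by move: al1; clear; lra.
move=> s hs.
have s0 : 0 < s by move: al1 hs; clear; lra.
(* 2/mu is the midpoint of 4 al - 2 and s. *)
pose mu := 4 / (s + (4 * al - 2)).
have d0 : 0 < s + (4 * al - 2) by move: al1 hs; clear; lra.
have mu0 : 0 < mu by rewrite divr_gt0.
apply: (@hausdorff_null_subset R s _ (well_approx mu)).
  apply: level_subset => //.
  by rewrite /mu mulrAC ltr_pdivrMr//; move: hs; clear; lra.
apply: well_approx_null => //; rewrite /mu invf_div mulrA ltr_pdivrMr//.
by move: hs; clear; lra.
Qed.

(** For al = 3/4 the identity serves, every irrational having exponent at most 3/4. For smaller al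
    both la and mu are 1/(2 al - 1), so that 1/2 + 1/(2 la) = al. *)
Lemma level_map x0 al : rational x0 -> 1 / 2 < al -> al <= 3 / 4 -> exists F : R -> R,
  (forall s, 0 <= s -> s < 4 * al - 2 -> exists2 C, 0 <= C & forall x y, 0 <= x -> x < y -> y < 1 ->
     y - x <= C * `|F y - F x| `^ s) /\
  (forall x, 0 <= x < 1 -> ~ rational (F x) -> (holder_exponent (riemann_fun x0) (F x) <= al%:E)%E).
Proof.
move=> rx al1; rewrite le_eqVlt => /orP[/eqP ->|al2].
  exists id; split; last by move=> x _ nr; exact: exponent_le_34.
  move=> s s0 s1; exists 1 => // x y x0' xy y1; rewrite mul1r.
  have yx : 0 <= y - x <= 1 by move: x0' xy y1; clear; lra.
  rewrite [`|_|]ger0_norm; last by case/andP: yx.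
  by apply: le_powR_frac => //; move: s0 s1; clear; lra.
pose mu := (2 * al - 1)^-1.
have d0 : 0 < 2 * al - 1 by move: al1; clear; lra.
have mu2 : 2 < mu.
  have -> : 2 = (1 / 2)^-1 :> R by field.
  by rewrite ltf_pV2 ?posrE//; move: al2; clear; lra.
have DE : 4 * al - 2 = 2 / mu by rewrite /mu invrK; ring.
have mup : 0 < mu by rewrite invr_gt0.
have D0 : 0 < 4 * al - 2 by move: al1; clear; lra.
have [|F [HF HG]] := @tree_map R (nice_near x0 mu mu) (4 * al - 2) D0.
  move=> n l s l0 l1 s0 sD.
  (* [stage_nice] wants D mu <= 2 th, and rational x0 are admissible for th < 1 only; hence a D'
     strictly between s and 2/mu = 4 al - 2. *)
  pose D' := (s + (4 * al - 2)) / 2.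
  have D'1 : D' < 4 * al - 2 by rewrite /D'; move: sD; clear; lra.
  have sD' : s < D' by rewrite /D'; move: sD; clear; lra.
  have D'0 : 0 < D' by rewrite /D'; move: s0 D0; clear; lra.
  have D'2 : D' < 1 by move: D'1 al2; clear; lra.
  have D'mu : D' * mu < 2 by rewrite -ltr_pdivlMr// -DE.
  pose de := minr (minr ((2 - D' * mu) / 2) ((1 - D') / 8)) (1 / 4).
  have de1 : de <= (2 - D' * mu) / 2 by rewrite /de !ge_min lexx.
  have de2 : de <= (1 - D') / 8 by rewrite /de !ge_min lexx orbT.
  have de3 : de <= 1 / 4 by rewrite /de !ge_min lexx !orbT.
  have de0 : 0 < de.
    have q1 : 0 < (2 - D' * mu) / 2 by rewrite divr_gt0// subr_gt0.
    have q2 : 0 < (1 - D') / 8 by rewrite divr_gt0// subr_gt0.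
    have q3 : 0 < 1 / 4 :> R by rewrite divr_gt0.
    by rewrite /de !lt_min q1 q2 q3.
  move: (de) de0 de1 de2 de3 => {}de de0 de1 de2 de3.
  apply: (@stage_nice R x0 mu mu (1 - de) D' n l s) => //.
  - by apply: admissible_rational => //; move: de0 de3; clear; lra.
  - by move: de3; clear; lra.
  - by move: de0; clear; lra.
  - exact: ltW.
  - by move: de1; clear; lra.
  - have : D' * de <= de by rewrite ler_piMl// ltW.
    by move: de2 D'2; clear; lra.
exists F; split => // x x01 _.
have := @exponent_le_nice x0 (F x) mu mu mu2 (lexx _) (fun n => HG x n x01).
suff -> : 1 / 2 + 1 / (2 * mu) = al by [].
by rewrite invfM /mu invrK; field.
Qed.

(** The orders [mu n] decrease to the critical 1/(2 al - 1), and 2/mu n < 4 al - 2 lets every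
    [well_approx (mu n)] be avoided; at the points that remain the lower bounds tend to al. *)
Lemma dim_level_ge x0 al : rational x0 -> 1 / 2 < al -> al <= 3 / 4 ->
  [set t | holder_exponent (riemann_fun x0) t = al%:E] !=set0 /\
  ((4 * al - 2)%:E <= hausdorff_dim [set t | holder_exponent (riemann_fun x0) t = al%:E])%E.
Proof.
move=> rx al1 al2; have [F [HF HE]] := level_map rx al1 al2.
pose mu (n : nat) : R := (2 * al - 1)^-1 * (1 + n.+1%:R^-1).
have d0 : 0 < 2 * al - 1 by move: al1; clear; lra.
have n0 (n : nat) : (0 : R) < n.+1%:R^-1 by rewrite invr_gt0.
have mu2 n : 2 < mu n.
  have : 2 * (2 * al - 1) < 1 + n.+1%:R^-1.
    by have := n0 n; move: (n.+1%:R^-1 : R) al2; clear => y; lra.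
  by rewrite /mu [_^-1 * _]mulrC ltr_pdivlMr.
have mup n : 0 < mu n by move: (mu2 n); clear; lra.
have Dn n : 2 / mu n < 4 * al - 2.
  rewrite ltr_pdivrMr//.
  have -> : (4 * al - 2) * mu n = 2 * (1 + n.+1%:R^-1).
    by rewrite /mu; move: (n.+1%:R^-1 : R) => y; field; rewrite gt_eqF.
  by have := n0 n; move: (n.+1%:R^-1 : R); clear => y; lra.
pose s n : R := (2 / mu n + (4 * al - 2)) / 2.
have s0 n : 0 <= s n.
  have : 0 < 2 / mu n by rewrite divr_gt0.
  by rewrite /s; move: (Dn n); clear; lra.
have sD n : s n < 4 * al - 2 by rewrite /s; move: (Dn n); clear; lra.
have ms n : 2 / mu n < s n by rewrite /s; move: (Dn n); clear; lra.
have HA n : exists s, [/\ 0 <= s, s < 4 * al - 2 & hausdorff_measure s (well_approx (mu n)) = 0%E].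
  by exists (s n); split => //; exact: well_approx_null.
have HX x : 0 <= x < 1 -> (forall n, ~ well_approx (mu n) (F x)) ->
    holder_exponent (riemann_fun x0) (F x) = al%:E.
  move=> x01 nW; apply/eqP; rewrite eq_le; apply/andP; split.
    by apply: HE => // /(well_approx_rational (mu 0%N)); exact: nW.
  apply/lee_addgt0Pr => eps eps0; rewrite -leeBlDr// -EFinB.
  pose n := truncn eps^-1.
  apply: le_trans (exponent_ge_badly x0 (ltW (mu2 n)) (nW n)); rewrite lee_fin.
  have en : n.+1%:R^-1 <= eps.
    by rewrite -[leRHS]invrK lef_pV2 ?posrE ?invr_gt0// ltW// truncnS_gt.
  have : al - 1 / 2 - eps <= 1 / (2 * mu n).
    rewrite ler_pdivlMr; last by rewrite pmulr_rgt0.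
    have E : (al - 1 / 2) * (2 * mu n) = 1 + n.+1%:R^-1.
      by rewrite /mu; move: (n.+1%:R^-1 : R) => y; field; rewrite gt_eqF.
    rewrite mulrBl E; have : eps * (2 * 2) <= eps * (2 * mu n) by rewrite ler_pM2l// ler_pM2l// ltW.
    by move: (n.+1%:R^-1 : R) (eps * (2 * mu n) : R) en eps0; clear => y z; lra.
  by clear; lra.
split; last exact: hausdorff_dim_ge HF HA HX.
have [x [x01 Hx]] := avoid_null HF HA.
by exists (F x); exact: HX.
Qed.

Lemma spectrum_riemann x0 (a : \bar R) : rational x0 ->
  spectrum (riemann_fun x0) a =
    (if (1 / 2)%:E <= a <= (3 / 4)%:E then 4%:E * a - 2%:E
     else if a == (3 / 2)%:E then 0 else -oo)%E.
Proof.
move=> rx; rewrite /spectrum.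
have [|na] := boolP ((1 / 2)%:E <= a <= (3 / 4)%:E)%E.
  case: a => [al| |]; last 2 first.
  - by rewrite leye_eq andbF.
  - by rewrite leeNy_eq.
  rewrite !lee_fin => /andP[al1 al2].
  rewrite -EFinM -EFinB.
  have up := dim_level_le rx al1 al2.
  move: al1; rewrite le_eqVlt => /orP[/eqP E|al1]; last first.
    have [ne ge] := dim_level_ge rx al1 al2.
    have /negbTE -> : [set t | holder_exponent (riemann_fun x0) t = al%:E] != set0 by apply/set0P.
    by apply/eqP; rewrite eq_le up ge.
  (* At al = 1/2 the upper bound is 0, and what remains is that the level set is not empty. *)
  have [t ht] := exists_exponent_half rx.
  have /negbTE -> : [set t | holder_exponent (riemann_fun x0) t = al%:E] != set0.
    by apply/set0P; exists t; rewrite /= ht E.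
  apply/eqP; rewrite eq_le up /=; apply: le_trans (hausdorff_dim_ge0 _).
  by rewrite lee_fin -E; clear; lra.
have [->|a32] := eqVneq a (3 / 2)%:E.
  have [t ht] := exists_exponent_32 rx.
  have /negbTE -> : [set t | holder_exponent (riemann_fun x0) t = (3 / 2)%:E] != set0.
    by apply/set0P; exists t.
  apply/eqP; rewrite eq_le hausdorff_dim_ge0 andbT.
  apply: hausdorff_dim_le_lim => // s s0.
  (* Points of exponent 3/2 are rational, hence in every [well_approx]; the order mu = 4/s makes
     2/mu = s/2 < s. *)
  apply: (@hausdorff_null_subset R s _ (well_approx (4 / s))); last first.
    by apply: well_approx_null; rewrite ?divr_gt0// invf_div mulrA ltr_pdivrMr//; move: s0; clear; lra.
  move=> u /= hu; apply: well_approx_rational; apply: contrapT => nr.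
  have /andP[_] := exponent_irrational rx nr; rewrite hu lee_fin; clear; lra.
have -> : [set t | holder_exponent (riemann_fun x0) t = a] == set0; last by [].
apply/eqP/seteqP; split => // t /= ht.
have [rt|nr] := pselect (rational t).
  have [E|E] := exponent_rational rx rt; rewrite ht in E.
    by move/negP: na; apply; rewrite E !lee_fin; apply/andP; split; clear; lra.
  by move/negP: a32; apply; rewrite E.
by have := exponent_irrational rx nr; rewrite ht; move/negP: na.
Qed.

End Exponents.

Theorem theorem1 (R : realType) :
  (forall x0 : R, multifractal (riemann_fun x0)) /\
  (forall x0 : R, rational x0 -> forall a : \bar R,
     spectrum (riemann_fun x0) a =
       (if ((1 / 2 : R)%:E <= a <= (3 / 4 : R)%:E) then 4%:E * a - 2%:E
        else if a == (3 / 2 : R)%:E then 0 else -oo)%E).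
Proof.
by split => [x0|x0 rx a]; [exact: multifractal_riemann|exact: spectrum_riemann].
Qed.
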